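(* Let $k=(k_1,k_2)\in\mathbb{C}^2$ with $\operatorname{Re}k_1>0$ and $\operatorname{Re}k_2>0$. For $x,y\in\mathbb{R}$ with $|x|>|y|$ define $$\mathcal{K}(x,y)=\frac{c}{4}\,A(x)^{-1}\int_{|y|}^{|x|}\sigma(x,y,z)\,\Bigl(\cosh\frac z2-\cosh\frac y2\Bigr)^{k_1-1}\,(\cosh x-\cosh z)^{k_2-1}\,\Bigl(\sinh\frac z2\Bigr)\,dz,$$ where $$c=2^{3k_1+3k_2}\,\frac{\Gamma(k_1+k_2+\frac12)}{\sqrt{\pi}\,\Gamma(k_1)\,\Gamma(k_2)}$$ and $$\sigma(x,y,z)=(\operatorname{sign}x)\,\Bigl\{e^{\frac x2}\Bigl(2\cosh\frac x2\Bigr)-e^{-\frac y2}\Bigl(2\cosh\frac z2\Bigr)\Bigr\}.$$ Then the intertwining operator $\mathcal{V}$ and its dual $\mathcal{V}^t$ (with parameters $k_1,k_2$) are given as follows: for every $f\in C^\infty(\mathbb{R})$ and every $x\in\mathbb{R}\setminus\{0\}$, $$\mathcal{V}f(x)=\int_{|y|<|x|}\mathcal{K}(x,y)\,f(y)\,dy,$$ and for every $g\in C_c^\infty(\mathbb{R})$ and every $y\in\mathbb{R}$, $$\mathcal{V}^t g(y)=\int_{|x|>|y|}\mathcal{K}(x,y)\,g(x)\,A(x)\,dx.$$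
   Context: Functions are complex-valued. For $k=(k_1,k_2)\in\mathbb{C}^2$, the Cherednik operator on $C^\infty(\mathbb{R})$ is $$Df(x)=f'(x)+\Bigl\{\frac{k_1}{1-e^{-x}}+\frac{2k_2}{1-e^{-2x}}\Bigr\}\{f(x)-f(-x)\}-\Bigl(\frac{k_1}2+k_2\Bigr)f(x),$$ extended to $x=0$ by continuity. The weight is $$A(x)=\bigl|2\sinh\tfrac x2\bigr|^{2k_1}\,\bigl|2\sinh x\bigr|^{2k_2}.$$ Complex powers of positive real numbers are defined by $t^s=e^{s\log t}$ with real logarithm. The intertwining operator is the continuous linear operator $\mathcal{V}:C^\infty(\mathbb{R})\to C^\infty(\mathbb{R})$ (with $C^\infty(\mathbb{R})$ carrying its usual Fréchet topology) characterized by $$\mathcal{V}\circ\frac{d}{dx}=D\circ\mathcal{V}\quad\text{and}\quad \mathcal{V}f(0)=f(0)\ \text{ for all } f\in C^\infty(\mathbb{R}).$$ For every $\lambda\in\mathbb{C}$, it maps $x\mapsto e^{i\lambda x}$ to the Opdam hypergeometric function $$G_{i\lambda}(x)={}_2F_1\bigl(\tfrac{k_1}2+k_2+i\lambda,\tfrac{k_1}2+k_2-i\lambda;k_1+k_2+\tfrac12;-\sinh^2\tfrac x2\bigr)+\frac{\frac{k_1}2+k_2+i\lambda}{2k_1+2k_2+1}(\sinh x)\,{}_2F_1\bigl(\tfrac{k_1}2+k_2+1+i\lambda,\tfrac{k_1}2+k_2+1-i\lambda;k_1+k_2+\tfrac32;-\sinh^2\tfrac x2\bigr).$$ The dual operator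 $\mathcal{V}^t:C_c^\infty(\mathbb{R})\to C_c^\infty(\mathbb{R})$ is determined by $$\int_{-\infty}^{+\infty}\mathcal{V}f(x)\,g(x)\,A(x)\,dx=\int_{-\infty}^{+\infty}f(y)\,\mathcal{V}^t g(y)\,dy\qquad\text{for all } f\in C^\infty(\mathbb{R}),\ g\in C_c^\infty(\mathbb{R}).$$ *)

(* Defs.v *)
From HB Require Import structures.
From mathcomp Require Import all_boot all_order all_algebra.
From mathcomp Require Import all_classical all_reals all_analysis.
From mathcomp Require Import complex.

Set Implicit Arguments.
Unset Strict Implicit.
Unset Printing Implicit Defensive.

Import Order.TTheory GRing.Theory Num.Theory numFieldNormedType.Exports.
Local Open Scope classical_set_scope.
Local Open Scope ring_scope.
Local Open Scope complex_scope.

(* Complex-valued functions of a real variable are differentiated and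
   integrated through their real and imaginary parts. *)
Section complex_valued.
Context {R : realType}.
Implicit Types (f g : R -> R[i]) (D : set R).

Definition cderivn (n : nat) f : R -> R[i] :=
  fun x => (derive1n n (fun t => complex.Re (f t)) x)
        +i* (derive1n n (fun t => complex.Im (f t)) x).

Definition csmooth f : Prop :=
  forall (n : nat) (x : R),
    derivable (derive1n n (fun t => complex.Re (f t))) x 1 /\
    derivable (derive1n n (fun t => complex.Im (f t))) x 1.

Definition ctest f : Prop :=
  csmooth f /\ exists M : R, forall x : R, M < `|x| -> f x = 0.

(* [Rintegral] is total, so [cint D f] is only meaningful together with
   [cintegrable D f]. *)
Definition cintegrable D f : Prop :=
  lebesgue_measure.-integrable D (EFin \o (fun x => complex.Re (f x))) /\
  lebesgue_measure.-integrable D (EFin \o (fun x => complex.Im (f x))).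

Definition cint D f : R[i] :=
  (\int[lebesgue_measure]_(x in D) complex.Re (f x))
  +i* (\int[lebesgue_measure]_(x in D) complex.Im (f x)).

Definition cexp (z : R[i]) : R[i] :=
  (expR (complex.Re z) * cos (complex.Im z))
  +i* (expR (complex.Re z) * sin (complex.Im z)).

(* t^s, meaningful for t > 0 only ([ln] is 0 on nonpositive reals). *)
Definition cpow (t : R) (s : R[i]) : R[i] := cexp (s * (ln t)%:C).

(* Euler's integral; it defines the Gamma function on Re s > 0. *)
Definition cGamma (s : R[i]) : R[i] :=
  cint `]0, +oo[ (fun t => cpow t (s - 1) * (expR (- t))%:C).

Definition cosh (x : R) : R := (expR x + expR (- x)) / 2.
Definition sinh (x : R) : R := (expR x - expR (- x)) / 2.

(* The balls { g | max_(j <= n) sup_(|x| <= n) |f^(j)(x) - g^(j)(x)| < e },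
   for n : nat and e > 0, form a neighborhood basis of f for the Frechet
   topology of the space of smooth functions. *)
Definition frechet_ball f (n : nat) (e : R) g : Prop :=
  forall (j : nat) (x : R), (j <= n)%N -> `|x| <= n%:R ->
    `|cderivn j f x - cderivn j g x| < e%:C.

Definition frechet_continuous (V : (R -> R[i]) -> (R -> R[i])) : Prop :=
  forall f, csmooth f -> forall (n : nat) (e : R), 0 < e ->
    exists (m : nat) (d : R), 0 < d /\
      forall g, csmooth g -> frechet_ball f m d g ->
        frechet_ball (V f) n e (V g).

End complex_valued.

Section operators.
Context {R : realType}.
Implicit Types (f g : R -> R[i]) (x y z : R).

Definition cherednik_off0 (k1 k2 : R[i]) f x : R[i] :=
  cderivn 1 f x
  + (k1 / (1 - expR (- x))%:C + 2 * k2 / (1 - expR (- (2 * x)))%:C)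
    * (f x - f (- x))
  - (k1 / 2 + k2) * f x.

Definition cherednik (k1 k2 : R[i]) f x : R[i] :=
  if x == 0 then lim ((cherednik_off0 k1 k2 f t : R[i]^o) @[t --> (0 : R)^'])
  else cherednik_off0 k1 k2 f x.

(* Only the values at x <> 0 matter below. *)
Definition weight (k1 k2 : R[i]) x : R[i] :=
  cpow `|2 * sinh (x / 2)| (2 * k1) * cpow `|2 * sinh x| (2 * k2).

(* Operators on smooth functions are total maps, constrained on smooth
   arguments only. *)
Record intertwining (k1 k2 : R[i]) (V : (R -> R[i]) -> (R -> R[i])) : Prop := {
  intertwining_smooth : forall f, csmooth f -> csmooth (V f);
  intertwining_linear : forall (a : R[i]) f g, csmooth f -> csmooth g ->
    forall x, V (fun t => a * f t + g t) x = a * V f x + V g x;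
  intertwining_continuous : frechet_continuous V;
  intertwining_comm : forall f, csmooth f ->
    forall x, V (cderivn 1 f) x = cherednik k1 k2 (V f) x;
  intertwining_at0 : forall f, csmooth f -> V f 0 = f 0
}.

Record dual_intertwining (k1 k2 : R[i]) (V Vt : (R -> R[i]) -> (R -> R[i])) : Prop := {
  dual_test : forall g, ctest g -> ctest (Vt g);
  dual_pairing : forall f g, csmooth f -> ctest g ->
    cint setT (fun x => V f x * g x * weight k1 k2 x)
    = cint setT (fun y => f y * Vt g y)
}.

Definition kconst (k1 k2 : R[i]) : R[i] :=
  cpow 2 (3 * k1 + 3 * k2)
  * (cGamma (k1 + k2 + 2^-1)
     / ((Num.sqrt (pi : R))%:C * cGamma k1 * cGamma k2)).

Definition ksigma x y z : R :=
  Num.sg x * (expR (x / 2) * (2 * cosh (x / 2))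
              - expR (- (y / 2)) * (2 * cosh (z / 2))).

Definition kernel_integrand (k1 k2 : R[i]) x y z : R[i] :=
  (ksigma x y z)%:C
  * cpow (cosh (z / 2) - cosh (y / 2)) (k1 - 1)
  * cpow (cosh x - cosh z) (k2 - 1)
  * (sinh (z / 2))%:C.

Definition vkernel (k1 k2 : R[i]) x y : R[i] :=
  kconst k1 k2 / 4 * (weight k1 k2 x)^-1
  * cint `]`|y|, `|x|[ (kernel_integrand k1 k2 x y).

End operators.

(* Main.v *)
Require Import Defs.
From HB Require Import structures.
From mathcomp Require Import all_boot all_order all_algebra.
From mathcomp Require Import all_classical all_reals all_analysis.
From mathcomp Require Import measurable_realfun complex ring lra.

Set Implicit Arguments.
Unset Strict Implicit.
Unset Printing Implicit Defensive.

Import Order.TTheory GRing.Theory Num.Theory numFieldNormedType.Exports.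
Local Open Scope classical_set_scope.
Local Open Scope ring_scope.
Local Open Scope complex_scope.

Local Notation Re := complex.Re.
Local Notation Im := complex.Im.
Local Notation mu := lebesgue_measure.
Local Notation Rm R := (measurableTypeR R).
Local Notation msble D := (measurable (D : set (Rm _))).

(** Write [A] for the weight, [rho = k1/2 + k2], and let [W f] be the function
    defined by the kernel. Exchanging the order of integration turns the even
    and odd parts of [W f] into iterated Abel transforms of the even and odd
    parts of [f]: the inner one is
    [int_0^z F(y) (cosh(z/2) - cosh(y/2))^(k1-1) dy], the outer one
    [int_0^x G(z) (cosh x - cosh z)^(k2-1) dz]. An Abel transform becomes
    differentiable once its exponent is raised by one, and multiplication by
    [sinh^2(z/2)] followed by an integration by parts raises the exponent by
    one; differentiating in this way gives [D (W f) = W f'] off the origin.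
    Beta integrals give [W f -> f 0] at the origin, which is where the
    constant [c] comes from.

    If [V f' = W f'], then the even and odd parts [e], [o] of [V f - W f]
    tend to [0] at the origin and satisfy [e' = - rho o] and
    [o' = rho e - (A'/A) o] on the positive axis. As [Re (A'/A) >= 0],
    Gronwall's inequality for [|e|^2 + |o|^2] yields [V f = W f]. Hence
    [V = W] on polynomials, by induction on the degree, and then on all
    smooth functions, since polynomials are dense and [V] is continuous.

    By Fubini, [V^t g] and the function [U g] given by the transposed kernel
    have the same moments. Their difference is continuous with compact
    support, hence [0] by Weierstrass approximation. *)

(** * Complex-valued functions of a real variable *)

(** [Re k1] and [Re k2] may lie below 1. The kernels are then singular at a moving end point and
    cannot be differentiated under the integral sign, which is why exponents have to be raised. The
    factor [sinh^2] suits the kernel: [sinh^2 (z/2) - sinh^2 (y/2)] equals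
    [cosh^2 (z/2) - cosh^2 (y/2)], a multiple of the kernel's base, and the term left over has a
    spare factor [sinh] for the integration by parts. The odd part of [W f] asks for less, as an
    integration by parts already leaves it with outer exponent [k2 + 1].

    [W f] is handled off the origin only and is never shown to be smooth. Hence [V] and [W] are
    compared by passing from [f'] to [f], not as two intertwining operators, and polynomials are the
    class on which this descent ends at 0.

    In the constant, the beta values at [(1/2, k1)] and [(k1 + 1/2, k2)] telescope to [Gamma (1/2)
    Gamma k1 Gamma k2 / Gamma (k1 + k2 + 1/2)]. Cancelling these factors requires that the complex
    Gamma function has no zero where [Re s > 0]. *)

Section complex_numbers.
Context {R : realType}.
Implicit Types (z w s : R[i]) (t : R).

Lemma ReD z w : Re (z + w) = Re z + Re w. Proof. by case: z; case: w. Qed.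
Lemma ImD z w : Im (z + w) = Im z + Im w. Proof. by case: z; case: w. Qed.
Lemma ReN z : Re (- z) = - Re z. Proof. by case: z. Qed.
Lemma ImN z : Im (- z) = - Im z. Proof. by case: z. Qed.
Lemma ReB z w : Re (z - w) = Re z - Re w. Proof. by rewrite ReD ReN. Qed.
Lemma ImB z w : Im (z - w) = Im z - Im w. Proof. by rewrite ImD ImN. Qed.
Lemma ReM z w : Re (z * w) = Re z * Re w - Im z * Im w.
Proof. by case: z; case: w. Qed.
Lemma ImM z w : Im (z * w) = Re z * Im w + Im z * Re w.
Proof. by case: z; case: w. Qed.
Lemma ReRM t z : Re (t%:C * z) = t * Re z.
Proof. by rewrite ReM /= mul0r subr0. Qed.
Lemma ImRM t z : Im (t%:C * z) = t * Im z.
Proof. by rewrite ImM /= mul0r addr0. Qed.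

Lemma complexP z w : Re z = Re w -> Im z = Im w -> z = w.
Proof. by case: z => a b; case: w => c d /= -> ->. Qed.

(** The norm of [R[i]] takes its values in [R[i]]; this real-valued version can be compared with
    real integrands and real limits. *)
Definition cn z : R := Normc.normc z.

Lemma cnE z : cn z = Num.sqrt (Re z ^+ 2 + Im z ^+ 2).
Proof. by case: z. Qed.
Lemma norm_cn z : `|z| = (cn z)%:C. Proof. by rewrite normc_def cnE. Qed.
Lemma cn_ge0 z : 0 <= cn z. Proof. by rewrite cnE sqrtr_ge0. Qed.
Lemma cnM z w : cn (z * w) = cn z * cn w. Proof. exact: Normc.normcM. Qed.
Lemma cnD z w : cn (z + w) <= cn z + cn w. Proof. exact: le_normcD. Qed.
Lemma cnN z : cn (- z) = cn z. Proof. exact: normcN. Qed.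
Lemma cnB z w : cn (z - w) <= cn z + cn w.
Proof. by rewrite -[cn w]cnN; exact: cnD. Qed.
Lemma cnR t : cn t%:C = `|t|.
Proof. by rewrite cnE /= expr0n /= addr0 sqrtr_sqr. Qed.
Lemma cn0 : cn 0 = 0. Proof. by rewrite -[0]/((0 : R)%:C) cnR normr0. Qed.
Lemma cn_eq0 z : (cn z == 0) = (z == 0).
Proof.
apply/eqP/eqP => [h|->]; last exact: cn0.
by apply/eqP; rewrite -normr_eq0 norm_cn h.
Qed.
Lemma cn_gt0 z : (0 < cn z) = (z != 0).
Proof. by rewrite lt_def cn_eq0 cn_ge0 andbT. Qed.
Lemma normRe_le z : `|Re z| <= cn z.
Proof. by rewrite cnE -sqrtr_sqr ler_wsqrtr// lerDl sqr_ge0. Qed.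
Lemma normIm_le z : `|Im z| <= cn z.
Proof. by rewrite cnE -sqrtr_sqr ler_wsqrtr// lerDr sqr_ge0. Qed.
Lemma cn_sqr z : cn z ^+ 2 = Re z ^+ 2 + Im z ^+ 2.
Proof. by rewrite cnE sqr_sqrtr// addr_ge0// sqr_ge0. Qed.
Lemma cn_leD z : cn z <= `|Re z| + `|Im z|.
Proof.
rewrite -(ler_pXn2r (n := 2))// ?nnegrE ?cn_ge0 ?addr_ge0//.
rewrite cn_sqr sqrrD !real_normK ?num_real// lerD2r.
by rewrite lerDl mulrn_wge0// mulr_ge0.
Qed.

Lemma cexpD z w : cexp (z + w) = cexp z * cexp w.
Proof.
by apply: complexP; rewrite (ReM, ImM) /= !(ReD, ImD) expRD (cosD, sinD); ring.
Qed.
Lemma cexpR t : cexp t%:C = (expR t)%:C.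
Proof. by apply: complexP => /=; rewrite (cos0, sin0) (mulr1, mulr0). Qed.
Lemma cn_cexp z : cn (cexp z) = expR (Re z).
Proof.
rewrite cnE /= !exprMn -mulrDr cos2Dsin2 mulr1 sqrtr_sqr ger0_norm//.
Qed.
Lemma cexp_neq0 z : cexp z != 0.
Proof. by rewrite -cn_gt0 cn_cexp expR_gt0. Qed.

Lemma cpowD t s s' : cpow t (s + s') = cpow t s * cpow t s'.
Proof. by rewrite /cpow mulrDl cexpD. Qed.
Lemma cpow0 t : cpow t 0 = 1.
Proof. by rewrite /cpow mul0r -[0]/((0 : R)%:C) cexpR expR0. Qed.
Lemma cpowRE t (a : R) : 0 < t -> cpow t a%:C = (t `^ a)%:C.
Proof.
by move=> t0; rewrite /cpow -rmorphM cexpR /powR gt_eqF// mulrC.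
Qed.
Lemma cpow1 t : 0 < t -> cpow t 1 = t%:C.
Proof. by move=> t0; rewrite -[1]/((1 : R)%:C) cpowRE// powRr1// ltW. Qed.
Lemma cpowM t u s : 0 < t -> 0 < u -> cpow (t * u) s = cpow t s * cpow u s.
Proof. by move=> t0 u0; rewrite /cpow lnM// rmorphD mulrDr cexpD. Qed.
Lemma cpow_sqr t s : 0 < t -> cpow (t ^+ 2) s = cpow t (2 * s).
Proof.
move=> t0; rewrite expr2 cpowM// -cpowD; congr cpow.
by rewrite -mulr2n mulr_natl.
Qed.
Lemma cpow_neq0 t s : cpow t s != 0. Proof. exact: cexp_neq0. Qed.
Lemma cn_cpow t s : 0 < t -> cn (cpow t s) = t `^ (Re s).
Proof.
move=> t0; rewrite cn_cexp mulrC ReRM /powR gt_eqF//; by rewrite mulrC.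
Qed.
Lemma cpowB1 t s : 0 < t -> t%:C * cpow t (s - 1) = cpow t s.
Proof. by move=> t0; rewrite -{1}(cpow1 t0) -cpowD addrC subrK. Qed.
Lemma cpowN t s : cpow t (- s) = (cpow t s)^-1.
Proof.
apply: (mulfI (cpow_neq0 t s)); rewrite divff ?cpow_neq0//.
by rewrite -cpowD subrr cpow0.
Qed.
Lemma cpow_1l s : cpow 1 s = 1.
Proof. by rewrite /cpow ln1 mulr0 -[0]/((0 : R)%:C) cexpR expR0. Qed.
End complex_numbers.

Section complex_calculus.
Context {R : realType}.
Implicit Types (f g : R -> R[i]) (h : R -> R) (x : R) (l m : R[i]).

(** Working by components agrees with [cderivn] and [csmooth] and lets the real theorems apply to
    each part. *)
Definition cder f x l : Prop :=
  is_derive x 1 (fun t => Re (f t)) (Re l) /\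
  is_derive x 1 (fun t => Im (f t)) (Im l).

Definition ccont f x : Prop :=
  {for x, continuous (fun t => Re (f t))} /\
  {for x, continuous (fun t => Im (f t))}.

Lemma cder_eq f x l m : cder f x l -> l = m -> cder f x m.
Proof. by move=> + <-. Qed.

Lemma cderC l x : cder (fun=> l) x 0.
Proof. by split; exact: is_derive_cst. Qed.

Lemma cderD f g x l m : cder f x l -> cder g x m ->
  cder (fun t => f t + g t) x (l + m).
Proof.
move=> [h1 h2] [h3 h4]; split.
  rewrite ReD (_ : (fun t => _) = (fun t => Re (f t)) \+ (fun t => Re (g t))).
    exact: is_deriveD.
  by apply/funext => t /=; rewrite ReD.
rewrite ImD (_ : (fun t => _) = (fun t => Im (f t)) \+ (fun t => Im (g t))).
  exact: is_deriveD.
by apply/funext => t /=; rewrite ImD.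
Qed.

Lemma cderM f g x l m : cder f x l -> cder g x m ->
  cder (fun t => f t * g t) x (l * g x + f x * m).
Proof.
move=> [h1 h2] [h3 h4]; split.
  rewrite (_ : (fun t => _) = (fun t => Re (f t)) * (fun t => Re (g t))
     - (fun t => Im (f t)) * (fun t => Im (g t))).
    apply: (is_derive_eq (is_deriveB (is_deriveM h1 h3) (is_deriveM h2 h4))).
    by rewrite ReD !ReM /GRing.scale /=; ring.
  by apply/funext => t /=; rewrite ReM.
rewrite (_ : (fun t => _) = (fun t => Re (f t)) * (fun t => Im (g t))
     + (fun t => Im (f t)) * (fun t => Re (g t))).
  apply: (is_derive_eq (is_deriveD (is_deriveM h1 h4) (is_deriveM h2 h3))).
  by rewrite ImD !ImM /GRing.scale /=; ring.
by apply/funext => t /=; rewrite ImM.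
Qed.


Lemma cderR h x (d : R) : is_derive x 1 h d -> cder (fun t => (h t)%:C) x d%:C.
Proof. by move=> hd; split => //=; exact: is_derive_cst. Qed.

Lemma cder_comp f h x (d : R) l : is_derive x 1 h d -> cder f (h x) l ->
  cder (fun t => f (h t)) x (d%:C * l).
Proof.
move=> hd [h1 h2]; split; rewrite (ReRM, ImRM) mulrC.
  exact: (@is_derive1_comp _ (fun t => Re (f t)) h).
exact: (@is_derive1_comp _ (fun t => Im (f t)) h).
Qed.

Lemma cder_cexpM l x : cder (fun t => cexp (l * t%:C)) x (l * cexp (l * x%:C)).
Proof.
have e1 : forall t : R, Re (l * t%:C) = Re l * t by move=> t; rewrite mulrC ReRM mulrC.
have e2 : forall t : R, Im (l * t%:C) = Im l * t by move=> t; rewrite mulrC ImRM mulrC.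
have d1 (a : R) : is_derive x 1 (fun t : R => a * t) a.
  by apply: (@is_derive_eq _ _ _ (a *: id)) => //=; rewrite /GRing.scale /= mulr1.
have dE : is_derive x 1 (fun t => expR (Re l * t)) (expR (Re l * x) * Re l).
  exact: (@is_derive1_comp _ expR).
have dc : is_derive x 1 (fun t => cos (Im l * t)) (- sin (Im l * x) * Im l).
  exact: (@is_derive1_comp _ cos).
have ds : is_derive x 1 (fun t => sin (Im l * t)) (cos (Im l * x) * Im l).
  exact: (@is_derive1_comp _ sin).
split.
  rewrite (_ : (fun t => _) =
    (fun t => expR (Re l * t)) * (fun t => cos (Im l * t))).
    by apply: is_derive_eq; rewrite ReM /GRing.scale /= e1 e2; ring.
  by apply/funext => t /=; rewrite e1 e2.
rewrite (_ : (fun t => _) =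
  (fun t => expR (Re l * t)) * (fun t => sin (Im l * t))).
  by apply: is_derive_eq; rewrite ImM /GRing.scale /= e1 e2; ring.
by apply/funext => t /=; rewrite e1 e2.
Qed.

Lemma cder_cpow h x (d : R) l : is_derive x 1 h d -> 0 < h x ->
  cder (fun t => cpow (h t) l) x (d%:C * (l * cpow (h x) (l - 1))).
Proof.
move=> hd hx0.
have dl : is_derive x 1 (fun t => ln (h t)) ((h x)^-1 * d).
  by apply: (@is_derive1_comp _ (@ln R)) => //; exact: is_derive1_ln.
have := cder_comp dl (cder_cexpM l (ln (h x))).
move=> hc; apply: cder_eq hc _.
rewrite -/(cpow (h x) l) -(cpowB1 _ hx0) rmorphM fmorphV.
have : (h x)%:C != 0 by rewrite -cn_gt0 cnR normr_gt0 gt_eqF.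
by move=> ?; field.
Qed.

Lemma cder_cont f x l : cder f x l -> ccont f x.
Proof.
move=> [h1 h2]; split; apply: differentiable_continuous;
  exact/derivable1_diffP/ex_derive.
Qed.

Lemma ccontC l x : ccont (fun=> l) x.
Proof. by split; apply: cvg_cst. Qed.

Lemma ccontD f g x : ccont f x -> ccont g x -> ccont (fun t => f t + g t) x.
Proof.
move=> [h1 h2] [h3 h4]; split; rewrite /prop_for /continuous_at.
  under eq_fun do rewrite ReD; rewrite ReD; exact: cvgD.
under eq_fun do rewrite ImD; rewrite ImD; exact: cvgD.
Qed.

Lemma ccontM f g x : ccont f x -> ccont g x -> ccont (fun t => f t * g t) x.
Proof.
move=> [h1 h2] [h3 h4]; split; rewrite /prop_for /continuous_at.
  under eq_fun do rewrite ReM; rewrite ReM.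
  by apply: cvgB; apply: cvgM.
under eq_fun do rewrite ImM; rewrite ImM.
by apply: cvgD; apply: cvgM.
Qed.

Lemma ccontR h x : {for x, continuous h} -> ccont (fun t => (h t)%:C) x.
Proof. by move=> hc; split => //; apply: cvg_cst. Qed.

Lemma ccont_comp f h x : {for x, continuous h} -> ccont f (h x) ->
  ccont (fun t => f (h t)) x.
Proof. by move=> hc [h1 h2]; split; [exact: (continuous_comp hc h1)|exact: (continuous_comp hc h2)]. Qed.

Lemma ccont_cpow h x l : {for x, continuous h} -> 0 < h x ->
  ccont (fun t => cpow (h t) l) x.
Proof.
move=> hc h0; apply: (ccont_comp (f := fun t => cpow t l)) => //.
by apply: cder_cont; apply: (cder_cpow (h := id)); exact: h0.
Qed.
End complex_calculus.

Section complex_measurability.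
Context {R : realType} d {T : measurableType d}.
Implicit Types (D : set T) (f g : T -> R[i]) (h : T -> R).

Definition cmeas D f : Prop :=
  measurable_fun D (fun x => Re (f x)) /\ measurable_fun D (fun x => Im (f x)).

Lemma cmeasC D z : cmeas D (fun=> z).
Proof. by split; exact: measurable_cst. Qed.
Lemma cmeasR D h : measurable_fun D h -> cmeas D (fun x => (h x)%:C).
Proof. by move=> mh; split => //; exact: measurable_cst. Qed.
Lemma cmeasD D f g : cmeas D f -> cmeas D g -> cmeas D (fun x => f x + g x).
Proof.
move=> [f1 f2] [g1 g2]; split.
  by under eq_fun do rewrite ReD; exact: measurable_funD.
by under eq_fun do rewrite ImD; exact: measurable_funD.
Qed.
Lemma cmeasM D f g : cmeas D f -> cmeas D g -> cmeas D (fun x => f x * g x).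
Proof.
move=> [f1 f2] [g1 g2]; split.
  under eq_fun do rewrite ReM.
  by apply: measurable_funB; exact: measurable_funM.
under eq_fun do rewrite ImM.
by apply: measurable_funD; exact: measurable_funM.
Qed.
Lemma cmeas_eq D f g : {in D, f =1 g} -> cmeas D f -> cmeas D g.
Proof.
move=> fg [f1 f2]; split.
  by apply: eq_measurable_fun f1 => x xD; rewrite fg.
by apply: eq_measurable_fun f2 => x xD; rewrite fg.
Qed.
Lemma cmeasS D E f : measurable E -> D `<=` E -> cmeas E f -> cmeas D f.
Proof. by move=> mE DE [f1 f2]; split; exact: measurable_funS DE _. Qed.
Lemma cmeas_cn D f : cmeas D f -> measurable_fun D (fun x => cn (f x)).
Proof.
move=> [f1 f2]; under eq_fun do rewrite cnE.
have ms : measurable_fun setT (@Num.sqrt R).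
  by apply: continuous_measurable_fun; exact: sqrt_continuous.
by apply: (measurableT_comp ms); apply: measurable_funD; exact: measurable_funX.
Qed.
Lemma cmeas_cexp D f : cmeas D f -> cmeas D (fun x => cexp (f x)).
Proof.
move=> [f1 f2]; have mc : measurable_fun setT (@cos R).
  by apply: continuous_measurable_fun; exact: continuous_cos.
have ms : measurable_fun setT (@sin R).
  by apply: continuous_measurable_fun; exact: continuous_sin.
split => /=; (apply: measurable_funM; first exact: measurableT_comp f1);
  exact: measurableT_comp f2.
Qed.
Lemma cmeas_cpow D h s : measurable_fun D h -> cmeas D (fun x => cpow (h x) s).
Proof.
move=> mh; apply/cmeas_cexp/cmeasM; first exact: cmeasC.
apply: cmeasR; exact: (measurableT_comp (@measurable_ln R)).
Qed.
End complex_measurability.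

Section complex_integral.
Context {R : realType}.
Implicit Types (D : set R) (f g : R -> R[i]) (h : R -> R).

Lemma ccont_cmeas D f : open D -> (forall x, D x -> ccont f x) -> cmeas D f.
Proof.
move=> oD cf; split; apply: open_continuous_measurable_fun => // x;
  by rewrite inE => /cf[].
Qed.

Lemma cintegrable_cmeas D f : cintegrable D f -> cmeas D f.
Proof.
by move=> [/measurable_int/measurable_EFinP h1 /measurable_int/measurable_EFinP].
Qed.

Lemma cintegrable_dom D f h : msble D -> cmeas D f ->
  (forall x, D x -> cn (f x) <= h x) -> mu.-integrable D (EFin \o h) ->
  cintegrable D f.
Proof.
move=> mD [f1 f2] fh ih; split.
  apply: le_integrable ih => //; first exact/measurable_EFinP.
  move=> x Dx /=; rewrite lee_fin (le_trans (normRe_le _))//.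
  by rewrite (le_trans (fh _ Dx))// ler_norm.
apply: le_integrable ih => //; first exact/measurable_EFinP.
move=> x Dx /=; rewrite lee_fin (le_trans (normIm_le _))//.
by rewrite (le_trans (fh _ Dx))// ler_norm.
Qed.

Lemma cintegrable_cn D f : msble D -> cintegrable D f ->
  mu.-integrable D (EFin \o (fun x => cn (f x))).
Proof.
move=> mD hf; have [h1 h2] := hf.
have h3 : mu.-integrable D (EFin \o (fun x => `|Re (f x)| + `|Im (f x)|)).
  have := integrableD mD (integrable_norm h1) (integrable_norm h2).
  by apply: eq_integrable.
apply: le_integrable h3 => //.
  by apply/measurable_EFinP/cmeas_cn/cintegrable_cmeas.
move=> x Dx /=; rewrite lee_fin ger0_norm ?cn_ge0//.
by rewrite (le_trans (cn_leD _))// ler_norm.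
Qed.

Lemma eq_cintegrable D f g : msble D -> {in D, f =1 g} ->
  cintegrable D f -> cintegrable D g.
Proof.
move=> mD fg [h1 h2]; split; [apply: eq_integrable h1|apply: eq_integrable h2] => //.
  by move=> x xD /=; rewrite fg.
by move=> x xD /=; rewrite fg.
Qed.

Lemma eq_cint D f g : {in D, f =1 g} -> cint D f = cint D g.
Proof.
by move=> fg; congr Complex; apply: eq_Rintegral => x xD; rewrite fg.
Qed.

Lemma cintegrableS D E f : msble E -> msble D -> D `<=` E ->
  cintegrable E f -> cintegrable D f.
Proof. by move=> mE mD DE [h1 h2]; split; exact: integrableS mE mD DE _. Qed.

Lemma cintegrableD D f g : msble D -> cintegrable D f -> cintegrable D g ->
  cintegrable D (fun x => f x + g x).
Proof.
move=> mD [h1 h2] [h3 h4]; split.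
  by apply: eq_integrable (integrableD mD h1 h3) => // x _ /=; rewrite ReD.
by apply: eq_integrable (integrableD mD h2 h4) => // x _ /=; rewrite ImD.
Qed.

Lemma cintD D f g : msble D -> cintegrable D f -> cintegrable D g ->
  cint D (fun x => f x + g x) = cint D f + cint D g.
Proof.
move=> mD [h1 h2] [h3 h4]; apply: complexP => /=.
  by rewrite -RintegralD//; apply: eq_Rintegral => x _; rewrite ReD.
by rewrite -RintegralD//; apply: eq_Rintegral => x _; rewrite ImD.
Qed.

Lemma cintegrableZ D f z : msble D -> cintegrable D f ->
  cintegrable D (fun x => z * f x).
Proof.
move=> mD hf; have := integrableZl mD (cn z) (cintegrable_cn mD hf).
apply: cintegrable_dom => //; last by move=> x Dx; rewrite cnM.
by apply: cmeasM; [exact: cmeasC|exact: cintegrable_cmeas].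
Qed.

Lemma cintZ D f z : msble D -> cintegrable D f ->
  cint D (fun x => z * f x) = z * cint D f.
Proof.
move=> mD [h1 h2]; have i1 (a : R) := integrableZl mD a h1.
have i2 (a : R) := integrableZl mD a h2.
apply: complexP; rewrite (ReM, ImM) /= -!RintegralZl//.
  rewrite -(RintegralB mD (i1 (Re z)) (i2 (Im z))).
  by apply: eq_Rintegral => x _; rewrite ReM.
rewrite -(RintegralD mD (i2 (Re z)) (i1 (Im z))).
by apply: eq_Rintegral => x _; rewrite ImM.
Qed.

(** The factor 2 comes from bounding the real and imaginary parts separately; it is harmless in
    estimates up to a constant. *)
Lemma cint_le D f h : msble D -> cmeas D f ->
  (forall x, D x -> cn (f x) <= h x) -> mu.-integrable D (EFin \o h) ->
  cn (cint D f) <= 2 * \int[mu]_(x in D) h x.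
Proof.
move=> mD mf fh ih; have [h1 h2] := cintegrable_dom mD mf fh ih.
rewrite (le_trans (cn_leD _))//= mulrDl mul1r lerD//.
  rewrite (le_trans (le_normr_Rintegral mD h1))// le_Rintegral//.
    exact: integrable_norm.
  by move=> x Dx; rewrite (le_trans (normRe_le _))// fh.
rewrite (le_trans (le_normr_Rintegral mD h2))// le_Rintegral//.
  exact: integrable_norm.
by move=> x Dx; rewrite (le_trans (normIm_le _))// fh.
Qed.

(** Brings an integral into the form over the whole line on which substitution and Fubini
    operate. *)
Lemma cint_mkcond D f : cint D f = cint setT (fun x => (\1_D x)%:C * f x).
Proof.
rewrite /cint [in LHS]Rintegral_mkcond [in X in _ +i* X]Rintegral_mkcond.
congr Complex; apply: eq_Rintegral => x _; rewrite patchE (ReRM, ImRM) indicE;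
  by case: ifP; rewrite ?mul1r ?mul0r.
Qed.

Lemma cintegrable_mkcond D f : msble D ->
  cintegrable D f <-> cintegrable setT (fun x => (\1_D x)%:C * f x).
Proof.
move=> mD; have e1 : (EFin \o (fun x => Re (f x))) \_ D =
    EFin \o (fun x => Re ((\1_D x)%:C * f x)).
  apply/funext => x /=; rewrite patchE ReRM indicE.
  by case: ifP; rewrite ?mul1r ?mul0r.
have e2 : (EFin \o (fun x => Im (f x))) \_ D =
    EFin \o (fun x => Im ((\1_D x)%:C * f x)).
  apply/funext => x /=; rewrite patchE ImRM indicE.
  by case: ifP; rewrite ?mul1r ?mul0r.
rewrite /cintegrable -e1 -e2; split=> -[h1 h2]; split.
- exact/(integrable_mkcond _ mD).
- exact/(integrable_mkcond _ mD).
- exact/(integrable_mkcond _ mD).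
- exact/(integrable_mkcond _ mD).
Qed.

Lemma Re_cint D f : Re (cint D f) = \int[mu]_(x in D) Re (f x). Proof. by []. Qed.
Lemma Im_cint D f : Im (cint D f) = \int[mu]_(x in D) Im (f x). Proof. by []. Qed.

Lemma cint_eq0 D f :
  (forall x, D x -> f x = 0) -> cint D f = 0.
Proof.
move=> f0; apply: etrans (@eq_cint _ _ (fun=> 0) _) _.
  by move=> x; rewrite inE; exact: f0.
by rewrite /cint /=; congr Complex; rewrite /Rintegral integral0.
Qed.
End complex_integral.

(** * Affine changes of variable and the reflection *)

Section substitution.
Context {R : realType}.
Local Open Scope ereal_scope.
Implicit Types (a b : R) (f : R -> \bar R) (g : R -> R[i]).

Let phi a b : Rm R -> Rm R := fun x => (a * x + b)%R.

Let measurable_phi a b : measurable_fun setT (phi a b).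
Proof. by apply: measurable_funD => //; exact: measurable_funM. Qed.

Let affine_measure a b : {measure set (Rm R) -> \bar R} :=
  measure_function_pushforward__canonical__measure_function_Measure
    mu (measurable_phi a b).

(** By uniqueness of Lebesgue measure it is enough to compare both sides on half-open intervals,
    whose preimage under [phi a b] has its length divided by [a]. *)
Let lebesgue_measure_affine a b (a0 : (0 < a)%R) (A : set (Rm R)) : measurable A ->
  mu A = mscale (NngNum (ltW a0)) (affine_measure a b) A.
Proof.
apply: lebesgue_measure_unique => X /= [[u v] _ <-].
rewrite /mscale /= /pushforward.
rewrite (_ : phi a b @^-1` _ = `](u - b) / a, (v - b) / a]%classic)%R; last first.
  apply/seteqP; split=> x /=; rewrite !in_itv/= /phi ltr_pdivrMr// ler_pdivlMr//;
    by rewrite ltrBlDr lerBrDr mulrC.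
rewrite !lebesgue_measure_itv /= !lte_fin ltr_pM2r ?invr_gt0// ltrD2r.
case: ifP => _; last by rewrite mule0.
rewrite -!EFinB -EFinM; congr EFin; field; exact: lt0r_neq0.
Qed.

Lemma ge0_integral_affine f a b : (0 < a)%R ->
  measurable_fun setT (f : Rm R -> \bar R) -> (forall x, 0 <= f x) ->
  \int[mu]_x f x = a%:E * \int[mu]_x f (a * x + b)%R.
Proof.
move=> a0 mf f0.
rewrite (eq_measure_integral (mscale (NngNum (ltW a0)) (affine_measure a b))).
  rewrite ge0_integral_mscale//.
  by rewrite (ge0_integral_pushforward (measurable_phi a b)).
by move=> A mA _; exact: lebesgue_measure_affine.
Qed.

Lemma ge0_integral_oppr f :
  measurable_fun setT (f : Rm R -> \bar R) -> (forall x, 0 <= f x) ->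
  \int[mu]_x f x = \int[mu]_x f (- x)%R.
Proof.
move=> mf f0; have mN : measurable_fun [set: Rm R] (-%R : Rm R -> Rm R).
  exact: oppr_measurable.
transitivity (\int[pushforward mu (-%R : Rm R -> Rm R)]_x f x).
  by apply: eq_measure_integral => //= A mA AS; exact/esym/lebesgue_measureN.
by rewrite (ge0_integral_pushforward mN).
Qed.

(** A law known for nonnegative functions is applied to the absolute value, for integrability, and
    then to the positive and negative parts. The map [p] is abstract so that dilations and the
    reflection are treated at once. *)
Let transfer (p : Rm R -> Rm R) (c : R) : (0 < c)%R -> measurable_fun setT p ->
  (forall f, measurable_fun setT (f : Rm R -> \bar R) -> (forall x, 0 <= f x) ->
    \int[mu]_x f x = c%:E * \int[mu]_x f (p x)) ->
  forall h : R -> R, mu.-integrable setT (EFin \o h) ->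
  mu.-integrable setT (EFin \o (h \o p)) /\
  (\int[mu]_x h x = c * \int[mu]_x h (p x))%R.
Proof.
move=> c0 mp law h ih; have [mh hoo] := integrableP _ _ _ ih.
have ihp : mu.-integrable setT (EFin \o (h \o p)).
  apply/integrableP; split; first exact: (measurableT_comp mh).
  move: hoo; rewrite (law (fun x => `|(EFin \o h) x|))//; last exact: measurableT_comp.
  by apply: contraTT; rewrite -!leNgt !leye_eq => /eqP /= ->; rewrite gt0_muley.
split => //; rewrite /Rintegral integralE (law (fun x => (EFin \o h)^\+ x))//.
  rewrite (law (fun x => (EFin \o h)^\- x))//; last exact: measurable_funeneg.
  have := integrable_pos_fin_num measurableT ihp; have := integrable_neg_fin_num measurableT ihp.
  rewrite [in RHS]integralE /comp /=.
  have key (X Y : \bar R) : X \is a fin_num -> Y \is a fin_num ->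
      fine (c%:E * X - c%:E * Y) = (c * fine (X - Y))%R.
    by case: X => [x| |]//; case: Y => [y| |]// _ _ /=; rewrite mulrBr.
  move=> a1 a2; apply: etrans (key _ _ a2 a1).
  by congr (fine (_ * _ - _ * _)); apply: eq_integral => x _; rewrite !(funeposE, funenegE).
exact: measurable_funepos.
Qed.

Lemma cint_affine g a b : (0 < a)%R -> cintegrable setT g ->
  cintegrable setT (fun x => g (a * x + b)%R) /\
  cint setT g = (a%:C * cint setT (fun x => g (a * x + b)))%R.
Proof.
move=> a0 [g1 g2]; have law f := @ge0_integral_affine f a b a0.
have [h1 h2] := transfer a0 (measurable_phi a b) law g1.
have [h3 h4] := transfer a0 (measurable_phi a b) law g2.
by split; [split|apply: complexP; rewrite (ReRM, ImRM) /=].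
Qed.

Lemma cint_oppr g : cintegrable setT g ->
  cintegrable setT (fun x => g (- x)%R) /\
  cint setT g = cint setT (fun x => g (- x)%R).
Proof.
have mN : measurable_fun [set: Rm R] (-%R : Rm R -> Rm R) by exact: oppr_measurable.
have law f : measurable_fun setT (f : Rm R -> \bar R) -> (forall x, 0 <= f x) ->
    \int[mu]_x f x = 1%:E * \int[mu]_x f (- x)%R.
  by move=> mf f0; rewrite mul1e; exact: ge0_integral_oppr.
move=> [g1 g2]; have [h1 h2] := transfer ltr01 mN law g1.
have [h3 h4] := transfer ltr01 mN law g2.
split; first by split.
by apply: complexP; rewrite /= ?h2 ?h4 mul1r.
Qed.
End substitution.

(** * Fubini's theorem for complex integrands *)

Section fubini.
Context {R : realType}.
Implicit Types (F : R -> R -> R[i]).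
Local Open Scope ereal_scope.

Let ae_eq_integrable (f g : Rm R -> \bar R) : measurable_fun setT g ->
  ae_eq mu setT f g -> mu.-integrable setT f -> mu.-integrable setT g.
Proof.
move=> mg fg /integrableP[mf foo]; apply/integrableP; split => //.
rewrite -(@ae_eq_integral _ _ _ mu setT (abse \o g) (abse \o f))//.
- exact: measurableT_comp.
- exact: measurableT_comp.
- exact: ae_eq_comp.
Qed.

(** [Rintegral] replaces infinite values by real ones, so the two inner integrals are known to agree
    only where the section [F x] is integrable, that is almost everywhere. *)
Let fubini_left (F : R -> R -> R) :
  measurable_fun setT (fun p : Rm R * Rm R => F p.1 p.2) ->
  \int[mu]_x \int[mu]_y `|F x y|%:E < +oo ->
  mu.-integrable setT (EFin \o (fun x => \int[mu]_y F x y)%R) /\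
  \int[mu]_x (\int[mu]_y F x y)%R%:E = \int[mu]_x \int[mu]_y (F x y)%:E.
Proof.
move=> mF Foo; pose f (p : Rm R * Rm R) := (F p.1 p.2)%:E.
have mf : measurable_fun setT f by exact/measurable_EFinP.
have fi : (mu \x mu).-integrable setT f.
  exact: (proj2 (integrable12ltyP mu mu mf) Foo).
have ae1 := ae_integrable1 fi; have i1 := integrable_fubini_F fi.
have m1 := measurable_fubini_F fi.
have mf1 : measurable_fun setT (EFin \o (fun x => \int[mu]_y F x y)%R : Rm R -> \bar R).
  apply/measurable_EFinP.
  exact: (measurableT_comp (@fine_measurable R setT measurableT) m1).
have e1 : ae_eq mu setT (fubini_F mu f) (EFin \o (fun x => \int[mu]_y F x y)%R).
  apply: filterS ae1 => x /= ix _; rewrite /fubini_F /Rintegral fineK//.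
  exact: (integrable_fin_num measurableT ix).
split; first exact: (ae_eq_integrable mf1 e1 i1).
apply/esym; exact: (@ae_eq_integral _ _ _ mu setT _ _ measurableT m1 mf1 e1).
Qed.

Let fubini_real (F : R -> R -> R) :
  measurable_fun setT (fun p : Rm R * Rm R => F p.1 p.2) ->
  \int[mu]_x \int[mu]_y `|F x y|%:E < +oo ->
  [/\ mu.-integrable setT (EFin \o (fun x => \int[mu]_y F x y)%R),
     mu.-integrable setT (EFin \o (fun y => \int[mu]_x F x y)%R) &
    (\int[mu]_x (\int[mu]_y F x y) = \int[mu]_y (\int[mu]_x F x y))%R].
Proof.
move=> mF Foo; pose f (p : Rm R * Rm R) := (F p.1 p.2)%:E.
have mf : measurable_fun setT f by exact/measurable_EFinP.
have fi : (mu \x mu).-integrable setT f.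
  exact: (proj2 (integrable12ltyP mu mu mf) Foo).
have mG : measurable_fun setT (fun p : Rm R * Rm R => F p.2 p.1).
  exact: (measurableT_comp mF (@measurable_swap _ _ (Rm R) (Rm R))).
have Goo : \int[mu]_x \int[mu]_y `|F y x|%:E < +oo.
  have m2 : measurable_fun setT (fun p : Rm R * Rm R => `|F p.1 p.2|%:E).
    by apply/measurable_EFinP; exact: (measurableT_comp (@normr_measurable R setT) mF).
  have m20 p : 0 <= `|F p.1 p.2|%:E by rewrite lee_fin.
  by have /= <- := @fubini_tonelli _ _ (Rm R) (Rm R) R mu mu _ m2 m20.
have [h1 h2] := fubini_left mF Foo.
have [h3 h4] := fubini_left mG Goo.
split => //; rewrite /Rintegral; congr fine.
rewrite /Rintegral in h2 h4; rewrite h2 h4.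
exact: (Fubini fi).
Qed.

(** Absolute integrability is asked for in iterated form, as an integrable bound [g] on the inner
    integrals of the norm; this is how all the kernels below are estimated. *)
Lemma cint_fubini F (g : R -> R) :
  cmeas setT (fun p : Rm R * Rm R => F p.1 p.2) ->
  (forall x, \int[mu]_y (cn (F x y))%:E <= (g x)%:E) ->
  mu.-integrable setT (EFin \o g) ->
  [/\ cintegrable setT (fun x => cint setT (F x)),
      cintegrable setT (fun y => cint setT (F ^~ y)) &
      cint setT (fun x => cint setT (F x)) =
      cint setT (fun y => cint setT (F ^~ y))].
Proof.
move=> mF Fg ig.
have bound (h : R -> R -> R) : (forall x y, `|h x y| <= cn (F x y))%R ->
   measurable_fun setT (fun p : Rm R * Rm R => h p.1 p.2) ->
   \int[mu]_x \int[mu]_y `|h x y|%:E < +oo.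
  move=> hF mh.
  have mh2 : measurable_fun setT (fun p : Rm R * Rm R => `|h p.1 p.2|%:E).
    by apply/measurable_EFinP; exact: (measurableT_comp (@normr_measurable R setT) mh).
  apply: le_lt_trans (integrable_lty measurableT ig).
  apply: (@le_trans _ _ (\int[mu]_x `|g x|%:E)).
    apply: ge0_le_integral => //.
    - by move=> x _; exact: integral_ge0.
    - exact: (@measurable_fun_fubini_tonelli_F _ _ _ _ _ mu (fun p => `|h p.1 p.2|%:E)).
    - have /measurable_EFinP mg := measurable_int _ ig.
      by apply/measurable_EFinP; exact: (measurableT_comp (@normr_measurable R setT) mg).
    - move=> x _; apply: (@le_trans _ _ (g x)%:E); last by rewrite lee_fin ler_norm.
      apply: le_trans (Fg x); apply: ge0_le_integral => //.
      + apply/measurable_EFinP; exact: (measurableT_comp (measurableT_comp (@normr_measurable R setT) mh) (pair1_measurable x)).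
      + apply/measurable_EFinP; exact: (measurableT_comp (cmeas_cn mF) (pair1_measurable x)).
      + by move=> y _; rewrite lee_fin hF.
  (* The bound [Fg] forces [g] to be nonnegative, so [g] and its absolute value have the same
     integral. *)
  rewrite le_eqVlt; apply/orP; left; apply/eqP; apply: eq_integral => x _ /=.
  congr EFin; rewrite ger0_norm// -lee_fin; apply: le_trans (Fg x).
  by apply: integral_ge0 => y _; rewrite lee_fin cn_ge0.
have [mF1 mF2] := mF.
have [r1 r2 r3] := fubini_real mF1 (bound _ (fun x y => normRe_le _) mF1).
have [s1 s2 s3] := fubini_real mF2 (bound _ (fun x y => normIm_le _) mF2).
by split; [split|split|apply: complexP].
Qed.
End fubini.

Section parametric_integral.
Context {R : realType}.

(** By Tonelli the integrals of the positive and of the negative part are measurable in the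
    parameter as extended reals, and so is their difference. *)
Lemma cmeas_cint d (T : measurableType d) (F : T -> R -> R[i]) :
  cmeas setT (fun p : T * Rm R => F p.1 p.2) -> cmeas setT (fun x => cint setT (F x)).
Proof.
have real (h : T -> R -> R) : measurable_fun setT (fun p : T * Rm R => h p.1 p.2) ->
    measurable_fun setT (fun x => \int[mu]_y h x y).
  move=> mh; pose H (p : T * Rm R) : \bar R := (h p.1 p.2)%:E.
  have mH : measurable_fun setT H by exact/measurable_EFinP.
  apply: (measurableT_comp (@fine_measurable R setT measurableT)).
  rewrite (_ : (fun x => _) = (fun x => \int[mu]_y (H^\+)%E (x, y) - \int[mu]_y (H^\- )%E (x, y))%E); last first.
    apply/funext => x; rewrite integralE.
    by congr (_ - _)%E; apply: eq_integral => y _; rewrite !(funeposE, funenegE).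
  apply: emeasurable_funB.
    by apply: (@measurable_fun_fubini_tonelli_F _ _ _ _ _ mu (H^\+)%E) => //; exact: measurable_funepos.
  by apply: (@measurable_fun_fubini_tonelli_F _ _ _ _ _ mu (H^\-)%E) => //; exact: measurable_funeneg.
by move=> [m1 m2]; split; [exact: real m1|exact: real m2].
Qed.
End parametric_integral.

Section limits_of_integrals.
Context {R : realType}.
Implicit Types (D : set R) (h : R -> R).

Lemma ccont_cint (F : R -> R -> R[i]) D h (u v a : R) : msble D ->
  (forall x, u < x < v -> cmeas D (F x)) ->
  (forall x y, u < x < v -> D y -> ccont (F ^~ y) x) ->
  (forall x y, u < x < v -> D y -> cn (F x y) <= h y) ->
  mu.-integrable D (EFin \o h) ->
  u < a < v -> ccont (fun x => cint D (F x)) a.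
Proof.
move=> mD mF cF Fh ih auv; have iF x : `]u, v[%classic x -> cintegrable D (F x).
  by rewrite /= in_itv/= => xuv; apply: cintegrable_dom ih => //; [exact: mF|move=> y; exact: Fh].
have aI : a \in (`]u, v[%classic : set R) by rewrite inE /= in_itv.
split.
- apply: (@continuity_under_integral R _ _ mu (fun x y => Re (F x y)) D mD u v
    (fun x xI => (iF x xI).1) _ h ih) => //.
  + apply: aeW => y Dy x; rewrite inE /= in_itv/= => xuv.
    by have [] := cF x y xuv Dy.
  + move=> x; rewrite /= in_itv/= => xuv; apply: aeW => y Dy.
    by rewrite (le_trans (normRe_le _))// Fh.
- apply: (@continuity_under_integral R _ _ mu (fun x y => Im (F x y)) D mD u v
    (fun x xI => (iF x xI).2) _ h ih) => //.
  + apply: aeW => y Dy x; rewrite inE /= in_itv/= => xuv.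
    by have [] := cF x y xuv Dy.
  + move=> x; rewrite /= in_itv/= => xuv; apply: aeW => y Dy.
    by rewrite (le_trans (normIm_le _))// Fh.
Qed.
End limits_of_integrals.

Section complex_limits.
Context {R : realType}.
Implicit Types (f g : R -> R[i]) (F : set_system R) (l m : R[i]).

Definition ccvg f F l : Prop :=
  Re (f x) @[x --> F] --> Re l /\ Im (f x) @[x --> F] --> Im l.

Lemma ccvg_squeeze0 f F (u : R -> R) : Filter F ->
  (\forall x \near F, cn (f x) <= u x) -> u x @[x --> F] --> 0 -> ccvg f F 0.
Proof.
move=> FF fu u0; have Nu : - u x @[x --> F] --> 0 by rewrite -oppr0; exact: cvgN.
split; apply: (squeeze_cvgr _ Nu u0); near=> x; rewrite -ler_norml.
  apply: le_trans (normRe_le _) _; near: x; exact: fu.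
apply: le_trans (normIm_le _) _; near: x; exact: fu.
Unshelve. all: by end_near. Qed.

Lemma ccvgD f g F l m : Filter F -> ccvg f F l -> ccvg g F m ->
  ccvg (fun x => f x + g x) F (l + m).
Proof.
move=> FF [h1 h2] [h3 h4]; split.
  by under eq_fun do rewrite ReD; rewrite ReD; exact: cvgD.
by under eq_fun do rewrite ImD; rewrite ImD; exact: cvgD.
Qed.

Lemma ccvgM f g F l m : Filter F -> ccvg f F l -> ccvg g F m ->
  ccvg (fun x => f x * g x) F (l * m).
Proof.
move=> FF [h1 h2] [h3 h4]; split.
  by under eq_fun do rewrite ReM; rewrite ReM; apply: cvgB; exact: cvgM.
by under eq_fun do rewrite ImM; rewrite ImM; apply: cvgD; exact: cvgM.
Qed.

Lemma ccvgC F l : Filter F -> ccvg (fun=> l) F l.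
Proof. by move=> FF; split; exact: cvg_cst. Qed.

Lemma ccont_ccvg f (x : R) : ccont f x ->
  ccvg f x^'+ (f x) /\ ccvg f x^'- (f x).
Proof.
by move=> [h1 h2]; split; split; (apply: cvg_at_right_filter || apply: cvg_at_left_filter).
Qed.

End complex_limits.

(** * The fundamental theorem of calculus on open intervals *)

Section improper_ftc.
Context {R : realType}.
Implicit Types (f F : R -> R) (a b la lb : R).

(** Interior end points converging to [a] and [b]; the offset 3 keeps [al] strictly below [be] from
    the first index on. *)
Let al a b (n : nat) : R := a + (b - a) / n.+3%:R.
Let be a b (n : nat) : R := b - (b - a) / n.+3%:R.

Let alP a b n : a < b -> [/\ a < al a b n, al a b n < be a b n & be a b n < b].
Proof.
move=> ab; have ba : 0 < b - a by rewrite subr_gt0.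
have n0 : (0 : R) < n.+3%:R by rewrite ltr0n.
have d0 : 0 < (b - a) / n.+3%:R by rewrite divr_gt0.
have d1 : (b - a) / n.+3%:R * 3 <= b - a.
  by rewrite mulrAC ler_pdivrMr// ler_pM2l// ler_nat.
by rewrite /al /be; move: d0 d1; set d := _ / _ => d0 d1; split; lra.
Qed.

Let al_cvg a b : al a b n @[n --> \oo] --> a.
Proof.
rewrite -[X in _ --> X]addr0; apply: cvgD; first exact: cvg_cst.
rewrite -[X in _ --> X](mulr0 (b - a)); apply: cvgM; first exact: cvg_cst.
by have := @cvg_harmonic R; rewrite -(cvg_shiftn 2); under eq_fun do rewrite addn2.
Qed.

Let be_cvg a b : be a b n @[n --> \oo] --> b.
Proof.
rewrite -[X in _ --> X]subr0; apply: cvgB; first exact: cvg_cst.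
rewrite -[X in _ --> X](mulr0 (b - a)); apply: cvgM; first exact: cvg_cst.
by have := @cvg_harmonic R; rewrite -(cvg_shiftn 2); under eq_fun do rewrite addn2.
Qed.

Let cut a b n : set R := `[al a b n, be a b n]%classic.

Let cut_sub a b n : a < b -> cut a b n `<=` `]a, b[.
Proof.
move=> ab x; have [h1 h2 h3] := alP n ab.
rewrite /cut /= !in_itv/= => /andP[h4 h5].
by rewrite (lt_le_trans h1 h4) (le_lt_trans h5 h3).
Qed.

Let cut_cvg a b (f : R -> \bar R) x : a < x < b ->
  (f \_ (cut a b n)) x @[n --> \oo] --> f x.
Proof.
move=> /andP[ax xb]; apply: cvg_near_cst; near=> n.
rewrite patchE mem_set// /cut /= in_itv/=; apply/andP; split.
  by apply: ltW; near: n; apply: (cvgr_lt a) ax; exact: al_cvg.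
by apply: ltW; near: n; apply: (cvgr_gt b) xb; exact: be_cvg.
Unshelve. all: by end_near. Qed.

Let ftc_cut f F a b n : a < b ->
  (forall x, a < x < b -> is_derive x 1 F (f x)) ->
  (forall x, a < x < b -> {for x, continuous f}) ->
  (\int[mu]_(x in `]a, b[) ((EFin \o f) \_ (cut a b n)) x =
    (F (be a b n) - F (al a b n))%:E)%E.
Proof.
move=> ab dF cf; have [h1 h2 h3] := alP n ab.
rewrite -integral_mkcondr setIidr; last exact: cut_sub.
have inab x : x \in `[al a b n, be a b n] -> a < x < b.
  by move=> xi; have := @cut_sub a b n ab x; rewrite /cut /= xi in_itv/=; apply.
have cF x : x \in `[al a b n, be a b n] -> {for x, continuous F}.
  move=> /inab /dF dFx; apply: differentiable_continuous.
  exact/derivable1_diffP/ex_derive.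
rewrite /cut (@continuous_FTC2 _ f F)// ?EFinB//.
- apply: continuous_in_subspaceT => x; rewrite inE/= => xi.
  exact/cf/inab.
- split.
  + move=> x xi; have := dF x (inab x (subset_itv_oo_cc xi)).
    by move=> ?; exact: ex_derive.
  + by apply: cvg_at_right_filter; apply: cF; rewrite in_itv/= lexx ltW.
  + by apply: cvg_at_left_filter; apply: cF; rewrite in_itv/= lexx ltW.
- move=> x xi; have := dF x (inab x (subset_itv_oo_cc xi)).
  by move=> ?; rewrite derive1E; exact: derive_val.
Qed.

Let cvg_ends F a b la lb : a < b ->
  F x @[x --> a^'+] --> la -> F x @[x --> b^'-] --> lb ->
  F (be a b n) - F (al a b n) @[n --> \oo] --> lb - la.
Proof.
move=> ab Fa Fb; apply: cvgB.
  move/cvg_at_leftP : Fb; apply; split; last exact: be_cvg.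
  by move=> n; have [] := alP n ab.
move/cvg_at_rightP : Fa; apply; split; last exact: al_cvg.
by move=> n; have [] := alP n ab.
Qed.

Let measurable_cont f a b : (forall x, a < x < b -> {for x, continuous f}) ->
  measurable_fun (`]a, b[%classic : set (Rm R)) f.
Proof.
move=> cf; apply: open_continuous_measurable_fun; first exact: interval_open.
by move=> x; rewrite inE /= in_itv/= => /cf.
Qed.

(** For a nonnegative integrand, monotone convergence along compact subintervals gives integrability
    together with the value; the power integrals are obtained in this way. *)
Lemma ge0_improper_ftc f F a b la lb : a < b ->
  (forall x, a < x < b -> is_derive x 1 F (f x)) ->
  (forall x, a < x < b -> {for x, continuous f}) ->
  (forall x, a < x < b -> 0 <= f x) ->
  F x @[x --> a^'+] --> la -> F x @[x --> b^'-] --> lb ->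
  mu.-integrable `]a, b[ (EFin \o f) /\ \int[mu]_(x in `]a, b[) f x = lb - la.
Proof.
move=> ab dF cf f0 Fa Fb.
have mf := measurable_cont cf.
have mcut n : measurable (cut a b n : set (Rm R)) by exact: measurable_itv.
have E : (\int[mu]_(x in `]a, b[) (f x)%:E = (lb - la)%:E)%E.
  have : (\int[mu]_(x in `]a, b[) ((EFin \o f) \_ (cut a b n)) x @[n --> \oo]
     --> \int[mu]_(x in `]a, b[) limn (fun n => ((EFin \o f) \_ (cut a b n)) x))%E.
    apply: cvg_monotone_convergence => //.
    - move=> n; apply: (measurable_funS (E := `]a, b[%classic)) => //.
      apply/(measurable_restrict _ _ _) => //.
        exact: mcut.
      apply/measurable_EFinP; apply: measurable_funS mf => //; exact: subIsetl.
    - move=> n x /=; rewrite in_itv/= => xab; rewrite patchE; case: ifP => // _.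
      by rewrite lee_fin f0.
    - move=> x /=; rewrite in_itv/= => xab m n mn; rewrite !patchE.
      have sub : cut a b m `<=` cut a b n.
        have ba : 0 < b - a by rewrite subr_gt0.
        have hle : (b - a) / n.+3%:R <= (b - a) / m.+3%:R.
          by rewrite ler_pM2l// lef_pV2 ?posrE ?ltr0n// ler_nat !ltnS.
        move=> y; rewrite /cut /= !in_itv/= /al /be => /andP[h1 h2].
        by apply/andP; split; [apply: le_trans h1|apply: le_trans h2 _]; rewrite ?lerD2l ?lerN2.
      case: ifPn => [/set_mem/sub/mem_set ->//|_]; case: ifP => // _.
      by rewrite lee_fin f0.
  under eq_fun do rewrite (ftc_cut _ ab dF cf).
  have hl : (F (be a b n) - F (al a b n))%:E @[n --> \oo] --> (lb - la)%:E.
    by apply: cvg_EFin; [exact: nearW|exact: cvg_ends].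
  move=> /(cvg_unique _ hl) ->//.
  apply: eq_integral => x; rewrite inE/= in_itv/= => xab.
  by apply/esym/cvg_lim => //; exact: cut_cvg.
split; last by rewrite /Rintegral E.
apply/integrableP; split; first exact/measurable_EFinP.
under eq_integral => x.
  by rewrite inE/= in_itv/= => xab; rewrite ger0_norm ?f0//; over.
by rewrite E ltry.
Qed.

(** For a signed integrand the truncations to compact subintervals are dominated by its absolute
    value. *)
Lemma improper_ftc f F a b la lb : a < b ->
  (forall x, a < x < b -> is_derive x 1 F (f x)) ->
  (forall x, a < x < b -> {for x, continuous f}) ->
  mu.-integrable `]a, b[ (EFin \o f) ->
  F x @[x --> a^'+] --> la -> F x @[x --> b^'-] --> lb ->
  \int[mu]_(x in `]a, b[) f x = lb - la.
Proof.
move=> ab dF cf fi Fa Fb.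
have mcut n : measurable (cut a b n : set (Rm R)) by exact: measurable_itv.
have hl : (F (be a b n) - F (al a b n))%:E @[n --> \oo] --> (lb - la)%:E.
  by apply: cvg_EFin; [exact: nearW|exact: cvg_ends].
have : (\int[mu]_(x in `]a, b[) ((EFin \o f) \_ (cut a b n)) x @[n --> \oo]
   --> \int[mu]_(x in `]a, b[) (f x)%:E)%E.
  apply: (@dominated_cvg _ _ _ mu `]a, b[%classic _
    (fun n => (EFin \o f) \_ (cut a b n)) (EFin \o f) (abse \o (EFin \o f))) => //.
  - move=> n; apply/(measurable_restrict _ _ _) => //.
    by apply: measurable_funS (measurable_int _ fi) => //; exact: subIsetl.
  - by move=> x /=; rewrite in_itv/= => xab; exact: cut_cvg.
  - exact: integrable_abse.
  - by move=> n x _; rewrite patchE; case: ifP => _ /=; [exact: lexx|rewrite normr0 lee_fin].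
under eq_fun do rewrite (ftc_cut _ ab dF cf).
by move=> /(cvg_unique _ hl); rewrite /Rintegral => <-.
Qed.
Lemma cimproper_ftc (f F : R -> R[i]) a b (la lb : R[i]) : a < b ->
  (forall x, a < x < b -> cder F x (f x)) ->
  (forall x, a < x < b -> ccont f x) ->
  cintegrable `]a, b[ f ->
  ccvg F a^'+ la -> ccvg F b^'- lb ->
  cint `]a, b[ f = lb - la.
Proof.
move=> ab dF cf [i1 i2] [a1 a2] [b1 b2]; apply: complexP; rewrite (ReB, ImB) /=.
  apply: (improper_ftc ab _ _ i1 a1 b1) => x xab; first by have [] := dF x xab.
  by have [] := cf x xab.
apply: (improper_ftc ab _ _ i2 a2 b2) => x xab; first by have [] := dF x xab.
by have [] := cf x xab.
Qed.
End improper_ftc.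

(** * Abel transforms *)
Section hyperbolic.
Context {R : realType}.
Implicit Types x y z : R.

Lemma sinhN x : sinh (- x) = - sinh x :> R.
Proof. by rewrite /sinh opprK -mulNr opprB. Qed.
Lemma coshN x : cosh (- x) = cosh x :> R.
Proof. by rewrite /cosh opprK addrC. Qed.
Lemma sinh0 : sinh 0 = 0 :> R. Proof. by rewrite /sinh oppr0 subrr mul0r. Qed.
Lemma cosh0 : cosh 0 = 1 :> R. Proof. by rewrite /cosh oppr0 expR0; lra. Qed.

Lemma cosh_abs x : cosh `|x| = cosh x :> R.
Proof. by have [_|_] := ger0P x; rewrite ?coshN. Qed.

Lemma expRNM x : expR x * expR (- x) = 1 :> R.
Proof. by rewrite -expRD subrr expR0. Qed.

Lemma cosh2sinh2 x : cosh x ^+ 2 = 1 + sinh x ^+ 2 :> R.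
Proof. by have h := expRNM x; rewrite /cosh /sinh; nra. Qed.

Lemma cosh_double x : cosh x = 2 * cosh (x / 2) ^+ 2 - 1 :> R.
Proof.
have h := expRNM (x / 2).
rewrite {1}/cosh (_ : x = x / 2 + x / 2); last lra.
rewrite opprD !expRD (_ : (x / 2 + x / 2) / 2 = x / 2); last lra.
by rewrite /cosh; nra.
Qed.

Lemma sinh_double x : sinh x = 2 * sinh (x / 2) * cosh (x / 2) :> R.
Proof.
rewrite {1}/sinh (_ : x = x / 2 + x / 2); last lra.
rewrite opprD !expRD (_ : (x / 2 + x / 2) / 2 = x / 2); last lra.
by rewrite /cosh /sinh; lra.
Qed.

Lemma expR_cosh_sinh x : expR x = cosh x + sinh x :> R.
Proof. by rewrite /cosh /sinh; lra. Qed.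

Global Instance is_derive_sinh x : is_derive x 1 (@sinh R) (cosh x).
Proof.
have dN : is_derive x 1 (fun t : R => expR (- t)) (- expR (- x)).
  apply: (is_derive_eq (@is_derive1_comp _ expR -%R x _ _ (is_derive_expR _) (is_deriveNid x 1))).
  by rewrite mulrN1.
rewrite (_ : @sinh R = 2^-1 *: (expR - (fun t : R => expR (- t)))); last first.
  by apply/funext => t; rewrite /sinh /= mulrC.
apply: (is_derive_eq (is_deriveZ 2^-1 (is_deriveB (is_derive_expR x) dN))).
by rewrite /cosh /GRing.scale /= opprK mulrC.
Qed.

Global Instance is_derive_cosh x : is_derive x 1 (@cosh R) (sinh x).
Proof.
have dN : is_derive x 1 (fun t : R => expR (- t)) (- expR (- x)).
  apply: (is_derive_eq (@is_derive1_comp _ expR -%R x _ _ (is_derive_expR _) (is_deriveNid x 1))).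
  by rewrite mulrN1.
rewrite (_ : @cosh R = 2^-1 *: (expR + (fun t : R => expR (- t)))); last first.
  by apply/funext => t; rewrite /cosh /= mulrC.
apply: (is_derive_eq (is_deriveZ 2^-1 (is_deriveD (is_derive_expR x) dN))).
by rewrite /sinh /GRing.scale /= mulrC.
Qed.

Lemma continuous_sinh : continuous (@sinh R).
Proof. by move=> x; exact/differentiable_continuous/derivable1_diffP. Qed.
Lemma continuous_cosh : continuous (@cosh R).
Proof. by move=> x; exact/differentiable_continuous/derivable1_diffP. Qed.

Lemma is_derive_half (f : R -> R) x (d : R) : is_derive (x / 2) 1 f d ->
  is_derive x 1 (fun t => f (t / 2)) (d / 2).
Proof.
move=> hf; have hid : is_derive x 1 (fun t : R => t / 2) 2^-1.
  rewrite (_ : (fun t => _) = 2^-1 *: id); last by apply/funext => t; rewrite /= mulrC.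
  by apply: (is_derive_eq (is_deriveZ 2^-1 (is_derive_id x 1))); rewrite /GRing.scale /= mulr1.
exact: (@is_derive1_comp _ f (fun t => t / 2)).
Qed.

Lemma cosh_ge1 x : 1 <= cosh x :> R.
Proof.
rewrite -(ler_pXn2r (n := 2))// ?nnegrE//; last first.
  by rewrite /cosh divr_ge0// addr_ge0// expR_ge0.
by rewrite cosh2sinh2 expr1n lerDl sqr_ge0.
Qed.
Lemma cosh_gt0 x : 0 < cosh x :> R.
Proof. exact: lt_le_trans (cosh_ge1 x). Qed.

Lemma sinh_ge_id x : 0 <= x -> x <= sinh x :> R.
Proof.
rewrite le_eqVlt => /predU1P[<-|x0]; first by rewrite sinh0.
have [c _ e] : exists2 c, c \in `]0, x[%R & sinh x - sinh 0 = cosh c * (x - 0).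
  apply: MVT => //.
  by apply: continuous_subspaceT; exact: continuous_sinh.
rewrite sinh0 !subr0 in e; rewrite e ler_peMl ?cosh_ge1//; exact: ltW.
Qed.
Lemma sinh_gt0 x : 0 < x -> 0 < sinh x :> R.
Proof. by move=> x0; apply: lt_le_trans (sinh_ge_id (ltW x0)). Qed.
Lemma sinh_ge0 x : 0 <= x -> 0 <= sinh x :> R.
Proof. by move=> x0; apply: le_trans (sinh_ge_id x0). Qed.

Lemma ltr_cosh x y : 0 <= x -> x < y -> cosh x < cosh y :> R.
Proof.
move=> x0 xy; rewrite -subr_gt0.
have [c + ->] : exists2 c, c \in `]x, y[%R & cosh y - cosh x = sinh c * (y - x).
  apply: MVT => //.
  by apply: continuous_subspaceT; exact: continuous_cosh.
rewrite in_itv/= => /andP[xc _]; rewrite mulr_gt0 ?subr_gt0// sinh_gt0//.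
exact: le_lt_trans xc.
Qed.
Lemma ler_cosh x y : 0 <= x -> x <= y -> cosh x <= cosh y :> R.
Proof.
by move=> x0; rewrite le_eqVlt => /predU1P[->//|/(ltr_cosh x0)/ltW].
Qed.

Lemma sinh_le_cosh_id x (L : R) : 0 <= x -> x <= L -> sinh x <= cosh L * x :> R.
Proof.
rewrite le_eqVlt => /predU1P[<-|x0] xL; first by rewrite sinh0 mulr0.
have [c + e] : exists2 c, c \in `]0, x[%R & sinh x - sinh 0 = cosh c * (x - 0).
  apply: MVT => //.
  by apply: continuous_subspaceT; exact: continuous_sinh.
rewrite in_itv/= => /andP[c0 cx]; rewrite sinh0 !subr0 in e; rewrite e ler_pM2r//.
by apply: ler_cosh; [exact: ltW|rewrite (le_trans (ltW cx))].
Qed.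
End hyperbolic.

(** * Real powers with an exponent of either sign *)

Section power_integrals.
Context {R : realType}.
Implicit Types (a b r u v m M : R).

Lemma powR_comp_cvg0 {T : Type} (F : set_system T) (u : T -> R) r : Filter F ->
  0 < r -> u t @[t --> F] --> 0 -> (\forall t \near F, 0 < u t) ->
  u t `^ r @[t --> F] --> 0.
Proof.
move=> FF r0 u0 upos; apply: (cvg_comp u (fun x => x `^ r) _ (powR_cvg0 r0)).
move=> A; rewrite /at_right /within /= => hA.
have := u0 _ hA; rewrite /= /nbhs /= => h; near=> t.
have : 0 < u t by near: t.
by near: t.
Unshelve. all: by end_near. Qed.

(** For [r >= 0] the upper bound on [v] gives the estimate, for [r < 0] the lower one. The sum of
    the two constants covers both cases, since exponents such as [Re k - 1] may have either sign. *)
Lemma powR_between r m M u v : 0 < m -> 0 < u -> m * u <= v -> v <= M * u ->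
  v `^ r <= (M `^ r + m `^ r) * u `^ r.
Proof.
move=> m0 u0 muv vMu; have v0 : 0 < v by apply: lt_le_trans muv; rewrite mulr_gt0.
have M0 : 0 < M by rewrite -(pmulr_lgt0 _ u0) (lt_le_trans v0).
rewrite mulrDl -!powRM ?(ltW u0) ?(ltW m0) ?(ltW M0)//.
have [r0|r0] := leP 0 r.
  apply: (@le_trans _ _ ((M * u) `^ r)); last by rewrite lerDl powR_ge0.
  by rewrite ge0_ler_powR// nnegrE ?ltW// mulr_gt0.
apply: (@le_trans _ _ ((m * u) `^ r)); last by rewrite lerDr powR_ge0.
rewrite -[r]opprK [v `^ _]powRN [(m * u) `^ _]powRN.
rewrite lef_pV2 ?posrE ?powR_gt0// ?mulr_gt0//.
apply: ge0_ler_powR => //; rewrite ?nnegrE ?oppr_ge0;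
  [exact: ltW|exact/ltW/mulr_gt0|exact: ltW].
Qed.

Let cont_powR r v : 0 < v -> {for v, continuous (fun t => t `^ r)}.
Proof.
move=> v0; apply: differentiable_continuous; apply/derivable1_diffP.
by have h := @is_derive1_powR R r v v0; exact: ex_derive.
Qed.

Lemma continuous_powR_comp (h : R -> R) r v : 0 < h v -> {for v, continuous h} ->
  {for v, continuous (fun t => h t `^ r)}.
Proof. by move=> hv0 hc; exact: (continuous_comp hc (@cont_powR _ _ hv0)). Qed.

Let is_derive_sub (a t : R) : is_derive t 1 (fun x : R => x - a) 1.
Proof.
by apply: (is_derive_eq (is_deriveB (is_derive_id t 1) (is_derive_cst a t 1))); rewrite subr0.
Qed.

Let is_derive_subl (a t : R) : is_derive t 1 (fun x : R => a - x) (-1).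
Proof.
by apply: (is_derive_eq (is_deriveB (is_derive_cst a t 1) (is_derive_id t 1))); rewrite sub0r.
Qed.

Lemma integral_powR_left a b r : a < b -> 0 < r ->
  mu.-integrable `]a, b[ (EFin \o (fun t => (t - a) `^ (r - 1))) /\
  \int[mu]_(t in `]a, b[) (t - a) `^ (r - 1) = (b - a) `^ r / r.
Proof.
move=> ab r0; rewrite -[X in _ = X]subr0.
apply: (@ge0_improper_ftc _ _ (fun t => (t - a) `^ r / r)) => //.
- move=> t /andP[at_ tb]; have ta : 0 < t - a by rewrite subr_gt0.
  have h := @is_derive1_powR R r _ ta.
  have hc := @is_derive1_comp _ (fun x => x `^ r) (fun x => x - a) t _ _ h (is_derive_sub a t).
  rewrite (_ : (fun t => _) = r^-1 *: (fun t => (t - a) `^ r)); last first.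
    by apply/funext => x; rewrite /= mulrC.
  by apply: (is_derive_eq (is_deriveZ r^-1 hc)); rewrite /GRing.scale /=; field; exact: lt0r_neq0.
- move=> t /andP[at_ tb]; apply: continuous_powR_comp; rewrite ?subr_gt0//.
  by apply: cvgB; [exact: cvg_id|exact: cvg_cst].
- by move=> t _; rewrite powR_ge0.
- rewrite -[X in _ --> X](mul0r r^-1); apply: cvgM; last exact: cvg_cst.
  apply: powR_comp_cvg0 => //.
    rewrite -[X in _ --> X](subrr a); apply: cvg_at_right_filter.
    by apply: cvgB; [exact: cvg_id|exact: cvg_cst].
  by near=> t; rewrite subr_gt0; near: t; exact: nbhs_right_gt.
- apply: cvg_at_left_filter; apply: cvgM; last exact: cvg_cst.
  apply: (@continuous_powR_comp (fun t => t - a) r b); rewrite ?subr_gt0//.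
  by apply: cvgB; [exact: cvg_id|exact: cvg_cst].
Unshelve. all: by end_near. Qed.

Lemma integral_powR_right a b r : a < b -> 0 < r ->
  mu.-integrable `]a, b[ (EFin \o (fun t => (b - t) `^ (r - 1))) /\
  \int[mu]_(t in `]a, b[) (b - t) `^ (r - 1) = (b - a) `^ r / r.
Proof.
move=> ab r0; rewrite -[X in _ = X](opprK) -sub0r.
apply: (@ge0_improper_ftc _ _ (fun t => - ((b - t) `^ r / r))) => //.
- move=> t /andP[at_ tb]; have ta : 0 < b - t by rewrite subr_gt0.
  have h := @is_derive1_powR R r _ ta.
  have hc := @is_derive1_comp _ (fun x => x `^ r) (fun x => b - x) t _ _ h (is_derive_subl b t).
  rewrite (_ : (fun t => _) = (- r^-1) *: (fun t => (b - t) `^ r)); last first.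
    by apply/funext => x; rewrite mulrC -mulNr.
  apply: (is_derive_eq (is_deriveZ (- r^-1) hc)); rewrite /GRing.scale /=.
  by field; exact: lt0r_neq0.
- move=> t /andP[at_ tb]; apply: continuous_powR_comp; rewrite ?subr_gt0//.
  by apply: cvgB; [exact: cvg_cst|exact: cvg_id].
- by move=> t _; rewrite powR_ge0.
- apply: cvgN; apply: cvg_at_right_filter; apply: cvgM; last exact: cvg_cst.
  apply: (@continuous_powR_comp (fun t => b - t) r a); rewrite ?subr_gt0//.
  by apply: cvgB; [exact: cvg_cst|exact: cvg_id].
- rewrite -[X in _ --> X]oppr0 -(mul0r r^-1); apply: cvgN; apply: cvgM; last exact: cvg_cst.
  apply: powR_comp_cvg0 => //.
    rewrite -[X in _ --> X](subrr b); apply: cvg_at_left_filter.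
    by apply: cvgB; [exact: cvg_cst|exact: cvg_id].
  by near=> t; rewrite subr_gt0; near: t; exact: nbhs_left_lt.
Unshelve. all: by end_near. Qed.
End power_integrals.

(** * Definition of the transform and bounds on its kernel *)

Section abel_transform.
Context {R : realType}.
Implicit Types (x y z L r : R) (k : R[i]) (f g F : R -> R[i]) (D : set R).

(** The common features of [cosh x] and [cosh (x/2)]: on bounded intervals [C'] is comparable with
    [y], so that [C] behaves like a square and [C z - C y] like [z (z - y)]. *)
Definition abel_weight (C C' : R -> R) : Prop :=
  [/\ forall y, is_derive y 1 C (C' y), continuous C' &
   forall L, 0 < L -> exists m M, [/\ 0 < m, 0 < M &
     forall y, 0 <= y <= L -> m * y <= C' y <= M * y]].

Definition locally_bounded F : Prop :=
  forall L, 0 < L -> exists2 M, 0 < M & forall y, 0 < y <= L -> cn (F y) <= M.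

(** Abel transforms only see positive arguments. The class contains the continuous functions and is
    stable under sums, products and multiplication of an inner transform by [cS]. *)
Definition admissible F : Prop :=
  (forall y, 0 < y -> ccont F y) /\ locally_bounded F.

(** Up to the factor [Gamma k], the fractional integral of order [k] of [F / C'] with respect to
    [C]. *)
Definition abel (C : R -> R) k F x : R[i] :=
  cint `]0, x[ (fun y => F y * cpow (C x - C y) (k - 1)).

Lemma abel_weight_cosh : abel_weight cosh sinh.
Proof.
split; [exact: is_derive_cosh|exact: continuous_sinh|move=> L L0].
exists 1, (cosh L); split; [exact: ltr01|exact: cosh_gt0|].
move=> y /andP[y0 yL]; rewrite mul1r sinh_ge_id//=.
exact: sinh_le_cosh_id.
Qed.

Lemma abel_weight_cosh_half :
  abel_weight (fun x => cosh (x / 2)) (fun x => sinh (x / 2) / 2).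
Proof.
split; first by move=> y; exact: is_derive_half.
  move=> y; apply: cvgM; last exact: cvg_cst.
  apply: (@continuous_comp _ _ _ (fun x => x / 2) sinh); last exact: continuous_sinh.
  by apply: cvgM; [exact: cvg_id|exact: cvg_cst].
move=> L L0; exists 4^-1, (cosh (L / 2) / 4); split.
- by rewrite invr_gt0.
- by rewrite divr_gt0// cosh_gt0.
move=> y /andP[y0 yL].
have h1 := @sinh_ge_id R (y / 2); have h2 := @sinh_le_cosh_id R (y / 2) (L / 2).
have {}h1 : y / 2 <= sinh (y / 2) by apply: h1; lra.
have {}h2 : sinh (y / 2) <= cosh (L / 2) * (y / 2) by apply: h2; lra.
by apply/andP; split; lra.
Qed.

Section fixed_weight.
Context (C C' : R -> R) (hC : abel_weight C C').

Let dC y : is_derive y 1 C (C' y). Proof. by case: hC. Qed.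

Lemma abel_weight_cont y : {for y, continuous C}.
Proof.
apply: differentiable_continuous; apply/derivable1_diffP.
by have h := dC y; exact: ex_derive.
Qed.

Lemma abel_weight_diff L : 0 < L -> exists m M, [/\ 0 < m, 0 < M &
  forall y z, 0 <= y < z -> z <= L ->
    m * (z * (z - y)) <= C z - C y <= M * (z * (z - y))].
Proof.
move=> L0; have [_ _ /(_ L L0)[m [M [m0 M0 hm]]]] := hC.
exists (m / 2), M; split => //; first by rewrite divr_gt0.
move=> y z /andP[y0 yz] zL; apply/andP; split.
  (* The mean value theorem for [C] alone would produce a factor [c] that may lie far below [z]. It
     is applied to [C - m t^2 / 2], whose derivative is nonnegative, and
     [z^2 - y^2 >= z (z - y)]. *)
  have hd (t : R) : is_derive t 1 (C - (fun t => m / 2 * (t * t))) (C' t - m * t).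
    have h1 : is_derive t 1 (fun t : R => m / 2 * (t * t)) (m * t).
      rewrite (_ : (fun t => _) = (m / 2) *: (id * id)); last by [].
      apply: (is_derive_eq (is_deriveZ (m / 2) (is_deriveM (is_derive_id t 1) (is_derive_id t 1)))).
      by rewrite /GRing.scale /=; lra.
    exact: is_deriveB.
  have [c + e] : exists2 c, c \in `]y, z[%R &
     (C - (fun t => m / 2 * (t * t))) z - (C - (fun t => m / 2 * (t * t))) y
        = (C' c - m * c) * (z - y).
    apply: (@MVT _ _ (fun c => C' c - m * c)) => //.
    apply: continuous_subspaceT => t; apply: differentiable_continuous.
    by apply/derivable1_diffP; have h := hd t; exact: ex_derive.
  rewrite in_itv/= => /andP[yc cz].
  have /andP[h1 _] : m * c <= C' c <= M * c.
    by apply: hm; rewrite (le_trans y0 (ltW yc)) (le_trans (ltW cz)).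
  have e2 : C z - C y - m / 2 * (z * z - y * y) = (C' c - m * c) * (z - y).
    have eu (u : R) : (C - (fun t : R => m / 2 * (t * t))) u = C u - m / 2 * (u * u) by [].
    by rewrite !eu in e; rewrite -e; ring.
  have h3 : 0 <= (C' c - m * c) * (z - y) by rewrite mulr_ge0// subr_ge0// ltW.
  have h4 : 0 <= m / 2 * (y * (z - y)).
    by rewrite !mulr_ge0// ?divr_ge0 ?subr_ge0// ltW.
  by move: e2 h3 h4; nra.
have [c + e] : exists2 c, c \in `]y, z[%R & C z - C y = C' c * (z - y).
  apply: (@MVT _ _ C') => //.
  by apply: continuous_subspaceT => t; exact: abel_weight_cont.
rewrite in_itv/= => /andP[yc cz].
have /andP[_ h1] : m * c <= C' c <= M * c.
  by apply: hm; rewrite (le_trans y0 (ltW yc)) (le_trans (ltW cz)).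
rewrite e mulrA ler_pM2r ?subr_gt0// (le_trans h1)// ler_pM2l//.
exact: ltW.
Qed.

Lemma abel_weight_lt y z : 0 <= y -> y < z -> 0 < C z - C y.
Proof.
move=> y0 yz; have z0 : 0 < z by exact: le_lt_trans yz.
have [m [M [m0 _ /(_ y z)]]] := abel_weight_diff z0.
rewrite y0 yz lexx => /(_ isT isT)/andP[h _]; apply: lt_le_trans h.
by rewrite !mulr_gt0// subr_gt0.
Qed.

Lemma abel_kernel_bound k L : 0 < L -> exists2 K, 0 < K &
  forall y z, 0 <= y < z -> z <= L ->
    cn (cpow (C z - C y) k) <= K * (z `^ Re k * (z - y) `^ Re k).
Proof.
move=> L0; have [m [M [m0 M0 h]]] := abel_weight_diff L0.
exists (M `^ Re k + m `^ Re k); first by rewrite addr_gt0// powR_gt0.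
move=> y z /[dup] yz /andP[y0 ltyz] zL.
have z0 : 0 < z by exact: le_lt_trans ltyz.
rewrite cn_cpow ?abel_weight_lt// -powRM ?subr_ge0 ?(ltW ltyz) ?(ltW z0)//.
have /andP[h1 h2] := h y z yz zL.
by apply: powR_between => //; rewrite mulr_gt0// subr_gt0.
Qed.
End fixed_weight.
End abel_transform.

Section local_lemmas.
Context {R : realType}.
Implicit Types (f g : R -> R[i]) (x a b : R).

Lemma near_gt0 x : 0 < x -> \forall t \near x, 0 < t.
Proof. by move=> x0; exact: lt_nbhsr. Qed.

Lemma ccont_near f g x : (\forall t \near x, f t = g t) -> ccont g x -> ccont f x.
Proof.
move=> fg [g1 g2]; have fgx : f x = g x by exact: nbhs_singleton fg.
split; rewrite /prop_for /continuous_at fgx.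
  by apply: cvg_trans g1; apply: near_eq_cvg; apply: filterS fg => t ->.
by apply: cvg_trans g2; apply: near_eq_cvg; apply: filterS fg => t ->.
Qed.

Lemma cder_near f g x l : (\forall t \near x, f t = g t) -> cder g x l -> cder f x l.
Proof.
move=> fg [g1 g2]; split.
  apply: near_eq_is_derive g1.
  by apply: filterS fg => t ->.
apply: near_eq_is_derive g2.
by apply: filterS fg => t ->.
Qed.

Lemma msble_itv (i : interval R) : msble [set` i].
Proof. exact: measurable_itv. Qed.

Lemma rintegrableZ (D : set R) (h : R -> R) a : msble D ->
  mu.-integrable D (EFin \o h) -> mu.-integrable D (EFin \o (fun x => a * h x)).
Proof.
by move=> mD hi; have := integrableZl mD a hi; apply: eq_integrable.
Qed.

Lemma cint_scale f x : 0 < x -> cintegrable `]0, x[ f ->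
  cintegrable `]0, 1[ (fun s => f (x * s)) /\
  cint `]0, x[ f = x%:C * cint `]0, 1[ (fun s => f (x * s)).
Proof.
move=> x0 hf.
have e s : \1_(`]0, x[%classic) (x * s + 0) = \1_(`]0, 1[%classic) s :> R.
  rewrite addr0 !indicE; congr ((nat_of_bool _)%:R).
  rewrite !mem_setE !in_itv/= pmulr_rgt0//; congr andb.
  by rewrite -[X in _ < X]mulr1 ltr_pM2l.
have := proj1 (cintegrable_mkcond f (msble_itv _)) hf.
move=> /(cint_affine 0 x0)[h1 h2].
have e2 : (fun s => (\1_(`]0, x[%classic) (x * s + 0))%:C * f (x * s + 0)) =
          (fun s => (\1_(`]0, 1[%classic) s)%:C * f (x * s)).
  by apply/funext => s; rewrite e addr0.
split.
  by apply/cintegrable_mkcond; [exact: msble_itv|rewrite -e2].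
by rewrite cint_mkcond h2 e2 -cint_mkcond.
Qed.
End local_lemmas.

Section abel_analysis.
Context {R : realType} (C C' : R -> R) (hC : abel_weight C C').
Implicit Types (x y z L r : R) (k : R[i]) (f g F : R -> R[i]).

Lemma ccont_abel_kernel k x y : 0 < y < x ->
  ccont (fun t => cpow (C x - C t) (k - 1)) y.
Proof.
move=> /andP[y0 yx]; apply: ccont_cpow.
  by apply: cvgB; [exact: cvg_cst|exact: (abel_weight_cont hC)].
by apply: (abel_weight_lt hC) => //; exact: ltW.
Qed.

Lemma abel_integrand_bound k F L : 0 < L -> locally_bounded F ->
  exists2 K, 0 < K & forall y x, 0 < y < x -> x <= L ->
    cn (F y * cpow (C x - C y) (k - 1)) <=
      K * x `^ (Re k - 1) * (x - y) `^ (Re k - 1).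
Proof.
move=> L0 /(_ L L0)[M M0 FM].
have [K K0 hK] := abel_kernel_bound hC (k - 1) L0.
exists (M * K); first exact: mulr_gt0.
move=> y x /andP[y0 yx] xL; rewrite cnM -!mulrA; apply: ler_pM.
- exact: cn_ge0.
- exact: cn_ge0.
- by apply: FM; rewrite y0 (le_trans (ltW yx)).
by have := hK y x; rewrite ReB /=; apply => //; rewrite (ltW y0).
Qed.

Lemma cmeas_abel_integrand k F x : (forall y, 0 < y -> ccont F y) ->
  cmeas `]0, x[ (fun y => F y * cpow (C x - C y) (k - 1)).
Proof.
move=> cF; apply: ccont_cmeas; first exact: interval_open.
move=> y; rewrite /= in_itv/= => /[dup] yx /andP[y0 _].
by apply: ccontM; [exact: cF|exact: ccont_abel_kernel].
Qed.

Lemma abel_integrable k F x : 0 < Re k -> admissible F -> 0 < x ->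
  cintegrable `]0, x[ (fun y => F y * cpow (C x - C y) (k - 1)).
Proof.
move=> k0 [cF bF] x0; have [K K0 hK] := abel_integrand_bound k x0 bF.
have [hi _] := integral_powR_right x0 k0.
apply: (cintegrable_dom (h := fun y => K * x `^ (Re k - 1) * (x - y) `^ (Re k - 1))).
- exact: msble_itv.
- exact: cmeas_abel_integrand.
- by move=> y; rewrite /= in_itv/= => yx; exact: hK.
- by exact: rintegrableZ (msble_itv _) hi.
Qed.

Lemma powR_mulD x r s : 0 < x -> x `^ r * x `^ s = x `^ (r + s).
Proof. by move=> x0; rewrite powRD// (gt_eqF x0) implybT. Qed.

(** The kernel contributes [x^(Re k - 1)], and the integral of [(x - y)^(Re k - 1)] another
    [x^(Re k) / Re k]. *)
Lemma abel_bound k F L : 0 < Re k -> admissible F -> 0 < L ->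
  exists2 K, 0 < K & forall x, 0 < x <= L ->
    cn (abel C k F x) <= K * x `^ (2 * Re k - 1).
Proof.
move=> k0 [cF bF] L0; have [K K0 hK] := abel_integrand_bound k L0 bF.
exists (2 * K / Re k); first by rewrite divr_gt0// mulr_gt0.
move=> x /andP[x0 xL]; have [hi he] := integral_powR_right x0 k0.
have hi2 : mu.-integrable `]0, x[
    (EFin \o (fun y => K * x `^ (Re k - 1) * (x - y) `^ (Re k - 1))).
  by exact: rintegrableZ (msble_itv _) hi.
apply: le_trans (cint_le _ _ _ hi2) _.
- exact: msble_itv.
- exact: cmeas_abel_integrand.
- by move=> y; rewrite /= in_itv/= => yx; exact: hK.
rewrite (RintegralZl _ (msble_itv _) hi).
rewrite he subr0 (_ : 2 * Re k - 1 = (Re k - 1) + Re k); last lra.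
rewrite -(powR_mulD (Re k - 1) (Re k) x0) le_eqVlt; apply/orP; left; apply/eqP.
by field; exact: lt0r_neq0.
Qed.

Lemma abel_scale k F x : 0 < Re k -> admissible F -> 0 < x ->
  abel C k F x = x%:C * cint `]0, 1[
     (fun s => F (x * s) * cpow (C x - C (x * s)) (k - 1)).
Proof.
move=> k0 hF x0; have [_ h] := cint_scale x0 (abel_integrable k0 hF x0).
exact: h.
Qed.

(** After the substitution [y = x s] the singularity stays at [s = 1], and one dominating function
    serves all arguments near [x]. *)
Lemma abel_cont k F x : 0 < Re k -> admissible F -> 0 < x ->
  ccont (abel C k F) x.
Proof.
move=> k0 hF x0; have [cF bF] := hF.
apply: (@ccont_near _ _ (fun x => x%:C * cint `]0, 1[
     (fun s => F (x * s) * cpow (C x - C (x * s)) (k - 1)))).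
  by apply: filterS (near_gt0 x0) => t t0; exact: abel_scale.
apply: ccontM; first by apply: ccontR; exact: cvg_id.
have L0 : 0 < 2 * x by rewrite mulr_gt0.
have [K K0 hK] := abel_integrand_bound k L0 bF.
have [hi _] := integral_powR_right ltr01 k0.
(* Bounds [t^(2 (Re k - 1))] for [t] between [x/2] and [2x], whatever the sign of the exponent. *)
pose K2 := K * ((2 * x) `^ (2 * (Re k - 1)) + (x / 2) `^ (2 * (Re k - 1))).
apply: (@ccont_cint _ _ _ (fun s => K2 * (1 - s) `^ (Re k - 1)) (x / 2) (2 * x)).
- exact: msble_itv.
- move=> t /andP[xt tx]; have t0 : 0 < t by apply: lt_trans xt; rewrite divr_gt0.
  have [+ _] := cint_scale t0 (abel_integrable k0 hF t0).
  exact: cintegrable_cmeas.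
- move=> t s /andP[xt tx]; rewrite /= in_itv/= => /andP[s0 s1].
  have t0 : 0 < t by apply: lt_trans xt; rewrite divr_gt0.
  have cts : {for t, continuous (fun t : R => t * s)}.
    by apply: cvgM; [exact: cvg_id|exact: cvg_cst].
  apply: ccontM.
    by apply: (ccont_comp (f := F)) => //; apply: cF; rewrite mulr_gt0.
  apply: ccont_cpow.
    apply: cvgB; first exact: (abel_weight_cont hC).
    apply: (@continuous_comp _ _ _ (fun t : R => t * s) C) => //.
    exact: (abel_weight_cont hC).
  apply: (abel_weight_lt hC); first by rewrite ltW// mulr_gt0.
  by rewrite -[X in _ < X]mulr1 ltr_pM2l.
- move=> t s /andP[xt tx]; rewrite /= in_itv/= => /andP[s0 s1].
  have t0 : 0 < t by apply: lt_trans xt; rewrite divr_gt0.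
  have := hK (t * s) t; rewrite mulr_gt0//= -{2}[t]mulr1 ltr_pM2l// => /(_ s1 (ltW tx)).
  move=> /le_trans; apply; rewrite (_ : t - t * s = t * (1 - s)); last ring.
  rewrite powRM ?subr_ge0 ?(ltW t0) ?(ltW s1)// mulrA ler_wpM2r ?powR_ge0//.
  rewrite -mulrA powR_mulD// -mulr2n -mulr_natl ler_pM2l//.
  have := @powR_between R (2 * (Re k - 1)) (x / 2) (2 * x) 1 t.
  rewrite powR1 !mulr1; apply => //; first by rewrite divr_gt0.
  exact: ltW. exact: ltW.
- by exact: rintegrableZ (msble_itv _) hi.
- by apply/andP; split; move: x0; lra.
Qed.
End abel_analysis.

Section measurability_lemmas.
Context {R : realType}.

Lemma indic_in {T} (D : set T) x : D x -> \1_D x = 1 :> R.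
Proof. by move=> Dx; rewrite indicE mem_set. Qed.

Lemma indic_out {T} (D : set T) x : ~ D x -> \1_D x = 0 :> R.
Proof. by move=> Dx; rewrite indicE memNset. Qed.

Lemma indic_oo (a b t : R) : a < t < b -> \1_(`]a, b[%classic) t = 1 :> R.
Proof. by move=> h; rewrite indic_in//= in_itv. Qed.

Lemma indic_oo0 (a b t : R) : ~~ (a < t < b) -> \1_(`]a, b[%classic) t = 0 :> R.
Proof. by move=> /negP h; rewrite indic_out//= in_itv. Qed.

Lemma cmeas_indicM d (T : measurableType d) (D : set T) (f : T -> R[i]) :
  measurable D -> cmeas D f -> cmeas setT (fun x => (\1_D x)%:C * f x).
Proof.
move=> mD [f1 f2]; split.
  rewrite (_ : (fun x => _) = (fun x => Re (f x)) \_ D).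
    exact/(measurable_restrictT _ mD).
  by apply/funext => x; rewrite patchE ReRM indicE; case: ifP; rewrite ?mul1r ?mul0r.
rewrite (_ : (fun x => _) = (fun x => Im (f x)) \_ D).
  exact/(measurable_restrictT _ mD).
by apply/funext => x; rewrite patchE ImRM indicE; case: ifP; rewrite ?mul1r ?mul0r.
Qed.

Lemma cmeas_comp d1 d2 (T1 : measurableType d1) (T2 : measurableType d2)
    (f : T2 -> R[i]) (h : T1 -> T2) :
  measurable_fun setT h -> cmeas setT f -> cmeas setT (fun x => f (h x)).
Proof. by move=> mh [f1 f2]; split; [exact: measurableT_comp f1 mh|exact: measurableT_comp f2 mh]. Qed.

Lemma le_integral_support (D : set R) (u h : R -> R) : msble D ->
  measurable_fun setT (u : Rm R -> R) -> mu.-integrable D (EFin \o h) ->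
  (forall y, 0 <= u y) -> (forall y, D y -> u y <= h y) ->
  (forall y, ~ D y -> u y = 0) ->
  (\int[mu]_y (u y)%:E <= (\int[mu]_(y in D) h y)%:E)%E.
Proof.
move=> mD mu_ hi u0 uh uD.
have -> : (\int[mu]_y (u y)%:E = \int[mu]_(y in D) (u y)%:E)%E.
  rewrite [RHS]integral_mkcond; apply: eq_integral => y _; rewrite patchE.
  by case: ifPn => // /negP; rewrite inE => /uD ->.
rewrite /Rintegral fineK; last exact: (integrable_fin_num mD hi).
apply: ge0_le_integral => //.
- by move=> y _; rewrite lee_fin.
- by apply/measurable_EFinP; exact: measurable_funTS.
- exact: measurable_int hi.
Qed.
End measurability_lemmas.

Section admissible_functions.
Context {R : realType}.
Implicit Types (F G : R -> R[i]) (h : R -> R).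

Lemma admissibleC (z : R[i]) : admissible (fun=> z : R[i]).
Proof.
split; first by move=> y _; exact: ccontC.
move=> L L0; exists (cn z + 1); first by rewrite ltr_pwDr// cn_ge0.
by move=> y _; rewrite lerDl.
Qed.

Lemma admissibleD F G : admissible F -> admissible G ->
  admissible (fun y => F y + G y).
Proof.
move=> [cF bF] [cG bG]; split.
  by move=> y y0; apply: ccontD; [exact: cF|exact: cG].
move=> L L0; have [M M0 hM] := bF L L0; have [N N0 hN] := bG L L0.
exists (M + N); first exact: addr_gt0.
by move=> y yL; apply: le_trans (cnD _ _) _; rewrite lerD ?hM ?hN.
Qed.

Lemma admissibleM F G : admissible F -> admissible G ->
  admissible (fun y => F y * G y).
Proof.
move=> [cF bF] [cG bG]; split.
  by move=> y y0; apply: ccontM; [exact: cF|exact: cG].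
move=> L L0; have [M M0 hM] := bF L L0; have [N N0 hN] := bG L L0.
exists (M * N); first exact: mulr_gt0.
by move=> y yL; rewrite cnM ler_pM ?cn_ge0 ?hM ?hN.
Qed.

Lemma ccont_admissible F : (forall y, ccont F y) -> admissible F.
Proof.
move=> cF; split; first by move=> y _; exact: cF.
move=> L L0.
have cRe : {within `[0, L], continuous (fun y => Re (F y))}.
  by apply: continuous_subspaceT => y; have [] := cF y.
have cIm : {within `[0, L], continuous (fun y => Im (F y))}.
  by apply: continuous_subspaceT => y; have [] := cF y.
have bnd (u : R -> R) : {within `[0, L], continuous u} ->
    exists M, forall y, 0 <= y <= L -> `|u y| <= M.
  move=> cu.
  have [c1 _ h1] := EVT_max (ltW L0) cu; have [c2 _ h2] := EVT_min (ltW L0) cu.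
  exists (`|u c1| + `|u c2|) => y yL; have yI : y \in `[0, L] by rewrite in_itv.
  have {}h1 := h1 y yI; have {}h2 := h2 y yI; rewrite ler_norml.
  have n1 := ler_norm (u c1); have n2 := ler_norm (- u c2); rewrite normrN in n2.
  have p1 := normr_ge0 (u c1); have p2 := normr_ge0 (u c2).
  by apply/andP; split; lra.
have [M hM] := bnd _ cRe; have [N hN] := bnd _ cIm.
have LL : 0 <= L <= L by rewrite lexx ltW.
exists (M + N + 1).
  by rewrite ltr_pwDr// addr_ge0// (le_trans _ (hM L LL), le_trans _ (hN L LL)).
move=> y /andP[y0 yL]; apply: le_trans (cn_leD _) _.
by rewrite -[leLHS]addr0 lerD// lerD// ?hM ?hN// ltW.
Qed.

Lemma admissibleR h : continuous h -> admissible (fun y => (h y)%:C).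
Proof. by move=> ch; apply: ccont_admissible => y; exact/ccontR/ch. Qed.
End admissible_functions.

Section abel_fubini.
Context {R : realType} (C C' : R -> R) (hC : abel_weight C C').
Implicit Types (x y z t L r : R) (k : R[i]) (f g p F : R -> R[i]).

(** The order of integration is exchanged on the triangle [0 < y < t < x]. The outer factor [p] is
    left general: it is [k * C'] when a primitive is computed and the kernel of a second transform
    when two transforms are composed. The hypothesis on [g] is calibrated on [abel_bound]. *)
Lemma abel_fubini k f p x (g : R -> R) : 0 < Re k -> 0 < x -> admissible f ->
  (forall t, 0 < t < x -> ccont p t) ->
  (forall t, 0 < t < x -> cn (p t) * t `^ (2 * Re k - 1) <= g t) ->
  mu.-integrable `]0, x[ (EFin \o g) ->
  [/\ cintegrable `]0, x[ (fun t => p t * abel C k f t),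
    cintegrable `]0, x[
      (fun y => cint `]y, x[ (fun t => p t * (f y * cpow (C t - C y) (k - 1)))) &
    cint `]0, x[ (fun t => p t * abel C k f t) =
    cint `]0, x[
      (fun y => cint `]y, x[ (fun t => p t * (f y * cpow (C t - C y) (k - 1))))].
Proof.
move=> k0 x0 hf cp pg ig; have [cf bf] := hf.
pose w t y := cpow (C t - C y) (k - 1).
pose p1 t := (\1_(`]0, x[%classic) t)%:C * p t.
pose f1 y := (\1_(`]0, x[%classic) y)%:C * f y.
pose S : set (Rm R * Rm R) := [set q | q.2 < q.1].
pose F t y := (\1_S (t, y))%:C * (p1 t * (f1 y * w t y)).
have mp1 : cmeas setT (p1 : Rm R -> R[i]).
  apply: cmeas_indicM; first exact: msble_itv.
  apply: ccont_cmeas; first exact: interval_open.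
  by move=> t; rewrite /= in_itv/=; exact: cp.
have mf1 : cmeas setT (f1 : Rm R -> R[i]).
  apply: cmeas_indicM; first exact: msble_itv.
  apply: ccont_cmeas; first exact: interval_open.
  by move=> t; rewrite /= in_itv/= => /andP[t0 _]; exact: cf.
have mC : measurable_fun setT (C : Rm R -> Rm R).
  by apply: continuous_measurable_fun => t; exact: (abel_weight_cont hC).
have mF : cmeas setT (fun q : Rm R * Rm R => F q.1 q.2).
  have mfst : measurable_fun setT (fst : Rm R * Rm R -> Rm R) by exact: measurable_fst.
  have msnd : measurable_fun setT (snd : Rm R * Rm R -> Rm R) by exact: measurable_snd.
  apply: (@cmeas_eq _ _ _ _ (fun q : Rm R * Rm R => (\1_S q)%:C * (p1 q.1 * (f1 q.2 * w q.1 q.2)))).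
    by move=> [t y] _.
  apply: cmeas_indicM.
    have mB : measurable_fun setT (fun q : Rm R * Rm R => q.1 - q.2 : Rm R).
      exact: measurable_funB.
    have := mB measurableT `]0, +oo[%classic (msble_itv _).
    rewrite setTI; congr (measurable _); apply/seteqP.
    by split=> q; rewrite /S /= in_itv/= andbT subr_gt0.
  apply: (cmeasS measurableT (@subsetT _ _)).
  apply: cmeasM; first exact: (cmeas_comp mfst mp1).
  apply: cmeasM; first exact: (cmeas_comp msnd mf1).
  apply: cmeas_cpow; apply: measurable_funB.
    exact: (measurableT_comp mC mfst).
  exact: (measurableT_comp mC msnd).
have [K K0 hK] := abel_integrand_bound hC k x0 bf.
pose g1 t := \1_(`]0, x[%classic) t * (K / Re k * g t).
have ig1 : mu.-integrable setT (EFin \o g1).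
  have h := rintegrableZ (K / Re k) (msble_itv _) ig.
  have := proj1 (integrable_mkcond _ (msble_itv `]0, x[)) h.
  apply: eq_integrable => // t _; rewrite /= patchE /g1 indicE.
  by case: ifP; rewrite ?mul1r ?mul0r.
have bF t : (\int[mu]_y (cn (F t y))%:E <= (g1 t)%:E)%E.
  have [t0x|nt] := boolP (0 < t < x); last first.
    rewrite /g1 indic_oo0// mul0r integral0_eq// => y _.
    by rewrite /F /p1 indic_oo0// !(mul0r, mulr0) cn0.
  have /andP[t0 tx] := t0x.
  have [hi he] := integral_powR_right t0 k0.
  have hi2 := rintegrableZ (cn (p t) * (K * t `^ (Re k - 1))) (msble_itv _) hi.
  apply: (@le_trans _ _ (\int[mu]_(y in `]0, t[)
     (cn (p t) * (K * t `^ (Re k - 1)) * (t - y) `^ (Re k - 1)))%:E).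
    apply: le_integral_support hi2 _ _ _.
    - exact: msble_itv.
    - apply: (measurableT_comp (cmeas_cn mF) (pair1_measurable t)).
    - by move=> y; exact: cn_ge0.
    - move=> y; rewrite /= in_itv/= => /andP[y0 yt].
      rewrite /F /p1 /f1 indic_in// indic_oo// indic_oo ?y0 ?(lt_trans yt)// !mul1r.
      rewrite cnM -mulrA ler_wpM2l ?cn_ge0//.
      by apply: hK; rewrite ?y0// ltW.
    - move=> y; rewrite /= in_itv/= => /negP; rewrite negb_and -!leNgt => /orP[y0|ty].
        by rewrite /F /f1 (@indic_oo0 _ 0 x y) ?[0 < y]ltNge ?y0// !(mul0r, mulr0) cn0.
      rewrite /F indic_out ?mul0r ?cn0// /S /=.
      by apply/negP; rewrite -leNgt.
  rewrite (RintegralZl _ (msble_itv _) hi) he subr0 lee_fin.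
  rewrite /g1 indic_oo// mul1r.
  apply: le_trans (ler_wpM2l (_ : 0 <= K / Re k) (pg t t0x)).
    rewrite (_ : 2 * Re k - 1 = (Re k - 1) + Re k); last lra.
    rewrite -(powR_mulD (Re k - 1) (Re k) t0) le_eqVlt; apply/orP; left; apply/eqP.
    by field; exact: lt0r_neq0.
  by rewrite divr_ge0 ?ltW.
have [i1 i2 e] := cint_fubini mF bF ig1.
have cint00 : cint setT (fun=> 0 : R[i]) = 0.
  by rewrite /cint /=; congr Complex; rewrite /Rintegral integral0.
have e1 : (fun t => cint setT (F t)) =
    (fun t => (\1_(`]0, x[%classic) t)%:C * (p t * abel C k f t)).
  apply/funext => t; have [t0x|nt] := boolP (0 < t < x); last first.
    have -> : F t = fun=> 0.
      by apply/funext => y; rewrite /F /p1 (indic_oo0 nt) !(mul0r, mulr0).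
    by rewrite (indic_oo0 nt) mul0r cint00.
  have /andP[t0 tx] := t0x.
  have ez := cintZ (p t) (msble_itv _) (abel_integrable hC k0 hf t0).
  rewrite (indic_oo t0x) mul1r /abel -ez [RHS]cint_mkcond.
  apply: eq_cint => y _; rewrite /F /p1 /f1 -/(w t y) (indic_oo t0x) mul1r.
  have [/[dup] y0t /andP[y0 yt]|ny] := boolP (0 < y < t).
    have y0x : 0 < y < x by rewrite y0 (lt_trans yt).
    have Sty : S (t, y) by [].
    by rewrite (indic_in Sty) (indic_oo y0x) (indic_oo y0t) !mul1r.
  rewrite (indic_oo0 ny) mul0r; move: ny; rewrite negb_and -!leNgt => /orP[y0|ty].
    have ny : ~~ (0 < y < x) by rewrite [0 < y]ltNge y0.
    by rewrite (indic_oo0 ny) !(mul0r, mulr0).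
  have nS : ~ S (t, y) by apply/negP; rewrite /S /= -leNgt.
  by rewrite (indic_out nS) mul0r.
have e2 : (fun y => cint setT (F ^~ y)) = (fun y => (\1_(`]0, x[%classic) y)%:C *
     cint `]y, x[ (fun t => p t * (f y * cpow (C t - C y) (k - 1)))).
  apply/funext => y; have [y0x|nt] := boolP (0 < y < x); last first.
    have -> : F ^~ y = fun=> 0.
      by apply/funext => t; rewrite /F /f1 (indic_oo0 nt) !(mul0r, mulr0).
    by rewrite (indic_oo0 nt) mul0r cint00.
  have /andP[y0 yx] := y0x.
  rewrite (indic_oo y0x) mul1r [RHS]cint_mkcond.
  apply: eq_cint => t _; rewrite /F /p1 /f1 -/(w t y) (indic_oo y0x) mul1r.
  have [/[dup] ytx /andP[yt tx]|ny] := boolP (y < t < x).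
    have t0x : 0 < t < x by rewrite tx (lt_trans y0).
    have Sty : S (t, y) by [].
    by rewrite (indic_in Sty) (indic_oo t0x) (indic_oo ytx) !mul1r.
  rewrite (indic_oo0 ny) mul0r; move: ny; rewrite negb_and -!leNgt => /orP[ty|xt].
    have nS : ~ S (t, y) by apply/negP; rewrite /S /= -leNgt.
    by rewrite (indic_out nS) mul0r.
  have nt : ~~ (0 < t < x) by rewrite [t < x]ltNge xt andbF.
  by rewrite (indic_oo0 nt) !(mul0r, mulr0).
rewrite e1 e2 in i1 i2 e; split.
- exact/(cintegrable_mkcond _ (msble_itv _)).
- exact/(cintegrable_mkcond _ (msble_itv _)).
- by rewrite [LHS]cint_mkcond e; apply/esym; exact: cint_mkcond.
Qed.
End abel_fubini.

Lemma integrable_cst_itv {R : realType} (a b c : R) :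
  mu.-integrable `]a, b[ (EFin \o (fun=> c)).
Proof.
have hoo : (mu (`]a, b[%classic : set R) < +oo)%E.
  by rewrite lebesgue_measure_itv /=; case: ifP => _; rewrite ?ltry// -EFinB ltry.
apply: measurable_bounded_integrable => //.
by exists `|c|; split; [exact: num_real|move=> M cM t _; exact: ltW].
Qed.

(** * Raising the exponent: primitives, derivatives, integration by parts *)

Section abel_calculus.
Context {R : realType} (C C' : R -> R) (hC : abel_weight C C').
Implicit Types (x y z t L r : R) (k l : R[i]) (f g p F G : R -> R[i]).

Let dC y : is_derive y 1 C (C' y). Proof. by case: hC. Qed.
Let cC' : continuous C'. Proof. by case: hC. Qed.

Lemma admissible_dweight : admissible (fun y => (C' y)%:C).
Proof. exact: admissibleR. Qed.

Lemma admissible_weight : admissible (fun y => (C y)%:C).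
Proof. by apply: admissibleR => y; exact: (abel_weight_cont hC). Qed.

Lemma eq_abel k F G x : (forall y, 0 < y < x -> F y = G y) ->
  abel C k F x = abel C k G x.
Proof.
by move=> FG; apply: eq_cint => y; rewrite inE /= in_itv/= => /FG ->.
Qed.

Lemma abelD k F G x : 0 < Re k -> 0 < x -> admissible F -> admissible G ->
  abel C k (fun y => F y + G y) x = abel C k F x + abel C k G x.
Proof.
move=> k0 x0 hF hG; rewrite /abel.
have h := cintD (msble_itv _) (abel_integrable hC k0 hF x0) (abel_integrable hC k0 hG x0).
by rewrite -h; apply: eq_cint => y _; rewrite mulrDl.
Qed.

Lemma abelZ k l F x : 0 < Re k -> 0 < x -> admissible F ->
  abel C k (fun y => l * F y) x = l * abel C k F x.
Proof.
move=> k0 x0 hF; rewrite /abel.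
have h := cintZ l (msble_itv _) (abel_integrable hC k0 hF x0).
by rewrite -h; apply: eq_cint => y _; rewrite mulrA.
Qed.

Lemma Re_gt0S k : 0 < Re k -> 0 < Re (k + 1).
Proof. by move=> k0; rewrite ReD /= addr_gt0. Qed.

(** One factor [C x - C y] is taken out of the kernel and distributed. *)
Lemma abelS k F x : 0 < Re k -> 0 < x -> admissible F ->
  abel C (k + 1) F x = (C x)%:C * abel C k F x - abel C k (fun y => (C y)%:C * F y) x.
Proof.
move=> k0 x0 hF; have hCF := admissibleM admissible_weight hF.
have h1 := admissibleM (admissibleC (C x)%:C) hF.
have h2 := admissibleM (admissibleC (-1)) hCF.
have e1 := abelZ (C x)%:C k0 x0 hF; have e2 := abelZ (-1) k0 x0 hCF.
have e3 := abelD k0 x0 h1 h2; rewrite -mulN1r -e1 -e2 -e3.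
apply: eq_cint => y; rewrite inE /= in_itv/= => /andP[y0 yx].
have hCy : 0 < C x - C y by apply: (abel_weight_lt hC) => //; exact: ltW.
by rewrite addrK -(cpowB1 k hCy) rmorphB /=; ring.
Qed.

Let cder_kernel k x y : 0 <= y -> y < x ->
  cder (fun t => cpow (C t - C y) k) x
    (k * ((C' x)%:C * cpow (C x - C y) (k - 1))).
Proof.
move=> y0 yx; have h : is_derive x 1 (fun t => C t - C y) (C' x).
  by apply: (is_derive_eq (is_deriveB (dC x) (is_derive_cst (C y) x 1))); rewrite subr0.
apply: (cder_eq (cder_cpow k h (abel_weight_lt hC y0 yx))).
by ring.
Qed.

Let cder_kernel_r k x y : 0 <= y -> y < x ->
  cder (fun t => cpow (C x - C t) k) y
    (- (k * ((C' y)%:C * cpow (C x - C y) (k - 1)))).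
Proof.
move=> y0 yx; have h : is_derive y 1 (fun t => C x - C t) (- C' y).
  by apply: (is_derive_eq (is_deriveB (is_derive_cst (C x) y 1) (dC y))); rewrite sub0r.
apply: (cder_eq (cder_cpow k h (abel_weight_lt hC y0 yx))).
by rewrite rmorphN /=; ring.
Qed.

(** The integrand is the derivative in [t] of [cpow (C t - C y) k], which vanishes at [t = y]
    because [Re k > 0]. *)
Lemma kernel_integral k x y : 0 < Re k -> 0 <= y < x ->
  cintegrable `]y, x[ (fun t => k * ((C' t)%:C * cpow (C t - C y) (k - 1))) /\
  cint `]y, x[ (fun t => k * ((C' t)%:C * cpow (C t - C y) (k - 1))) =
    cpow (C x - C y) k.
Proof.
move=> k0 /[dup] yx0 /andP[y0 yx]; have x0 : 0 < x by exact: le_lt_trans yx.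
have cT (f : R -> R) : continuous f -> forall t, {for t, continuous f} by [].
have cont t : y < t -> ccont (fun t => k * ((C' t)%:C * cpow (C t - C y) (k - 1))) t.
  move=> yt; apply: ccontM; first exact: ccontC.
  apply: ccontM; first exact/ccontR/cC'.
  apply: ccont_cpow; last exact: (abel_weight_lt hC).
  by apply: cvgB; [exact: (abel_weight_cont hC)|exact: cvg_cst].
have iint : cintegrable `]y, x[ (fun t => k * ((C' t)%:C * cpow (C t - C y) (k - 1))).
  have [m [M [m0 M0 hd]]] := abel_weight_diff hC x0.
  have [hi _] := integral_powR_left yx k0.
  have [_ _ /(_ x x0)[m' [M' [m'0 M'0 hM']]]] := hC.
  pose Q := M `^ (Re k - 1) + m `^ (Re k - 1).
  have hi2 := rintegrableZ (cn k * (M' * (Q * (x `^ Re k)))) (msble_itv _) hi.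
  apply: cintegrable_dom hi2.
  - exact: msble_itv.
  - apply: ccont_cmeas; first exact: interval_open.
    by move=> t; rewrite /= in_itv/= => /andP[yt _]; exact: cont.
  - move=> t; rewrite /= in_itv/= => /andP[yt tx]; have t0 : 0 < t by exact: le_lt_trans yt.
    rewrite !cnM -!mulrA ler_wpM2l ?cn_ge0//.
    have /andP[l1 l2] : m * (t * (t - y)) <= C t - C y <= M * (t * (t - y)).
      by apply: hd; [rewrite y0|exact: ltW].
    (* This bound turns [t^(Re k - 1)] into [t^(Re k)], so that no second singularity appears when
       [y = 0]. *)
    have h1 : cn (C' t)%:C <= M' * t.
      have /andP[h1 h2] : m' * t <= C' t <= M' * t by apply: hM'; rewrite !ltW.
      by rewrite cnR ger0_norm// (le_trans _ h1)// mulr_ge0// ltW.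
    have h2 : cn (cpow (C t - C y) (k - 1)) <= Q * (t `^ (Re k - 1) * (t - y) `^ (Re k - 1)).
      rewrite cn_cpow; last exact: (abel_weight_lt hC).
      rewrite ReB /= -powRM ?subr_ge0 ?(ltW t0) ?(ltW yt)//.
      by apply: powR_between l1 l2 => //; rewrite mulr_gt0// subr_gt0.
    apply: le_trans (ler_pM (cn_ge0 _) (cn_ge0 _) h1 h2) _.
    rewrite -!mulrA ler_wpM2l ?(ltW M'0)// mulrCA ler_wpM2l ?addr_ge0 ?powR_ge0//.
    rewrite mulrA ler_wpM2r ?powR_ge0// -{1}[t]powRr1 ?(ltW t0)// powR_mulD// addrCA subrr addr0.
    by rewrite ge0_ler_powR ?nnegrE ?(ltW x0) ?(ltW t0) ?(ltW k0) ?(ltW tx).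
split => //; rewrite -[RHS]subr0.
apply: (@cimproper_ftc _ _ (fun t => cpow (C t - C y) k)) => //.
- by move=> t /andP[yt _]; exact: cder_kernel.
- by move=> t /andP[yt _]; exact: cont.
- apply: (@ccvg_squeeze0 _ _ _ (fun t => (C t - C y) `^ Re k)).
    near=> t; have yt : y < t by near: t; exact: nbhs_right_gt.
    by rewrite cn_cpow//; exact: (abel_weight_lt hC).
  apply: powR_comp_cvg0 => //.
    rewrite -(subrr (C y)); apply: cvg_at_right_filter; apply: cvgB; last exact: cvg_cst.
    exact: (abel_weight_cont hC).
  near=> t; apply: (abel_weight_lt hC); first exact: y0.
  by near: t; exact: nbhs_right_gt.
- have [] := @ccont_ccvg _ (fun t => cpow (C t - C y) k) x; last by [].
  apply: ccont_cpow; last exact: (abel_weight_lt hC).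
  by apply: cvgB; [exact: (abel_weight_cont hC)|exact: cvg_cst].
Unshelve. all: by end_near. Qed.

(** Integrating in [t] first rebuilds the kernel with exponent [k], by [kernel_integral]. Exhibiting
    [abel C (k + 1) F] as a primitive makes it differentiable without any derivative under the
    integral sign. *)
Lemma abel_primitive k F x : 0 < Re k -> 0 < x -> admissible F ->
  cintegrable `]0, x[ (fun t => k * (C' t)%:C * abel C k F t) /\
  cint `]0, x[ (fun t => k * (C' t)%:C * abel C k F t) = abel C (k + 1) F x.
Proof.
move=> k0 x0 hF.
have [_ _ /(_ x x0)[m [M [m0 M0 hM]]]] := hC.
pose g (t : R) := cn k * M * x `^ (2 * Re k).
have ig : mu.-integrable `]0, x[ (EFin \o g).
  exact: integrable_cst_itv.
have [|t /andP[t0 tx]|i1 i2 e] := @abel_fubini _ _ _ hC k F (fun t => k * (C' t)%:C) x g k0 x0 hF _ _ ig.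
- move=> t /andP[t0 _]; apply: ccontM; first exact: ccontC.
  exact/ccontR/cC'.
- have h : cn (C' t)%:C <= M * t.
    have /andP[h1 h2] : m * t <= C' t <= M * t by apply: hM; rewrite !ltW.
    by rewrite cnR ger0_norm// (le_trans _ h1)// mulr_ge0// ltW.
  rewrite cnM /g -!mulrA ler_wpM2l ?cn_ge0//.
  apply: le_trans (ler_wpM2r (powR_ge0 _ _) h) _.
  rewrite -mulrA ler_wpM2l ?(ltW M0)// -{1}[t]powRr1 ?(ltW t0)// powR_mulD//.
  rewrite addrCA subrr addr0 ge0_ler_powR ?nnegrE ?(ltW x0) ?(ltW t0) ?(ltW tx)//.
  by rewrite mulr_ge0// ltW.
split => //; rewrite e /abel; apply: eq_cint => y; rewrite inE /= in_itv/= => /andP[y0 yx].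
have y0x : 0 <= y < x by rewrite (ltW y0).
have [h1 h2] := kernel_integral k0 y0x.
rewrite addrK -h2 -(cintZ (F y) (msble_itv _) h1).
by apply: eq_cint => t _; ring.
Qed.

Lemma cder_cint_primitive f x : (forall u, 0 < u -> cintegrable `]0, u[ f) ->
  (forall t, 0 < t -> ccont f t) -> 0 < x ->
  cder (fun u => cint `]0, u[ f) x (f x).
Proof.
move=> fi cf x0; have fi1 u : 0 < u -> cintegrable `]0, u] f.
  move=> u0; have sub : `]0, u]%classic `<=` (`]0, u + 1[%classic : set R).
    by move=> t; rewrite /= !in_itv/= => /andP[-> tu]; rewrite (le_lt_trans tu) ?ltrDl.
  exact: (cintegrableS (msble_itv _) (msble_itv _) sub (fi _ (addr_gt0 u0 ltr01))).
have x1 : x < x + 1 by rewrite ltrDl.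
have [i1 i2] := fi1 (x + 1) (addr_gt0 x0 ltr01).
have b0 : (BRight 0 < BRight x)%O by rewrite bnd_simp.
have [c1 c2] := cf x x0.
have [d1 e1] := continuous_FTC1 x1 i1 b0 c1.
have [d2 e2] := continuous_FTC1 x1 i2 b0 c2.
apply: (@cder_near _ _ (fun u => cint `]0, u] f)).
  apply: filterS (near_gt0 x0) => u u0; have [j1 j2] := fi u u0.
  by rewrite /cint (Rintegral_itv_bndo_bndc j1) (Rintegral_itv_bndo_bndc j2).
rewrite derive1E in e1; rewrite derive1E in e2.
by split; [exact: (DeriveDef d1 e1)|exact: (DeriveDef d2 e2)].
Qed.

Lemma cder_abelS k F x : 0 < Re k -> 0 < x -> admissible F ->
  cder (abel C (k + 1) F) x (k * (C' x)%:C * abel C k F x).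
Proof.
move=> k0 x0 hF.
apply: (@cder_near _ _ (fun u => cint `]0, u[ (fun t => k * (C' t)%:C * abel C k F t))).
  by apply: filterS (near_gt0 x0) => u u0; have [_ ->] := abel_primitive k0 u0 hF.
apply: (@cder_cint_primitive (fun t => k * (C' t)%:C * abel C k F t) _ _ _ x0).
  by move=> u u0; have [] := abel_primitive k0 u0 hF.
move=> t t0; apply: ccontM; last exact: (abel_cont hC).
by apply: ccontM; [exact: ccontC|exact/ccontR/cC'].
Qed.

(** The primitive is [F y * cpow (C x - C y) k]: it vanishes at [x] because [Re k > 0], and at the
    origin because [F] does. *)
Lemma abel_ibp k F F' x : 0 < Re k -> 0 < x -> admissible F -> admissible F' ->
  (forall y, 0 < y -> cder F y (F' y)) -> ccvg F 0^'+ 0 ->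
  k * abel C k (fun y => (C' y)%:C * F y) x = abel C (k + 1) F' x.
Proof.
move=> k0 x0 hF hF' dF F0.
have hCF := admissibleM admissible_dweight hF.
have i1 := abel_integrable hC k0 hCF x0.
have i2 := abel_integrable hC (Re_gt0S k0) hF' x0.
have i3 := cintegrableZ (- k) (msble_itv _) i1.
have e := cimproper_ftc x0 (F := fun y => F y * cpow (C x - C y) k)
   (f := fun y => F' y * cpow (C x - C y) (k + 1 - 1) +
        - k * ((C' y)%:C * F y * cpow (C x - C y) (k - 1)))
   (la := 0) (lb := 0).
have /eqP : 0 = abel C (k + 1) F' x - k * abel C k (fun y => (C' y)%:C * F y) x.
  rewrite /abel -mulNr -(cintZ (- k) (msble_itv _) i1) -(cintD (msble_itv _) i2 i3).
  rewrite e ?subr0//.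
  - move=> y /andP[y0 yx]; apply: (cder_eq (cderM (dF y y0) (cder_kernel_r k (ltW y0) yx))).
    by rewrite addrK; ring.
  - have [cF _] := hF; have [cF' _] := hF'.
    move=> y /[dup] yx /andP[y0 _]; apply: ccontD.
      by apply: ccontM; [exact: cF'|exact: (ccont_abel_kernel hC)].
    apply: ccontM; first exact: ccontC.
    apply: ccontM; last exact: (ccont_abel_kernel hC).
    by apply: ccontM; [exact/ccontR/cC'|exact: cF].
  - exact: (cintegrableD (msble_itv _) i2 i3).
  - rewrite -(mul0r (cpow (C x - C 0) k)); apply: ccvgM => //.
    have [] := @ccont_ccvg _ (fun t => cpow (C x - C t) k) 0; last by [].
    apply: ccont_cpow; last exact: (abel_weight_lt hC).
    by apply: cvgB; [exact: cvg_cst|exact: (abel_weight_cont hC)].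
  - have [_ /(_ x x0)[M M0 hM]] := hF.
    apply: (@ccvg_squeeze0 _ _ _ (fun t => M * (C x - C t) `^ Re k)).
      near=> t; have t0 : 0 < t by near: t; exact: nbhs_left_gt.
      have tx : t < x by near: t; exact: nbhs_left_lt.
      rewrite cnM cn_cpow; last by apply: (abel_weight_lt hC) => //; exact: ltW.
      by rewrite ler_wpM2r ?powR_ge0// hM// t0 ltW.
    rewrite -(mulr0 M); apply: cvgM; first exact: cvg_cst.
    apply: powR_comp_cvg0 => //.
      rewrite -(subrr (C x)); apply: cvg_at_left_filter; apply: cvgB; first exact: cvg_cst.
      exact: (abel_weight_cont hC).
    near=> t; have t0 : 0 < t by near: t; exact: nbhs_left_gt.
    apply: (abel_weight_lt hC); first exact: ltW.
    by near: t; exact: nbhs_left_lt.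
by rewrite eq_sym subr_eq0 => /eqP ->.
Unshelve. all: by end_near. Qed.
End abel_calculus.

(** * Iterated Abel transforms *)
Section half_argument.
Context {R : realType}.
Implicit Types (x y z : R).

(** All hyperbolic functions are expressed through [cS] and [cZ], so that identities reduce to
    [cZ^2 = 1 + cS^2] and can be left to [ring] and [field]. *)
Definition cS z : R[i] := (sinh (z / 2))%:C.
Definition cZ z : R[i] := (cosh (z / 2))%:C.

Lemma cZ2 z : cZ z ^+ 2 = 1 + cS z ^+ 2.
Proof. by rewrite /cZ /cS -!rmorphXn /= cosh2sinh2 rmorphD. Qed.
Lemma ccosh_cZ z : (cosh z)%:C = 2 * cZ z ^+ 2 - 1 :> R[i].
Proof. by rewrite cosh_double rmorphB rmorphM rmorph_nat rmorphXn rmorph1. Qed.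
Lemma csinh_cS z : (sinh z)%:C = 2 * cS z * cZ z :> R[i].
Proof. by rewrite sinh_double /cS /cZ !rmorphM rmorph_nat. Qed.
Lemma cZ_neq0 z : cZ z != 0.
Proof. by rewrite -cn_gt0 cnR normr_gt0 gt_eqF// cosh_gt0. Qed.
Lemma cS_neq0 z : 0 < z -> cS z != 0.
Proof. by move=> z0; rewrite -cn_gt0 cnR normr_gt0 gt_eqF// sinh_gt0// divr_gt0. Qed.
Lemma C2_neq0 : (2 : R[i]) != 0. Proof. by rewrite pnatr_eq0. Qed.

Lemma cder_cS z : cder cS z (cZ z / 2).
Proof.
apply: (cder_eq (cderR (is_derive_half (is_derive_sinh (z / 2))))).
by rewrite rmorphM fmorphV rmorph_nat.
Qed.
Lemma cder_cZ z : cder cZ z (cS z / 2).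
Proof.
apply: (cder_eq (cderR (is_derive_half (is_derive_cosh (z / 2))))).
by rewrite rmorphM fmorphV rmorph_nat.
Qed.


Lemma continuous_half (h : R -> R) : continuous h -> continuous (fun z => h (z / 2)).
Proof.
move=> ch z; apply: (@continuous_comp _ _ _ (fun x : R => x / 2) h); last exact: ch.
by apply: cvgM; [exact: cvg_id|exact: cvg_cst].
Qed.

Lemma admissible_cS : admissible cS.
Proof. by apply/admissibleR/continuous_half; exact: continuous_sinh. Qed.
Lemma admissible_cZ : admissible cZ.
Proof. by apply/admissibleR/continuous_half; exact: continuous_cosh. Qed.

Lemma is_derive_coshV z : is_derive z 1 (fun t : R => (cosh (t / 2))^-1)
  (- (sinh (z / 2) / 2) / cosh (z / 2) ^+ 2).
Proof.
have h0 : cosh (z / 2) != 0 :> R by rewrite gt_eqF// cosh_gt0.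
have h := is_derive_half (is_derive_cosh (z / 2)).
have := @is_deriveV R (fun t => cosh (t / 2)) z _ 1 h0 h.
move=> hv; apply: (is_derive_eq hv); rewrite /GRing.scale /= mulNr mulrC -mulNr.
by rewrite exprnN mulNr.
Qed.

Lemma cder_cZV z : cder (fun t => (cZ t)^-1) z (- (cS z / 2) / cZ z ^+ 2).
Proof.
rewrite (_ : (fun t => (cZ t)^-1) = fun t => ((cosh (t / 2))^-1)%:C); last first.
  by apply/funext => t; rewrite fmorphV.
apply: (cder_eq (cderR (is_derive_coshV z))).
by rewrite /cS /cZ !(rmorphM, rmorphN, fmorphV, rmorphXn, rmorph_nat).
Qed.

Lemma is_derive_sinhV z : 0 < z -> is_derive z 1 (fun t : R => (sinh (t / 2))^-1)
  (- (cosh (z / 2) / 2) / sinh (z / 2) ^+ 2).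
Proof.
move=> z0; have h0 : sinh (z / 2) != 0 :> R by rewrite gt_eqF// sinh_gt0// divr_gt0.
have h := is_derive_half (is_derive_sinh (z / 2)).
have := @is_deriveV R (fun t => sinh (t / 2)) z _ 1 h0 h.
move=> hv; apply: (is_derive_eq hv); rewrite /GRing.scale /= mulNr mulrC -mulNr.
by rewrite exprnN mulNr.
Qed.

Lemma cder_cSV z : 0 < z -> cder (fun t => (cS t)^-1) z (- (cZ z / 2) / cS z ^+ 2).
Proof.
move=> z0; rewrite (_ : (fun t => (cS t)^-1) = fun t => ((sinh (t / 2))^-1)%:C); last first.
  by apply/funext => t; rewrite fmorphV.
apply: (cder_eq (cderR (is_derive_sinhV z0))).
by rewrite /cS /cZ !(rmorphM, rmorphN, fmorphV, rmorphXn, rmorph_nat).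
Qed.

Lemma admissible_cZV : admissible (fun z => (cZ z)^-1).
Proof. by apply: ccont_admissible => z; exact: (cder_cont (cder_cZV z)). Qed.
End half_argument.

(** * The inner transform and its derivative *)

Section inner_transform.
Context {R : realType} (k : R[i]) (k0 : 0 < Re k).
Implicit Types (x y z : R) (f g F G : R -> R[i]).

Let hC := @abel_weight_cosh_half R.

Definition inner F := abel (fun x => cosh (x / 2)) k F.
Definition innerS F := abel (fun x => cosh (x / 2)) (k + 1) F.

Lemma innerSE F z : 0 < z -> admissible F ->
  innerS F z = cZ z * inner F z - inner (fun y => cZ y * F y) z.
Proof. by move=> z0 hF; exact: (abelS hC k0 z0 hF). Qed.

Lemma innerD F G z : 0 < z -> admissible F -> admissible G ->
  inner (fun y => F y + G y) z = inner F z + inner G z.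
Proof. by move=> z0 hF hG; exact: (abelD hC k0 z0 hF hG). Qed.

Lemma innerZ l F z : 0 < z -> admissible F ->
  inner (fun y => l * F y) z = l * inner F z.
Proof. by move=> z0 hF; exact: (abelZ hC l k0 z0 hF). Qed.

Lemma cder_innerS F z : 0 < z -> admissible F ->
  cder (innerS F) z (k * (cS z / 2) * inner F z).
Proof.
move=> z0 hF; apply: (cder_eq (cder_abelS hC k0 z0 hF)).
by rewrite rmorphM fmorphV rmorph_nat.
Qed.

Lemma k_neq0 : k != 0.
Proof. by apply/eqP => k00; move: k0; rewrite k00 ltxx. Qed.

(** The 2 comes from the derivative [sinh (y/2) / 2] of [cosh (y/2)]. *)
Lemma inner_ibp F F' z : 0 < z -> admissible F -> admissible F' ->
  (forall y, 0 < y -> cder F y (F' y)) -> ccvg F 0^'+ 0 ->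
  inner (fun y => cS y * F y) z = 2 / k * innerS F' z.
Proof.
move=> z0 hF hF' dF F0; rewrite /innerS -(abel_ibp hC k0 z0 hF hF' dF F0).
have -> : (fun y => (sinh (y / 2) / 2)%:C * F y) = (fun y => 2^-1 * (cS y * F y)).
  by apply/funext => y; rewrite rmorphM fmorphV rmorph_nat /cS; ring.
have e := innerZ 2^-1 z0 (admissibleM admissible_cS hF); rewrite /inner in e *; rewrite e.
by field; rewrite ?C2_neq0 ?k_neq0.
Qed.

Lemma ccvg_cS_M F : locally_bounded F -> ccvg (fun y => cS y * F y) 0^'+ 0.
Proof.
move=> /(_ 1 ltr01)[M M0 hM].
apply: (@ccvg_squeeze0 _ _ _ (fun y => `|sinh (y / 2)| * M)).
  near=> y; have y0 : 0 < y by near: y; exact: nbhs_right_gt.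
  have y1 : y <= 1 by near: y; exact: nbhs_right_le.
  by rewrite cnM cnR ler_wpM2l// hM// y0.
rewrite -[X in _ --> X](mul0r M); apply: cvgM; last exact: cvg_cst.
have h : (fun y : R => `|sinh (y / 2)|) y @[y --> (0 : R)] --> `|sinh (0 / 2) : R|.
  by apply: cvg_norm; exact: (continuous_half (@continuous_sinh R)).
have -> : (0 : R) = `|sinh (0 / 2) : R| by rewrite mul0r sinh0 normr0.
by apply: cvg_at_right_filter; rewrite mul0r sinh0 normr0 in h *.
Unshelve. all: by end_near. Qed.

Section inner_derivative.
Context (f f' : R -> R[i]) (hf : admissible f) (hf' : admissible f').
Context (df : forall y, 0 < y -> cder f y (f' y)).

(** The derivative of [inner f], read off from [S2inner]: it involves transforms of exponent [k]
    only, and [(cS z)^-1] carries its singularity at the origin. *)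
Definition dinner z := (cS z)^-1 * (inner (fun y => cS y * f' y) z
  + (k - 1) / 2 * cZ z * inner f z + k / 2 * inner (fun y => cZ y * f y) z).

Let hZf := admissibleM admissible_cZ hf.
Let hSf := admissibleM admissible_cS hf.
Let hSf' := admissibleM admissible_cS hf'.
(** The derivative of [2 cS f], onto which the integration by parts leads. *)
Let g y := 2 * (cS y * f' y) + cZ y * f y.
Let hg : admissible g.
Proof. exact: admissibleD (admissibleM (admissibleC 2) hSf') hZf. Qed.

(* Multiplying by S^2 raises the exponent by one, which makes the transform differentiable. *)
Let S2inner z : 0 < z -> cS z ^+ 2 * inner f z =
  cZ z * innerS f z + innerS (fun y => cZ y * f y) z + k^-1 * innerS g z.
Proof.
move=> z0.
have e1 := @inner_ibp (fun y => 2 * (cS y * f y)) g z z0.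
have -> : k^-1 * innerS g z = 2^-1 * inner (fun y => cS y * (2 * (cS y * f y))) z.
  rewrite e1; [|exact: admissibleM (admissibleC 2) hSf|exact: hg| |].
  - by field; rewrite ?C2_neq0 ?k_neq0.
  - move=> y y0; apply: (cder_eq (cderM (cderC 2 y) (cderM (cder_cS y) (df y0)))).
    by rewrite /g; field.
  - rewrite -(mulr0 (2 : R[i])); apply: ccvgM; first exact: ccvgC.
    by apply: ccvg_cS_M; case: hf.
have -> : (fun y => cS y * (2 * (cS y * f y))) =
    (fun y => 2 * (cZ y * (cZ y * f y)) + -2 * f y).
  by apply/funext => y; have := cZ2 y; rewrite !expr2 => h; rewrite mulrA; ring: h.
have hZZf := admissibleM admissible_cZ hZf.
have h2ZZ := admissibleM (admissibleC (2 : R[i])) hZZf.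
have h2f := admissibleM (admissibleC (-2 : R[i])) hf.
rewrite (innerD z0 h2ZZ h2f) (innerZ _ z0 hZZf) (innerZ _ z0 hf).
(* The first two terms on the right telescope to [cZ z^2 * inner f - inner (cZ^2 f)]; the third one
   is [inner (cZ^2 f) - inner f]. *)
rewrite (innerSE z0 hf) (innerSE z0 hZf).
have h := cZ2 z; have -> : cS z ^+ 2 = cZ z ^+ 2 - 1 by rewrite h; ring.
by field.
Qed.

Lemma cder_inner z : 0 < z -> cder (inner f) z (dinner z).
Proof.
move=> z0; pose rhs t := (cS t)^-1 * (cS t)^-1 *
  (cZ t * innerS f t + innerS (fun y => cZ y * f y) t + k^-1 * innerS g t).
apply: (@cder_near _ _ rhs).
  apply: filterS (near_gt0 z0) => t t0; rewrite /rhs -(S2inner t0).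
  by field; exact: cS_neq0.
have d1 := cder_cSV z0.
have d2 := cderD (cderD (cderM (cder_cZ z) (cder_innerS z0 hf))
  (cder_innerS z0 hZf)) (cderM (cderC k^-1 z) (cder_innerS z0 hg)).
apply: (cder_eq (cderM (cderM d1 d1) d2)).
rewrite -(S2inner z0) /dinner.
have h2Sf' := admissibleM (admissibleC (2 : R[i])) hSf'.
have -> : inner g z = 2 * inner (fun y => cS y * f' y) z + inner (fun y => cZ y * f y) z.
  by rewrite (innerD z0 h2Sf' hZf) (innerZ _ z0 hSf').
rewrite (innerSE z0 hf).
by field; rewrite ?C2_neq0 ?k_neq0 ?cS_neq0.
Qed.
End inner_derivative.

(** [inner F] may blow up like [z^(2 Re k - 1)]; the factor [cS z], of order [z], makes it bounded
    near the origin. *)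
Lemma admissible_SJ F : admissible F -> admissible (fun z => cS z * inner F z).
Proof.
move=> hF; have [cSc _] := @admissible_cS R; split.
  by move=> z z0; apply: ccontM; [exact: cSc|exact: (abel_cont hC)].
move=> L L0; have [K K0 hK] := abel_bound hC k0 hF L0.
have M0 : 0 < cosh (L / 2) * K * L `^ (2 * Re k).
  by apply: mulr_gt0; [apply: mulr_gt0; [exact: cosh_gt0|exact: K0]|exact: powR_gt0].
exists (cosh (L / 2) * K * L `^ (2 * Re k)) => // z /andP[z0 zL].
have h1 : cn (cS z) <= cosh (L / 2) * z.
  rewrite cnR ger0_norm ?sinh_ge0 ?divr_ge0 ?(ltW z0)//.
  have := @sinh_le_cosh_id R (z / 2) (L / 2); have z2 : z / 2 <= z by lra.
  move=> h; apply: le_trans (h _ _) _; [by rewrite divr_ge0// ltW|by lra|].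
  by rewrite ler_wpM2l// ltW// cosh_gt0.
have h2 := hK z; rewrite z0 zL in h2; have {}h2 := h2 isT.
rewrite cnM; apply: le_trans (ler_pM (cn_ge0 _) (cn_ge0 _) h1 h2) _.
have -> : cosh (L / 2) * z * (K * z `^ (2 * Re k - 1)) =
   cosh (L / 2) * K * (z `^ 1 * z `^ (2 * Re k - 1)).
  by rewrite powRr1 ?(ltW z0)//; ring.
rewrite powR_mulD// addrCA subrr addr0; apply: ler_wpM2l.
  by apply: mulr_ge0; [exact/ltW/cosh_gt0|exact: ltW].
by apply: ge0_ler_powR; rewrite ?nnegrE ?(ltW z0) ?(ltW L0)// mulr_ge0// ltW.
Qed.

Lemma admissible_innerS F : admissible F -> admissible (innerS F).
Proof.
move=> hF; have kS := Re_gt0S k0; split; first by move=> z z0; exact: (abel_cont hC).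
move=> L L0; have [K K0 hK] := abel_bound hC kS hF L0.
exists (K * L `^ (2 * Re (k + 1) - 1)); first by rewrite mulr_gt0// powR_gt0.
move=> z /[dup] zL /andP[z0 zl]; apply: le_trans (hK z zL) _; rewrite ler_wpM2l ?(ltW K0)//.
rewrite ge0_ler_powR ?nnegrE ?(ltW z0) ?(ltW L0)//.
by rewrite ReD /=; move: k0; lra.
Qed.

Lemma innerS_cvg0 F : admissible F -> ccvg (innerS F) 0^'+ 0.
Proof.
move=> hF; have kS := Re_gt0S k0; have [K K0 hK] := abel_bound hC kS hF ltr01.
apply: (@ccvg_squeeze0 _ _ _ (fun z => K * z `^ (2 * Re (k + 1) - 1))).
  near=> z; apply: hK; apply/andP; split; near: z; [exact: nbhs_right_gt|exact: nbhs_right_le].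
rewrite -[X in _ --> X](mulr0 K); apply: cvgM; first exact: cvg_cst.
apply: powR_cvg0; rewrite ReD /=; move: k0; lra.
Unshelve. all: by end_near. Qed.
End inner_transform.

(** * The outer transform applied to the inner one *)

Section outer_transform.
Context {R : realType} (k1 k2 : R[i]) (k1_gt0 : 0 < Re k1) (k2_gt0 : 0 < Re k2).
Implicit Types (x y z : R) (f g F G : R -> R[i]).

Let hC := @abel_weight_cosh R.

Definition outer F := abel cosh k2 F.
Definition outerS F := abel cosh (k2 + 1) F.
(** The factor [cS z] is the [sinh (z/2)] of the kernel. *)
Definition SJ F z := cS z * inner k1 F z.
Definition double_abel F := outer (SJ F).

Let adSJ F : admissible F -> admissible (SJ F).
Proof. exact: admissible_SJ. Qed.

Lemma outerSE F x : 0 < x -> admissible F ->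
  outerS F x = (cosh x)%:C * outer F x - outer (fun z => (cosh z)%:C * F z) x.
Proof. by move=> x0 hF; exact: (abelS hC k2_gt0 x0 hF). Qed.

Lemma outerD F G x : 0 < x -> admissible F -> admissible G ->
  outer (fun z => F z + G z) x = outer F x + outer G x.
Proof. by move=> x0 hF hG; exact: (abelD hC k2_gt0 x0 hF hG). Qed.

Lemma outerZ l F x : 0 < x -> admissible F ->
  outer (fun z => l * F z) x = l * outer F x.
Proof. by move=> x0 hF; exact: (abelZ hC l k2_gt0 x0 hF). Qed.

Lemma outerSD F G x : 0 < x -> admissible F -> admissible G ->
  outerS (fun z => F z + G z) x = outerS F x + outerS G x.
Proof. by move=> x0 hF hG; exact: (abelD hC (Re_gt0S k2_gt0) x0 hF hG). Qed.

Lemma outerSZ l F x : 0 < x -> admissible F ->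
  outerS (fun z => l * F z) x = l * outerS F x.
Proof. by move=> x0 hF; exact: (abelZ hC l (Re_gt0S k2_gt0) x0 hF). Qed.

Lemma cder_outerS F x : 0 < x -> admissible F ->
  cder (outerS F) x (k2 * (sinh x)%:C * outer F x).
Proof. by move=> x0 hF; exact: (cder_abelS hC k2_gt0 x0 hF). Qed.

Lemma outer_ibp F F' x : 0 < x -> admissible F -> admissible F' ->
  (forall z, 0 < z -> cder F z (F' z)) -> ccvg F 0^'+ 0 ->
  outer (fun z => (sinh z)%:C * F z) x = k2^-1 * outerS F' x.
Proof.
move=> x0 hF hF' dF F0; rewrite /outerS -(abel_ibp hC k2_gt0 x0 hF hF' dF F0).
by rewrite mulKf// k_neq0.
Qed.

Let admissible_ccosh : admissible (fun z : R => (cosh z)%:C : R[i]).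
Proof. exact: (admissible_weight hC). Qed.
Let admissible_csinh : admissible (fun z : R => (sinh z)%:C : R[i]).
Proof. exact: (admissible_dweight hC). Qed.

Lemma outer_sinh_innerS F x : 0 < x -> admissible F ->
  outer (fun z => (sinh z)%:C * innerS k1 F z) x = k1 / (2 * k2) * outerS (SJ F) x.
Proof.
move=> x0 hF.
rewrite (@outer_ibp _ (fun z => k1 / 2 * SJ F z))//.
- rewrite (outerSZ _ x0 (adSJ hF)); field; rewrite ?C2_neq0 ?k_neq0//.
- exact: admissible_innerS.
- exact: admissibleM (admissibleC _) (adSJ hF).
- move=> z z0; apply: (cder_eq (cder_innerS k1_gt0 z0 hF)); rewrite /SJ.
  by field; rewrite ?C2_neq0.
- exact: innerS_cvg0.
Qed.

(** Integration by parts in [y], then in [z]: the inner exponent goes up and comes down again, and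
    the outer one stays raised. This is what makes the odd part of the kernel operator
    differentiable. *)
Lemma outer_sinh_inner_odd F F' x : 0 < x -> admissible F -> admissible F' ->
  (forall y, 0 < y -> cder F y (F' y)) -> ccvg F 0^'+ 0 ->
  outer (fun z => (sinh z)%:C * inner k1 (fun y => cS y * F y) z) x =
    k2^-1 * outerS (SJ F') x.
Proof.
move=> x0 hF hF' dF F0.
have hi := admissible_innerS k1_gt0 hF'.
transitivity (outer (fun z => 2 / k1 * ((sinh z)%:C * innerS k1 F' z)) x).
  apply: eq_abel => z /andP[z0 _].
  by rewrite (inner_ibp k1_gt0 z0 hF hF' dF F0); ring.
rewrite (outerZ _ x0 (admissibleM admissible_csinh hi)) outer_sinh_innerS//.
by field; rewrite ?C2_neq0 ?(k_neq0 k1_gt0) ?(k_neq0 k2_gt0).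
Qed.

(** The left side is what the even part of [f] contributes to the odd part of the kernel operator.
    Expanding [innerS] gives [outerS (SJ F)] and a term that [outer_sinh_innerS] turns into
    [k1 / (2 k2)] times the same transform; so the shift [k1/2 + k2] of the Cherednik operator
    appears. *)
Lemma double_abel_even F x : 0 < x -> admissible F ->
  (1 + (cosh x)%:C) * double_abel F x
    - outer (fun z => (sinh z)%:C * inner k1 (fun y => cZ y * F y) z) x =
  (k1 / 2 + k2) / k2 * outerS (SJ F) x.
Proof.
move=> x0 hF; have hZF := admissibleM admissible_cZ hF.
have hi := admissible_innerS k1_gt0 hF.
have a1 := admissibleM admissible_ccosh (adSJ hF).
have a2 := admissibleM admissible_csinh hi.
have a3 : admissible (fun z => -1 * ((sinh z)%:C * innerS k1 F z)).
  exact: admissibleM (admissibleC _) a2.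
have a4 := admissibleD (adSJ hF) a1.
have e : outer (fun z => (sinh z)%:C * inner k1 (fun y => cZ y * F y) z) x =
   outer (fun z => (SJ F z + (cosh z)%:C * SJ F z) + -1 * ((sinh z)%:C * innerS k1 F z)) x.
  apply: eq_abel => z /andP[z0 _]; rewrite (innerSE k1_gt0 z0 hF) /SJ.
  by rewrite csinh_cS ccosh_cZ; ring.
rewrite e (outerD x0 a4 a3) (outerD x0 (adSJ hF) a1) (outerZ _ x0 a2).
rewrite outer_sinh_innerS// (outerSE x0 (adSJ hF)) /double_abel.
by field; rewrite ?C2_neq0 ?(k_neq0 k1_gt0) ?(k_neq0 k2_gt0).
Qed.

Section double_abel_derivative.
Context (f f' : R -> R[i]) (hf : admissible f) (hf' : admissible f').
Context (df : forall y, 0 < y -> cder f y (f' y)).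

Let hZf := admissibleM admissible_cZ hf.
Let hSf' := admissibleM admissible_cS hf'.

(** Chosen so that [sinh z * F z = cS z^2 * SJ f z], the product that is to be integrated by parts
    against [sinh]. *)
Let F z := cS z * (SJ f z * (cZ z)^-1) * 2^-1.

(** [cS^2] times the derivative of [inner k1 f], written without division so that admissibility is
    visible; likewise [Fp] is the derivative of [F]. *)
Let SdJ z := SJ (fun y => cS y * f' y) z + (k1 - 1) / 2 * (cZ z * SJ f z)
   + k1 / 2 * SJ (fun y => cZ y * f y) z.

Let Fp z := 2^-1 * SJ f z + 2^-1 * ((cZ z)^-1 * SdJ z)
   + - 4^-1 * (cS z * (cS z * (SJ f z * ((cZ z)^-1 * (cZ z)^-1)))).

Let adSdJ : admissible SdJ.
Proof.
apply: admissibleD; last exact: admissibleM (admissibleC _) (adSJ hZf).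
apply: admissibleD; first exact: adSJ.
exact: admissibleM (admissibleC _) (admissibleM admissible_cZ (adSJ hf)).
Qed.

Let adF : admissible F.
Proof.
apply: admissibleM; last exact: admissibleC.
exact: admissibleM admissible_cS (admissibleM (adSJ hf) admissible_cZV).
Qed.

Let adFp : admissible Fp.
Proof.
apply: admissibleD.
  apply: admissibleD; first exact: admissibleM (admissibleC _) (adSJ hf).
  exact: admissibleM (admissibleC _) (admissibleM admissible_cZV adSdJ).
apply: admissibleM (admissibleC _) (admissibleM admissible_cS _).
apply: admissibleM admissible_cS (admissibleM (adSJ hf) _).
exact: admissibleM admissible_cZV admissible_cZV.
Qed.

Let SdJE z : 0 < z -> SdJ z = cS z ^+ 2 * dinner k1 f f' z.
Proof. by move=> z0; rewrite /SdJ /dinner /SJ; field; exact: cS_neq0. Qed.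

Let cder_F z : 0 < z -> cder F z (Fp z).
Proof.
move=> z0; have dJ := cder_inner k1_gt0 hf hf' df z0.
apply: (cder_eq (cderM (cderM (cder_cS z) (cderM (cderM (cder_cS z) dJ) (cder_cZV z)))
  (cderC 2^-1 z))).
rewrite /Fp (SdJE z0) /SJ; have h := cZ2 z.
by field; rewrite ?C2_neq0 ?cZ_neq0.
Qed.

Let cvg_F : ccvg F 0^'+ 0.
Proof.
rewrite -(mul0r (2^-1 : R[i])); apply: ccvgM; last exact: ccvgC.
by apply: ccvg_cS_M; case: (admissibleM (adSJ hf) admissible_cZV).
Qed.

Let G z := Fp z + k2 / 2 * SJ f z.
Let adG : admissible G.
Proof. exact: admissibleD adFp (admissibleM (admissibleC _) (adSJ hf)). Qed.

(** Since [cS x^2 - cS z^2 = (cosh x - cosh z) / 2], the left side is [outer (cS^2 * SJ f)] plus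
    half of [outerS (SJ f)], and the first of these is integrated by parts. *)
Let S2double x : 0 < x -> cS x ^+ 2 * double_abel f x = k2^-1 * outerS G x.
Proof.
move=> x0; have := outer_ibp x0 adF adFp cder_F cvg_F.
have a1 := admissibleM admissible_ccosh (adSJ hf).
have a2 := admissibleM (admissibleC (2^-1 : R[i])) a1.
have a3 := admissibleM (admissibleC (- 2^-1 : R[i])) (adSJ hf).
have -> : outer (fun z => (sinh z)%:C * F z) x =
    outer (fun z => 2^-1 * ((cosh z)%:C * SJ f z) + - 2^-1 * SJ f z) x.
  apply: eq_abel => z /andP[z0 _]; rewrite /F csinh_cS ccosh_cZ cZ2.
  by field; rewrite ?C2_neq0 ?cZ_neq0.
rewrite (outerD x0 a2 a3) (outerZ _ x0 a1) (outerZ _ x0 (adSJ hf)).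
move=> e; rewrite (outerSD x0 adFp (admissibleM (admissibleC (k2 / 2)) (adSJ hf))).
rewrite (outerSZ _ x0 (adSJ hf)) mulrDr -e (outerSE x0 (adSJ hf)) /double_abel.
rewrite ccosh_cZ cZ2.
by field; rewrite ?C2_neq0 ?(k_neq0 k2_gt0).
Qed.

(** Obtained from [S2double]: differentiating [outerS G] brings the exponent back to [k2]. *)
Definition ddouble_abel x := (cS x)^-1 * (2 * cZ x * outer G x - cZ x * double_abel f x).

Lemma cder_double_abel x : 0 < x -> cder (double_abel f) x (ddouble_abel x).
Proof.
move=> x0; pose rhs t := (cS t)^-1 * (cS t)^-1 * (k2^-1 * outerS G t).
apply: (@cder_near _ _ rhs).
  apply: filterS (near_gt0 x0) => t t0; rewrite /rhs -(S2double t0).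
  by field; exact: cS_neq0.
have d1 := cder_cSV x0.
have d2 := cderM (cderC k2^-1 x) (cder_outerS x0 adG).
apply: (cder_eq (cderM (cderM d1 d1) d2)).
rewrite -(S2double x0) /ddouble_abel csinh_cS.
by field; rewrite ?C2_neq0 ?(k_neq0 k2_gt0) ?cS_neq0.
Qed.

(** On the positive axis this is [inner (cZ f) - inner f / cZ]; the form chosen shows that it is
    bounded and tends to 0 at the origin. *)
Let Y z := cS z * (SJ f z * (cZ z)^-1) + -1 * innerS k1 f z.
Let Yp z := 2 * Fp z + - (k1 / 2) * SJ f z.

Let adY : admissible Y.
Proof.
apply: admissibleD; last exact: admissibleM (admissibleC _) (admissible_innerS k1_gt0 hf).
exact: admissibleM admissible_cS (admissibleM (adSJ hf) admissible_cZV).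
Qed.

Let adYp : admissible Yp.
Proof.
exact: admissibleD (admissibleM (admissibleC _) adFp) (admissibleM (admissibleC _) (adSJ hf)).
Qed.

Let cder_Y z : 0 < z -> cder Y z (Yp z).
Proof.
move=> z0; have dF := cderM (cderC 2 z) (cder_F z0).
have dI := cderM (cderC (-1) z) (cder_innerS k1_gt0 z0 hf).
have := cderD dF dI; rewrite (_ : (fun t => _) = Y); last first.
  by apply/funext => t; rewrite /Y /F; field; rewrite ?C2_neq0 ?cZ_neq0.
move=> d; apply: (cder_eq d); rewrite /Yp /SJ.
by field; rewrite ?C2_neq0.
Qed.

Let cvg_Y : ccvg Y 0^'+ 0.
Proof.
rewrite -(addr0 (0 : R[i])); apply: ccvgD.
  by apply: ccvg_cS_M; case: (admissibleM (adSJ hf) admissible_cZV).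
rewrite -(mulr0 (-1 : R[i])); apply: ccvgM; first exact: ccvgC.
exact: innerS_cvg0.
Qed.

(* The two sides differ by the integral of the derivative of
   [(cosh x - cosh z)^k2 * Y z], which vanishes at both ends. *)
Lemma jacobi_identity x : 0 < x ->
  (sinh x)%:C * ddouble_abel x + (cosh x)%:C * double_abel f x
  - (2 * k1 * cZ x ^+ 2 + 2 * k2 * (cosh x)%:C) * double_abel f x
  + (k1 / 2 + k2) * ((k1 / 2 + k2) / k2 * outerS (SJ f) x)
  = outer (fun z => (sinh z)%:C * inner k1 (fun y => cS y * f' y) z) x.
Proof.
move=> x0; rewrite -(double_abel_even x0 hf).
pose Q z := (sinh z)%:C * inner k1 (fun y => cZ y * f y) z.
have adQ : admissible Q.
  rewrite (_ : Q = fun z => 2 * (cZ z * SJ (fun y => cZ y * f y) z)).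
    exact: admissibleM (admissibleC _) (admissibleM admissible_cZ (adSJ hZf)).
  by apply/funext => z; rewrite /Q /SJ csinh_cS; ring.
pose P z := (sinh z)%:C * inner k1 (fun y => cS y * f' y) z.
have adP : admissible P.
  rewrite (_ : P = fun z => 2 * (cZ z * SJ (fun y => cS y * f' y) z)).
    exact: admissibleM (admissibleC _) (admissibleM admissible_cZ (adSJ hSf')).
  by apply/funext => z; rewrite /P /SJ csinh_cS; ring.
rewrite -/Q -/P.
have e := outer_ibp x0 adY adYp cder_Y cvg_Y.
rewrite (outerSE x0 adYp) in e.
have aZ := admissibleM admissible_ccosh adYp.
have aY := admissibleM admissible_csinh adY.
have b1 := admissibleM (admissibleC k2) aY.
have b2 := admissibleD b1 aZ.
have b3 := admissibleD b2 adYp.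
have b4 := admissibleM (admissibleC (2 * k2 - 1)) (adSJ hf).
have b5 := admissibleD b3 b4.
have b6 := admissibleM (admissibleC (- (k1 / 2 + k2))) adQ.
(* A pointwise identity of integrands. By [e] the first two terms on the right integrate to
   [cosh x * outer Yp x], which removes the weight [cosh z]. *)
have eP : outer P x = outer (fun z => k2 * ((sinh z)%:C * Y z) + (cosh z)%:C * Yp z + Yp z
    + (2 * k2 - 1) * SJ f z + - (k1 / 2 + k2) * Q z) x.
  apply: eq_abel => z /andP[z0 _].
  rewrite /P /Q /Y /Yp /Fp /SdJ (innerSE k1_gt0 z0 hf) /SJ csinh_cS ccosh_cZ.
  have h := cZ2 z.
  have hz := cZ_neq0 z.
  by field: h; rewrite ?C2_neq0 ?hz.
rewrite eP (outerD x0 b5 b6) (outerD x0 b3 b4) (outerD x0 b2 adYp) (outerD x0 b1 aZ).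
rewrite (outerZ _ x0 aY) (outerZ _ x0 (adSJ hf)) (outerZ _ x0 adQ).
have d1 := admissibleM (admissibleC (2 : R[i])) adFp.
have d2 := admissibleM (admissibleC (- (k1 / 2))) (adSJ hf).
have eYp : outer Yp x = 2 * outer Fp x + - (k1 / 2) * double_abel f x.
  by rewrite (outerD x0 d1 d2) (outerZ _ x0 adFp) (outerZ _ x0 (adSJ hf)).
have d3 := admissibleM (admissibleC (k2 / 2)) (adSJ hf).
have eG : outer G x = outer Fp x + k2 / 2 * double_abel f x.
  by rewrite (outerD x0 adFp d3) (outerZ _ x0 (adSJ hf)).
have {}e : k2 * outer (fun z => (sinh z)%:C * Y z) x =
    (cosh x)%:C * outer Yp x - outer (fun z => (cosh z)%:C * Yp z) x.
  by rewrite e mulrA divff ?mul1r// k_neq0.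
rewrite e eYp /ddouble_abel eG csinh_cS ccosh_cZ /double_abel.
move: (outer Fp x) (outer (SJ f) x) (outer Q x) (cS x) (cZ x) (cS_neq0 x0)
  (outer (fun z => (cosh z)%:C * Yp z) x) => a b q s w s0 r.
by field.
Qed.
End double_abel_derivative.
End outer_transform.

(** * The kernel operator *)
Section reflection.
Context {R : realType}.
Implicit Types (g : R -> R[i]) (D S : set R).

(** As [D] lies on the positive side, it is disjoint from its mirror image, and the two indicators
    add up to that of [S]. *)
Lemma cint_reflect D S g : msble D -> msble S -> (forall x, D x -> 0 < x) ->
  (forall x, S x <-> D x \/ D (- x)) ->
  cintegrable D g -> cintegrable D (fun x => g (- x)) ->
  cintegrable S g /\ cint S g = cint D (fun x => g x + g (- x)).
Proof.
move=> mD mS D0 DS i1 i2.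
pose g1 x := (\1_D x)%:C * g x; pose h x := (\1_D x)%:C * g (- x).
have ig1 : cintegrable setT g1 by exact/(cintegrable_mkcond _ mD).
have ih : cintegrable setT h by exact/(cintegrable_mkcond _ mD).
have [ih' eh] := cint_oppr ih.
have e : (fun x => (\1_S x)%:C * g x) = fun x => g1 x + h (- x).
  apply/funext => x; rewrite /g1 /h opprK -mulrDl -rmorphD; congr (_%:C * _).
  have [Dx|nDx] := pselect (D x).
    have nD : ~ D (- x).
      by move=> /D0; rewrite oppr_gt0 => /(lt_trans (D0 _ Dx)); rewrite ltxx.
    rewrite (indic_in Dx) (indic_out nD) addr0 indic_in//.
    by apply/DS; left.
  rewrite (indic_out nDx) add0r; have [Dx|nDx'] := pselect (D (- x)).
    by rewrite (indic_in Dx) indic_in//; apply/DS; right.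
  by rewrite (indic_out nDx') indic_out// => /DS[].
split; first by apply/(cintegrable_mkcond _ mS); rewrite e; exact: cintegrableD.
rewrite cint_mkcond e (cintD measurableT ig1 ih') -eh (cintD mD i1 i2).
by congr (_ + _); apply/esym; exact: cint_mkcond.
Qed.

Lemma cint_setD1 D (c : R) g : msble D -> cintegrable (D `\ c) g ->
  cintegrable D g /\ cint D g = cint (D `\ c) g.
Proof.
move=> mD; have mc : msble [set c] by exact: measurable_set1.
have mDc : msble (D `\ c) by exact: measurableD.
have c0 : mu ([set c] : set (Rm R)) = 0%E by exact: lebesgue_measure_set1.
have part (h : R -> R) : mu.-integrable (D `\ c) (EFin \o h) ->
    mu.-integrable D (EFin \o h) /\
    \int[mu]_(x in D) h x = \int[mu]_(x in D `\ c) h x.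
  move=> ih; have mh : measurable_fun (D : set (Rm R)) (EFin \o h).
    apply: (@measurable_funS _ _ _ _ (D `\ c `|` [set c])).
    - exact: measurableU.
    - by move=> x Dx; have [->|xc] := pselect (x = c); [right|left].
    - apply/measurable_funU => //; split; last exact: measurable_fun_set1.
      exact: measurable_int ih.
  have iD := proj2 (negligible_integrable mc mD mh c0) ih.
  by split; rewrite // /Rintegral (negligible_integral mc mD iD c0).
by move=> [/part[i1 e1] /part[i2 e2]]; split; rewrite // /cint e1 e2.
Qed.

Lemma cint_symmetric_itv t g : 0 < t ->
  cintegrable `]0, t[ g -> cintegrable `]0, t[ (fun y => g (- y)) ->
  cintegrable [set y | `|y| < t] g /\
  cint [set y | `|y| < t] g = cint `]0, t[ (fun y => g y + g (- y)).
Proof.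
move=> t0 i1 i2.
have e : [set y | `|y| < t] = `]- t, t[%classic.
  by apply/seteqP; split=> y; rewrite /= in_itv/= ltr_norml.
have mS : msble [set y | `|y| < t] by rewrite e; exact: msble_itv.
have mc : msble ([set y | `|y| < t] `\ 0).
  by apply: measurableD => //; exact: measurable_set1.
have [|||i12 e12] := @cint_reflect `]0, t[ ([set y | `|y| < t] `\ 0) g _ mc _ _ i1 i2.
- exact: msble_itv.
- by move=> x; rewrite /= in_itv/= => /andP[].
- move=> x; rewrite /= !in_itv/=; split.
    move=> [xt /eqP x0]; have [x1|x1] := ltP 0 x.
      by left; rewrite (le_lt_trans _ xt)// ler_norm.
    have xl : x < 0 by rewrite lt_neqAle x0.
    by right; rewrite ltr0_norm// in xt; rewrite oppr_gt0 xl.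
  move=> [/andP[x0 xt]|/andP[x0 xt]].
    by split; [rewrite gtr0_norm|apply/eqP; rewrite gt_eqF].
  split; first by rewrite -normrN gtr0_norm.
  by apply/eqP; rewrite lt_eqF// -oppr_gt0.
by have [i3 e3] := cint_setD1 mS i12; split; rewrite ?e3.
Qed.
End reflection.

Section power_product.
Context {R : realType}.

Lemma powR_product_bound (a b p q z : R) : a < z < b ->
  (z - a) `^ p * (b - z) `^ q <=
  (1 `^ q + 2^-1 `^ q) * (b - a) `^ q * (z - a) `^ p +
  (1 `^ p + 2^-1 `^ p) * (b - a) `^ p * (b - z) `^ q.
Proof.
move=> /andP[az zb]; have h2 : 0 < 2^-1 :> R by rewrite invr_gt0.
have ab : 0 < b - a by lra.
have [zm|zm] := leP z ((a + b) / 2).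
  rewrite -[leLHS]addr0 lerD//; last by rewrite !(mulr_ge0, addr_ge0) ?powR_ge0.
  by rewrite mulrC ler_wpM2r ?powR_ge0//; apply: powR_between => //; lra.
rewrite -[leLHS]add0r lerD//; first by rewrite !(mulr_ge0, addr_ge0) ?powR_ge0.
by rewrite ler_wpM2r ?powR_ge0//; apply: powR_between => //; lra.
Qed.

Lemma integrable_powR_product (a b p q : R) : a < b -> 0 < p -> 0 < q ->
  mu.-integrable `]a, b[ (EFin \o (fun z => (z - a) `^ (p - 1) * (b - z) `^ (q - 1))).
Proof.
move=> ab p0 q0; have [i1 _] := integral_powR_left ab p0.
have [i2 _] := integral_powR_right ab q0.
pose c1 := (1 `^ (q - 1) + 2^-1 `^ (q - 1)) * (b - a) `^ (q - 1).
pose c2 := (1 `^ (p - 1) + 2^-1 `^ (p - 1)) * (b - a) `^ (p - 1).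
have j1 := rintegrableZ c1 (msble_itv _) i1.
have j2 := rintegrableZ c2 (msble_itv _) i2.
apply: le_integrable (integrableD (msble_itv `]a, b[) j1 j2); first exact: msble_itv.
  have m1 := measurable_int _ i1; have m2 := measurable_int _ i2.
  by apply/measurable_EFinP/measurable_funM; exact/measurable_EFinP.
move=> z; rewrite /= in_itv/= => zab; rewrite lee_fin !ger0_norm.
- exact: powR_product_bound.
- by rewrite addr_ge0 // !(mulr_ge0, addr_ge0) ?powR_ge0.
- by rewrite mulr_ge0 ?powR_ge0.
Qed.
End power_product.

(** * Size and integrability of the kernel *)

Section kernel_bounds.
Context {R : realType} (k1 k2 : R[i]) (k1_gt0 : 0 < Re k1) (k2_gt0 : 0 < Re k2).
Implicit Types (x y z : R).

(** With [u = exp ((z - y)/2)] and [v = exp (-(z + y)/2)] the braces equal [exp x + 1 - (u + v)],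
    and [u + v] lies between [1 + exp (-z)] and [1 + exp z]. The bound has to vanish at [x = 0] in
    order to absorb the power [|x|^(Re k2 - 1)] of the outer kernel. *)
Lemma ksigma_le x y z : `|y| < z -> z < `|x| -> `|ksigma x y z| <= 2 * sinh `|x|.
Proof.
move=> yz zx; have x0 : x != 0 by rewrite -normr_gt0 (lt_trans _ zx)// (le_lt_trans _ yz).
have [yz1 yz2] : - z < y /\ y < z by move: yz; rewrite ltr_norml => /andP[].
have -> : ksigma x y z = Num.sg x * ((expR x + 1) - (expR ((z - y) / 2) + expR (- ((z + y) / 2)))).
  rewrite /ksigma /cosh !(mulrC 2) !divfK ?pnatr_eq0//.
  rewrite !mulrDr -!expRD subrr expR0.
  have -> : x / 2 + x / 2 = x by lra.
  have -> : - (y / 2) + z / 2 = (z - y) / 2 by lra.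
  by have -> : - (y / 2) + - (z / 2) = - ((z + y) / 2) by lra.
set u := expR ((z - y) / 2); set v := expR (- ((z + y) / 2)).
have u1 : 1 <= u by rewrite -expR0 ler_expR; lra.
have v1 : v <= 1 by rewrite -expR0 ler_expR; lra.
have v0 : 0 < v by exact: expR_gt0.
have uz : u <= expR z by rewrite ler_expR; lra.
have vz : expR (- z) <= v by rewrite ler_expR; lra.
have ux : expR z <= expR `|x| by rewrite ler_expR ltW.
have vx : expR (- `|x|) <= expR (- z) by rewrite ler_expR; lra.
have ss : 2 * sinh `|x| = expR `|x| - expR (- `|x|) by rewrite /sinh mulrC divfK.
(* As [u = exp z * v], this is [(1 - v) (exp z - 1) >= 0]; the lower bound follows in the same way
   from [v = exp (-z) * u]. *)
have uv1 : u + v <= 1 + expR z.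
  have p1 : expR z * v = expR ((z - y) / 2) by rewrite -expRD; congr expR; lra.
  rewrite -/u in p1; have e1 : 1 <= expR z by rewrite -expR0 ler_expR; lra.
  have : 0 <= (1 - v) * (expR z - 1) by apply: mulr_ge0; lra.
  by rewrite mulrBl mul1r mulrBr mulr1 [v * _]mulrC p1; lra.
have uv2 : 1 + expR (- z) <= u + v.
  have p1 : expR (- z) * u = v by rewrite -expRD; congr expR; lra.
  have e1 : expR (- z) <= 1 by rewrite -expR0 ler_expR; lra.
  have : 0 <= (u - 1) * (1 - expR (- z)) by apply: mulr_ge0; lra.
  by rewrite mulrBl mul1r mulrBr mulr1 [u * _]mulrC p1; lra.
have [x1|x1] := ltP 0 x.
  rewrite gtr0_sg// mul1r ss; rewrite gtr0_norm// in ux vx *.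
  by rewrite ler_norml; apply/andP; split; lra.
have {}x1 : x < 0 by rewrite lt_neqAle x0.
rewrite ltr0_sg// ss; rewrite ltr0_norm// opprK in ux vx *.
by rewrite ler_norml; apply/andP; split; lra.
Qed.

(** By [2 cosh (z/2) sinh (z/2) = sinh z], each of the two terms of [ksigma] becomes a factor free
    of [z] times [cS z] or [sinh z]. *)
Lemma kernel_integrandE x y z : kernel_integrand k1 k2 x y z =
  (Num.sg x * (expR (x / 2) * (2 * cosh (x / 2))))%:C
    * (cS z * (cpow (cosh (z / 2) - cosh (`|y| / 2)) (k1 - 1)
    * cpow (cosh `|x| - cosh z) (k2 - 1)))
  + (- (Num.sg x * expR (- (y / 2))))%:C
    * ((sinh z)%:C * (cpow (cosh (z / 2) - cosh (`|y| / 2)) (k1 - 1)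
    * cpow (cosh `|x| - cosh z) (k2 - 1))).
Proof.
have ey : cosh (`|y| / 2) = cosh (y / 2).
  by rewrite -[RHS]cosh_abs normrM [`|2^-1|]gtr0_norm ?invr_gt0.
rewrite /kernel_integrand /ksigma ey cosh_abs (csinh_cS z) /cS /cZ.
by rewrite !(rmorphM, rmorphB, rmorphN, rmorph_nat); ring.
Qed.

Lemma ccont_kernel_integrand x y z : `|y| < z < `|x| ->
  ccont (kernel_integrand k1 k2 x y) z.
Proof.
move=> /andP[yz zx]; apply: (@ccont_near _ _ (fun z => _)).
  by near=> t; exact: kernel_integrandE.
have z0 : 0 <= `|y| by [].
have c1 : ccont (fun t => cpow (cosh (t / 2) - cosh (`|y| / 2)) (k1 - 1)) z.
  apply: ccont_cpow; last exact: (abel_weight_lt (@abel_weight_cosh_half R)).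
  by apply: cvgB; [exact: (continuous_half (@continuous_cosh R))|exact: cvg_cst].
have c2 : ccont (fun t => cpow (cosh `|x| - cosh t) (k2 - 1)) z.
  apply: ccont_cpow; last first.
    by apply: (abel_weight_lt (@abel_weight_cosh R)) => //; exact: (le_trans z0 (ltW yz)).
  by apply: cvgB; [exact: cvg_cst|exact: continuous_cosh].
apply: ccontD.
  apply: ccontM; first exact: ccontC.
  apply: ccontM; last exact: ccontM.
  by apply/ccontR; exact: (continuous_half (@continuous_sinh R)).
apply: ccontM; first exact: ccontC.
apply: ccontM; last exact: ccontM.
by apply/ccontR; exact: continuous_sinh.
Unshelve. all: by end_near. Qed.

(** The factors [sinh (z/2)] and [ksigma] absorb [z^(Re k1 - 1)] and [|x|^(Re k2 - 1)], so that only
    the singularities at the two ends of the interval remain. *)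
Lemma kernel_bound (L : R) : 0 < L -> exists2 K : R, 0 < K & forall x y z,
  `|y| < z < `|x| -> `|x| <= L -> cn (kernel_integrand k1 k2 x y z) <=
    K * ((z - `|y|) `^ (Re k1 - 1) * (`|x| - z) `^ (Re k2 - 1)).
Proof.
move=> L0.
have [K1 K10 h1] := abel_kernel_bound (@abel_weight_cosh_half R) (k1 - 1) L0.
have [K2 K20 h2] := abel_kernel_bound (@abel_weight_cosh R) (k2 - 1) L0.
have c0 : 0 < cosh L by exact: cosh_gt0.
pose A := L `^ Re k1; pose B := L `^ Re k2.
have A0 : 0 < A by exact: powR_gt0.
have B0 : 0 < B by exact: powR_gt0.
exists (2 * cosh L * cosh L * (K1 * A) * (K2 * B)).
  apply: mulr_gt0 (mulr_gt0 K20 B0).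
  apply: mulr_gt0 (mulr_gt0 K10 A0).
  exact: mulr_gt0 (mulr_gt0 (ltr0n _ 2) c0) c0.
move=> x y z /andP[yz zx] xL.
have y0 : 0 <= `|y| by []. have z0 : 0 < z by exact: le_lt_trans yz.
have x0 : 0 < `|x| by exact: lt_trans zx.
have ey : cosh (`|y| / 2) = cosh (y / 2).
  by rewrite -[RHS]cosh_abs normrM [`|2^-1|]gtr0_norm ?invr_gt0.
have b1 : cn (cpow (cosh (z / 2) - cosh (y / 2)) (k1 - 1)) <=
    K1 * (z `^ (Re k1 - 1) * (z - `|y|) `^ (Re k1 - 1)).
  rewrite -ey; have := h1 `|y| z; rewrite ReB /=; apply; first by rewrite y0.
  by rewrite (le_trans (ltW zx)).
have b2 : cn (cpow (cosh x - cosh z) (k2 - 1)) <=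
    K2 * (`|x| `^ (Re k2 - 1) * (`|x| - z) `^ (Re k2 - 1)).
  by rewrite -(cosh_abs x); have := h2 z `|x|; rewrite ReB /=; apply; rewrite // ltW.
have b3 : cn (sinh (z / 2))%:C <= cosh L * z.
  rewrite cnR ger0_norm ?sinh_ge0 ?divr_ge0 ?(ltW z0)//.
  have h : sinh (z / 2) <= cosh L * (z / 2) by apply: sinh_le_cosh_id; lra.
  by apply: le_trans h _; rewrite ler_wpM2l ?ltW//; lra.
have b4 : cn (ksigma x y z)%:C <= 2 * (cosh L * `|x|).
  rewrite cnR; apply: le_trans (ksigma_le yz zx) _; rewrite ler_wpM2l//.
  by apply: sinh_le_cosh_id.
have n := @cn_ge0 R.
rewrite /kernel_integrand !cnM.
apply: le_trans (ler_pM (mulr_ge0 (mulr_ge0 (n _) (n _)) (n _)) (n _)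
  (ler_pM (mulr_ge0 (n _) (n _)) (n _) (ler_pM (n _) (n _) b4 b1) b2) b3) _.
have e1 : z * z `^ (Re k1 - 1) <= A.
  rewrite -{1}[z]powRr1 ?(ltW z0)// powR_mulD// addrCA subrr addr0.
  by rewrite ge0_ler_powR ?nnegrE ?(ltW z0) ?(ltW L0) ?(ltW k1_gt0)//; lra.
have e2 : `|x| * `|x| `^ (Re k2 - 1) <= B.
  rewrite -{1}[`|x|]powRr1 ?(ltW x0)// powR_mulD// addrCA subrr addr0.
  by rewrite ge0_ler_powR ?nnegrE ?(ltW x0) ?(ltW L0) ?(ltW k2_gt0).
set p := (z - _) `^ _; set q := (_ - z) `^ _.
have p0 : 0 <= p by exact: powR_ge0. have q0 : 0 <= q by exact: powR_ge0.
have -> : 2 * (cosh L * `|x|) * (K1 * (z `^ (Re k1 - 1) * p)) *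
    (K2 * (`|x| `^ (Re k2 - 1) * q)) * (cosh L * z) =
  (2 * cosh L * cosh L * K1 * K2 * (p * q)) *
    ((z * z `^ (Re k1 - 1)) * (`|x| * `|x| `^ (Re k2 - 1))) by ring.
have -> : 2 * cosh L * cosh L * (K1 * A) * (K2 * B) * (p * q) =
  (2 * cosh L * cosh L * K1 * K2 * (p * q)) * (A * B) by ring.
rewrite ler_wpM2l//; first by rewrite !mulr_ge0// ltW.
by rewrite ler_pM// mulr_ge0 ?powR_ge0// ltW.
Qed.

Lemma kernel_integrable x y : `|y| < `|x| ->
  cintegrable `]`|y|, `|x|[ (kernel_integrand k1 k2 x y).
Proof.
move=> yx; have x0 : 0 < `|x| by exact: le_lt_trans yx.
have [K K0 hK] := kernel_bound x0.
have hi := integrable_powR_product yx k1_gt0 k2_gt0.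
apply: cintegrable_dom (rintegrableZ K (msble_itv _) hi); first exact: msble_itv.
  apply: ccont_cmeas; first exact: interval_open.
  by move=> z; rewrite /= in_itv/=; exact: ccont_kernel_integrand.
by move=> z; rewrite /= in_itv/= => yzx; exact: hK.
Qed.
End kernel_bounds.

Local Opaque cint cpow.

Section even_odd_parts.
Context {R : realType}.
Implicit Types (f g : R -> R[i]).

Definition cev f (y : R) : R[i] := 2^-1 * (f y + f (- y)).
(** The difference is written with [-1 *] so that the rules for sums and products apply to it
    directly. *)
Definition cod f (y : R) : R[i] := 2^-1 * (f y + -1 * f (- y)).

Lemma ccont_oppr f (y : R) : ccont f (- y) -> ccont (fun t => f (- t)) y.
Proof.
move=> [c1 c2]; have cN : {for y, continuous (-%R : R -> R)} by exact: continuousN.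
by split; [exact: continuous_comp cN c1|exact: continuous_comp cN c2].
Qed.

Lemma ccont_cev f : (forall y, ccont f y) -> forall y, ccont (cev f) y.
Proof.
move=> cf y; apply: ccontM; first exact: ccontC.
by apply: ccontD; [exact: cf|exact/ccont_oppr/cf].
Qed.

Lemma ccont_cod f : (forall y, ccont f y) -> forall y, ccont (cod f) y.
Proof.
move=> cf y; apply: ccontM; first exact: ccontC.
apply: ccontD; first exact: cf.
by apply: ccontM; [exact: ccontC|exact/ccont_oppr/cf].
Qed.

Lemma cevD_cod f y : f y = cev f y + cod f y.
Proof. by rewrite /cev /cod; field. Qed.
Lemma cevB_cod f y : f (- y) = cev f y - cod f y.
Proof. by rewrite /cev /cod; field. Qed.
End even_odd_parts.

(** * Folding the kernel onto the positive axis *)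

Section kernel_folding.
Context {R : realType} (k1 k2 : R[i]) (k1_gt0 : 0 < Re k1) (k2_gt0 : 0 < Re k2).
Implicit Types (x y z t : R) (f F : R -> R[i]) (q : R -> R).

Let w1 y z : R[i] := cpow (cosh (z / 2) - cosh (y / 2)) (k1 - 1).
Let w2 t z : R[i] := cpow (cosh t - cosh z) (k2 - 1).

(** The bound [|q z| <= M z] compensates for the possible blow-up [z^(2 Re k1 - 1)] of the inner
    transform. It is used for [q z = sinh (z/2)] and for [q z = sinh z]. *)
Lemma double_fubini q F t (M : R) : continuous q -> 0 < t -> 0 < M ->
  (forall z, 0 < z < t -> `|q z| <= M * z) -> admissible F ->
  cintegrable `]0, t[ (fun y => cint `]y, t[ (fun z => (q z)%:C * w2 t z * (F y * w1 y z))) /\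
  cint `]0, t[ (fun y => cint `]y, t[ (fun z => (q z)%:C * w2 t z * (F y * w1 y z))) =
    outer k2 (fun z => (q z)%:C * inner k1 F z) t.
Proof.
move=> cq t0 M0 hq hF.
have [K K0 hK] := abel_kernel_bound (@abel_weight_cosh R) (k2 - 1) t0.
have [hi _] := integral_powR_right t0 k2_gt0.
pose c := M * t `^ (2 * Re k1) * (K * t `^ (Re k2 - 1)).
have c2 z : 0 < z < t -> ccont (fun z => (q z)%:C * w2 t z) z.
  move=> z0t; apply: ccontM; first exact/ccontR/cq.
  exact: (ccont_abel_kernel (@abel_weight_cosh R)).
have bnd z : 0 < z < t -> cn ((q z)%:C * w2 t z) * z `^ (2 * Re k1 - 1)
    <= c * (t - z) `^ (Re k2 - 1).
  move=> /[dup] z0t /andP[z0 zt].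
  have h2 : cn (w2 t z) <= K * (t `^ (Re k2 - 1) * (t - z) `^ (Re k2 - 1)).
    by have := hK z t; rewrite ReB /=; apply; rewrite ?(ltW z0).
  have h1 : cn (q z)%:C * z `^ (2 * Re k1 - 1) <= M * t `^ (2 * Re k1).
    rewrite cnR; apply: le_trans (ler_wpM2r (powR_ge0 _ _) (hq z z0t)) _.
    rewrite -mulrA ler_wpM2l ?(ltW M0)// -{1}[z]powRr1 ?(ltW z0)// powR_mulD//.
    rewrite addrCA subrr addr0 ge0_ler_powR ?nnegrE ?(ltW z0) ?(ltW t0) ?(ltW zt)//.
    by rewrite mulr_ge0 ?ltW.
  rewrite cnM mulrAC.
  have := ler_pM (mulr_ge0 (cn_ge0 _) (powR_ge0 _ _)) (cn_ge0 _) h1 h2.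
  by rewrite /c !mulrA.
have [_ i2 e] := abel_fubini (@abel_weight_cosh_half R) k1_gt0 t0 hF c2 bnd
  (rintegrableZ c (msble_itv _) hi).
split; first exact: i2.
rewrite /outer /abel -e; apply: eq_cint => z _.
by rewrite -!mulrA [w2 t z * _]mulrC.
Qed.

(** The terms with [exp (-(y/2))] cancel between [x] and [-x], so the integrability of the kernel
    passes to its [cS] piece alone. *)
Let i0 x y z : 0 < x -> kernel_integrand k1 k2 x y z + kernel_integrand k1 k2 (- x) y z =
  (2 * (sinh x)%:C) * (cS z * (w1 `|y| z * w2 x z)).
Proof.
move=> x0; rewrite !kernel_integrandE normrN (gtr0_norm x0) gtr0_sg// ltr0_sg ?oppr_lt0//.
rewrite -/(w1 _ z) -/(w2 _ z).
have -> : 2 * (sinh x)%:C = (1 * (expR (x / 2) * (2 * cosh (x / 2))))%:C +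
   (-1 * (expR (- x / 2) * (2 * cosh (- x / 2))))%:C :> R[i].
  rewrite -rmorphD -(rmorph_nat (real_complex R)) -rmorphM; congr (_%:C).
  by rewrite !mulNr (coshN (x / 2)) sinh_double !expR_cosh_sinh (coshN (x / 2)) sinhN; ring.
by rewrite !(rmorphM, rmorphN, rmorph1); ring.
Qed.

Lemma cintegrable_sinh_half x y : 0 < x -> `|y| < x ->
  cintegrable `]`|y|, x[ (fun z => cS z * (w1 `|y| z * w2 x z)).
Proof.
move=> x0 yx.
have h1 := @kernel_integrable _ k1 k2 k1_gt0 k2_gt0 x y.
have h2 := @kernel_integrable _ k1 k2 k1_gt0 k2_gt0 (- x) y.
rewrite normrN (gtr0_norm x0) in h1 h2.
have := cintegrableZ (2 * (sinh x)%:C)^-1 (msble_itv _)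
  (cintegrableD (msble_itv _) (h1 yx) (h2 yx)).
apply: eq_cintegrable; first exact: msble_itv.
move=> z _; rewrite (i0 y z x0) mulrA mulVf ?mul1r// mulf_neq0 ?C2_neq0//.
by rewrite -cn_gt0 cnR normr_gt0 gt_eqF// sinh_gt0.
Qed.

Lemma cintegrable_sinh x y : 0 < x -> `|y| < x ->
  cintegrable `]`|y|, x[ (fun z => (sinh z)%:C * (w1 `|y| z * w2 x z)).
Proof.
move=> x0 yx; have h0 := cintegrable_sinh_half x0 yx.
have h1 := @kernel_integrable _ k1 k2 k1_gt0 k2_gt0 x y.
rewrite (gtr0_norm x0) in h1.
have ab (a b u v : R[i]) : b != 0 -> b^-1 * ((a * u + b * v) + - a * u) = v.
  by move=> b0; rewrite mulNr addrAC subrr add0r mulKf.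
have b0 : (- (Num.sg x * expR (- (y / 2))))%:C != 0 :> R[i].
  by rewrite -cn_gt0 cnR normr_gt0 oppr_eq0 gtr0_sg// mul1r gt_eqF// expR_gt0.
have := cintegrableZ (- (Num.sg x * expR (- (y / 2))))%:C^-1 (msble_itv _)
  (cintegrableD (msble_itv _) (h1 yx)
    (cintegrableZ (- (Num.sg x * (expR (x / 2) * (2 * cosh (x / 2))))%:C) (msble_itv _) h0)).
apply: eq_cintegrable; first exact: msble_itv.
by move=> z _; rewrite kernel_integrandE (gtr0_norm x0) -/(w1 _ z) -/(w2 _ z) ab.
Qed.

Definition kernel_mass x y : R[i] := cint `]`|y|, `|x|[ (kernel_integrand k1 k2 x y).

Lemma kernel_massE x y : `|y| < `|x| -> kernel_mass x y =
  (Num.sg x * (expR (x / 2) * (2 * cosh (x / 2))))%:C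
    * cint `]`|y|, `|x|[ (fun z => cS z * (w1 `|y| z * w2 `|x| z))
  + (- (Num.sg x * expR (- (y / 2))))%:C
    * cint `]`|y|, `|x|[ (fun z => (sinh z)%:C * (w1 `|y| z * w2 `|x| z)).
Proof.
move=> yx; have x0 : 0 < `|x| by exact: le_lt_trans yx.
have h1 := cintegrable_sinh_half x0 yx; have h2 := cintegrable_sinh x0 yx.
have m := msble_itv `]`|y|, `|x|[.
rewrite -(cintZ _ m h1) -(cintZ _ m h2).
have j1 := cintegrableZ (Num.sg x * (expR (x / 2) * (2 * cosh (x / 2))))%:C m h1.
have j2 := cintegrableZ (- (Num.sg x * expR (- (y / 2))))%:C m h2.
rewrite -(cintD m j1 j2) /kernel_mass.
by apply: eq_cint => z _; exact: kernel_integrandE.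
Qed.

Let b x (d : R) y : R[i] := (- (Num.sg x * expR (- (d * y / 2))))%:C.

Let b_admissible x d : admissible (b x d).
Proof.
apply: admissibleR => y; apply: cvgN; apply: cvgM; first exact: cvg_cst.
apply: (@continuous_comp _ _ _ (fun y => - (d * y / 2)) expR); last exact: continuous_expR.
by apply: cvgN; apply: cvgM; [apply: cvgM; [exact: cvg_cst|exact: cvg_id]|exact: cvg_cst].
Qed.

(** One half of the fold: [d] is 1 or -1. The map [e] is kept apart from [d] so that the statement
    applies literally to [y] and to [- y]. *)
Lemma kernel_mass_half x (d : R) (e : R -> R) F : x != 0 -> `|d| = 1 ->
  (forall y, e y = d * y) -> admissible F ->
  cintegrable `]0, `|x|[ (fun y => kernel_mass x (e y) * F y) /\
  cint `]0, `|x|[ (fun y => kernel_mass x (e y) * F y) =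
    (Num.sg x * (expR (x / 2) * (2 * cosh (x / 2))))%:C * double_abel k1 k2 F `|x|
    + outer k2 (fun z => (sinh z)%:C * inner k1 (fun y => b x d y * F y) z) `|x|.
Proof.
move=> x0 d1 ed hF; have t0 : 0 < `|x| by rewrite normr_gt0.
have m := msble_itv `]0, `|x|[.
have hbF := admissibleM (b_admissible x d) hF.
have c0 : 0 < cosh `|x| :> R by exact: cosh_gt0.
have q1 z : 0 < z < `|x| -> `|sinh (z / 2)| <= cosh `|x| * z.
  move=> /andP[z0 zt]; rewrite ger0_norm ?sinh_ge0 ?divr_ge0 ?(ltW z0)//.
  have h : sinh (z / 2) <= cosh `|x| * (z / 2) by apply: sinh_le_cosh_id; lra.
  by apply: le_trans h _; rewrite ler_wpM2l ?ltW//; lra.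
have q2 z : 0 < z < `|x| -> `|sinh z| <= cosh `|x| * z.
  move=> /andP[z0 zt]; rewrite ger0_norm ?sinh_ge0 ?(ltW z0)//.
  by apply: sinh_le_cosh_id; exact: ltW.
have [i1 e1] := double_fubini (continuous_half (@continuous_sinh R)) t0 c0 q1 hF.
have [i2 e2] := double_fubini (@continuous_sinh R) t0 c0 q2 hbF.
set a := (Num.sg x * (expR (x / 2) * (2 * cosh (x / 2))))%:C.
have j1 := cintegrableZ a m i1.
have eq_ : {in (`]0, `|x|[%classic : set R),
   (fun y => a * cint `]y, `|x|[ (fun z => (sinh (z / 2))%:C * w2 `|x| z * (F y * w1 y z))
     + cint `]y, `|x|[ (fun z => (sinh z)%:C * w2 `|x| z * (b x d y * F y * w1 y z)))
    =1 (fun y => kernel_mass x (e y) * F y)}.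
  move=> y; rewrite inE /= in_itv/= => /andP[y0 yx]; rewrite ed.
  have ny : `|d * y| = y by rewrite normrM d1 mul1r gtr0_norm.
  have yx' : `|d * y| < `|x| by rewrite ny.
  rewrite (kernel_massE yx') mulrDl -/a -/(b x d y) ny.
  have h1 := cintegrable_sinh_half t0 yx'; have h2 := cintegrable_sinh t0 yx'.
  rewrite ny in h1 h2; have my := msble_itv `]y, `|x|[.
  have E1 : cint `]y, `|x|[ (fun z => (sinh (z / 2))%:C * w2 `|x| z * (F y * w1 y z)) =
      F y * cint `]y, `|x|[ (fun z => cS z * (w1 y z * w2 `|x| z)).
    by apply: etrans (cintZ (F y) my h1); apply: eq_cint => z _; rewrite /cS; ring.
  have E2 : cint `]y, `|x|[ (fun z => (sinh z)%:C * w2 `|x| z * (b x d y * F y * w1 y z)) =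
      b x d y * F y * cint `]y, `|x|[ (fun z => (sinh z)%:C * (w1 y z * w2 `|x| z)).
    by apply: etrans (cintZ (b x d y * F y) my h2); apply: eq_cint => z _; ring.
  have calc (u v p q r w : R[i]) : p = r * u -> q = w * r * v ->
    a * p + q = a * u * r + w * v * r by move=> -> ->; ring.
  exact: calc E1 E2.
split; first exact: eq_cintegrable m eq_ (cintegrableD m j1 i2).
apply: etrans (esym (eq_cint eq_)) _; apply: etrans (cintD m j1 i2) _.
exact: (f_equal2 +%R (etrans (cintZ a m i1) (f_equal (fun u => a * u) e1)) e2).
Qed.

Let TJ F z : R[i] := (sinh z)%:C * inner k1 F z.

Let admissible_TJ F : admissible F -> admissible (TJ F).
Proof.
move=> hF; have -> : TJ F = fun z => 2 * (cZ z * SJ k1 F z).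
  by apply/funext => z; rewrite /TJ /SJ csinh_cS; ring.
apply: admissibleM (admissibleC _) (admissibleM (@admissible_cZ R) _).
exact: admissible_SJ.
Qed.

Let outer_TJ_lin l F G t : 0 < t -> admissible F -> admissible G ->
  outer k2 (TJ (fun y => l * F y + G y)) t = l * outer k2 (TJ F) t + outer k2 (TJ G) t.
Proof.
move=> t0 hF hG; have hlF := admissibleM (admissibleC l) hF.
have a1 := admissible_TJ hF; have a2 := admissibleM (admissibleC l) a1.
apply: etrans (etrans (outerD k2_gt0 t0 a2 (admissible_TJ hG)) _); last first.
  by apply: (f_equal2 +%R _ erefl); exact: outerZ.
apply: eq_abel => z /andP[z0 _]; rewrite /TJ (innerD k1_gt0 z0 hlF hG).
by rewrite (innerZ k1_gt0 _ z0 hF); ring.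
Qed.

Let double_abel_lin l F G t : 0 < t -> admissible F -> admissible G ->
  double_abel k1 k2 (fun y => l * F y + G y) t =
  l * double_abel k1 k2 F t + double_abel k1 k2 G t.
Proof.
move=> t0 hF hG; have hlF := admissibleM (admissibleC l) hF.
have a1 := admissible_SJ k1_gt0 hF; have a2 := admissibleM (admissibleC l) a1.
apply: etrans (etrans (outerD k2_gt0 t0 a2 (admissible_SJ k1_gt0 hG)) _); last first.
  by apply: (f_equal2 +%R _ erefl); exact: outerZ.
apply: eq_abel => z /andP[z0 _]; rewrite /SJ (innerD k1_gt0 z0 hlF hG).
by rewrite (innerZ k1_gt0 _ z0 hF); ring.
Qed.

(** Two splittings meet: [exp (x/2) * 2 cosh (x/2) = 1 + cosh x + sinh x] separates the
    contributions with and without [sign x], and [exp (-(y/2)) = cZ y - cS y] pairs [cZ] with the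
    even and [cS] with the odd part of [f]. The terms in the even part that carry [sign x] are
    collected by [double_abel_even]. *)
Lemma kernel_mass_integral x f : x != 0 -> (forall y, ccont f y) ->
  cintegrable [set y | `|y| < `|x|] (fun y => kernel_mass x y * f y) /\
  cint [set y | `|y| < `|x|] (fun y => kernel_mass x y * f y) =
  2 * ((sinh `|x|)%:C * double_abel k1 k2 (cev f) `|x| + (Num.sg x)%:C *
    ((k1 / 2 + k2) / k2 * outerS k2 (SJ k1 (cev f)) `|x| +
     outer k2 (fun z => (sinh z)%:C * inner k1 (fun y => cS y * cod f y) z) `|x|)).
Proof.
move=> x0 cf; have t0 : 0 < `|x| by rewrite normr_gt0.
have m := msble_itv `]0, `|x|[.
have hf := ccont_admissible cf.
have hf' : admissible (fun y => f (- y)) by apply: ccont_admissible => y; exact/ccont_oppr/cf.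
have [i1 e1] := kernel_mass_half x0 (normr1 R) (fun y => esym (mul1r y)) hf.
have nN1 : `|-1| = 1 :> R by rewrite normrN1.
have [i2 e2] := kernel_mass_half x0 nN1 (fun y => esym (mulN1r y)) hf'.
have [I E] := @cint_symmetric_itv _ _ (fun y => kernel_mass x y * f y) t0 i1 i2.
split; first exact: I.
have hE := ccont_admissible (ccont_cev cf); have hO := ccont_admissible (ccont_cod cf).
have hZE := admissibleM (@admissible_cZ R) hE.
have hSO := admissibleM (@admissible_cS R) hO.
have eA : (Num.sg x * (expR (x / 2) * (2 * cosh (x / 2))))%:C =
    (Num.sg x)%:C * (1 + (cosh `|x|)%:C) + (sinh `|x|)%:C :> R[i].
  rewrite -(rmorph1 (real_complex R)) -!(rmorphD, rmorphM); congr (_%:C).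
  have -> : expR (x / 2) * (2 * cosh (x / 2)) = 1 + cosh x + sinh x.
    by rewrite expR_cosh_sinh (cosh_double x) (sinh_double x); ring.
  rewrite cosh_abs; have [xp|xn] := ltP 0 x; first by rewrite gtr0_sg// gtr0_norm//; ring.
  have xl : x < 0 by rewrite lt_neqAle x0.
  by rewrite ltr0_sg// ltr0_norm// sinhN; ring.
have eE := double_abel_even k1_gt0 k2_gt0 t0 hE.
have h1 := admissibleM (b_admissible x 1) hf.
have h2 := admissibleM (b_admissible x (-1)) hf'.
have eB : double_abel k1 k2 f `|x| + double_abel k1 k2 (fun y => f (- y)) `|x| =
    2 * double_abel k1 k2 (cev f) `|x|.
  have z0 := admissibleC (0 : R[i]).
  have l1 := double_abel_lin 1 t0 hf hf'; have l2 := double_abel_lin 2 t0 hE z0.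
  have l3 := double_abel_lin (-1) t0 z0 z0.
  rewrite mul1r in l1; apply: etrans (esym l1) (etrans _ (etrans l2 _)).
    by apply: (f_equal (fun F => double_abel k1 k2 F `|x|)); apply/funext => y; rewrite /cev; field.
  rewrite (_ : double_abel _ _ (fun=> 0) _ = 0) ?addr0//.
  apply: etrans (etrans l3 _); last by rewrite mulN1r addNr.
  by apply: (f_equal (fun F => double_abel k1 k2 F `|x|)); apply/funext => y; rewrite mulr0 addr0.
have eT : outer k2 (TJ (fun y => b x 1 y * f y)) `|x| +
    outer k2 (TJ (fun y => b x (-1) y * f (- y))) `|x| =
    - (2 * (Num.sg x)%:C) * outer k2 (TJ (fun y => cZ y * cev f y)) `|x| +
    2 * (Num.sg x)%:C * outer k2 (TJ (fun y => cS y * cod f y)) `|x|.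
  have hs := admissibleM (admissibleC (2 * (Num.sg x)%:C)) hSO.
  have z0 := admissibleC (0 : R[i]).
  have l1 := outer_TJ_lin 1 t0 h1 h2.
  have l2 := outer_TJ_lin (- (2 * (Num.sg x)%:C)) t0 hZE hs.
  have l3 := outer_TJ_lin (2 * (Num.sg x)%:C) t0 hSO z0.
  have l4 := outer_TJ_lin (-1) t0 z0 z0.
  have e0 : outer k2 (TJ (fun=> 0)) `|x| = 0.
    apply: etrans (etrans l4 _); last by rewrite mulN1r addNr.
    by apply: (f_equal (fun F => outer k2 (TJ F) `|x|)); apply/funext => y; rewrite mulr0 addr0.
  have eh : outer k2 (TJ (fun y => 2 * (Num.sg x)%:C * (cS y * cod f y))) `|x| =
      2 * (Num.sg x)%:C * outer k2 (TJ (fun y => cS y * cod f y)) `|x|.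
    apply: etrans (etrans l3 _).
      by apply: (f_equal (fun F => outer k2 (TJ F) `|x|)); apply/funext => y; rewrite addr0.
    exact: etrans (f_equal2 +%R erefl e0) (addr0 _).
  rewrite mul1r in l1.
  apply: etrans (esym l1) (etrans _ (etrans l2 (f_equal2 +%R erefl eh))).
    apply: (f_equal (fun F => outer k2 (TJ F) `|x|)); apply/funext => y.
    have -> : b x 1 y = (Num.sg x)%:C * (cS y - cZ y).
      rewrite /b /cS /cZ -rmorphB -rmorphM; congr (_%:C).
      by rewrite mul1r expR_cosh_sinh coshN sinhN; ring.
    have -> : b x (-1) y = (Num.sg x)%:C * - (cS y + cZ y).
      rewrite /b /cS /cZ -rmorphD -rmorphN -rmorphM; congr (_%:C).
      by rewrite mulN1r mulNr opprK expR_cosh_sinh; ring.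
    by rewrite /cev /cod; field; rewrite ?C2_neq0.
apply: etrans E (etrans (cintD m i1 i2) (etrans (f_equal2 +%R e1 e2) _)).
have calc (sg A sh ch B1 B2 B T1 T2 Q P Ev : R[i]) : A = sg * (1 + ch) + sh ->
  B1 + B2 = 2 * B -> T1 + T2 = - (2 * sg) * Q + 2 * sg * P -> (1 + ch) * B - Q = Ev ->
  A * B1 + T1 + (A * B2 + T2) = 2 * (sh * B + sg * (Ev + P)).
  by move=> -> hB hT <-; rewrite addrACA -mulrDr hB hT; ring.
exact: calc eA eB eT eE.
Qed.
End kernel_folding.

Section weight_derivative.
Context {R : realType} (k1 k2 : R[i]).
Implicit Types (x t : R).

Lemma weightN x : weight k1 k2 (- x) = weight k1 k2 x.
Proof. by rewrite /weight mulNr !sinhN !mulrN !normrN. Qed.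

Lemma weight_gt0 t : 0 < t ->
  weight k1 k2 t = cpow (2 * sinh (t / 2)) (2 * k1) * cpow (2 * sinh t) (2 * k2).
Proof.
move=> t0; rewrite /weight !gtr0_norm// mulr_gt0// sinh_gt0//.
by rewrite divr_gt0.
Qed.

(** True at the origin as well, [cpow] being an exponential whatever its base. *)
Lemma weight_neq0 x : weight k1 k2 x != 0.
Proof. by rewrite /weight mulf_neq0// cpow_neq0. Qed.

Lemma weightV t : 0 < t -> (weight k1 k2 t)^-1 =
  cpow (2 * sinh (t / 2)) (- (2 * k1)) * cpow (2 * sinh t) (- (2 * k2)).
Proof. by move=> t0; rewrite weight_gt0// invfM !cpowN. Qed.

(* The logarithmic derivative of [weight k1 k2] on the positive axis. *)
Definition weight_rate t : R[i] :=
  k1 * (cZ t / cS t) + 2 * k2 * ((cosh t)%:C / (sinh t)%:C).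

Lemma cder_weightV t : 0 < t ->
  cder (fun t => (weight k1 k2 t)^-1) t (- weight_rate t * (weight k1 k2 t)^-1).
Proof.
move=> t0; have s0 : 0 < 2 * sinh (t / 2) by rewrite mulr_gt0// sinh_gt0// divr_gt0.
have s1 : 0 < 2 * sinh t by rewrite mulr_gt0// sinh_gt0.
apply: (@cder_near _ _ (fun t => cpow (2 * sinh (t / 2)) (- (2 * k1)) *
    cpow (2 * sinh t) (- (2 * k2)))).
  by apply: filterS (near_gt0 t0) => u u0; exact: weightV.
have dd (h : R -> R) d : is_derive t 1 h d -> is_derive t 1 (fun u => 2 * h u) (2 * d).
  move=> dh; have := is_deriveM (is_derive_cst (2 : R) t 1) dh.
  by move=> /is_derive_eq; apply; rewrite scaler0 addr0 /GRing.scale.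
have d1 := dd _ _ (is_derive_half (is_derive_sinh (t / 2))).
have d2 := dd _ _ (is_derive_sinh t).
have p1 l (u : R) : 0 < u -> cpow u (l - 1) = cpow u l / u%:C.
  move=> u0; rewrite -(cpowB1 l u0) mulrC mulKf// -cn_gt0 cnR normr_gt0.
  exact: lt0r_neq0.
apply: (cder_eq (cderM (cder_cpow (- (2 * k1)) d1 s0) (cder_cpow (- (2 * k2)) d2 s1))).
rewrite (weightV t0) (p1 _ _ s0) (p1 _ _ s1) /weight_rate.
have -> : (2 * sinh (t / 2))%:C = 2 * cS t by rewrite rmorphM rmorph_nat.
have -> : (2 * (cosh (t / 2) / 2))%:C = cZ t.
  by rewrite /cZ; congr (_%:C); field.
have -> : (2 * sinh t)%:C = 2 * (sinh t)%:C :> R[i] by rewrite rmorphM rmorph_nat.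
have -> : (2 * cosh t)%:C = 2 * (cosh t)%:C :> R[i] by rewrite rmorphM rmorph_nat.
have cs0 := cS_neq0 t0.
have ss0 : (sinh t)%:C != 0 :> R[i].
  by rewrite -cn_gt0 cnR normr_gt0 gt_eqF// sinh_gt0.
move: (cpow _ _) (cpow _ _) (cS t) (cZ t) ((sinh t)%:C) ((cosh t)%:C) cs0 ss0.
by move=> p q s c s' c' h1 h2; field; rewrite ?C2_neq0 h1 h2.
Qed.
End weight_derivative.

Section candidate_operator.
Context {R : realType} (k1 k2 : R[i]) (k1_gt0 : 0 < Re k1) (k2_gt0 : 0 < Re k2).
Implicit Types (x y z t : R) (f F : R -> R[i]).

(** The operator [W] of the overview. *)
Definition kernel_op f x : R[i] :=
  cint [set y | `|y| < `|x|] (fun y => vkernel k1 k2 x y * f y).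

Definition odd_mass f t : R[i] :=
  (k1 / 2 + k2) / k2 * outerS k2 (SJ k1 (cev f)) t +
  outer k2 (fun z => (sinh z)%:C * inner k1 (fun y => cS y * cod f y) z) t.

Definition kernel_even f t : R[i] := kconst k1 k2 / 2 * ((weight k1 k2 t)^-1 *
  ((sinh t)%:C * double_abel k1 k2 (cev f) t)).
Definition kernel_odd f t : R[i] :=
  kconst k1 k2 / 2 * ((weight k1 k2 t)^-1 * odd_mass f t).

Lemma kernel_op_formula f x : x != 0 -> (forall y, ccont f y) ->
  cintegrable [set y | `|y| < `|x|] (fun y => vkernel k1 k2 x y * f y) /\
  kernel_op f x = kernel_even f `|x| + (Num.sg x)%:C * kernel_odd f `|x|.
Proof.
move=> x0 cf; have [I E] := kernel_mass_integral k1_gt0 k2_gt0 x0 cf.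
pose c := kconst k1 k2 / 4 * (weight k1 k2 x)^-1.
have eq_ : (fun y => c * (kernel_mass k1 k2 x y * f y)) = (fun y => vkernel k1 k2 x y * f y).
  by apply/funext => y; rewrite mulrA.
have m : msble [set y | `|y| < `|x|].
  rewrite (_ : [set y | _] = `]- `|x|, `|x|[%classic); first exact: msble_itv.
  by apply/seteqP; split=> y; rewrite /= in_itv/= ltr_norml.
split; first by move: (cintegrableZ c m I); rewrite eq_.
rewrite /kernel_op -eq_; apply: etrans (cintZ c m I) (etrans (f_equal (fun u => c * u) E) _).
have eA : weight k1 k2 x = weight k1 k2 `|x|.
  by have [x1|x1] := leP 0 x; [rewrite (ger0_norm x1)|rewrite (ltr0_norm x1) weightN].
have calc (a w B e U : R[i]) : a / 4 * w * (2 * (B + e * U)) =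
    a / 2 * (w * B) + e * (a / 2 * (w * U)) by field.
rewrite /c eA; exact: calc.
Qed.

Section derivatives.
Context (f f' : R -> R[i]) (df : forall y, cder f y (f' y)) (cf' : forall y, ccont f' y).

Let cf y : ccont f y. Proof. exact: cder_cont (df y). Qed.

Let df_opp y : cder (fun t => f (- t)) y (- f' (- y)).
Proof.
apply: (cder_eq (@cder_comp _ f (fun t => - t) y (-1) (f' (- y)) _ (df (- y)))).
by rewrite rmorphN1 mulN1r.
Qed.

Lemma cder_cev y : cder (cev f) y (cod f' y).
Proof.
apply: (cder_eq (cderM (cderC 2^-1 y) (cderD (df y) (df_opp y)))).
by rewrite mul0r add0r /cod mulN1r.
Qed.

Lemma cder_cod y : cder (cod f) y (cev f' y).
Proof.
apply: (cder_eq (cderM (cderC 2^-1 y) (cderD (df y) (cderM (cderC (-1) y) (df_opp y))))).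
by rewrite !mul0r !add0r /cev mulrNN mul1r.
Qed.

Let a_cev := ccont_admissible (ccont_cev cf).
Let a_cod := ccont_admissible (ccont_cod cf).
Let a_cev' := ccont_admissible (ccont_cev cf').
Let a_cod' := ccont_admissible (ccont_cod cf').

Let cod_cvg0 : ccvg (cod f) 0^'+ 0.
Proof.
have [h _] := ccont_ccvg (ccont_cod cf 0).
by move: h; rewrite {2}/cod oppr0 mulN1r subrr mulr0.
Qed.

Lemma odd_massE t : 0 < t -> odd_mass f t =
  (k1 / 2 + k2) / k2 * outerS k2 (SJ k1 (cev f)) t + k2^-1 * outerS k2 (SJ k1 (cev f')) t.
Proof.
move=> t0; apply: (f_equal2 +%R erefl).
exact: (outer_sinh_inner_odd k1_gt0 k2_gt0 t0 a_cod a_cev' (fun y _ => cder_cod y) cod_cvg0).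
Qed.

(** The even component of [D (W f) = W f']. By [odd_massE] both terms have outer exponent [k2 + 1],
    hence are differentiable. *)
Lemma cder_kernel_odd t : 0 < t -> cder (kernel_odd f) t
  (kernel_even f' t + (k1 / 2 + k2) * kernel_even f t - weight_rate k1 k2 t * kernel_odd f t).
Proof.
move=> t0; pose rho := k1 / 2 + k2.
have near_ : \forall u \near t, kernel_odd f u = kconst k1 k2 / 2 * ((weight k1 k2 u)^-1 *
    (rho / k2 * outerS k2 (SJ k1 (cev f)) u + k2^-1 * outerS k2 (SJ k1 (cev f')) u)).
  by apply: filterS (near_gt0 t0) => u u0; rewrite /kernel_odd (odd_massE u0).
apply: (cder_near near_).
have d1 := cder_outerS k2_gt0 t0 (admissible_SJ k1_gt0 a_cev).
have d2 := cder_outerS k2_gt0 t0 (admissible_SJ k1_gt0 a_cev').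
apply: (cder_eq (cderM (cderC _ t) (cderM (cder_weightV k1 k2 t0)
  (cderD (cderM (cderC (rho / k2) t) d1) (cderM (cderC k2^-1 t) d2))))).
rewrite /kernel_odd (odd_massE t0) /kernel_even -/rho.
have k20 := k_neq0 k2_gt0.
have calc (a w A s B B' O O' : R[i]) : 0 * (w * (rho / k2 * O + k2^-1 * O')) +
   a / 2 * (- A * w * (rho / k2 * O + k2^-1 * O') +
     w * (0 * O + rho / k2 * (k2 * s * B) + (0 * O' + k2^-1 * (k2 * s * B')))) =
   a / 2 * (w * (s * B')) + rho * (a / 2 * (w * (s * B))) -
   A * (a / 2 * (w * (rho / k2 * O + k2^-1 * O'))) by field; rewrite k20.
exact: calc.
Qed.

(** The odd component of [D (W f) = W f']; what the product rule leaves to be shown is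
    [jacobi_identity]. *)
Lemma cder_kernel_even t : 0 < t -> cder (kernel_even f) t
  (kernel_odd f' t - (k1 / 2 + k2) * kernel_odd f t).
Proof.
move=> t0; pose rho := k1 / 2 + k2.
have dB := cder_double_abel k1_gt0 k2_gt0 a_cev a_cod' (fun y _ => cder_cev y) t0.
have ji := jacobi_identity k1_gt0 k2_gt0 a_cev a_cod' (fun y _ => cder_cev y) t0.
apply: (cder_eq (cderM (cderC _ t) (cderM (cder_weightV k1 k2 t0)
  (cderM (cderR (is_derive_sinh t)) dB)))).
rewrite /kernel_odd (odd_massE t0) /odd_mass -/rho.
have -> : weight_rate k1 k2 t = (2 * k1 * cZ t ^+ 2 + 2 * k2 * (cosh t)%:C) / (sinh t)%:C.
  by rewrite /weight_rate csinh_cS; field; rewrite cS_neq0// cZ_neq0 ?C2_neq0.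
have k20 := k_neq0 k2_gt0.
have ss0 : (sinh t)%:C != 0 :> R[i].
  by rewrite -cn_gt0 cnR normr_gt0 gt_eqF// sinh_gt0.
have calc (a w A s c B dB' O O' T : R[i]) : s != 0 ->
   s * dB' + c * B - A * B + rho * (rho / k2 * O) = T ->
   0 * (w * (s * B)) + a / 2 * (- (A / s) * w * (s * B) + w * (c * B + s * dB')) =
   a / 2 * (w * (rho / k2 * O' + T)) - rho * (a / 2 * (w * (rho / k2 * O + k2^-1 * O'))).
  by move=> s0 <-; field; rewrite k20.
exact: calc ss0 ji.
Qed.
End derivatives.
End candidate_operator.

(** * Beta and Gamma functions *)
Section square_substitution.
Context {R : realType}.
Implicit Types (h : R -> R).

(** Substitution [u = s^2] for integrands that may be singular at both ends: a primitive of the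
    transformed integrand is given and the improper fundamental theorem applied to it. *)
Lemma subst_sqr h : (forall u : R, 0 < u < 1 -> {for u, continuous h}) ->
  mu.-integrable `]0, 1[ (EFin \o h) ->
  mu.-integrable `]0, 1[ (EFin \o (fun s => 2 * s * h (s ^+ 2))) /\
  \int[mu]_(s in `]0, 1[) (2 * s * h (s ^+ 2)) = \int[mu]_(u in `]0, 1[) h u.
Proof.
(* Used twice: for the absolute value of [h], which gives integrability, and then for [h] itself,
   which gives the value. *)
suff main (g : R -> R) : (forall u : R, 0 < u < 1 -> {for u, continuous g}) ->
    mu.-integrable `]0, 1[ (EFin \o g) ->
    exists F : R -> R, [/\ forall s : R, 0 < s < 1 -> is_derive s 1 F (2 * s * g (s ^+ 2)),
      F s @[s --> 0^'+] --> 0 & F s @[s --> 1^'-] --> \int[mu]_(u in `]0, 1[) g u].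
  move=> ch ih.
  have c2 (g : R -> R) (s : R) : (forall u : R, 0 < u < 1 -> {for u, continuous g}) ->
      0 < s < 1 -> {for s, continuous (fun s : R => 2 * s * g (s ^+ 2))}.
    move=> cg /andP[s0 s1]; apply: cvgM.
      by apply: cvgM; [exact: cvg_cst|exact: cvg_id].
    apply: (@continuous_comp _ _ _ (fun s : R => s ^+ 2) g); first exact: exprn_continuous.
    by apply: cg; rewrite exprn_gt0//= expr_lt1// ltW.
  have cn_h (u : R) : 0 < u < 1 -> {for u, continuous (fun u => `|h u|)}.
    by move=> u01; apply: cvg_norm; exact: ch.
  have [F [dF F0 F1]] := main _ cn_h (integrable_norm ih).
  have p0 (s : R) : 0 < s < 1 -> 0 <= 2 * s * `|h (s ^+ 2)|.
    by move=> /andP[s0 _]; rewrite !mulr_ge0// ltW.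
  have [i1 _] := ge0_improper_ftc ltr01 dF (fun s => c2 _ s cn_h) p0 F0 F1.
  have ii : mu.-integrable `]0, 1[ (EFin \o (fun s => 2 * s * h (s ^+ 2))).
    apply: le_integrable i1; first exact: msble_itv.
      apply/measurable_EFinP.
      apply: open_continuous_measurable_fun; first exact: interval_open.
      by move=> s; rewrite inE /= in_itv/=; exact: c2.
    move=> s; rewrite /= in_itv/= => /andP[s0 s1]; rewrite lee_fin.
    by rewrite !normrM normr_id.
  split; first exact: ii.
  have [G [dG G0 G1]] := main _ ch ih.
  by rewrite (improper_ftc ltr01 dG (fun s => c2 _ s ch) ii G0 G1) subr0.
move=> cg ig; pose gt : R -> R := g \_ `]0, 1[.
have igt : mu.-integrable setT (EFin \o gt).
  have := proj1 (integrable_mkcond _ (msble_itv `]0, 1[)) ig.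
  by rewrite /gt restrict_EFin.
have igS (D : set R) : msble D -> mu.-integrable D (EFin \o gt).
  by move=> mD; exact: integrableS igt.
(* As [g] is extended by zero, 0 and 1 are interior points of [[-1, 2]], and [P] is continuous
   there. *)
pose P x := \int[mu]_(u in `[(-1), x]) gt u.
have cP (x : R) : -1 < x < 2 -> {for x, continuous P}.
  move=> x12; have h12 : -1 <= 2 :> R by lra.
  have := parameterized_integral_continuous h12 (igS `[(-1), 2]%classic (msble_itv _)).
  move=> /continuous_within_itvP[]; first lra.
  by move=> cP _ _; apply: cP; rewrite in_itv.
have gtE (u : R) : 0 < u < 1 -> gt u = g u.
  by move=> u01; rewrite /gt patchE mem_set//= in_itv.
have dP (x : R) : 0 < x < 1 -> is_derive x 1 P (g x).
  move=> /[dup] x01 /andP[x0 x1].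
  have cx : {for x, continuous gt}.
    rewrite /prop_for /continuous_at (gtE _ x01).
    apply: cvg_trans (cg x x01); apply: near_eq_cvg; near=> t; rewrite gtE//.
    by apply/andP; split; near: t; [exact: near_gt0|exact: lt_nbhsl].
  have := @continuous_FTC1_closed R gt (-1) x 2 _ (igS `[(-1), 2]%classic (msble_itv _)) _ cx.
  by case=> [||d e]; [lra|lra|]; rewrite derive1E gtE// in e; exact: (DeriveDef d e).
have P0 : P 0 = 0.
  rewrite /P /Rintegral integral0_eq// => u; rewrite /= in_itv/= => /andP[_ u0].
  by rewrite /gt patchE memNset//= in_itv/= ltNge u0.
have P1 : P 1 = \int[mu]_(u in `]0, 1[) g u.
  rewrite /P /Rintegral; congr fine.
  rewrite [RHS]integral_mkcond [LHS]integral_mkcond; apply: eq_integral => u _.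
  rewrite !patchE; case: ifPn => hu; last first.
    rewrite memNset//= in_itv/= => /andP[u0 u1]; move/negP: hu; apply.
    by rewrite inE /= in_itv/=; apply/andP; split; lra.
  by rewrite /gt /= patchE; case: ifP.
have cc (x : R) : -1 < x ^+ 2 < 2 -> P (s ^+ 2) @[s --> x] --> P (x ^+ 2).
  move=> hx; apply: (@continuous_comp _ _ _ (fun s : R => s ^+ 2) P).
    exact: exprn_continuous.
  exact: cP.
exists (fun s : R => P (s ^+ 2)); split.
- move=> s /andP[s0 s1]; have s2 : 0 < s ^+ 2 < 1 by rewrite exprn_gt0//= expr_lt1// ltW.
  have d : is_derive s 1 (fun s : R => s ^+ 2) (s + s).
    by apply: (is_derive_eq (is_deriveM (is_derive_id s (1 : R)) (is_derive_id s (1 : R))));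
      rewrite /GRing.scale /= mulr1.
  apply: (is_derive_eq (@is_derive1_comp R P (fun s : R => s ^+ 2) s _ _ (dP _ s2) d)).
  by ring.
- have := cc 0; rewrite expr0n /= P0 => hc; apply: cvg_at_right_filter.
  by apply: hc; lra.
- have := cc 1; rewrite expr1n P1 => hc; apply: cvg_at_left_filter.
  by apply: hc; lra.
Unshelve. all: by end_near. Qed.
End square_substitution.

(** * Euler's integrals and their product formula *)

Section gamma_function.
Context {R : realType}.
Implicit Types (a b s : R[i]) (t u : R).

(** From [ln w <= w - 1] at [w = t / (2r)]; the constant is [(2r)^r]. *)
Lemma powR_le_expR (r : R) : 0 < r -> exists2 K : R, 0 < K &
  forall t, 0 < t -> t `^ r <= K * expR (t / 2).
Proof.
move=> r0; exists (expR (r * ln (2 * r))); first exact: expR_gt0.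
move=> t t0; rewrite /powR gt_eqF// -expRD ler_expR.
have r2 : 0 < 2 * r by rewrite mulr_gt0.
have h : ln (t / (2 * r)) <= t / (2 * r) - 1.
  have := @le_ln1Dx R (t / (2 * r) - 1); rewrite addrCA subrr addr0; apply.
  by rewrite ltrBrDr addNr divr_gt0.
have e : ln t = ln (t / (2 * r)) + ln (2 * r).
  by rewrite -lnM ?posrE ?divr_gt0// divfK// gt_eqF.
have h2 : r * ln (t / (2 * r)) <= r * (t / (2 * r) - 1) by rewrite ler_wpM2l// ltW.
have e2 : r * (t / (2 * r) - 1) = t / 2 - r by field; exact: lt0r_neq0.
by rewrite e mulrDr; lra.
Qed.

(** Read off from the density of the exponential law with parameter 1/2. *)
Lemma integrable_expR_half :
  mu.-integrable `]0, +oo[ (EFin \o (fun t : R => expR (- (t / 2)))).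
Proof.
have r0 : 0 < 2^-1 :> R by rewrite invr_gt0.
have i1 := integrable_exponential_pdf r0.
have i2 : mu.-integrable `]0, +oo[ (EFin \o exponential_pdf (2^-1 : R)).
  by apply: integrableS i1 => //; exact: msble_itv.
have i3 := rintegrableZ 2 (msble_itv _) i2.
apply: eq_integrable i3; first exact: msble_itv.
move=> t; rewrite inE /= in_itv/= andbT => t0.
rewrite exponential_pdfE ?(ltW t0)//= mulrA divff ?mul1r ?pnatr_eq0//.
by rewrite mulNr mulrC.
Qed.

Lemma integrable_powR_expR (r : R) : 0 < r ->
  mu.-integrable `]0, +oo[ (EFin \o (fun t => t `^ (r - 1) * expR (- t))).
Proof.
move=> r0; have [K K0 hK] := powR_le_expR r0.
have [i1 _] := @integral_powR_left R 0 1 r ltr01 r0.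
have i2 : mu.-integrable `]0, +oo[ (EFin \o (fun t => \1_(`]0, 1[%classic) t * t `^ (r - 1))).
  apply: (@integrableS _ _ _ mu setT); [by []|exact: msble_itv|by []|].
  have := proj1 (integrable_mkcond _ (msble_itv `]0, 1[)) i1.
  apply: eq_integrable => // t _; rewrite /= patchE indicE /=.
  by case: ifP; rewrite ?mul1r ?mul0r ?subr0.
have i3 := rintegrableZ K (msble_itv _) integrable_expR_half.
apply: le_integrable (integrableD (msble_itv _) i2 i3); first exact: msble_itv.
  apply/measurable_EFinP; apply: open_continuous_measurable_fun; first exact: interval_open.
  move=> t; rewrite inE /= in_itv/= andbT => t0.
  apply: cvgM; first by apply: (@continuous_powR_comp _ id); [exact: t0|exact: cvg_id].
  apply: (@continuous_comp _ _ _ (fun t : R => - t) expR); last exact: continuous_expR.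
  exact: continuousN.
move=> t; rewrite /= in_itv/= andbT => t0; rewrite lee_fin.
have p0 := powR_ge0 t (r - 1); have e0 := expR_ge0 (- t); have e1 := expR_ge0 (- (t / 2)).
have Ke : 0 <= K * expR (- (t / 2)) by rewrite mulr_ge0// ltW.
have ip : 0 <= \1_(`]0, 1[%classic : set R) t * t `^ (r - 1) by rewrite mulr_ge0.
rewrite !ger0_norm ?addr_ge0 ?mulr_ge0 ?(ltW K0)//.
have [t1|t1] := ltP t 1.
  rewrite indic_oo ?t0// mul1r -[leLHS]addr0 lerD// ler_piMr//.
  by rewrite -expR0 ler_expR oppr_le0 ltW.
rewrite -[leLHS]add0r lerD//.
have h : t `^ (r - 1) <= t `^ r by apply: ler_powR => //; lra.
apply: le_trans (ler_wpM2r e0 (le_trans h (hK t t0))) _.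
rewrite -mulrA -expRD; apply: ler_wpM2l; first exact: ltW.
by rewrite ler_expR; lra.
Qed.

Let gam s t : R[i] := cpow t (s - 1) * (expR (- t))%:C.

Let cn_gam s t : 0 < t -> cn (gam s t) = t `^ (Re s - 1) * expR (- t).
Proof. by move=> t0; rewrite cnM cn_cpow// cnR ger0_norm ?expR_ge0// ReB. Qed.

Let ccont_gam s t : 0 < t -> ccont (gam s) t.
Proof.
move=> t0; apply: ccontM.
  by apply: (ccont_cpow (h := id)); [exact: cvg_id|exact: t0].
apply: ccontR; apply: (@continuous_comp _ _ _ (fun t : R => - t) expR); last exact: continuous_expR.
exact: continuousN.
Qed.

Let cmeas_gam s : cmeas (`]0, +oo[%classic : set (Rm R)) (gam s).
Proof.
apply: ccont_cmeas; first exact: interval_open.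
by move=> t; rewrite /= in_itv/= andbT; exact: ccont_gam.
Qed.

Lemma cintegrable_gamma s : 0 < Re s -> cintegrable `]0, +oo[ (gam s).
Proof.
move=> s0; apply: cintegrable_dom (integrable_powR_expR s0).
- exact: msble_itv.
- exact: cmeas_gam.
- by move=> t; rewrite /= in_itv/= andbT => t0; rewrite cn_gam.
Qed.

Definition cBeta a b : R[i] :=
  cint `]0, 1[ (fun t => cpow t (a - 1) * cpow (1 - t) (b - 1)).

Lemma cintegrable_beta a b u : 0 < u -> 0 < Re a -> 0 < Re b ->
  cintegrable `]0, u[ (fun t => cpow t (a - 1) * cpow (u - t) (b - 1)).
Proof.
move=> u0 a0 b0; have i := integrable_powR_product u0 a0 b0.
apply: cintegrable_dom i; first exact: msble_itv.
  apply: ccont_cmeas; first exact: interval_open.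
  move=> t; rewrite /= in_itv/= => /andP[t0 tu]; apply: ccontM.
    by apply: (ccont_cpow (h := id)); [exact: cvg_id|exact: t0].
  by apply: ccont_cpow; [apply: cvgB; [exact: cvg_cst|exact: cvg_id]|rewrite subr_gt0].
move=> t; rewrite /= in_itv/= => /andP[t0 tu]; rewrite cnM !cn_cpow ?subr_gt0//.
by rewrite !ReB subr0.
Qed.

Lemma beta_scale a b u : 0 < Re a -> 0 < Re b -> 0 < u ->
  cint `]0, u[ (fun t => cpow t (a - 1) * cpow (u - t) (b - 1)) =
  cpow u (a + b - 1) * cBeta a b.
Proof.
move=> a0 b0 u0; have [i e] := cint_scale u0 (cintegrable_beta u0 a0 b0).
have iB := cintegrable_beta ltr01 a0 b0.
apply: etrans e _; rewrite -(cpowB1 (a + b - 1) u0) -mulrA; congr (_ * _).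
apply: etrans (cintZ _ (msble_itv _) iB); apply: eq_cint => s.
rewrite inE /= in_itv/= => /andP[s0 s1].
have -> : u - u * s = u * (1 - s) by ring.
have -> : a + b - 1 - 1 = (a - 1) + (b - 1) by ring.
by rewrite cpowM// cpowM ?subr_gt0// (cpowD u (a - 1) (b - 1)); ring.
Qed.

(** With [x = t + v] the product becomes the integral of [t^(a-1) (x-t)^(b-1) exp (-x)] over
    [0 < t < x]; integrating in [t] first yields [x^(a+b-1)] times the beta integral, by
    homogeneity. *)
Lemma cGamma_mul a b : 0 < Re a -> 0 < Re b ->
  cGamma a * cGamma b = cGamma (a + b) * cBeta a b.
Proof.
move=> a0 b0.
pose S : set (Rm R * Rm R) := [set q | 0 < q.1] `&` [set q | q.1 < q.2].
pose F t x : R[i] := (\1_S (t, x))%:C *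
  (cpow t (a - 1) * (cpow (x - t) (b - 1) * (expR (- x))%:C)).
pose g t : R := \1_(`]0, +oo[%classic : set R) t * (t `^ (Re a - 1) * expR (- t) *
   \int[mu]_(v in `]0, +oo[) (v `^ (Re b - 1) * expR (- v))).
have ia := integrable_powR_expR a0; have ib := integrable_powR_expR b0.
have mfst : measurable_fun setT (fst : Rm R * Rm R -> Rm R) by exact: measurable_fst.
have msnd : measurable_fun setT (snd : Rm R * Rm R -> Rm R) by exact: measurable_snd.
have mB : measurable_fun setT (fun q : Rm R * Rm R => q.2 - q.1 : Rm R).
  exact: measurable_funB.
have mF : cmeas setT (fun q : Rm R * Rm R => F q.1 q.2).
  apply: (@cmeas_eq _ _ _ _ (fun q : Rm R * Rm R => (\1_S q)%:C *
    (cpow q.1 (a - 1) * (cpow (q.2 - q.1) (b - 1) * (expR (- q.2))%:C)))).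
    by move=> [t y] _.
  apply: cmeas_indicM.
    apply: measurableI.
      have := mfst measurableT `]0, +oo[%classic (msble_itv _).
      rewrite setTI; congr (measurable _); apply/seteqP.
      by split=> q; rewrite /= in_itv/= andbT.
    have := mB measurableT `]0, +oo[%classic (msble_itv _).
    rewrite setTI; congr (measurable _); apply/seteqP.
    by split=> q; rewrite /= in_itv/= andbT subr_gt0.
  apply: (cmeasS measurableT (@subsetT _ _)).
  apply: cmeasM; first exact: cmeas_cpow.
  apply: cmeasM; first exact: cmeas_cpow.
  apply: cmeasR; apply: measurableT_comp; first exact: measurable_expR.
  exact: measurable_funN.
have ig : mu.-integrable setT (EFin \o g).
  have := rintegrableZ (\int[mu]_(v in `]0, +oo[) (v `^ (Re b - 1) * expR (- v))) (msble_itv _) ia.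
  move=> /(integrable_mkcond _ (msble_itv _)).
  apply: eq_integrable => // t _; rewrite /= patchE /g indicE.
  by case: ifP => _; rewrite ?mul1r ?mul0r// mulrC.
have F0 t x : ~~ (0 < t < x) -> F t x = 0.
  move=> h; have nS : ~ S (t, x) by case=> /= h1 h2; move: h; rewrite h1 h2.
  by rewrite /F (indic_out nS) mul0r.
have Sin t x : 0 < t -> t < x -> S (t, x) by [].
have bF t : (\int[mu]_x (cn (F t x))%:E <= (g t)%:E)%E.
  have [t0|t0] := ltP 0 t; last first.
    have -> : g t = 0.
      by rewrite /g indic_out ?mul0r//= in_itv/= andbT; apply/negP; rewrite -leNgt.
    rewrite integral0_eq// => x _; rewrite /F indic_out ?mul0r ?cn0//.
    by case=> /= h _; move: h; rewrite ltNge t0.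
  rewrite /g indic_in ?mul1r; last by rewrite /= in_itv/= t0.
  have m1 : measurable_fun setT (fun x : Rm R => cn (F t x)).
    exact: (measurableT_comp (cmeas_cn mF) (pair1_measurable t)).
  have mFt : measurable_fun setT (fun x : Rm R => (cn (F t x))%:E).
    exact/measurable_EFinP.
  have mphi : measurable_fun setT (fun x : Rm R => 1 * x + t : Rm R).
    by apply: measurable_funD => //; exact: measurable_funM.
  rewrite (ge0_integral_affine t (@ltr01 R) mFt); last by move=> x; rewrite lee_fin cn_ge0.
  rewrite mul1e.
  have jb := rintegrableZ (t `^ (Re a - 1) * expR (- t)) (msble_itv _) ib.
  rewrite -(RintegralZl _ (msble_itv _) ib).
  apply: le_integral_support jb _ _ _.
  - exact: msble_itv.
  - exact: (measurableT_comp m1 mphi).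
  - by move=> x; exact: cn_ge0.
  - move=> v; rewrite /= in_itv/= andbT => v0; rewrite mul1r.
    rewrite /F indic_in ?mul1r; last by apply: Sin; rewrite ?ltrDr.
    rewrite addrK !cnM !cn_cpow// cnR ger0_norm ?expR_ge0// !ReB opprD expRD.
    by rewrite le_eqVlt; apply/orP; left; apply/eqP; ring.
  - move=> v; rewrite /= in_itv/= andbT => /negP; rewrite -leNgt => v0.
    rewrite mul1r /F indic_out ?mul0r ?cn0//.
    by case=> _ /=; rewrite ltrDr ltNge v0.
have [_ _ e] := cint_fubini mF bF ig.
have iGa := cintegrable_gamma a0; have iGb := cintegrable_gamma b0.
have e1 : cint setT (fun t => cint setT (F t)) = cGamma a * cGamma b.
  rewrite mulrC; apply: etrans (cintZ _ (msble_itv _) iGa).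
  apply: esym; apply: etrans (cint_mkcond _ _) _; apply: eq_cint => t _.
  have [t0|t0] := ltP 0 t; last first.
    rewrite indic_out ?mul0r; last by rewrite /= in_itv/= andbT; apply/negP; rewrite -leNgt.
    symmetry; apply: cint_eq0 => x _; apply: F0.
    by rewrite ltNge t0.
  rewrite indic_in ?mul1r; last by rewrite /= in_itv/= t0.
  pose h v : R[i] := (\1_(`]0, +oo[%classic) v)%:C * (gam a t * gam b v).
  have ih : cintegrable setT h.
    apply/(cintegrable_mkcond _ (msble_itv _)).
    exact: (cintegrableZ (gam a t) (msble_itv _) iGb).
  have [_ eh] := cint_affine (- t) ltr01 ih.
  have -> : F t = fun x => h (1 * x + - t).
    apply/funext => x; rewrite /F /h mul1r; have [tx|tx] := ltP t x.
      rewrite (indic_in (Sin _ _ t0 tx)) indic_in; last by rewrite /= in_itv/= andbT subr_gt0.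
      rewrite !mul1r /gam.
      have -> : (expR (- x))%:C = (expR (- t))%:C * (expR (- (x - t)))%:C :> R[i].
        by rewrite -rmorphM -expRD; congr (expR _)%:C; ring.
      by ring.
    rewrite indic_out; last by case=> _ /=; rewrite ltNge tx.
    rewrite indic_out; first by rewrite !mul0r.
    by rewrite /= in_itv/= andbT subr_gt0; apply/negP; rewrite -leNgt.
  have {}eh : cint setT (fun x => h (1 * x + - t)) = cint setT h.
    by move: eh; rewrite rmorph1 mul1r => ->.
  apply: etrans _ (esym eh); apply: etrans _ (esym (esym (cint_mkcond _ _))).
  by rewrite mulrC; apply/esym; exact: (cintZ (gam a t) (msble_itv _) iGb).
rewrite -e1 e mulrC.
have ab0 : 0 < Re (a + b) by rewrite ReD addr_gt0.
apply: etrans _ (cintZ _ (msble_itv _) (cintegrable_gamma ab0)).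
apply: esym; apply: etrans (cint_mkcond _ _) _; apply: eq_cint => x _.
have [x0|x0] := ltP 0 x; last first.
  rewrite indic_out ?mul0r; last by rewrite /= in_itv/= andbT; apply/negP; rewrite -leNgt.
  symmetry; apply: cint_eq0 => t _; apply: F0; apply/negP => /andP[h1 h2].
  by move: (lt_trans h1 h2); rewrite ltNge x0.
rewrite indic_in ?mul1r; last by rewrite /= in_itv/= x0.
have iB := cintegrable_beta x0 a0 b0.
have -> : F ^~ x = fun t => (\1_(`]0, x[%classic) t)%:C *
    ((expR (- x))%:C * (cpow t (a - 1) * cpow (x - t) (b - 1))).
  apply/funext => t; have [h|h] := boolP (0 < t < x).
    by have /andP[h1 h2] := h; rewrite /F (indic_in (Sin _ _ h1 h2)) (indic_oo h); ring.
  by rewrite (F0 _ _ h) (indic_oo0 h) mul0r.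
apply: esym; apply: etrans (esym (cint_mkcond _ _)) _.
apply: etrans (cintZ _ (msble_itv _) iB) _.
by rewrite (beta_scale a0 b0 x0) /gam; ring.
Qed.
End gamma_function.

Section elementary_inequalities.
Context {R : realType}.
Implicit Types (x u : R).

Lemma sin_le_id x : 0 <= x -> `|sin x| <= x.
Proof.
rewrite le_eqVlt => /predU1P[<-|x0]; first by rewrite sin0 normr0.
have [c _ e] := @MVT R sin cos 0 x x0 (fun y _ => is_derive_sin y)
  (continuous_subspaceT (@continuous_sin R)).
move: e; rewrite sin0 !subr0 => ->; rewrite normrM (gtr0_norm x0).
by rewrite ler_piMl ?(ltW x0)// cos_max.
Qed.

Lemma cos_ge x : 1 - x ^+ 2 / 2 <= cos x.
Proof.
have -> : cos x = 1 - 2 * sin (`|x| / 2) ^+ 2.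
  have -> : cos x = cos (`|x| / 2 *+ 2).
    rewrite -mulr_natr divfK ?pnatr_eq0//.
    by have [x0|x0] := leP 0 x; [rewrite ger0_norm|rewrite ltr0_norm// cosN].
  by rewrite cos_mulr2n cos2sin2 -mulr_natl; ring.
have h : `|sin (`|x| / 2)| <= `|x| / 2 by apply: sin_le_id; rewrite divr_ge0.
have := ler_pM (normr_ge0 _) (normr_ge0 _) h h.
rewrite -!expr2 expr_div_n !real_normK ?num_real// => h2.
have -> : x ^+ 2 / 2 = 2 * (x ^+ 2 / 2 ^+ 2) by field.
by rewrite lerD2l lerN2 ler_wpM2l.
Qed.

(** With [u = exp v] the right side is [(2 sinh (v/2))^2], and [sinh w >= w] for [w >= 0]. *)
Lemma ln_sqr_le u : 0 < u -> ln u ^+ 2 <= u - 2 + u^-1.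
Proof.
move=> u0; set v := ln u; have eu : u = expR v by rewrite lnK.
have -> : u - 2 + u^-1 = (2 * sinh (`|v| / 2)) ^+ 2.
  have -> : (2 * sinh (`|v| / 2)) ^+ 2 = 2 * cosh v - 2.
    have := cosh_double `|v|; have := cosh2sinh2 (`|v| / 2); rewrite cosh_abs => -> ->.
    by ring.
  by rewrite eu -expRN /cosh; field.
have -> : v ^+ 2 = (2 * (`|v| / 2)) ^+ 2.
  by rewrite mulrC divfK ?pnatr_eq0// -normrX ger0_norm ?sqr_ge0.
have h : `|v| / 2 <= sinh (`|v| / 2) by apply: sinh_ge_id; rewrite divr_ge0.
have p : 0 <= `|v| / 2 by rewrite divr_ge0.
by rewrite ler_pXn2r ?nnegrE//; lra.
Qed.
End elementary_inequalities.

Local Transparent cint cpow.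

(** * Special values and non-vanishing of the Gamma function *)

Section gamma_values.
Context {R : realType}.
Implicit Types (a b s : R[i]) (t u m : R).

Definition rGamma m : R := \int[mu]_(t in `]0, +oo[) (t `^ (m - 1) * expR (- t)).

Lemma cGammaR m : cGamma m%:C = (rGamma m)%:C.
Proof.
have e : {in (`]0, +oo[%classic : set R), (fun t => cpow t (m%:C - 1) * (expR (- t))%:C) =1
    (fun t => (t `^ (m - 1) * expR (- t))%:C)}.
  move=> t; rewrite inE /= in_itv/= andbT => t0.
  by rewrite -[1]/((1 : R)%:C) -rmorphB cpowRE// -rmorphM.
rewrite /cGamma (eq_cint e) /cint /=; congr Complex.
by rewrite /Rintegral integral0.
Qed.

Lemma cGamma1 : cGamma (1 : R[i]) = 1.
Proof.
rewrite -[1 in LHS]/((1 : R)%:C) cGammaR -[RHS]/((1 : R)%:C); congr (_%:C).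
have := @integral_exponential_pdf R 1 ltr01.
have -> : (\int[mu]_x (exponential_pdf (1 : R) x)%:E =
    \int[mu]_(x in `[0%R, +oo[) (expR (- x))%:E)%E.
  rewrite [RHS]integral_mkcond; apply: eq_integral => x _.
  by rewrite /exponential_pdf !patchE; case: ifP; rewrite // mul1r mulN1r.
move=> e; rewrite /rGamma /Rintegral -[RHS]/(fine 1%:E) -e; congr fine.
rewrite -integral_itv_obnd_cbnd; last first.
  apply/measurable_EFinP; apply: measurable_funTS.
  by apply: measurableT_comp; [exact: measurable_expR|exact: measurable_funN].
by apply: eq_integral => t _; rewrite subrr powRr0 mul1r.
Qed.

Lemma cBeta1 a : 0 < Re a -> cBeta a 1 = a^-1.
Proof.
move=> a0; have h1 : 0 < Re (1 : R[i]) by exact: ltr01.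
have i := cintegrable_beta ltr01 a0 h1.
have a_neq0 := k_neq0 a0.
rewrite /cBeta (cimproper_ftc ltr01 (F := fun t => a^-1 * cpow t a) _ _ i (la := 0) (lb := a^-1)).
- by rewrite subr0.
- move=> t /andP[t0 t1]; rewrite subrr cpow0 mulr1.
  apply: (cder_eq (cderM (cderC a^-1 t) (cder_cpow a (is_derive_id t (1 : R)) t0))).
  by rewrite mul0r add0r rmorph1 mul1r mulKf.
- move=> t /andP[t0 t1]; rewrite subrr; apply: ccontM.
    by apply: (ccont_cpow (h := id)); [exact: cvg_id|exact: t0].
  by apply: ccont_cpow; [apply: cvgB; [exact: cvg_cst|exact: cvg_id]|rewrite subr_gt0].
- rewrite -(mulr0 a^-1); apply: ccvgM; first exact: ccvgC.
  apply: (@ccvg_squeeze0 _ _ _ (fun t => t `^ Re a)).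
    by near=> t; rewrite cn_cpow//; near: t; exact: nbhs_right_gt.
  exact: powR_cvg0.
- rewrite -[X in ccvg _ _ X]mulr1; apply: ccvgM; first exact: ccvgC.
  have c1 : ccont (fun t : R => cpow t a) 1.
    by apply: (ccont_cpow (h := id)); [exact: cvg_id|exact: ltr01].
  have [_ h] := ccont_ccvg c1; move: h; rewrite {2}/cpow ln1 mulr0.
  by rewrite -[0]/((0 : R)%:C) cexpR expR0.
Unshelve. all: by end_near. Qed.

Lemma cGammaS a : 0 < Re a -> cGamma (a + 1) = a * cGamma a.
Proof.
move=> a0; have h1 : 0 < Re (1 : R[i]) by exact: ltr01.
have := cGamma_mul a0 h1; rewrite cGamma1 mulr1 cBeta1// => ->.
by rewrite mulrC divfK// k_neq0.
Qed.

Lemma rGammaS m : 0 < m -> rGamma (m + 1) = m * rGamma m.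
Proof.
move=> m0; have h : 0 < Re (m%:C : R[i]) by [].
have := cGammaS h; rewrite -[1]/((1 : R)%:C) -rmorphD !cGammaR -rmorphM.
by move=> /complexI.
Qed.

Lemma rGamma_gt0 m : 0 < m -> 0 < rGamma m.
Proof.
move=> m0; pose f t : R := t `^ (m - 1) * expR (- t).
have i := integrable_powR_expR m0.
have sub : `]1, 2[%classic `<=` (`]0, +oo[%classic : set R).
  by move=> t; rewrite /= !in_itv/= andbT => /andP[t1 _]; lra.
have f0 t : 0 <= f t by rewrite mulr_ge0 ?powR_ge0 ?expR_ge0.
(* A lower bound of the integrand on []1, 2[]: there [t^(1-m) <= 1 + 2^(1-m)] for either sign of the
   exponent, and [exp (-t) >= exp (-2)]. *)
pose c : R := (1 + 2 `^ (1 - m))^-1 * expR (- 2).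
have c0 : 0 < c by rewrite mulr_gt0 ?expR_gt0// invr_gt0 ltr_pwDl// powR_ge0.
have i1 : mu.-integrable `]1, 2[ (EFin \o f).
  exact: integrableS (msble_itv _) (msble_itv _) sub i.
apply: (@lt_le_trans _ _ (\int[mu]_(t in `]1, 2[) c)).
  have e1 : mu (`]1, 2[%classic : set (Rm R)) = 1%:E.
    by rewrite lebesgue_measure_itv /= lte_fin ltr1n -EFinB; congr EFin; lra.
  rewrite /Rintegral integral_cst; last exact: msble_itv.
  by rewrite [X in (_ * X)%E]e1 mule1.
apply: (@le_trans _ _ (\int[mu]_(t in `]1, 2[) f t)).
  apply: le_Rintegral => //; first exact: integrable_cst_itv.
  move=> t; rewrite /= in_itv/= => /andP[t1 t2]; rewrite /c /f.
  apply: ler_pM; rewrite ?expR_ge0 ?ler_expR//; last lra.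
  have tp : 0 < t by lra.
  have q0 : 0 < 1 + 2 `^ (1 - m) by rewrite ltr_pwDl// powR_ge0.
  have -> : t `^ (m - 1) = (t `^ (1 - m))^-1 by rewrite -powRN opprB.
  rewrite lef_pV2 ?posrE ?powR_gt0//.
  have := @powR_between R (1 - m) 1 2 1 t ltr01 ltr01.
  by rewrite !powR1 mul1r !mulr1 => h; rewrite [leRHS]addrC; apply: h; lra.
rewrite /Rintegral fine_le//; first exact: integrable_fin_num i1.
  exact: integrable_fin_num i.
apply: ge0_subset_integral => //; first exact: measurable_int i.
by move=> t _; rewrite lee_fin.
Qed.

(* By the recurrence [Re s] may be taken large. For [s = m + i u] the real part
   of [m^(- i u) Gamma s] is [int t^(m-1) e^(-t) cos (u ln (t/m)) dt], and
   [cos v >= 1 - v^2/2] with [(ln r)^2 <= r + 1/r - 2] bounds it from below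
   by [Gamma m * (1 - u^2 / (2 (m - 1)))]. *)
Lemma cGamma_neq0 s : 0 < Re s -> cGamma s != 0.
Proof.
have large m u : 1 < m -> u ^+ 2 < m - 1 -> cGamma (m +i* u) != 0.
  move=> m1 um; have m0 : 0 < m by exact: lt_trans m1.
  have m10 : 0 < m - 1 by rewrite subr_gt0.
  apply/eqP => G0.
  pose c : R[i] := cpow m (0 +i* (- u)).
  have s0 : 0 < Re (m +i* u) by [].
  have e0 := etrans (cintZ c (msble_itv `]0, +oo[) (cintegrable_gamma s0))
    (etrans (f_equal (fun z => c * z) G0) (mulr0 c)).
  have e : \int[mu]_(t in `]0, +oo[)
      Re (c * (cpow t (m +i* u - 1) * (expR (- t))%:C)) = 0 := f_equal (fun z => Re z) e0.
  have i0 := integrable_powR_expR m0; have i1 := integrable_powR_expR m10.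
  have i2 := integrable_powR_expR (addr_gt0 m0 ltr01).
  (* This is [t^(m-1) exp (-t) (1 - u^2 (t/m - 2 + m/t) / 2)], sorted into the integrands of Gamma
     at [m], [m + 1] and [m - 1]. *)
  pose g t : R := (1 + u ^+ 2) * (t `^ (m - 1) * expR (- t))
    + (- (u ^+ 2 / (2 * m))) * (t `^ (m + 1 - 1) * expR (- t))
    + (- (u ^+ 2 * m / 2)) * (t `^ (m - 1 - 1) * expR (- t)).
  have mm := msble_itv (`]0, +oo[ : interval R).
  have j0 := rintegrableZ (1 + u ^+ 2) mm i0.
  have j2 := rintegrableZ (- (u ^+ 2 / (2 * m))) mm i2.
  have j1 := rintegrableZ (- (u ^+ 2 * m / 2)) mm i1.
  have j02 := integrableD mm j0 j2.
  have ig : mu.-integrable `]0, +oo[ (EFin \o g) := integrableD mm j02 j1.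
  have eg : \int[mu]_(t in `]0, +oo[) g t = rGamma m * (1 - u ^+ 2 / (2 * (m - 1))).
    rewrite /g RintegralD// RintegralD// !RintegralZl// -/(rGamma m) -/(rGamma (m + 1)) -/(rGamma (m - 1)).
    have h1 := rGammaS m10; rewrite subrK in h1.
    rewrite rGammaS// h1; field; rewrite ?lt0r_neq0//.
  have g0 : 0 < \int[mu]_(t in `]0, +oo[) g t.
    rewrite eg mulr_gt0 ?rGamma_gt0// subr_gt0 ltr_pdivrMr ?mulr_gt0//.
    by have := sqr_ge0 u; lra.
  move: g0; rewrite ltNge => /negP; apply.
  rewrite -[X in _ <= X]e; apply: le_Rintegral => //.
    by have [] := cintegrableZ c mm (cintegrable_gamma s0).
  move=> t t0'; have t0 : 0 < t by move: t0'; rewrite /= in_itv/= andbT.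
  pose p := t `^ (m - 1) * expR (- t).
  have p0 : 0 <= p by rewrite mulr_ge0 ?powR_ge0 ?expR_ge0.
  have eR : Re (c * (cpow t (m +i* u - 1) * (expR (- t))%:C)) = p * cos (u * ln (t / m)).
    have -> : m +i* u - 1 = (m - 1)%:C + 0 +i* u.
      by apply/eqP; rewrite eq_complex /= addr0 add0r subr0 !eqxx.
    rewrite cpowD (cpowRE _ t0) mulrA mulrCA mulrAC -rmorphM -/p mulrC.
    rewrite mulrC ReRM; congr (_ * _).
    have -> : c * cpow t (0 +i* u) = cexp ((0 +i* u) * (ln (t / m))%:C).
      rewrite lnM ?posrE ?invr_gt0// lnV ?posrE// /c /cpow -cexpD; congr cexp.
      by apply/eqP; rewrite eq_complex /=; apply/andP; split; apply/eqP; ring.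
    by rewrite /cexp /= !(mul0r, mulr0) subrr expR0 mul1r add0r.
  rewrite eR /g.
  have -> : t `^ (m + 1 - 1) * expR (- t) = t * p.
    have -> : m + 1 - 1 = 1 + (m - 1) by ring.
    by rewrite -(powR_mulD 1 (m - 1) t0) powRr1 ?(ltW t0)// /p mulrA.
  have -> : t `^ (m - 1 - 1) * expR (- t) = t^-1 * p.
    have -> : m - 1 - 1 = -1 + (m - 1) by ring.
    by rewrite -(powR_mulD (-1) (m - 1) t0) powR_inv1 ?(ltW t0)// /p mulrA.
  have tm : 0 < t / m by rewrite divr_gt0.
  have h1 := cos_ge (u * ln (t / m)); have h2 := ln_sqr_le tm.
  have u2 : 0 <= u ^+ 2 by exact: sqr_ge0.
  have h3 := ler_wpM2l u2 h2; rewrite exprMn in h1.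
  have h4 : 1 - u ^+ 2 * (t / m - 2 + (t / m)^-1) / 2 <= cos (u * ln (t / m)) by lra.
  apply: le_trans (ler_wpM2l p0 h4).
  rewrite le_eqVlt; apply/orP; left; apply/eqP.
  by rewrite -/p; field; rewrite !lt0r_neq0.
move=> s0; apply/eqP => Gs0.
have Gn n : 0 < Re (s + n%:R) /\ cGamma (s + n%:R) = 0.
  elim: n => [|n [hn en]]; first by rewrite addr0.
  rewrite -addn1 natrD addrA; split; first exact: Re_gt0S.
  by rewrite cGammaS// en mulr0.
have [n hn] : exists n : nat, Im s ^+ 2 < n%:R.
  exists (Num.truncn (Im s ^+ 2)).+1; exact: truncnS_gt.
have [_ /eqP] := Gn n.+1; apply/negP.
have -> : s + n.+1%:R = (Re s + n.+1%:R) +i* (Im s).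
  rewrite -(rmorph_nat (real_complex R)); apply/eqP; rewrite eq_complex.
  by case: (s) => a b; rewrite /= addr0 !eqxx.
have e : n.+1%:R = n%:R + 1 :> R by rewrite -natr1.
have n0 : 0 <= n%:R :> R by [].
by apply: large; rewrite e; lra.
Qed.

(** At the end of the domain of [asin] monotonicity takes over: [s > sin y] forces [asin s > y], for
    any [y] below [pi/2]. *)
Lemma asin_cvg_left : asin s @[s --> (1 : R)^'-] --> pi / 2.
Proof.
apply/cvgrPdist_lt => eps eps0; have p0 := pi_gt0 R.
pose y : R := Num.max (pi / 2 - eps / 2) 0.
have y0 : 0 <= y by rewrite le_max lexx orbT.
have y1 : y < pi / 2 by rewrite gt_max; apply/andP; split; lra.
have hy : pi / 2 - eps / 2 <= y by rewrite le_max lexx.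
have sy : sin y < 1.
  rewrite -(@sin_pihalf R) ltr_sin// in_itv/=; apply/andP; split; lra.
near=> s.
have s1 : s < 1 by near: s; exact: nbhs_left_lt.
have s0 : sin y < s by near: s; exact: nbhs_left_gt.
have sI : -1 <= s <= 1.
  rewrite (ltW s1) andbT (le_trans _ (ltW s0))//; exact: sin_geN1.
have [/andP[a1 a2] e] := asin_def sI.
have ya : y < asin s.
  rewrite -ltr_sin ?e//; rewrite in_itv/=; apply/andP; split; lra.
by rewrite ger0_norm; lra.
Unshelve. all: by end_near. Qed.

(** The square of [Gamma (1/2)] is the beta integral at [(1/2, 1/2)], which [u = s^2] turns into
    twice the integral of [1 / sqrt (1 - s^2)], that is [pi]. Positivity selects the root. *)
Lemma cGamma_half : cGamma (2^-1 : R[i]) = (Num.sqrt (pi : R))%:C.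
Proof.
have h2 : 0 < 2^-1 :> R by rewrite invr_gt0.
have e2 : (2^-1 : R[i]) = (2^-1 : R)%:C by rewrite fmorphV rmorph_nat.
have hR : 0 < Re (2^-1 : R[i]) by rewrite e2.
have : cGamma (2^-1 : R[i]) * cGamma 2^-1 = (pi : R)%:C.
  rewrite (cGamma_mul hR hR).
  have -> : 2^-1 + 2^-1 = 1 :> R[i] by field.
  rewrite cGamma1 mul1r.
  pose h u : R := u `^ (2^-1 - 1) * (1 - u) `^ (2^-1 - 1).
  have ih : mu.-integrable `]0, 1[ (EFin \o h).
    have := integrable_powR_product (@ltr01 R) h2 h2.
    apply: eq_integrable; first exact: msble_itv.
    by move=> u _; rewrite /= subr0.
  have ch u : 0 < u < 1 -> {for u, continuous h}.
    move=> /andP[u0 u1]; apply: cvgM.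
      by apply: (@continuous_powR_comp _ id); [exact: u0|exact: cvg_id].
    by apply: (@continuous_powR_comp _ (fun u => 1 - u)); [rewrite subr_gt0|apply: cvgB; [exact: cvg_cst|exact: cvg_id]].
  have [i e] := subst_sqr ch ih.
  have -> : cBeta 2^-1 2^-1 = (\int[mu]_(u in `]0, 1[) h u)%:C :> R[i].
    have eB : {in (`]0, 1[%classic : set R),
        (fun t => cpow t (2^-1 - 1) * cpow (1 - t) (2^-1 - 1)) =1 (fun t => (h t)%:C : R[i])}.
      move=> t; rewrite inE /= in_itv/= => /andP[t0 t1].
      rewrite -[1]/((1 : R)%:C) e2 -rmorphB cpowRE// cpowRE ?subr_gt0//.
      by rewrite -rmorphM.
    rewrite /cBeta (eq_cint eB) /cint /=; congr Complex.
    by rewrite /Rintegral integral0.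
  congr (_%:C); rewrite -e.
  have pos (s : R) : 0 < s < 1 -> 2 * s * h (s ^+ 2) = 2 * (Num.sqrt (1 - s ^+ 2))^-1.
    move=> /andP[s0 s1]; rewrite /h -mulrA; congr (2 * _).
    have s2 : 0 < 1 - s ^+ 2 by rewrite subr_gt0 expr_lt1// ltW.
    have -> : 2^-1 - 1 = - 2^-1 :> R by lra.
    rewrite !powRN !powR12_sqrt ?sqr_ge0 ?(ltW s2)// sqrtr_sqr gtr0_norm// mulrA divff ?mul1r//.
    exact: lt0r_neq0.
  have dF (s : R) : 0 < s < 1 -> is_derive s 1 (fun s : R => 2 * asin s) (2 * s * h (s ^+ 2)).
    move=> s01; rewrite (pos s s01); have /andP[s0 s1] := s01.
    have s1' : -1 < s < 1 by rewrite s1 andbT; lra.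
    have := is_deriveM (is_derive_cst (2 : R) s 1) (is_derive1_asin s1').
    by move=> /is_derive_eq; apply; rewrite scaler0 addr0.
  have cF (s : R) : 0 < s < 1 -> {for s, continuous (fun s : R => 2 * s * h (s ^+ 2))}.
    move=> /andP[s0 s1]; apply: cvgM.
      by apply: cvgM; [exact: cvg_cst|exact: cvg_id].
    apply: (@continuous_comp _ _ _ (fun s : R => s ^+ 2) h); first exact: exprn_continuous.
    by apply: ch; rewrite exprn_gt0//= expr_lt1// ltW.
  rewrite (improper_ftc (@ltr01 R) dF cF i (la := 0) (lb := 2 * (pi / 2))).
  - by field.
  - rewrite -[X in _ --> X](mulr0 2); apply: cvgM; first exact: cvg_cst.
    have a0 : asin 0 = 0 :> R.
      rewrite -(@sin0 R) sinK ?sin0// in_itv/= oppr_le0 andbb.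
      by rewrite divr_ge0 ?pi_ge0.
    have := @continuous_asin R 0; rewrite /prop_for /continuous_at a0 => h0.
    by apply: cvg_at_right_filter; apply: h0; lra.
  - apply: cvgM; first exact: cvg_cst.
    exact: asin_cvg_left.
rewrite e2 cGammaR -rmorphM => /complexI => e.
have g0 : 0 <= rGamma (2^-1 : R) by exact/ltW/rGamma_gt0.
by congr (_%:C); rewrite -e -expr2 sqrtr_sqr ger0_norm.
Qed.
End gamma_values.

(** * Limits at the origin *)
Section limit_under_integral.
Context {R : realType}.

Let dominated_right (F : R -> R -> R) (f h : R -> R) (D : set R) (v : R) : msble D -> 0 < v ->
  (forall x, 0 < x < v -> measurable_fun (D : set (Rm R)) (F x)) ->
  measurable_fun (D : set (Rm R)) f ->
  (forall y, D y -> F x y @[x --> 0^'+] --> f y) ->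
  (forall x y, 0 < x < v -> D y -> `|F x y| <= h y) ->
  mu.-integrable D (EFin \o h) ->
  \int[mu]_(y in D) F x y @[x --> 0^'+] --> \int[mu]_(y in D) f y.
Proof.
move=> mD v0 mF mf Ff Fh ih; apply/cvg_at_rightP => w [w0 wc].
have [N _ hN] : \forall n \near \oo, w n < v by apply: (cvgr_lt 0 wc).
rewrite -(cvg_shiftn N); pose u n := w (n + N)%N.
have u0 n : 0 < u n < v by rewrite w0 hN//= leq_addl.
have uc : u n @[n --> \oo] --> 0 by rewrite (cvg_shiftn N).
have mf_ n : measurable_fun (D : set (Rm R)) (EFin \o F (u n)) by apply/measurable_EFinP; apply: mF.
have mf' : measurable_fun (D : set (Rm R)) (EFin \o f) by exact/measurable_EFinP.
have c1 : {ae mu, forall y, D y -> (EFin \o F (u n)) y @[n --> \oo] --> (EFin \o f) y}.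
  apply: aeW => y Dy; apply: cvg_EFin; first exact: nearW.
  have /cvg_at_rightP := Ff y Dy; apply; split=> // n.
  by have /andP[] := u0 n.
have c2 : {ae mu, forall y n, D y -> (`|(EFin \o F (u n)) y| <= (EFin \o h) y)%E}.
  by apply: aeW => y n Dy; rewrite lee_fin Fh.
have [i1 _ c] := dominated_convergence mD mf_ mf' c1 ih c2.
apply: (@fine_cvg _ _ _ _ (fun n => \int[mu]_(y in D) (EFin \o F (u n)) y)%E).
rewrite /Rintegral fineK; last exact: integrable_fin_num i1.
exact: c.
Qed.

Lemma ccvg_cint (F : R -> R -> R[i]) f D h (v : R) : msble D -> 0 < v ->
  (forall x, 0 < x < v -> cmeas D (F x)) -> cmeas D f ->
  (forall y, D y -> ccvg (F ^~ y) 0^'+ (f y)) ->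
  (forall x y, 0 < x < v -> D y -> cn (F x y) <= h y) ->
  mu.-integrable D (EFin \o h) ->
  ccvg (fun x => cint D (F x)) 0^'+ (cint D f).
Proof.
move=> mD v0 mF [mf1 mf2] Ff Fh ih; split.
  apply: (dominated_right (h := h) mD v0 _ mf1 _ _ ih).
  - by move=> x /mF[].
  - by move=> y /Ff[].
  - by move=> x y xv Dy; apply: le_trans (normRe_le _) _; exact: Fh.
apply: (dominated_right (h := h) mD v0 _ mf2 _ _ ih).
- by move=> x /mF[].
- by move=> y /Ff[].
- by move=> x y xv Dy; apply: le_trans (normIm_le _) _; exact: Fh.
Qed.

Lemma ccvg_near f g (F : set_system R) l : Filter F -> (\forall x \near F, f x = g x) ->
  ccvg f F l -> ccvg g F l.
Proof.
move=> FF fg [h1 h2]; split.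
  by apply: cvg_trans h1; apply: near_eq_cvg; apply: filterS fg => x ->.
by apply: cvg_trans h2; apply: near_eq_cvg; apply: filterS fg => x ->.
Qed.

Lemma ccvg_ccont_comp f (h : R -> R) (F : set_system R) (b : R) : Filter F ->
  h x @[x --> F] --> b -> ccont f b -> ccvg (fun x => f (h x)) F (f b).
Proof. by move=> FF hb [c1 c2]; split; [exact: cvg_comp hb c1|exact: cvg_comp hb c2]. Qed.

Lemma ccvg_real (h : R -> R) (F : set_system R) (b : R) : Filter F ->
  h x @[x --> F] --> b -> ccvg (fun x => (h x)%:C) F b%:C.
Proof. by move=> FF hb; split=> //=; exact: cvg_cst. Qed.
End limit_under_integral.

Section beta_sqr.
Context {R : realType}.
Implicit Types (a b l m : R[i]).

(** The form in which beta integrals come out of rescaled Abel transforms, because [C x - C (x s)]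
    is of order [x^2 (1 - s^2)]. *)
Definition beta_sqr l m : R[i] :=
  cint `]0, 1[ (fun s => cpow s l * cpow (1 - s ^+ 2) (m - 1)).

Lemma beta_sqrP a b : 0 < Re a -> 0 < Re b ->
  cintegrable `]0, 1[ (fun s => cpow s (2 * a - 1) * cpow (1 - s ^+ 2) (b - 1)) /\
  beta_sqr (2 * a - 1) b = 2^-1 * cBeta a b.
Proof.
move=> a0 b0; pose h (u : R) := cpow u (a - 1) * cpow (1 - u) (b - 1).
have [i1 i2] := cintegrable_beta ltr01 a0 b0.
have ch (u : R) : 0 < u < 1 -> ccont h u.
  move=> /andP[u0 u1]; apply: ccontM.
    by apply: (ccont_cpow (h := id)); [exact: cvg_id|exact: u0].
  by apply: ccont_cpow; [apply: cvgB; [exact: cvg_cst|exact: cvg_id]|rewrite subr_gt0].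
have [j1 e1] := subst_sqr (fun u hu => (ch u hu).1) i1.
have [j2 e2] := subst_sqr (fun u hu => (ch u hu).2) i2.
have eq1 : {in (`]0, 1[%classic : set R),
    (fun s : R => (2 * s)%:C * h (s ^+ 2)) =1
    (fun s => 2 * (cpow s (2 * a - 1) * cpow (1 - s ^+ 2) (b - 1)))}.
  move=> s; rewrite inE /= in_itv/= => /andP[s0 s1].
  have -> : (2 * s)%:C = 2 * s%:C :> R[i] by rewrite rmorphM rmorph_nat.
  rewrite /h cpow_sqr// -(cpow1 s0) -mulrA; congr (2 * _); rewrite mulrA; congr (_ * _).
  by rewrite -cpowD; congr cpow; ring.
have i3 : cintegrable `]0, 1[ (fun s : R => (2 * s)%:C * h (s ^+ 2)).
  have E1 : (fun s : R => 2 * s * Re (h (s ^+ 2))) = (fun s => Re ((2 * s)%:C * h (s ^+ 2))).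
    by apply/funext => s; rewrite ReRM.
  have E2 : (fun s : R => 2 * s * Im (h (s ^+ 2))) = (fun s => Im ((2 * s)%:C * h (s ^+ 2))).
    by apply/funext => s; rewrite ImRM.
  by rewrite E1 in j1; rewrite E2 in j2.
have e3 : cint `]0, 1[ (fun s : R => (2 * s)%:C * h (s ^+ 2)) = cBeta a b.
  rewrite /cBeta /cint -[\int[mu]_(x in _) Re (cpow x (a - 1) * _)]e1.
  rewrite -[\int[mu]_(x in _) Im (cpow x (a - 1) * _)]e2.
  by congr Complex; apply: eq_Rintegral => s _; rewrite ?ReRM ?ImRM.
have i4 := cintegrableZ 2^-1 (msble_itv _) (eq_cintegrable (msble_itv _) eq1 i3).
have half (z : R[i]) : 2^-1 * (2 * z) = z by rewrite mulrA mulVf ?mul1r// C2_neq0.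
have i5 : cintegrable `]0, 1[ (fun s => cpow s (2 * a - 1) * cpow (1 - s ^+ 2) (b - 1)).
  by apply: eq_cintegrable i4; [exact: msble_itv|move=> s _; exact: half].
split; first exact: i5.
rewrite -e3 (eq_cint eq1) (cintZ 2 (msble_itv _) i5); exact: esym (half _).
Qed.

Lemma cvg_scale_right (s : R) : 0 < s -> x * s @[x --> 0^'+] --> (0 : R)^'+.
Proof.
move=> s0 A [d /= d0 dA]; exists (d / s) => /=; first exact: divr_gt0.
move=> x /=; rewrite !sub0r !normrN => hx x0; apply: dA => /=; last exact: mulr_gt0.
by rewrite sub0r normrN normrM (gtr0_norm s0) -ltr_pdivlMr.
Qed.
End beta_sqr.

Local Opaque cint cpow.

(** * Behaviour of Abel transforms at the origin *)

Section abel_limit.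
Context {R : realType} (C C' : R -> R) (hC : abel_weight C C') (q : R) (q0 : 0 < q).
Context (Cq : forall s : R, 0 < s < 1 ->
  (C x - C (x * s)) / x ^+ 2 @[x --> 0^'+] --> q * (1 - s ^+ 2)).
Context (k a g0 : R[i]) (F g : R -> R[i]) (k0 : 0 < Re k) (a0 : 0 <= Re a).
Context (hF : admissible F) (Fg : forall y, 0 < y -> F y = cpow y a * g y).
Context (cg : ccvg g 0^'+ g0).

Let D x s := (C x - C (x * s)) / x ^+ 2.

Let D_gt0 x s : 0 < x -> 0 < s < 1 -> 0 < D x s.
Proof.
move=> x0 /andP[s0 s1]; rewrite divr_gt0 ?exprn_gt0//.
apply: (abel_weight_lt hC); first by rewrite mulr_ge0// ltW.
by rewrite -[ltRHS]mulr1 ltr_pM2l.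
Qed.

Let E x s := g (x * s) * cpow s a * cpow (D x s) (k - 1).

Let integrandE x s : 0 < x -> 0 < s < 1 -> F (x * s) * cpow (C x - C (x * s)) (k - 1) =
  cpow x (a + 2 * (k - 1)) * E x s.
Proof.
move=> x0 /[dup] s01 /andP[s0 s1]; rewrite Fg ?mulr_gt0// cpowM//.
have -> : C x - C (x * s) = x ^+ 2 * D x s.
  by rewrite /D mulrCA divff ?mulr1// expf_neq0// gt_eqF.
rewrite cpowM ?exprn_gt0 ?D_gt0// cpow_sqr// (cpowD x a) /E.
by ring.
Qed.

Let g_bound : exists2 v, 0 < v & exists2 M, 0 < M & forall y, 0 < y < v -> cn (g y) <= M.
Proof.
have [c1 c2] := cg.
have e1 : \forall y \near 0^'+, `|Re (g y)| < `|Re g0| + 1.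
  by apply: (cvgr_norm_lt _ c1); rewrite ltrDl.
have e2 : \forall y \near 0^'+, `|Im (g y)| < `|Im g0| + 1.
  by apply: (cvgr_norm_lt _ c2); rewrite ltrDl.
have [d /= d0 hd] : \forall y \near 0^'+, cn (g y) <= `|Re g0| + 1 + (`|Im g0| + 1).
  near=> y; apply: le_trans (cn_leD _) _; apply: lerD; apply: ltW.
    by near: y; exact: e1.
  by near: y; exact: e2.
exists d => //; exists (`|Re g0| + 1 + (`|Im g0| + 1)).
  by rewrite !ltr_pwDr// ?addr_ge0.
move=> y /andP[y0 yd]; apply: hd => //=.
by rewrite sub0r normrN gtr0_norm.
Unshelve. all: by end_near. Qed.

(** With [y = x s] and [C x - C (x s) = x^2 * D x s], the power [x^(a + 2k - 1)] comes out of the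
    transform, and the remaining integral over []0, 1[] converges by domination. *)
Lemma abel_limit :
  ccvg (fun x => abel C k F x * cpow x (- (a + 2 * k - 1))) 0^'+
    (g0 * cpow q (k - 1) * beta_sqr a k).
Proof.
have [v v0 [M M0 hM]] := g_bound.
have [m [m' [m0 m'0 hd]]] := abel_weight_diff hC v0.
have [hi _] := integral_powR_right (@ltr01 R) k0.
pose Q := m' `^ (Re k - 1) + m `^ (Re k - 1).
have ih := rintegrableZ (M * Q) (msble_itv _) hi.
have cmE x : 0 < x < v -> cmeas (`]0, 1[%classic : set (Rm R)) (E x).
  move=> /andP[x0 xv]; apply: (@cmeas_eq _ _ _ _ (fun s : Rm R =>
      cpow x (- (a + 2 * (k - 1))) * (F (x * s) * cpow (C x - C (x * s)) (k - 1)))).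
    move=> s; rewrite inE /= in_itv/= => s01; rewrite (integrandE x0 s01).
    by rewrite mulrA -cpowD addNr cpow0 mul1r.
  apply: ccont_cmeas; first exact: interval_open.
  move=> s; rewrite /= in_itv/= => /andP[s0 s1].
  have cx : {for s, continuous (fun s : R => x * s)}.
    by apply: cvgM; [exact: cvg_cst|exact: cvg_id].
  apply: ccontM; first exact: ccontC.
  apply: ccontM.
    have xs0 : 0 < x * s by exact: mulr_gt0.
    have [c1 c2] := (proj1 hF) _ xs0.
    by split; [exact: (continuous_comp cx c1)|exact: (continuous_comp cx c2)].
  apply: ccont_cpow.
    apply: cvgB; first exact: cvg_cst.
    apply: (@continuous_comp _ _ _ (fun s : R => x * s) C); first exact: cx.
    exact: (abel_weight_cont hC).
  have := D_gt0 x0 (s := s); rewrite s0 s1 => /(_ isT); rewrite /D.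
  by rewrite pmulr_lgt0 ?invr_gt0 ?exprn_gt0.
have bE x s : 0 < x < v -> `]0, 1[%classic s -> cn (E x s) <= M * Q * (1 - s) `^ (Re k - 1).
  move=> /andP[x0 xv]; rewrite /= in_itv/= => /[dup] s01 /andP[s0 s1].
  rewrite /E !cnM -!mulrA; apply: ler_pM; rewrite ?mulr_ge0 ?cn_ge0//.
    apply: hM; rewrite mulr_gt0//= (le_lt_trans _ xv)// -[leRHS]mulr1.
    by rewrite ler_wpM2l ?ltW.
  have s_le1 : cn (cpow s a) <= 1.
    have h1 : s `^ Re a <= 1 `^ Re a by rewrite ge0_ler_powR ?nnegrE ?(ltW s0) ?(ltW s1).
    by rewrite powR1 in h1; rewrite cn_cpow.
  rewrite -[leRHS]mul1r; apply: ler_pM; rewrite ?cn_ge0//.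
  rewrite cn_cpow ?D_gt0// ReB /=.
  have /andP[l1 l2] : m * (x * (x - x * s)) <= C x - C (x * s) <= m' * (x * (x - x * s)).
    apply: hd; last exact: ltW.
    by rewrite mulr_ge0 ?ltW//= -[ltRHS]mulr1 ltr_pM2l.
  have x2 : 0 < x ^+ 2 by rewrite exprn_gt0.
  have ex : x * (x - x * s) = (1 - s) * x ^+ 2 by ring.
  rewrite ex [_ * (_ * _)]mulrA in l1 l2.
  apply: powR_between; rewrite ?subr_gt0//; first by rewrite /D ler_pdivlMr.
  by rewrite /D ler_pdivrMr// -mulrA.
pose f s := g0 * cpow s a * cpow (q * (1 - s ^+ 2)) (k - 1).
have s2 (s : R) : 0 < s < 1 -> 0 < 1 - s ^+ 2.
  by move=> /andP[s0 s1]; rewrite subr_gt0 expr_lt1// ltW.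
have cf s : 0 < s < 1 -> ccont f s.
  move=> s01; apply: ccontM.
    apply: ccontM; first exact: ccontC.
    by apply: (ccont_cpow (h := id)); [exact: cvg_id|have /andP[] := s01].
  apply: ccont_cpow; last by rewrite mulr_gt0 ?s2.
  apply: cvgM; first exact: cvg_cst.
  by apply: cvgB; [exact: cvg_cst|exact: exprn_continuous].
have cmf : cmeas (`]0, 1[%classic : set (Rm R)) f.
  by apply: ccont_cmeas; [exact: interval_open|move=> s; rewrite /= in_itv/=; exact: cf].
have lim : ccvg (fun x => cint `]0, 1[ (E x)) 0^'+ (cint `]0, 1[ f).
  apply: (ccvg_cint (msble_itv _) v0 cmE cmf _ bE ih).
  move=> s; rewrite /= in_itv/= => s01; have /andP[s0 s1] := s01.
  apply: ccvgM.
    apply: ccvgM; last exact: ccvgC.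
    have cs : x * s @[x --> 0^'+] --> (0 : R)^'+.
      exact: cvg_scale_right.
    by have [c1 c2] := cg; split; [exact: cvg_comp cs c1|exact: cvg_comp cs c2].
  apply: (@ccvg_ccont_comp _ (fun u => cpow u (k - 1)) (D ^~ s)); first exact: Cq.
  by apply: (ccont_cpow (h := id)); [exact: cvg_id|rewrite mulr_gt0 ?s2].
have -> : g0 * cpow q (k - 1) * beta_sqr a k = cint `]0, 1[ f.
  have ib : cintegrable `]0, 1[ (fun s => cpow s a * cpow (1 - s ^+ 2) (k - 1)).
    have a1 : 0 < Re ((a + 1) / 2).
      rewrite (_ : (a + 1) / 2 = (2^-1 : R)%:C * (a + 1)); last first.
        by rewrite fmorphV rmorph_nat mulrC.
      by rewrite ReRM mulr_gt0 ?invr_gt0// ReD /= ltr_wpDl.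
    have [] := beta_sqrP a1 k0.
    by have -> : 2 * ((a + 1) / 2) - 1 = a by field.
  apply: etrans (esym (cintZ _ (msble_itv _) ib)) _; apply: eq_cint => s.
  rewrite inE /= in_itv/= => s01; rewrite /f cpowM ?s2//; ring.
apply: ccvg_near lim; near=> x.
have x0 : 0 < x by near: x; exact: nbhs_right_gt.
rewrite (abel_scale hC k0 hF x0).
have e1 : {in (`]0, 1[%classic : set R),
    (fun s => cpow x (- (a + 2 * (k - 1))) * (F (x * s) * cpow (C x - C (x * s)) (k - 1)))
    =1 E x}.
  move=> s; rewrite inE /= in_itv/= => s01; rewrite (integrandE x0 s01).
  by rewrite mulrA -cpowD addNr cpow0 mul1r.
have [iF _] := cint_scale x0 (abel_integrable hC k0 hF x0).
have := cintZ (cpow x (- (a + 2 * (k - 1)))) (msble_itv _) iF.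
rewrite (eq_cint e1) => ->.
have -> : - (a + 2 * k - 1) = - (a + 2 * (k - 1)) + -1 by ring.
rewrite -(cpowB1 (- (a + 2 * (k - 1))) x0).
by move: (cint _ _) (cpow _ _) => I p; rewrite mulrAC.
Unshelve. all: by end_near. Qed.
End abel_limit.

Lemma cvgr_near {R : realType} (f g : R -> R) (F : set_system R) (l : R) : Filter F ->
  (\forall x \near F, f x = g x) -> f x @[x --> F] --> l -> g x @[x --> F] --> l.
Proof.
by move=> FF fg; apply: cvg_trans; apply: near_eq_cvg; apply: filterS fg => x ->.
Qed.

Section weight_quotients.
Context {R : realType}.
Implicit Types (x s : R).

Lemma sinh_quotient : sinh x / x @[x --> (0 : R)^'+] --> (1 : R).
Proof.
have c1 : cosh x @[x --> (0 : R)^'+] --> (1 : R).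
  by apply: cvg_at_right_filter; rewrite -(@cosh0 R); exact: continuous_cosh.
apply: squeeze_cvgr (cvg_cst (1 : R)) c1; near=> x.
have x0 : 0 < x by near: x; exact: nbhs_right_gt.
rewrite ler_pdivlMr// mul1r sinh_ge_id ?(ltW x0)//= ler_pdivrMr//.
by apply: sinh_le_cosh_id => //; exact: ltW.
Unshelve. all: by end_near. Qed.

Lemma sinh_scale_quotient (a : R) : 0 < a -> sinh (x * a) / x @[x --> (0 : R)^'+] --> a.
Proof.
move=> a0; rewrite -[X in _ --> X]mulr1.
have h : sinh (x * a) / (x * a) @[x --> (0 : R)^'+] --> (1 : R).
  exact: (@cvg_comp _ _ _ (fun x : R => x * a) (fun x => sinh x / x) _ _ _ (cvg_scale_right a0) sinh_quotient).
have h2 : a * (sinh (x * a) / (x * a)) @[x --> (0 : R)^'+] --> a * 1.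
  by apply: cvgM h; exact: cvg_cst.
apply: cvgr_near h2; near=> x.
have x0 : 0 < x by near: x; exact: nbhs_right_gt.
by field; rewrite !gt_eqF.
Unshelve. all: by end_near. Qed.

Lemma cosh_quotient s : 0 < s < 1 ->
  (cosh x - cosh (x * s)) / x ^+ 2 @[x --> 0^'+] --> 2^-1 * (1 - s ^+ 2).
Proof.
move=> /andP[s0 s1].
have a0 : 0 < (1 + s) / 2 by lra.
have b0 : 0 < (1 - s) / 2 by lra.
have h : 2 * (sinh (x * ((1 + s) / 2)) / x * (sinh (x * ((1 - s) / 2)) / x))
    @[x --> (0 : R)^'+] --> 2 * ((1 + s) / 2 * ((1 - s) / 2)).
  apply: cvgM; first exact: cvg_cst.
  by apply: cvgM; exact: sinh_scale_quotient.
move: h; have -> : 2 * ((1 + s) / 2 * ((1 - s) / 2)) = 2^-1 * (1 - s ^+ 2) by field.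
apply: cvgr_near; near=> x.
have x0 : 0 < x by near: x; exact: nbhs_right_gt.
set p := x * _; set m := x * _.
have -> : cosh x = cosh (p + m) by congr cosh; rewrite /p /m; field.
have -> : cosh (x * s) = cosh (p - m) by congr cosh; rewrite /p /m; field.
have -> : cosh (p + m) - cosh (p - m) = 2 * (sinh p * sinh m).
  by rewrite /cosh /sinh opprB opprD !expRD; field.
by field; rewrite gt_eqF.
Unshelve. all: by end_near. Qed.

Lemma cosh_half_quotient s : 0 < s < 1 ->
  (cosh (x / 2) - cosh (x * s / 2)) / x ^+ 2 @[x --> 0^'+] --> 8^-1 * (1 - s ^+ 2).
Proof.
move=> s01; have h2 : 0 < 2^-1 :> R by rewrite invr_gt0.
have h := @cvg_comp _ _ _ (fun x : R => x * 2^-1) (fun x => (cosh x - cosh (x * s)) / x ^+ 2)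
  _ _ _ (cvg_scale_right h2) (cosh_quotient s01).
have h4 : 4^-1 * ((cosh (x * 2^-1) - cosh (x * 2^-1 * s)) / (x * 2^-1) ^+ 2)
    @[x --> (0 : R)^'+] --> 4^-1 * (2^-1 * (1 - s ^+ 2)).
  by apply: cvgM h; exact: cvg_cst.
move: h4; have -> : 4^-1 * (2^-1 * (1 - s ^+ 2)) = 8^-1 * (1 - s ^+ 2) by field.
apply: cvgr_near; near=> x.
have x0 : 0 < x by near: x; exact: nbhs_right_gt.
by rewrite (mulrAC x); field; rewrite gt_eqF.
Unshelve. all: by end_near. Qed.
End weight_quotients.

Section limits_at_zero.
Context {R : realType} (k1 k2 : R[i]) (k1_gt0 : 0 < Re k1) (k2_gt0 : 0 < Re k2).
Implicit Types (t z : R) (f F : R -> R[i]).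

Let q8 : 0 < 8^-1 :> R. Proof. by rewrite invr_gt0. Qed.
Let q2 : 0 < 2^-1 :> R. Proof. by rewrite invr_gt0. Qed.

Let rM f g (l m : R[i]) : ccvg f 0^'+ l -> ccvg g 0^'+ m ->
  ccvg (fun x => f x * g x) 0^'+ (l * m).
Proof. exact: ccvgM. Qed.
Let rD f g (l m : R[i]) : ccvg f 0^'+ l -> ccvg g 0^'+ m ->
  ccvg (fun x => f x + g x) 0^'+ (l + m).
Proof. exact: ccvgD. Qed.
Let rC (l : R[i]) : ccvg (fun=> l) (0 : R)^'+ l. Proof. exact: ccvgC. Qed.
Let rN f g (l : R[i]) : (\forall x \near 0^'+, f x = g x) -> ccvg f 0^'+ l -> ccvg g 0^'+ l.
Proof. exact: ccvg_near. Qed.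
Let rR (h : R -> R) (b : R) : h x @[x --> 0^'+] --> b ->
  ccvg (fun x => (h x)%:C : R[i]) 0^'+ b%:C.
Proof. exact: ccvg_real. Qed.

(** The limit of [z^(-2 k1) * SJ k1 F z]: the 1/2 is that of [sinh (z/2) ~ z/2], the 1/8 that of
    [cosh_half_quotient]. *)
Let Jlim F := 2^-1 * (F 0 * cpow 8^-1 (k1 - 1) * beta_sqr 0 k1).

Let gJ F z := cpow z (- (2 * k1)) * SJ k1 F z.

Let cvg_gJ F : (forall y, ccont F y) -> ccvg (gJ F) 0^'+ (Jlim F).
Proof.
move=> cF; have hF := ccont_admissible cF.
have Fg (y : R) : 0 < y -> F y = cpow y 0 * F y by rewrite cpow0 mul1r.
have [cF0 _] := ccont_ccvg (cF 0).
have re0 : 0 <= Re (0 : R[i]) by [].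
have l1 := abel_limit (@abel_weight_cosh_half R) q8 (@cosh_half_quotient R) k1_gt0 re0 hF Fg cF0.
have l2 : ccvg (fun z : R => (sinh (z * 2^-1) / z)%:C : R[i]) 0^'+ 2^-1.
  have e2 : (2^-1 : R[i]) = (2^-1 : R)%:C by rewrite fmorphV rmorph_nat.
  by rewrite e2; apply: rR; exact: sinh_scale_quotient.
apply: rN (rM l2 l1); near=> z.
have z0 : 0 < z by near: z; exact: nbhs_right_gt.
rewrite /gJ /SJ /inner /cS.
have -> : - (2 * k1) = - (0 + 2 * k1 - 1) - 1 by ring.
have -> : (sinh (z * 2^-1) / z)%:C = (sinh (z / 2))%:C * (z^-1)%:C :> R[i].
  by rewrite rmorphM.
have := cpowB1 (- (0 + 2 * k1 - 1)) z0; rewrite fmorphV.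
have zn0 : z%:C != 0 :> R[i] by rewrite -cn_gt0 cnR normr_gt0 gt_eqF.
move: (cpow _ _) (cpow _ _) (abel _ _ _ _) => p r J <-.
by field.
Unshelve. all: by end_near. Qed.

Lemma abel_SJ_limit k F : 0 < Re k -> (forall y, ccont F y) ->
  ccvg (fun t => abel cosh k (SJ k1 F) t * cpow t (- (2 * k1 + 2 * k - 1))) 0^'+
    (Jlim F * cpow 2^-1 (k - 1) * beta_sqr (2 * k1) k).
Proof.
move=> k0 cF; have hF := ccont_admissible cF.
have re0 : 0 <= Re (2 * k1).
  rewrite -(rmorph_nat (real_complex R)) ReRM mulr_ge0//; exact: ltW.
apply: (abel_limit (@abel_weight_cosh R) q2 (@cosh_quotient R) k0 re0 (admissible_SJ k1_gt0 hF) _ (cvg_gJ cF)).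
by move=> y y0; rewrite /gJ mulrA -cpowD subrr cpow0 mul1r.
Qed.

Let A t : R[i] := (weight k1 k2 t)^-1 * cpow t (2 * k1 + 2 * k2).

(** [2 sinh (t/2)] behaves like [t] and [2 sinh t] like [2t], so only the second factor of the
    weight leaves a power of two. *)
Let cvg_A : ccvg A 0^'+ (cpow 2 (- (2 * k2))).
Proof.
have c1 : sinh (t * 2^-1) / t * 2 @[t --> (0 : R)^'+] --> (1 : R).
  have e : 1 = 2^-1 * 2 :> R by rewrite mulVf ?pnatr_eq0.
  rewrite [X in _ --> X]e.
  by apply: cvgM; [exact: sinh_scale_quotient|exact: cvg_cst].
have c2 : sinh t / t * 2 @[t --> (0 : R)^'+] --> (2 : R).
  rewrite -[X in _ --> X]mul1r.
  by apply: cvgM; [exact: sinh_quotient|exact: cvg_cst].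
have cc (l : R[i]) (b : R) : 0 < b -> ccont (fun u => cpow u l) b.
  by move=> b0; apply: (ccont_cpow (h := id)); [exact: cvg_id|exact: b0].
have l1 := ccvg_ccont_comp (at_right_proper_filter 0) c1 (cc (- (2 * k1)) 1 ltr01).
have l2 := ccvg_ccont_comp (at_right_proper_filter 0) c2 (cc (- (2 * k2)) 2 (ltr0n _ 2)).
have := rM l1 l2.
rewrite cpow_1l mul1r; apply: rN; near=> t.
have t0 : 0 < t by near: t; exact: nbhs_right_gt.
have s0 : 0 < sinh (t * 2^-1) by rewrite sinh_gt0// mulr_gt0.
have s1 : 0 < sinh t by rewrite sinh_gt0.
rewrite /A (weightV k1 k2 t0).
have e (u : R) (l : R[i]) : 0 < u -> cpow (u / t * 2) (- l) * cpow t (- l) = cpow (2 * u) (- l).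
  move=> u0; have p1 : 0 < u / t * 2 by rewrite mulr_gt0// divr_gt0.
  have -> : 2 * u = u / t * 2 * t by field; rewrite gt_eqF.
  by rewrite (cpowM _ p1 t0).
rewrite -(e _ (2 * k1) s0) -(e _ (2 * k2) s1).
have e1 : cpow t (- (2 * k1)) * cpow t (2 * k1) = 1 by rewrite -cpowD addNr cpow0.
have e2 : cpow t (- (2 * k2)) * cpow t (2 * k2) = 1 by rewrite -cpowD addNr cpow0.
rewrite cpowD.
have calc (a p p' b q q' : R[i]) : p * p' = 1 -> q * q' = 1 ->
    a * b = a * p * (b * q) * (p' * q').
  by move=> h1 h2; rewrite -[LHS]mulr1 -h1 -[LHS]mulr1 -h2; ring.
exact: calc e1 e2.
Unshelve. all: by end_near. Qed.

Let cpow_half (s : R[i]) : cpow 2^-1 s = cpow 2 (- s).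
Proof.
rewrite cpowN; apply: (mulfI (cpow_neq0 2 s)); rewrite divff ?cpow_neq0//.
by rewrite -cpowM ?invr_gt0// divff ?pnatr_eq0// cpow_1l.
Qed.

(** The origin of [kconst]. The Gamma values cancel by two applications of [cGamma_mul]. The powers
    of two multiply to 16, against four factors 1/2: one from [kconst k1 k2 / 2], one from [Jlim]
    and one from each [beta_sqr]. *)
Let normalisation f : kconst k1 k2 / 2 * (cpow 2 (- (2 * k2)) * ((1 : R)%:C *
    (Jlim (cev f) * cpow 2^-1 (k2 - 1) * beta_sqr (2 * k1) k2))) = f 0.
Proof.
have h2 : 0 < Re (2^-1 : R[i]).
  by have -> : (2^-1 : R[i]) = (2^-1 : R)%:C by rewrite fmorphV rmorph_nat.
have k1h : 0 < Re (k1 + 2^-1) by rewrite ReD addr_gt0.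
have [_ b1] := beta_sqrP h2 k1_gt0; have [_ b2] := beta_sqrP k1h k2_gt0.
have e1 : 2 * 2^-1 - 1 = 0 :> R[i] by field.
have e2 : 2 * (k1 + 2^-1) - 1 = 2 * k1 by field.
rewrite e1 in b1; rewrite e2 in b2.
have g1 := cGamma_mul h2 k1_gt0; have g2 := cGamma_mul k1h k2_gt0.
rewrite cGamma_half in g1.
have n1 := cGamma_neq0 k1_gt0; have n2 := cGamma_neq0 k2_gt0; have n3 := cGamma_neq0 k1h.
have k12 : 0 < Re (k1 + k2 + 2^-1) by rewrite addrAC ReD addr_gt0.
have n4 := cGamma_neq0 k12.
rewrite addrAC in g2; rewrite addrC in g1.
have s0 : (Num.sqrt (pi : R))%:C != 0 :> R[i].
  by rewrite -cn_gt0 cnR normr_gt0 gt_eqF// sqrtr_gt0 pi_gt0.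
have f0 : cev f 0 = f 0 by rewrite /cev oppr0; field.
have p8 : cpow 8^-1 (k1 - 1) = cpow 2 (- (3 * (k1 - 1))).
  have -> : 8^-1 = 2^-1 * (2^-1 * 2^-1) :> R by field.
  by rewrite !cpowM ?mulr_gt0// !cpow_half -!cpowD; congr cpow; ring.
have p16 : cpow 2 (3 * k1 + 3 * k2) * (cpow 2 (- (2 * k2)) *
    (cpow 2 (- (3 * (k1 - 1))) * cpow 2 (- (k2 - 1)))) = 16.
  rewrite -!cpowD.
  have -> : 3 * k1 + 3 * k2 + (- (2 * k2) + (- (3 * (k1 - 1)) - (k2 - 1))) =
    1 + 1 + 1 + 1 :> R[i] by ring.
  by rewrite !cpowD cpow1// rmorph_nat -!natrM.
rewrite /kconst /Jlim f0 p8 cpow_half b1 b2 rmorph1.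
have calc (c0 c1 c2 c3 G P A1 A2 A3 B1 B2 v : R[i]) :
    P != 0 -> A1 != 0 -> A2 != 0 -> A3 != 0 -> G != 0 -> c0 * (c1 * (c2 * c3)) = 16 ->
    P * A1 = A3 * B1 -> A3 * A2 = G * B2 ->
    c0 * (G / (P * A1 * A2)) / 2 * (c1 * (1 * (2^-1 * (v * c2 * (2^-1 * B1)) * c3 *
      (2^-1 * B2)))) = v.
  move=> P0 A10 A20 A30 G0 hc h1 h3.
  have eB1 : B1 = P * A1 / A3 by rewrite h1 mulrC mulKf.
  have eB2 : B2 = A3 * A2 / G by rewrite h3 mulrC mulKf.
  transitivity (c0 * (c1 * (c2 * c3)) / 16 * v); last by rewrite hc divff ?mul1r ?pnatr_eq0.
  by rewrite eB1 eB2; field; rewrite P0 A10 A20 A30 G0.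
exact: calc s0 n1 n2 n3 n4 p16 g1 g2.
Qed.

Lemma kernel_even_limit f : (forall y, ccont f y) -> ccvg (kernel_even k1 k2 f) 0^'+ (f 0).
Proof.
move=> cf; have l1 := abel_SJ_limit k2_gt0 (ccont_cev cf).
have l2 := rR (sinh_quotient (R := R)).
have l3 := rM (rC (kconst k1 k2 / 2)) (rM cvg_A (rM l2 l1)).
have e : kconst k1 k2 / 2 * (cpow 2 (- (2 * k2)) * ((1 : R)%:C *
    (Jlim (cev f) * cpow 2^-1 (k2 - 1) * beta_sqr (2 * k1) k2))) = f 0.
  exact: normalisation.
rewrite -e; apply: rN l3; near=> t.
have t0 : 0 < t by near: t; exact: nbhs_right_gt.
rewrite /kernel_even /double_abel /outer /A.
have -> : (sinh t / t)%:C = (sinh t)%:C * (t%:C)^-1 :> R[i] by rewrite rmorphM fmorphV.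
have tn0 : t%:C != 0 :> R[i] by rewrite -cn_gt0 cnR normr_gt0 gt_eqF.
have e1 : cpow t (2 * k1 + 2 * k2) * cpow t (- (2 * k1 + 2 * k2 - 1)) = t%:C.
  by rewrite -cpowD -(cpow1 t0); congr cpow; ring.
have calc (a w p p' s u B : R[i]) : u != 0 -> p * p' = u ->
    a * (w * p * (s * u^-1 * (B * p'))) = a * (w * (s * B)).
  move=> u0 h; transitivity (a * (w * (s * B)) * (p * p' / u)); first by ring.
  by rewrite h divff ?mulr1.
exact: calc tn0 e1.
Unshelve. all: by end_near. Qed.

(** With outer exponent [k2 + 1] the transforms are of order [t^(2 k1 + 2 k2 + 1)], one power of [t]
    more than the weight. *)
Lemma kernel_odd_limit f f' : (forall y, cder f y (f' y)) -> (forall y, ccont f' y) ->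
  ccvg (kernel_odd k1 k2 f) 0^'+ 0.
Proof.
move=> df cf'; have cf y : ccont f y := cder_cont (df y).
have k2S := Re_gt0S k2_gt0.
have l1 := abel_SJ_limit k2S (ccont_cev cf); have l2 := abel_SJ_limit k2S (ccont_cev cf').
set L1 := _ * _ * _ in l1; set L2 := _ * _ * _ in l2.
have lt : ccvg (fun t => t%:C) 0^'+ (0 : R[i]).
  by apply: (rR (h := id)); apply: cvg_at_right_filter; exact: cvg_id.
have l3 := rM (rC (kconst k1 k2 / 2)) (rM cvg_A (rM lt
   (rD (rM (rC ((k1 / 2 + k2) / k2)) l1) (rM (rC k2^-1) l2)))).
rewrite !(mul0r, mulr0) in l3; apply: rN l3; near=> t.
have t0 : 0 < t by near: t; exact: nbhs_right_gt.
rewrite /kernel_odd (odd_massE k1_gt0 k2_gt0 df cf' t0) /outerS /A.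
have e1 : cpow t (2 * k1 + 2 * k2) * (t%:C * cpow t (- (2 * k1 + 2 * (k2 + 1) - 1))) = 1.
  by rewrite -(cpow1 t0) -!cpowD -[RHS](cpow0 t); congr cpow; ring.
have calc (a w p p' u r s B B' : R[i]) : p * (u * p') = 1 ->
    a * (w * p * (u * (r * (B * p') + s * (B' * p')))) = a * (w * (r * B + s * B')).
  by move=> h; rewrite -[RHS]mulr1 -h; ring.
exact: calc e1.
Unshelve. all: by end_near. Qed.
End limits_at_zero.

(** * Uniqueness *)
Section gronwall_uniqueness.
Context {R : realType}.
Implicit Types (t : R).

(** [E t * exp (- c t)] is nonincreasing, hence bounded by its limit 0 at the origin; the initial
    condition is a limit because [E'] is only controlled for [t > 0]. *)
Lemma gronwall_zero (E E' : R -> R) (c : R) :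
  (forall t, 0 < t -> is_derive t 1 E (E' t)) -> (forall t, 0 < t -> E' t <= c * E t) ->
  (forall t, 0 <= E t) -> E t @[t --> 0^'+] --> 0 -> forall t, 0 < t -> E t = 0.
Proof.
move=> dE le_E E0 Ec.
pose F t := E t * expR (- (c * t)).
have dexp t : is_derive t 1 (fun t : R => expR (- (c * t))) (- c * expR (- (c * t))).
  have d1 : is_derive t 1 (fun t : R => - (c * t)) (- c).
    have := is_deriveN (is_deriveM (is_derive_cst c t 1) (is_derive_id t (1 : R))).
    by move=> /is_derive_eq; apply; rewrite scaler0 addr0 /GRing.scale /= mulr1.
  have := @is_derive1_comp R expR (fun t => - (c * t)) t _ _ (is_derive_expR _) d1.
  by move=> /is_derive_eq; apply; rewrite mulrC.
have dF t : 0 < t -> is_derive t 1 F ((E' t - c * E t) * expR (- (c * t))).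
  move=> t0; have := is_deriveM (dE t t0) (dexp t).
  by move=> /is_derive_eq; apply; rewrite /GRing.scale /=; ring.
have decF (s t : R) : 0 < s -> s < t -> F t <= F s.
  move=> s0 st; have cF : {within `[s, t], continuous F}.
    apply: derivable_within_continuous => x; rewrite in_itv/= => /andP[sx _].
    by have [] := dF x (lt_le_trans s0 sx).
  have dF' x : x \in `]s, t[ -> is_derive x 1 F ((E' x - c * E x) * expR (- (c * x))).
    by rewrite in_itv/= => /andP[sx _]; apply: dF; exact: lt_trans sx.
  have [u + e] := MVT st dF' cF; rewrite in_itv/= => /andP[su _].
  rewrite -subr_le0 e mulr_le0_ge0 ?subr_ge0 ?(ltW st)//.
  by rewrite mulr_le0_ge0 ?expR_ge0// subr_le0 le_E// (lt_trans s0).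
have cF : F t @[t --> 0^'+] --> 0.
  rewrite -[X in _ --> X](mul0r (expR (- (c * 0)))); apply: cvgM; first exact: Ec.
  apply: cvg_at_right_filter.
  apply: (@continuous_comp _ _ _ (fun t => - (c * t)) expR); last exact: continuous_expR.
  by apply: cvgN; apply: cvgM; [exact: cvg_cst|exact: cvg_id].
move=> t t0; have F0 : F t <= 0.
  apply: (cvgr_to_ge cF); near=> s; apply: decF; near: s; first exact: nbhs_right_gt.
  exact: nbhs_right_lt.
apply/eqP; rewrite eq_le E0 andbT.
by rewrite -(@pmulr_lle0 _ (expR (- (c * t)))) ?expR_gt0.
Unshelve. all: by end_near. Qed.

(** In the derivative of [|e|^2 + |o|^2] the two coupling terms leave only the imaginary part of
    [rho], and the term [- 2 Re w |o|^2] is nonpositive. So a singularity of [w] at the origin, as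
    for [weight_rate], does no harm. *)
Lemma energy_zero (rho : R[i]) (e o w : R -> R[i]) :
  (forall t, 0 < t -> cder e t (- rho * o t)) ->
  (forall t, 0 < t -> cder o t (rho * e t - w t * o t)) ->
  (forall t, 0 < t -> 0 <= Re (w t)) ->
  ccvg e 0^'+ 0 -> ccvg o 0^'+ 0 -> forall t, 0 < t -> e t = 0 /\ o t = 0.
Proof.
move=> de do_ w0 [ea eb] [op oq].
pose a t := Re (e t); pose b t := Im (e t); pose p t := Re (o t); pose q t := Im (o t).
pose E t := (a t * a t + b t * b t) + (p t * p t + q t * q t).
pose r := Re rho; pose s := Im rho.
have sq (u : R -> R) t (d : R) : is_derive t 1 u d ->
    is_derive t 1 (fun t => u t * u t) (2 * (u t * d)).
  move=> du; apply: (is_derive_eq (is_deriveM du du)).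
  by rewrite /GRing.scale /=; ring.
pose E' t := 2 * ((2 * s * (a t * q t - b t * p t)) -
  Re (w t) * (p t * p t + q t * q t)).
have E0 t : 0 <= E t by rewrite !addr_ge0// -expr2 sqr_ge0.
have dE t : 0 < t -> is_derive t 1 E (E' t).
  move=> t0; have [d1 d2] := de t t0; have [d3 d4] := do_ t t0.
  have := is_deriveD (is_deriveD (sq _ _ _ d1) (sq _ _ _ d2)) (is_deriveD (sq _ _ _ d3) (sq _ _ _ d4)).
  move=> /is_derive_eq; apply.
  rewrite /E' /a /b /p /q /r /s.
  case: (e t) => a0 b0; case: (o t) => p0 q0; case: (w t) => w1 w2; case: (rho) => r0 s0 /=.
  by ring.
have le_E t : 0 < t -> E' t <= 2 * `|s| * E t.
  move=> t0; have wt := w0 t t0.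
  have P1 : 0 <= p t * p t + q t * q t by rewrite addr_ge0// -expr2 sqr_ge0.
  have P2 : 0 <= Re (w t) * (p t * p t + q t * q t) by rewrite mulr_ge0.
  have P3 : s * (2 * (a t * q t - b t * p t)) <= `|s| * E t.
    apply: le_trans (ler_norm _) _; rewrite normrM ler_wpM2l//.
    rewrite ler_norml; apply/andP; split; rewrite /E -subr_ge0.
      have -> : 2 * (a t * q t - b t * p t) - - (a t * a t + b t * b t + (p t * p t + q t * q t))
        = (a t + q t) ^+ 2 + (b t - p t) ^+ 2 by ring.
      by rewrite addr_ge0 ?sqr_ge0.
    have -> : a t * a t + b t * b t + (p t * p t + q t * q t) - 2 * (a t * q t - b t * p t)
        = (a t - q t) ^+ 2 + (b t + p t) ^+ 2 by ring.
    by rewrite addr_ge0 ?sqr_ge0.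
  have -> : E' t = 2 * (s * (2 * (a t * q t - b t * p t))) -
      2 * (Re (w t) * (p t * p t + q t * q t)) by rewrite /E'; ring.
  have -> : 2 * `|s| * E t = 2 * (`|s| * E t) by rewrite mulrA.
  move: P2 P3; move: (_ * (_ + _)) (s * _) (`|s| * _) => A B C A0 BC.
  by lra.
have Ec : E t @[t --> 0^'+] --> 0.
  have e0 : 0 = (0 * 0 + 0 * 0) + (0 * 0 + 0 * 0) :> R by ring.
  rewrite [X in _ --> X]e0; by apply: cvgD; apply: cvgD; apply: cvgM.
move=> t t0; have := gronwall_zero dE le_E E0 Ec t0.
move=> /eqP; rewrite /E paddr_eq0 ?addr_ge0 -?expr2 ?sqr_ge0//.
rewrite !paddr_eq0 ?sqr_ge0// !sqrf_eq0 => /andP[/andP[/eqP a0 /eqP b0] /andP[/eqP p0 /eqP q0]].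
by split; apply/eqP; rewrite eq_complex; apply/andP; split; apply/eqP.
Qed.
End gronwall_uniqueness.

Section smooth_functions.
Context {R : realType}.
Implicit Types (f g : R -> R[i]) (x : R).

Lemma derive1nSr n (u : R -> R) : derive1n n (derive1n 1 u) = derive1n n.+1 u.
Proof. by rewrite /derive1n -iterSr. Qed.

Lemma csmooth_cderivn1 f : csmooth f -> csmooth (cderivn 1 f).
Proof.
move=> sf n x; have [h1 h2] := sf n.+1 x; split.
  by have := h1; rewrite -derive1nSr.
by have := h2; rewrite -derive1nSr.
Qed.

Lemma csmooth_cder f x : csmooth f -> cder f x (cderivn 1 f x).
Proof.
move=> sf; have [d1 d2] := sf 0%N x.
by split; apply: DeriveDef; rewrite -?derive1E.
Qed.

Lemma csmooth_ccont f : csmooth f -> forall x, ccont f x.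
Proof. by move=> sf x; exact: cder_cont (csmooth_cder x sf). Qed.

End smooth_functions.

(** * From [f'] to [f]: the Cherednik operator as a system for even and odd parts *)

Section intertwining_uniqueness.
Context {R : realType} (k1 k2 : R[i]) (k1_gt0 : 0 < Re k1) (k2_gt0 : 0 < Re k2).
Context (V : (R -> R[i]) -> (R -> R[i])) (hV : intertwining k1 k2 V).
Implicit Types (f : R -> R[i]) (t x : R).

Let coef x : R[i] := k1 / (1 - expR (- x))%:C + 2 * k2 / (1 - expR (- (2 * x)))%:C.

(** [1 / (1 - exp (-t))] is [(1 + coth (t/2)) / 2], so its values at [t] and [-t] add up to 1 and
    differ by [coth (t/2)]. *)
Let recip t : 0 < t -> [/\ ((1 - expR (- t))%:C)^-1 + ((1 - expR t)%:C)^-1 = 1 :> R[i],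
   ((1 - expR (- t))%:C)^-1 - ((1 - expR t)%:C)^-1 = cZ t / cS t &
   cosh (t / 2) / sinh (t / 2) >= 0].
Proof.
move=> t0; set u := expR (t / 2); set v := expR (- (t / 2)).
have uv : u * v = 1 by rewrite expRNM.
have -> : expR t = u ^+ 2 by rewrite expr2 -expRD; congr expR; lra.
have -> : expR (- t) = v ^+ 2 by rewrite expr2 -expRD; congr expR; lra.
have s0 : 0 < sinh (t / 2) by rewrite sinh_gt0// divr_gt0.
have uvs : u - v = 2 * sinh (t / 2) by rewrite /sinh mulrC divfK ?pnatr_eq0.
have e1 : 1 - v ^+ 2 = v * (u - v) by rewrite mulrBr mulrC uv expr2.
have e2 : 1 - u ^+ 2 = - (u * (u - v)) by rewrite mulrBr uv opprB expr2.
have u0 : u != 0 by rewrite gt_eqF// expR_gt0.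
have v0 : v != 0 by rewrite gt_eqF// expR_gt0.
have w0 : u - v != 0 by rewrite uvs mulf_neq0 ?gt_eqF// pnatr_eq0.
split; last by rewrite divr_ge0 ?(ltW (cosh_gt0 _)) ?ltW.
  rewrite -!fmorphV -rmorphD -[RHS]/((1 : R)%:C); congr (_%:C).
  rewrite e1 e2 invrN !invfM -mulrBl.
  have -> : v^-1 = u by apply: (mulfI v0); rewrite divff// mulrC uv.
  have -> : u^-1 = v by apply: (mulfI u0); rewrite divff// uv.
  by rewrite divff.
rewrite /cZ /cS -!fmorphV -rmorphB -rmorphM; congr (_%:C).
rewrite e1 e2 invrN !invfM opprK -mulrDl.
have -> : v^-1 = u by apply: (mulfI v0); rewrite divff// mulrC uv.
have -> : u^-1 = v by apply: (mulfI u0); rewrite divff// uv.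
rewrite uvs /cosh -/u -/v invfM.
by field; rewrite gt_eqF.
Qed.

Let Re_weight_rate t : 0 < t -> 0 <= Re (weight_rate k1 k2 t).
Proof.
move=> t0; have t2 : 0 < 2 * t by rewrite mulr_gt0.
have [_ _ h1] := recip t0; have [_ _ h2] := recip t2.
have -> : weight_rate k1 k2 t = (cosh (t / 2) / sinh (t / 2))%:C * k1 +
    (2 * (cosh (2 * t / 2) / sinh (2 * t / 2)))%:C * k2.
  have -> : 2 * t / 2 = t by field.
  rewrite /weight_rate /cZ /cS -(rmorph_nat (real_complex R)) -!fmorphV -!rmorphM.
  by rewrite mulrC; congr (_ + _); rewrite mulrAC -!rmorphM.
rewrite ReD !ReRM; apply: addr_ge0; apply: mulr_ge0 => //; try exact: ltW.
by apply: mulr_ge0.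
Qed.

(** The even part of the coefficient in the Cherednik operator is [k1/2 + k2], and its odd part is
    half the logarithmic derivative of the weight; this produces the system of [energy_zero]. *)
Let coefP t : 0 < t -> coef t + coef (- t) = 2 * (k1 / 2 + k2) /\
  coef t - coef (- t) = weight_rate k1 k2 t.
Proof.
move=> t0; have t2 : 0 < 2 * t by rewrite mulr_gt0.
have [a1 b1 _] := recip t0; have [a2 b2 _] := recip t2.
rewrite /coef mulrN !opprK /weight_rate.
have eZ : cZ (2 * t) = (cosh t)%:C by rewrite /cZ; congr (cosh _)%:C; field.
have eS : cS (2 * t) = (sinh t)%:C by rewrite /cS; congr (sinh _)%:C; field.
rewrite -b1 -eZ -eS -b2.
have calc (p q r s : R[i]) : p + q = 1 -> r + s = 1 ->
    k1 * p + 2 * k2 * r + (k1 * q + 2 * k2 * s) = 2 * (k1 / 2 + k2) /\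
    k1 * p + 2 * k2 * r - (k1 * q + 2 * k2 * s) = k1 * (p - q) + 2 * k2 * (r - s).
  move=> h1 h2; split; last by ring.
  transitivity (k1 * (p + q) + 2 * k2 * (r + s)); first by ring.
  by rewrite h1 h2; field; rewrite ?C2_neq0.
exact: calc a1 a2.
Qed.

Lemma intertwining_step f : csmooth f ->
  (forall x, x != 0 -> V (cderivn 1 f) x = kernel_op k1 k2 (cderivn 1 f) x) ->
  forall x, x != 0 -> V f x = kernel_op k1 k2 f x.
Proof.
move=> sf Vf'.
have sf' := csmooth_cderivn1 sf; have cf' := csmooth_ccont sf'; have cf := csmooth_ccont sf.
have df y : cder f y (cderivn 1 f y) by exact: csmooth_cder.
pose v := V f; have sv : csmooth v by exact: (intertwining_smooth hV).
have cv := csmooth_ccont sv.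
pose rho := k1 / 2 + k2.
have dv y : cder v y (cderivn 1 v y) by exact: csmooth_cder.
have ev x : x != 0 -> cderivn 1 v x = V (cderivn 1 f) x - coef x * (v x - v (- x)) + rho * v x.
  move=> x0; rewrite (intertwining_comm hV sf) /cherednik (negPf x0) /cherednik_off0 -/v -/(coef x).
  by rewrite -/rho; move: (coef x) (cderivn 1 v x) => c d; ring.
have VE t : 0 < t -> cev (V (cderivn 1 f)) t = kernel_even k1 k2 (cderivn 1 f) t /\
    cod (V (cderivn 1 f)) t = kernel_odd k1 k2 (cderivn 1 f) t.
  move=> t0; have tn0 : t != 0 by rewrite gt_eqF.
  have ntn0 : - t != 0 by rewrite oppr_eq0.
  have [_ h1] := kernel_op_formula k1_gt0 k2_gt0 tn0 cf'.
  have [_ h2] := kernel_op_formula k1_gt0 k2_gt0 ntn0 cf'.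
  rewrite normrN (gtr0_norm t0) in h1 h2; rewrite gtr0_sg// in h1.
  rewrite ltr0_sg ?oppr_lt0// rmorphN1 in h2; rewrite rmorph1 in h1.
  rewrite /cev /cod !Vf'// h1 h2; split; field; rewrite ?C2_neq0//.
have d_cev t : cder (cev v) t (cod (cderivn 1 v) t).
  exact: (@cder_cev _ v _ dv).
have d_cod t : cder (cod v) t (cev (cderivn 1 v) t).
  exact: (@cder_cod _ v _ dv).
pose e t := cev v t + -1 * kernel_even k1 k2 f t; pose o t := cod v t + -1 * kernel_odd k1 k2 f t.
have de t : 0 < t -> cder e t (- rho * o t).
  move=> t0; have := cderD (d_cev t) (cderM (cderC (-1) t) (cder_kernel_even k1_gt0 k2_gt0 df cf' t0)).
  move=> /cder_eq; apply; have [VE1 VE2] := VE t t0; rewrite -VE2 /o.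
  have tn0 : t != 0 by rewrite gt_eqF.
  have ntn0 : - t != 0 by rewrite oppr_eq0.
  have [c1 c2] := coefP t0.
  rewrite /cod (ev t tn0) (ev (- t) ntn0) opprK -/rho.
  have -> : coef (- t) = 2 * rho - coef t by rewrite -c1; ring.
  move: (coef t) (v t) (v (- t)) (V _ t) (V _ (- t)) (kernel_even _ _ _ _) (kernel_odd _ _ _ _).
  by move=> c p q r s x y; field; rewrite ?C2_neq0.
have do_ t : 0 < t -> cder o t (rho * e t - weight_rate k1 k2 t * o t).
  move=> t0; have := cderD (d_cod t) (cderM (cderC (-1) t) (cder_kernel_odd k1_gt0 k2_gt0 df cf' t0)).
  move=> /cder_eq; apply; have [VE1 VE2] := VE t t0; rewrite -VE1 /e /o.
  have tn0 : t != 0 by rewrite gt_eqF.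
  have ntn0 : - t != 0 by rewrite oppr_eq0.
  have [c1 c2] := coefP t0.
  rewrite /cod /cev (ev t tn0) (ev (- t) ntn0) opprK -/rho -c2.
  move: (coef t) (coef (- t)) (v t) (v (- t)) (V _ t) (V _ (- t)) (kernel_even _ _ _ _) (kernel_odd _ _ _ _).
  by move=> c c' p q r s x y; field; rewrite ?C2_neq0.
have e0 : ccvg e 0^'+ 0.
  have [h _] := ccont_ccvg (ccont_cev cv 0).
  (* The normalisation [V f 0 = f 0] enters here, against the limit [f 0] of [kernel_even]. *)
  have z : 0 = cev v 0 + -1 * f 0.
    by rewrite /cev oppr0 /v (intertwining_at0 hV sf); field; rewrite ?C2_neq0.
  rewrite [X in ccvg _ _ X]z; apply: ccvgD; first exact: h.
  by apply: ccvgM; [exact: ccvgC|exact: kernel_even_limit].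
have o0 : ccvg o 0^'+ 0.
  have [h _] := ccont_ccvg (ccont_cod cv 0).
  have z : 0 = cod v 0 + -1 * 0 by rewrite /cod oppr0; field; rewrite ?C2_neq0.
  rewrite [X in ccvg _ _ X]z; apply: ccvgD; first exact: h.
  by apply: ccvgM; [exact: ccvgC|exact: (kernel_odd_limit k1_gt0 k2_gt0 df cf')].
have zero := energy_zero de do_ Re_weight_rate e0 o0.
have fin t : 0 < t -> cev v t = kernel_even k1 k2 f t /\ cod v t = kernel_odd k1 k2 f t.
  move=> t0; have [h1 h2] := zero t t0; split.
    by apply/eqP; rewrite -subr_eq0 -mulN1r; apply/eqP.
  by apply/eqP; rewrite -subr_eq0 -mulN1r; apply/eqP.
move=> x x0; have [_ ->] := kernel_op_formula k1_gt0 k2_gt0 x0 cf.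
have t0 : 0 < `|x| by rewrite normr_gt0.
have [<- <-] := fin _ t0; have [x1|x1] := ltP 0 x.
  by rewrite gtr0_sg// gtr0_norm// rmorph1 mul1r -cevD_cod.
have x2 : x < 0 by rewrite lt_neqAle x0.
rewrite ltr0_sg// ltr0_norm// rmorphN1 mulN1r -cevB_cod opprK//.
Qed.
End intertwining_uniqueness.

(** * Polynomial approximation *)
Section weierstrass.
Context {R : realType}.
Implicit Types (x y : R) (u : R -> R) (p : {poly R}).

Definition bernstein (n : nat) u : {poly R} :=
  \sum_(k < n.+1) u (k%:R / n%:R) *: (('X^k * (1 - 'X) ^+ (n - k)) *+ 'C(n, k)).

Let b n (k : 'I_n.+1) x : R := x ^+ k * (1 - x) ^+ (n - k) *+ 'C(n, k).

Let horner_bernstein n u x : (bernstein n u).[x] = \sum_(k < n.+1) u (k%:R / n%:R) * b k x.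
Proof.
rewrite /bernstein horner_sum; apply: eq_bigr => k _.
by rewrite hornerZ hornerMn !hornerE.
Qed.

(** [c] stays fixed while ['X] varies, so that differentiating and then evaluating at [x] with
    [c = 1 - x] yields the moments of the binomial law. *)
Let expansion n (c : R) : ('X + c%:P) ^+ n =
  \sum_(k < n.+1) (c ^+ (n - k) *+ 'C(n, k)) *: 'X^k.
Proof.
rewrite addrC exprDn; apply: eq_bigr => k _.
by rewrite -polyC_exp mul_polyC scalerMnl.
Qed.

Let deriv_sum n (F : 'I_n -> {poly R}) : (\sum_k F k)^`() = \sum_k (F k)^`().
Proof. exact: raddf_sum. Qed.

Let sum0 n x : \sum_(k < n.+1) b k x = 1.
Proof.
have := expansion n (1 - x); move=> /(f_equal (fun p => p.[x])).
rewrite horner_exp hornerD hornerX hornerC addrCA subrr addr0 expr1n => ->.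
rewrite horner_sum; apply: eq_bigr => k _; rewrite hornerZ hornerXn /b.
by rewrite mulrnAl mulrC.
Qed.

Let nat_C (z : R) n k : z *+ 'C(n, k) = z * ('C(n, k))%:R. Proof. by rewrite mulr_natr. Qed.
Let nat_l (z : R) n k : z ^+ n *+ k.+1 = k.+1%:R * z ^+ n. Proof. by rewrite mulr_natl. Qed.

Let sum1 n x : \sum_(k < n.+1) k%:R * b k x = n%:R * x.
Proof.
have := expansion n (1 - x); move=> /(f_equal (fun p => x * (p^`()).[x])).
rewrite deriv_exp derivD derivX derivC addr0 mul1r hornerMn horner_exp hornerD hornerX hornerC.
rewrite addrCA subrr addr0 expr1n => h.
rewrite [RHS]mulrC h deriv_sum horner_sum mulr_sumr; apply: eq_bigr => k _.
rewrite derivZ hornerZ derivXn hornerMn hornerXn /b.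
rewrite (nat_C (x ^+ k * _)) (nat_C ((1 - x) ^+ _)).
move: ('C(n, k)%:R : R) ((1 - x) ^+ (n - k)) => c z.
case: (k : nat) => [|j] /=; first by rewrite mulr0n !(mulr0, mul0r).
by rewrite nat_l exprS; ring.
Qed.

Let sum2 n x : \sum_(k < n.+1) k%:R * (k%:R - 1) * b k x = n%:R * (n%:R - 1) * x ^+ 2.
Proof.
have := expansion n (1 - x); move=> /(f_equal (fun p => x ^+ 2 * (p^`()^`()).[x])).
rewrite deriv_exp derivD derivX derivC addr0 mul1r derivMn deriv_exp derivD derivX derivC addr0 mul1r.
rewrite !hornerMn horner_exp hornerD hornerX hornerC addrCA subrr addr0 expr1n => h.
have -> : n%:R * (n%:R - 1) * x ^+ 2 = x ^+ 2 * (1 *+ n.-1 *+ n) :> R.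
  by case: n {h} => [|n] /=; rewrite ?mulr0n ?mul0r ?mulr0// -[_ *+ n.+1]mulr_natl -natr1; ring.
rewrite h !deriv_sum horner_sum mulr_sumr; apply: eq_bigr => k _.
rewrite !derivZ hornerZ derivXn derivMn derivXn !hornerMn hornerXn /b.
rewrite (nat_C (x ^+ k * _)) (nat_C ((1 - x) ^+ _)).
move: ('C(n, k)%:R : R) ((1 - x) ^+ (n - k)) => c z.
case: (k : nat) => [|[|j]] /=.
- by rewrite mulr0n !(mulr0, mul0r).
- by rewrite mulr0n mul0rn subrr !(mulr0, mul0r).
rewrite nat_l -[_ * _ *+ j.+2]mulr_natl.
rewrite (_ : j.+2%:R - 1 = j.+1%:R) ?(exprS x j.+1) ?(exprS x j); last by rewrite -natr1 addrK.
by ring.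
Qed.

Let variance n x : (0 < n)%N -> \sum_(k < n.+1) (x - k%:R / n%:R) ^+ 2 * b k x = x * (1 - x) / n%:R.
Proof.
move=> n0; have nn0 : n%:R != 0 :> R by rewrite pnatr_eq0 -lt0n.
transitivity (\sum_(k < n.+1) (x ^+ 2 * b k x + ((n%:R ^- 2 - 2 * x / n%:R) * (k%:R * b k x) +
   n%:R ^- 2 * (k%:R * (k%:R - 1) * b k x)))).
  apply: eq_bigr => k _; move: (b k x) (k%:R) => c d.
  by field.
rewrite !big_split /= -!mulr_sumr sum0 sum1 sum2.
by field.
Qed.

Let b_ge0 n (k : 'I_n.+1) x : 0 <= x <= 1 -> 0 <= b k x.
Proof.
by move=> /andP[x0 x1]; rewrite mulrn_wge0// mulr_ge0 ?exprn_ge0// subr_ge0.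
Qed.

Let weierstrass01 u (L e : R) : 0 <= L -> 0 < e ->
  (forall x y, 0 <= x <= 1 -> 0 <= y <= 1 -> `|u x - u y| <= L * `|x - y|) ->
  exists p, forall x, 0 <= x <= 1 -> `|u x - p.[x]| <= e.
Proof.
(* [d] splits the error through [|w| <= d + w^2 / d]: the first term costs [L d <= e/2], and the
   second is a variance, small for large [n]. *)
move=> L0 e0 uL; pose d := e / (2 * (L + 1)).
have d0 : 0 < d by rewrite divr_gt0// mulr_gt0// ltr_wpDl.
have [n n0 hn] : exists2 n : nat, (0 < n)%N & L / (d * n%:R) <= e / 2.
  pose N := (Num.truncn (2 * L / (d * e))).+1; exists N => //.
  have hN : 2 * L / (d * e) < N%:R by exact: truncnS_gt.
  have N0 : 0 < N%:R :> R by rewrite ltr0n.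
  have de0 : 0 < d * e by exact: mulr_gt0.
  have dN0 : 0 < d * N%:R by exact: mulr_gt0.
  rewrite (ler_pdivrMr _ _ dN0); move: hN; rewrite (ltr_pdivrMr _ _ de0) => /ltW hN.
  rewrite (_ : e / 2 * (d * N%:R) = N%:R * (d * e) / 2); last by field.
  by rewrite ler_pdivlMr// mulrC.
exists (bernstein n u) => x x01; have /andP[x0 x1] := x01.
have nR : 0 < n%:R :> R by rewrite ltr0n.
have e1 : u x = \sum_(k < n.+1) u x * b k x by rewrite -mulr_sumr sum0 mulr1.
rewrite horner_bernstein e1 -sumrB.
apply: le_trans (ler_norm_sum _ _ _) _.
apply: (@le_trans _ _ (\sum_(k < n.+1) (L * d * b k x + L / d * ((x - k%:R / n%:R) ^+ 2 * b k x)))).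
  apply: ler_sum => k _; rewrite -mulrBl normrM (ger0_norm (b_ge0 k x01)).
  rewrite mulrA -mulrDl ler_wpM2r ?b_ge0//.
  have kn : 0 <= (k%:R / n%:R : R) <= 1.
    by rewrite divr_ge0//= ler_pdivrMr// mul1r ler_nat -ltnS.
  apply: le_trans (uL _ _ x01 kn) _; rewrite -mulrA -mulrDr ler_wpM2l//.
  set w := x - _; have -> : w ^+ 2 = `|w| ^+ 2 by rewrite real_normK ?num_real.
  rewrite -(ler_pM2l d0) mulrDr; have -> : d * (d^-1 * `|w| ^+ 2) = `|w| ^+ 2.
    by rewrite mulrA divff ?mul1r// gt_eqF.
  move: `|w| (normr_ge0 w) => r r0; have := sqr_ge0 (r - d); rewrite !expr2; nra.
rewrite big_split /= -!mulr_sumr sum0 variance// mulr1.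
have h1 : L * d <= e / 2.
  rewrite /d mulrA ler_pdivrMr ?mulr_gt0 ?ltr_wpDl//.
  by rewrite (_ : e / 2 * (2 * (L + 1)) = L * e + e) ?lerDl ?ltW//; field.
have h2 : L / d * (x * (1 - x) / n%:R) <= L / (d * n%:R).
  rewrite (_ : L / d * (x * (1 - x) / n%:R) = L / (d * n%:R) * (x * (1 - x))); last first.
    by field; rewrite !gt_eqF.
  apply: ler_piMr; first exact: divr_ge0 L0 (ltW (mulr_gt0 d0 nR)).
  by rewrite mulr_ile1 ?subr_ge0 ?lerBlDr ?lerDl.
by apply: le_trans (lerD h1 (le_trans h2 hn)) _; rewrite -splitr.
Qed.

Lemma weierstrass_lipschitz u (M L e : R) : 0 < M -> 0 <= L -> 0 < e ->
  (forall x y, `|x| <= M -> `|y| <= M -> `|u x - u y| <= L * `|x - y|) ->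
  exists p, forall x, `|x| <= M -> `|u x - p.[x]| <= e.
Proof.
move=> M0 L0 e0 uL; pose v s := u (2 * M * s - M).
have M2 : 0 < 2 * M by rewrite mulr_gt0.
have rng s : 0 <= s <= 1 -> `|2 * M * s - M| <= M.
  move=> /andP[s0 s1]; have := ler_wpM2l (ltW M2) s0; have := ler_wpM2l (ltW M2) s1.
  by rewrite mulr1 mulr0 ler_norml => h1 h2; apply/andP; split; lra.
have [|x y x01 y01|p hp] := @weierstrass01 v (L * (2 * M)) e _ e0.
- by rewrite mulr_ge0// ltW.
- apply: le_trans (uL _ _ (rng _ x01) (rng _ y01)) _.
  have -> : 2 * M * x - M - (2 * M * y - M) = 2 * M * (x - y) by ring.
  by rewrite normrM (gtr0_norm M2) !mulrA.
exists (p \Po ((2 * M)^-1 *: ('X + M%:P))) => x xM.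
have /andP[x1 x2] : - M <= x <= M by rewrite -ler_norml.
rewrite horner_comp hornerZ hornerD hornerX hornerC.
have e1 : 2 * M * ((2 * M)^-1 * (x + M)) - M = x.
  by rewrite mulrA divff ?mul1r ?addrK// gt_eqF.
have := hp ((2 * M)^-1 * (x + M)); rewrite /v e1; apply.
rewrite mulr_ge0 ?invr_ge0 ?(ltW M2)//=; last lra.
by rewrite ler_pdivrMl// mulr1; lra.
Qed.
End weierstrass.

(** * Approximation of a smooth function together with its derivatives *)

Section smooth_density.
Context {R : realType}.
Implicit Types (x y : R) (u : R -> R) (p : {poly R}).

Lemma mvt_lipschitz u (u' : R -> R) (M L : R) : (forall x, is_derive x 1 u (u' x)) ->
  (forall x, `|x| <= M -> `|u' x| <= L) ->
  forall x y, `|x| <= M -> `|y| <= M -> `|u x - u y| <= L * `|x - y|.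
Proof.
move=> du hL.
have main x y : x < y -> `|x| <= M -> `|y| <= M -> `|u x - u y| <= L * `|x - y|.
  move=> xy xM yM; have cu : {within `[x, y], continuous u}.
    by apply: derivable_within_continuous => z _; have [] := du z.
  have [c + e] := MVT xy (fun z _ => du z) cu; rewrite in_itv/= => /andP[xc cy].
  rewrite distrC e distrC normrM; apply: ler_wpM2r => //; apply: hL.
  move: xM yM; rewrite !ler_norml => /andP[h1 h2] /andP[h3 h4].
  by apply/andP; split; lra.
move=> x y xM yM; have [xy|yx|->] := ltgtP x y; first exact: main.
  by rewrite distrC [`|x - y|]distrC; exact: main.
by rewrite !subrr normr0 mulr0.
Qed.

Let smooth u := forall n x, derivable (derive1n n u) x 1.

Let smooth_derive u x : smooth u -> is_derive x 1 u (derive1n 1 u x).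
Proof. by move=> su; apply: DeriveDef; [exact: (su 0%N)|rewrite /= derive1E]. Qed.

Let smooth_deriv1 u : smooth u -> smooth (derive1n 1 u).
Proof. by move=> su n x; rewrite derive1nSr; exact: su. Qed.

Lemma derive1n_horner n p : derive1n n (horner p) = horner (p^`(n)).
Proof. by elim: n => [//|n IH]; rewrite derive1nS IH derivnS derivE. Qed.

Let antideriv p (c : R) : exists q, q^`() = p /\ q.[0] = c.
Proof.
exists (\poly_(i < (size p).+1) (if i == 0%N then c else p`_i.-1 / i%:R)); split.
  apply/polyP => i; rewrite coef_deriv coef_poly /= ltnS.
  case: ltnP => [_|h]; last by rewrite mul0rn nth_default.
  by rewrite -[LHS]mulr_natr divfK// pnatr_eq0.
by rewrite horner_coef0 coef_poly.
Qed.

(** A polynomial close to [u'] together with [m] derivatives is integrated, with the value [u 0] at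
    the origin. *)
Lemma smooth_poly_approx (M : R) m u : 0 < M ->
  (forall n x, derivable (derive1n n u) x 1) -> forall e, 0 < e ->
  exists p, forall j x, (j <= m)%N -> `|x| <= M -> `|derive1n j u x - (p^`(j)).[x]| <= e.
Proof.
move=> M0; elim: m u => [|m IH] u su e e0.
  have [L L0 hL] : exists2 L, 0 <= L & forall x, `|x| <= M -> `|derive1n 1 u x| <= L.
    have cu : {within `[- M, M], continuous (fun x => `|derive1n 1 u x|)}.
      apply: continuous_subspaceT => x; apply: cvg_norm.
      by have /derivable1_diffP/differentiable_continuous := su 1%N x.
    have MM : - M <= M by lra.
    have [c _ hc] := EVT_max MM cu; exists `|derive1n 1 u c| => // x xM.
    by apply: hc; rewrite in_itv/= -ler_norml.
  have lip := mvt_lipschitz (fun x => smooth_derive x su) hL.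
  have [p hp] := weierstrass_lipschitz M0 L0 e0 lip.
  by exists p => j x; rewrite leqn0 => /eqP -> xM; rewrite derivn0; exact: hp.
have M1 : 0 < 1 + M by rewrite addr_gt0.
(* Integrating from 0 over [[-M, M]] multiplies the error by at most [M]; dividing by [1 + M] also
   keeps the bound for the higher derivatives below [e]. *)
have d0 : 0 < e / (1 + M) by rewrite divr_gt0.
have [p' hp'] := IH _ (smooth_deriv1 su) _ d0.
have de : e / (1 + M) <= e by rewrite ler_pdivrMr// ler_peMr ?lerDl ?ltW.
have [p [dp p0]] := antideriv p' (u 0).
exists p => -[|j] x jm xM; last first.
  by rewrite derivSn dp -derive1nSr; apply: le_trans de; exact: hp'.
rewrite derivn0.
have dd y : is_derive y 1 (fun z => u z - p.[z]) (derive1n 1 u y - p'.[y]).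
  rewrite -dp; exact: (is_deriveB (smooth_derive y su) (is_derive_poly p y)).
have M0' : `|0 : R| <= M by rewrite normr0 ltW.
have hd y : `|y| <= M -> `|derive1n 1 u y - p'.[y]| <= e / (1 + M).
  by move=> yM; have := hp' 0%N y isT yM.
have := mvt_lipschitz dd hd xM M0'.
rewrite p0 subrr !subr0 => h; apply: le_trans h _.
rewrite mulrAC ler_pdivrMr// ler_wpM2l ?(ltW e0)//; lra.
Qed.
End smooth_density.

Section polynomial_functions.
Context {R : realType}.
Implicit Types (p q : {poly R}).

Definition cpoly p q (y : R) : R[i] := p.[y] +i* q.[y].

Lemma cderivn_cpoly n p q : cderivn n (cpoly p q) = cpoly (p^`(n)) (q^`(n)).
Proof.
apply/funext => x; have h (r : {poly R}) : derive1n n (fun t : R => r.[t]) = horner (r^`(n)) by exact: derive1n_horner.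
by rewrite /cderivn /cpoly /= !h.
Qed.

Lemma csmooth_cpoly p q : csmooth (cpoly p q).
Proof.
move=> n x; have h (r : {poly R}) : derive1n n (fun t : R => r.[t]) = horner (r^`(n)) by exact: derive1n_horner.
by rewrite /cpoly /= !h; split; exact: ex_derive.
Qed.

Lemma cderivn0 (f : R -> R[i]) : cderivn 0 f = f.
Proof. by apply/funext => x; rewrite /cderivn /=; case: (f x). Qed.

Lemma cpoly_dense f m (M e : R) : csmooth f -> 0 < M -> 0 < e ->
  exists p q, forall j x, (j <= m)%N -> `|x| <= M ->
    cn (cderivn j f x - cderivn j (cpoly p q) x) <= e.
Proof.
move=> sf M0 e0; have e2 : 0 < e / 2 by exact: divr_gt0.
have [p hp] := smooth_poly_approx m M0 (fun n x => (sf n x).1) e2.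
have [q hq] := smooth_poly_approx m M0 (fun n x => (sf n x).2) e2.
exists p, q => j x jm xM; rewrite cderivn_cpoly; apply: le_trans (cn_leD _) _.
by rewrite ReB ImB [leRHS]splitr; apply: lerD; [exact: hp|exact: hq].
Qed.
End polynomial_functions.

Section intertwining_formula.
Context {R : realType} (k1 k2 : R[i]) (k1_gt0 : 0 < Re k1) (k2_gt0 : 0 < Re k2).
Context (V : (R -> R[i]) -> (R -> R[i])) (hV : intertwining k1 k2 V).
Implicit Types (f : R -> R[i]) (x : R).

Let V_cst0 x : V (fun=> 0) x = 0.
Proof.
have s0 : csmooth (fun=> 0 : R[i]).
  by have := csmooth_cpoly (0 : {poly R}) 0; congr csmooth; apply/funext => t; rewrite /cpoly horner0.
(* At [a = 1] linearity says [V 0 = V 0 + V 0]. *)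
have := intertwining_linear hV 1 s0 s0 x.
have -> : (fun t : R => 1 * 0 + 0) = (fun=> 0) :> (R -> R[i]).
  by apply/funext => t; rewrite mulr0 addr0.
by rewrite mul1r => /esym/eqP; rewrite -subr_eq0 addrK => /eqP.
Qed.

Let V_cpoly p q x : x != 0 -> V (cpoly p q) x = kernel_op k1 k2 (cpoly p q) x.
Proof.
have [n pn] := ubnP (size p); have [m qm] := ubnP (size q).
have {pn} pn : (size p <= n + m)%N by apply: leq_trans (leq_addr _ _); exact: ltnW.
have {qm} qm : (size q <= n + m)%N by apply: leq_trans (leq_addl _ _); exact: ltnW.
(* The sum serves as a common bound on both sizes, which differentiation lowers by one. *)
elim: (n + m)%N p q pn qm x => [p q|k IH p q pk qk].
  rewrite !leqn0 !size_poly_eq0 => /eqP -> /eqP -> x x0.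
  have -> : cpoly (0 : {poly R}) 0 = (fun=> 0).
    by apply/funext => t; rewrite /cpoly horner0.
  rewrite V_cst0 /kernel_op; apply/esym; apply: cint_eq0 => y _; exact: mulr0.
apply: (intertwining_step k1_gt0 k2_gt0 hV (csmooth_cpoly p q)) => x x0.
rewrite cderivn_cpoly; have sd (r : {poly R}) : (size r <= k.+1)%N -> (size (r^`(1)) <= k)%N.
  by rewrite derivn1 => rk; apply/leq_sizeP => j kj; rewrite coef_deriv nth_default ?mul0rn// (leq_trans rk).
by apply: IH; [exact: sd|exact: sd|].
Qed.

(** For fixed [x], [W f x] is continuous in the supremum norm on [|y| < |x|]; this passes the
    formula from polynomials to smooth functions. *)
Lemma kernel_op_le f g x (e : R) : x != 0 -> (forall y, ccont f y) -> (forall y, ccont g y) ->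
  (forall y, `|y| < `|x| -> cn (f y - g y) <= e) ->
  cn (kernel_op k1 k2 f x - kernel_op k1 k2 g x) <=
    2 * (e * \int[mu]_(y in [set y | `|y| < `|x|]) cn (vkernel k1 k2 x y)).
Proof.
move=> x0 cf cg fg; pose D := [set y : R | `|y| < `|x|].
have mD : msble D.
  have -> : D = `]- `|x|, `|x|[%classic.
    by apply/seteqP; split => y; rewrite /D /= in_itv/= ltr_norml.
  exact: measurable_itv.
have [If _] := kernel_op_formula k1_gt0 k2_gt0 x0 cf.
have [Ig _] := kernel_op_formula k1_gt0 k2_gt0 x0 cg.
(* Taking the function 1 gives the integrability of the kernel itself. *)
have [I1 _] := kernel_op_formula k1_gt0 k2_gt0 x0 (fun y => @ccontC R 1 y).
have {}I1 : cintegrable D (vkernel k1 k2 x).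
  by apply: eq_cintegrable I1 => // y _; rewrite mulr1.
have IK := integrableZl mD e (cintegrable_cn mD I1).
have -> : kernel_op k1 k2 f x - kernel_op k1 k2 g x =
    cint D (fun y => vkernel k1 k2 x y * f y + -1 * (vkernel k1 k2 x y * g y)).
  rewrite /kernel_op -/D; apply/esym; apply: etrans (cintD mD If (cintegrableZ (-1) mD Ig)) _.
  by rewrite (cintZ (-1) mD Ig) mulN1r.
rewrite -RintegralZl//; last exact: cintegrable_cn.
have M := cintegrable_cmeas (cintegrableD mD If (cintegrableZ (-1) mD Ig)).
have le y : D y -> cn (vkernel k1 k2 x y * f y + -1 * (vkernel k1 k2 x y * g y)) <=
    e * cn (vkernel k1 k2 x y).
  move=> Dy; rewrite mulN1r -mulrBr cnM mulrC; apply: ler_wpM2r; first exact: cn_ge0.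
  exact: fg.
exact: cint_le mD M le IK.
Qed.

Theorem intertwining_kernel f x : csmooth f -> x != 0 -> V f x = kernel_op k1 k2 f x.
Proof.
move=> sf x0; apply/eqP; rewrite -subr_eq0 -cn_eq0; apply/eqP/le_anti; rewrite cn_ge0 andbT.
apply/ler_addgt0Pl => e e0; rewrite addr0.
set I := \int[mu]_(y in [set y | `|y| < `|x|]) cn (vkernel k1 k2 x y).
have I0 : 0 <= I by apply: Rintegral_ge0 => y _; exact: cn_ge0.
pose n := (Num.truncn `|x|).+1.
have xn : `|x| <= n%:R by apply/ltW; exact: truncnS_gt.
have e2 : 0 < e / 2 by exact: divr_gt0.
have [m [d [d0 hV']]] := intertwining_continuous hV sf n e2.
(* Large enough both for the Frechet ball, where [|y| <= m], and for the domain of integration,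
   where [|y| < |x| <= n]. *)
pose M : R := (n + m)%:R; have M0 : 0 < M by rewrite ltr0n.
pose C := 4 * (I + 1); have C0 : 0 < C by rewrite mulr_gt0// ltr_wpDl.
pose r := Num.min (d / 2) (e / C).
have r0 : 0 < r by rewrite lt_min !divr_gt0.
have [p [q hpq]] := cpoly_dense m sf M0 r0.
have cf := csmooth_ccont sf; have sg := csmooth_cpoly p q; have cg := csmooth_ccont sg.
have h1 : cn (V f x - V (cpoly p q) x) <= e / 2.
  have ball : frechet_ball f m d (cpoly p q).
    move=> j t jm tm; rewrite norm_cn ltcR; apply: (@le_lt_trans _ _ (d / 2)); last by lra.
    apply: le_trans (hpq j t jm _) _; last by rewrite ge_min lexx.
    by apply: le_trans tm _; rewrite ler_nat leq_addl.
  have := hV' _ sg ball 0%N x isT xn; rewrite !cderivn0 norm_cn ltcR.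
  exact: ltW.
have h2 : cn (kernel_op k1 k2 f x - kernel_op k1 k2 (cpoly p q) x) <= e / 2.
  apply: (@le_trans _ _ (2 * (e / C * I))).
    apply: kernel_op_le => // y yx; apply: (@le_trans _ _ r); last by rewrite ge_min lexx orbT.
    have yM : `|y| <= M.
      by apply: le_trans (ltW yx) _; apply: le_trans xn _; rewrite ler_nat leq_addr.
    by have := hpq 0%N y isT yM; rewrite !cderivn0.
  have -> : 2 * (e / C * I) = e / 2 * (I / (I + 1)) by rewrite /C; field; rewrite gt_eqF// ltr_wpDl.
  by rewrite ler_piMr ?(ltW e2)// ler_pdivrMr ?ltr_wpDl// mul1r lerDl.
rewrite [leRHS]splitr; apply: le_trans (lerD h1 h2); apply: le_trans (cnB _ _).
by rewrite (V_cpoly p q x0) opprB addrA subrK.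
Qed.
End intertwining_formula.

(** * The dual operator *)
Section parametric_integrals.
Context {R : realType}.

Lemma cint_affine_itv (f : R -> R[i]) (a r M : R) : 0 < r -> cintegrable `]a, a + r * M[ f ->
  cintegrable `]0, M[ (fun s => f (r * s + a)) /\
  cint `]a, a + r * M[ f = r%:C * cint `]0, M[ (fun s => f (r * s + a)).
Proof.
move=> r0 hf.
have e s : \1_(`]a, a + r * M[%classic) (r * s + a) = \1_(`]0, M[%classic) s :> R.
  rewrite !indicE; congr ((nat_of_bool _)%:R).
  apply/idP/idP; rewrite !inE /= !in_itv/= => /andP[h1 h2]; apply/andP; split.
  - by rewrite -(ltr_pM2l r0) mulr0; lra.
  - by rewrite -(ltr_pM2l r0); lra.
  - by rewrite ltrDr mulr_gt0.
  - by rewrite addrC ltrD2l ltr_pM2l.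
have hf' : cintegrable setT (fun y => (\1_(`]a, a + r * M[%classic) y)%:C * f y).
  exact/(cintegrable_mkcond _ (msble_itv _)).
have [h1 h2] := cint_affine a r0 hf'.
have e' : (fun s => (\1_(`]a, a + r * M[%classic) (r * s + a))%:C * f (r * s + a)) =
    (fun s => (\1_(`]0, M[%classic) s)%:C * f (r * s + a)).
  by apply/funext => s; rewrite e.
rewrite e' in h1 h2; split.
  exact/(cintegrable_mkcond _ (msble_itv _)).
rewrite cint_mkcond; apply: etrans h2 _; congr (_ * _).
by apply/esym; exact: cint_mkcond.
Qed.
End parametric_integrals.

(** * Joint size and measurability of the kernel in both variables *)

Section kernel_mass_estimates.
Context {R : realType} (k1 k2 : R[i]) (k1_gt0 : 0 < Re k1) (k2_gt0 : 0 < Re k2).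
Implicit Types (x y z t s : R).

Let p := Re k1 + Re k2.

(** The interval of integration is empty; [kernel_mass] thus carries its own support condition
    [|y| < |x|] into Fubini. *)
Lemma kernel_mass_out x y : `|x| <= `|y| -> kernel_mass k1 k2 x y = 0.
Proof.
move=> xy; apply: cint_eq0 => z; rewrite /= in_itv/= => /andP[yz zx].
by have := lt_trans yz zx; rewrite ltNge xy.
Qed.

Lemma kernel_mass_affine x y t : 0 < t -> `|x| = `|y| + t ->
  kernel_mass k1 k2 x y = t%:C * cint `]0, 1[ (fun s => kernel_integrand k1 k2 x y (t * s + `|y|)).
Proof.
move=> t0 xt; have yx : `|y| < `|x| by rewrite xt ltrDl.
have := kernel_integrable k1_gt0 k2_gt0 yx.
rewrite /kernel_mass xt -[in `|y| + t](mulr1 t) => h.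
have [_ E] := cint_affine_itv t0 h.
exact: E.
Qed.

(* Under [x = |y| + t], [z = |y| + t s] the singularities no longer move
   with [y], so that one dominating function serves all [y]. *)
Lemma kernel_integrand_scaled_bound (L : R) : 0 < L -> exists2 K : R, 0 < K & forall x y t s,
  0 < t -> 0 < s < 1 -> `|x| = `|y| + t -> `|x| <= L ->
  cn (kernel_integrand k1 k2 x y (t * s + `|y|)) <=
    K * t `^ (p - 2) * ((s - 0) `^ (Re k1 - 1) * (1 - s) `^ (Re k2 - 1)).
Proof.
move=> L0; have [K K0 hK] := kernel_bound k1_gt0 k2_gt0 L0.
exists K => // x y t s t0 /andP[s0 s1] xt xL.
have ts : 0 < t * s < t by rewrite mulr_gt0//= -[ltRHS]mulr1 ltr_pM2l.
have hz : `|y| < t * s + `|y| < `|x| by rewrite xt; case/andP: ts => h1 h2; apply/andP; split; lra.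
apply: le_trans (hK _ _ _ hz xL) _; rewrite -mulrA ler_wpM2l ?(ltW K0)//.
rewrite addrK xt; have -> : `|y| + t - (t * s + `|y|) = t * (1 - s) by ring.
rewrite !powRM ?(ltW t0) ?(ltW s0) ?subr_ge0 ?(ltW s1)// subr0.
have -> : p - 2 = (Re k1 - 1) + (Re k2 - 1) by rewrite /p; ring.
by rewrite -(powR_mulD (Re k1 - 1) (Re k2 - 1) t0) mulrACA.
Qed.

(** The substitution contributes a factor [t = |x| - |y|] and the two end point powers
    [t^(p - 2)]. *)
Lemma kernel_mass_bound (L : R) : 0 < L -> exists2 K : R, 0 < K & forall x y,
  `|y| < `|x| -> `|x| <= L -> cn (kernel_mass k1 k2 x y) <= K * (`|x| - `|y|) `^ (p - 1).
Proof.
move=> L0; have [K K0 hK] := kernel_integrand_scaled_bound L0.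
pose w (s : R) := (s - 0) `^ (Re k1 - 1) * (1 - s) `^ (Re k2 - 1).
have iw : mu.-integrable `]0, 1[ (EFin \o w) := integrable_powR_product ltr01 k1_gt0 k2_gt0.
pose B := \int[mu]_(s in `]0, 1[) w s.
have B0 : 0 <= B by apply: Rintegral_ge0 => s _; rewrite mulr_ge0 ?powR_ge0.
exists (2 * K * (B + 1)); first by rewrite !mulr_gt0// ltr_wpDl.
move=> x y yx xL; pose t : R := `|x| - `|y|.
have t0 : 0 < t by rewrite subr_gt0.
have xt : `|x| = `|y| + t by rewrite addrC subrK.
rewrite (kernel_mass_affine t0 xt) cnM cnR gtr0_norm//.
have h := kernel_integrable k1_gt0 k2_gt0 yx.
have h' : cintegrable `]`|y|, `|y| + t * 1[ (kernel_integrand k1 k2 x y) by rewrite mulr1 -xt.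
have [Is _] := cint_affine_itv t0 h'.
have le s : s \in `]0, 1[ -> cn (kernel_integrand k1 k2 x y (t * s + `|y|)) <= (K * t `^ (p - 2)) * w s.
  by rewrite in_itv/= => s01; exact: hK.
have iw' := rintegrableZ (K * t `^ (p - 2)) (msble_itv `]0, 1[) iw.
have := cint_le (msble_itv _) (cintegrable_cmeas Is) le iw'.
rewrite (RintegralZl _ (msble_itv _) iw) -/B => hh.
apply: le_trans (ler_wpM2l (ltW t0) hh) _.
have -> : p - 1 = (p - 2) + 1 by ring.
rewrite -(powR_mulD (p - 2) 1 t0) powRr1 ?(ltW t0)//.
have -> : t * (2 * (K * t `^ (p - 2) * B)) = 2 * K * (t `^ (p - 2) * t) * B by ring.
have -> : 2 * K * (B + 1) * (t `^ (p - 2) * t) = 2 * K * (t `^ (p - 2) * t) * (B + 1) by ring.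
by rewrite ler_wpM2l ?lerDl// !mulr_ge0 ?powR_ge0 ?(ltW K0) ?(ltW t0).
Qed.

(** The moving interval of integration becomes an indicator in three variables, which reduces the
    claim to [cmeas_cint]. *)
Lemma cmeas_kernel_mass : cmeas setT (fun q : Rm R * Rm R => kernel_mass k1 k2 q.1 q.2).
Proof.
pose F (q : Rm R * Rm R) (z : R) : R[i] :=
  (\1_([set z : R | `|q.2| < z < `|q.1|]) z)%:C * kernel_integrand k1 k2 q.1 q.2 z.
have -> : (fun q : Rm R * Rm R => kernel_mass k1 k2 q.1 q.2) = (fun q => cint setT (F q)).
  apply/funext => q; rewrite /kernel_mass cint_mkcond.
  congr (cint setT _); apply/funext => z; rewrite /F; congr ((\1__ _)%:C * _).
apply: cmeas_cint.
have mx : measurable_fun setT (fun q : (Rm R * Rm R) * Rm R => q.1.1).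
  exact: (measurableT_comp measurable_fst measurable_fst).
have my : measurable_fun setT (fun q : (Rm R * Rm R) * Rm R => q.1.2).
  exact: (measurableT_comp measurable_snd measurable_fst).
have mz : measurable_fun setT (fun q : (Rm R * Rm R) * Rm R => q.2).
  exact: measurable_snd.
pose S := [set q : (Rm R * Rm R) * Rm R | `|q.1.2| < q.2 < `|q.1.1|].
pose G (q : (Rm R * Rm R) * Rm R) : R[i] := kernel_integrand k1 k2 q.1.1 q.1.2 q.2.
have mabs (h : (Rm R * Rm R) * Rm R -> R) : measurable_fun setT h -> measurable_fun setT (fun q => `|h q|).
  by move=> mh; exact: (measurableT_comp (@normr_measurable R setT) mh).
have mS : measurable S.
  have -> : S = ([set q | `|q.1.2| < q.2] `&` [set q | q.2 < `|q.1.1|]).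
    by apply/seteqP; split => q; rewrite /S /= => /andP.
  apply: measurableI.
    have := measurable_fun_ltr (mabs _ my) mz; move=> /(_ measurableT [set true] I).
    by rewrite setTI.
  have := measurable_fun_ltr mz (mabs _ mx); move=> /(_ measurableT [set true] I).
  by rewrite setTI.
have e : (fun q : (Rm R * Rm R) * Rm R => F q.1 q.2) = (fun q => (\1_S q)%:C * G q).
  apply/funext => q; rewrite /F /G; congr (_%:C * _); rewrite !indicE; congr (_%:R).
rewrite e; apply: (cmeas_indicM mS); apply: (@cmeasS _ _ _ S setT) => //.
rewrite /G /kernel_integrand.
have mcont (u : R -> R) (h : (Rm R * Rm R) * Rm R -> R) : continuous u ->
    measurable_fun setT h -> measurable_fun setT (fun q => u (h q)).
  by move=> cu mh; exact: (measurableT_comp (continuous_measurable_fun cu) mh).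
have mhalf (h : (Rm R * Rm R) * Rm R -> R) : measurable_fun setT h -> measurable_fun setT (fun q => h q / 2).
  by move=> mh; apply: measurable_funM => //.
have mexp := mcont _ _ (@continuous_expR R).
have mcosh := mcont _ _ (@continuous_cosh R).
have msinh := mcont _ _ (@continuous_sinh R).
apply: cmeasM; last exact: (cmeasR (msinh _ (mhalf _ mz))).
apply: cmeasM; last first.
  exact: (cmeas_cpow _ (measurable_funB (mcosh _ mx) (mcosh _ mz))).
apply: cmeasM; last first.
  exact: (cmeas_cpow _ (measurable_funB (mcosh _ (mhalf _ mz)) (mcosh _ (mhalf _ my)))).
have m2 (h : (Rm R * Rm R) * Rm R -> R) : measurable_fun setT h -> measurable_fun setT (fun q => 2 * h q).
  by move=> mh; apply: measurable_funM.
have mN (h : (Rm R * Rm R) * Rm R -> R) : measurable_fun setT h -> measurable_fun setT (fun q => - h q).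
  by move=> mh; apply: measurableT_comp mh.
have msg : measurable_fun setT (Num.sg : Rm R -> R).
  have -> : Num.sg = (fun x : R => \1_(`]0, +oo[%classic) x - \1_(`]-oo, 0[%classic) x) :> (R -> R).
    apply/funext => x; rewrite !indicE !mem_setE !in_itv/= andbT.
    have [x0|x0|x0] := ltgtP 0 x.
    - by rewrite (gtr0_sg x0) subr0.
    - by rewrite (ltr0_sg x0) sub0r.
    - by rewrite -x0 sgr0 subrr.
  by apply: measurable_funB; apply: measurable_indic; exact: msble_itv.
apply: cmeasR; apply: measurable_funM.
  exact: (measurableT_comp msg mx).
apply: measurable_funB.
  exact: (measurable_funM (mexp _ (mhalf _ mx)) (m2 _ (mcosh _ (mhalf _ mx)))).
exact: (measurable_funM (mexp _ (mN _ (mhalf _ my))) (m2 _ (mcosh _ (mhalf _ mz)))).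
Qed.
End kernel_mass_estimates.

(** * A continuous function with compact support is determined by its moments *)

Section compact_support.
Context {R : realType}.
Implicit Types (f : R -> R[i]) (u : R -> R) (M : R).

Lemma ccont_bounded f M : (forall x, ccont f x) ->
  exists2 G : R, 0 < G & forall x, `|x| <= M -> cn (f x) <= G.
Proof.
move=> cf; have cb u : continuous u ->
    exists2 G : R, 0 <= G & forall x, `|x| <= M -> `|u x| <= G.
  move=> cu; have [M0|M0] := ltP M 0.
    by exists 0 => // x xM; have := le_lt_trans xM M0; rewrite normr_lt0.
  have cu' : {within `[- M, M], continuous (fun x => `|u x|)}.
    by apply: continuous_subspaceT => x; apply: cvg_norm; exact: cu.
  have MM : - M <= M by lra.
  have [c _ hc] := EVT_max MM cu'; exists `|u c| => // x xM.
  by apply: hc; rewrite in_itv/= -ler_norml.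
have [G1 G10 h1] := cb _ (fun x => (cf x).1).
have [G2 G20 h2] := cb _ (fun x => (cf x).2).
exists (G1 + G2 + 1); first by rewrite ltr_wpDl ?addr_ge0.
move=> x xM; apply: le_trans (cn_leD _) _; apply: ler_wpDr => //.
by apply: lerD; [exact: h1|exact: h2].
Qed.

Lemma bounded_support f M : (forall x, ccont f x) -> (forall x, M <= `|x| -> f x = 0) ->
  exists2 G : R, 0 < G & forall x, cn (f x) <= G.
Proof.
move=> cf fM; have [G G0 hG] := ccont_bounded M cf; exists G => // x.
have [xM|xM] := leP `|x| M; first exact: hG.
by rewrite fM ?cn0 ?(ltW G0)// ltW.
Qed.

Lemma integrable_indic_oo (a b c : R) :
  mu.-integrable setT (EFin \o (fun x => c * \1_(`]a, b[%classic) x)).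
Proof.
by apply: rintegrableZ => //; exact: (integrable_indic_itv a b false true).
Qed.

Lemma cintegrable_support f M : (forall x, ccont f x) -> (forall x, M <= `|x| -> f x = 0) ->
  cintegrable setT f.
Proof.
move=> cf fM; have [G G0 hG] := bounded_support cf fM.
apply: cintegrable_dom (integrable_indic_oo (- M) M G) => //.
  by apply: ccont_cmeas => //; exact: openT.
move=> x _; have [xM|xM] := ltP `|x| M; last first.
  by rewrite fM// cn0 mulr_ge0 ?(ltW G0)// indicE.
by rewrite indic_oo ?mulr1// -ltr_norml.
Qed.

(** Vanishing moments pass to Lipschitz test functions by Weierstrass; a tent concentrated where [u]
    keeps a sign then gives a contradiction. *)
Lemma moment_zero u M : continuous u -> (forall x, M <= `|x| -> u x = 0) ->
  (forall p : {poly R}, \int[mu]_x (p.[x] * u x) = 0) -> forall x, u x = 0.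
Proof.
wlog M0 : M / 0 < M => [wl cu uM mu0|].
  apply: (wl (Num.max M 1)) => //; first by rewrite lt_max ltr01 orbT.
  by move=> x; rewrite ge_max => /andP[xM _]; exact: uM.
move=> cu uM mom.
have iu (h : R -> R) : continuous h -> mu.-integrable setT (EFin \o (fun x => h x * u x)).
  move=> ch; have [] := @cintegrable_support (fun x => (h x * u x)%:C) M.
  - by move=> x; apply: ccontR; apply: cvgM; [exact: ch|exact: cu].
  - by move=> x xM; rewrite uM// mulr0.
  - by [].
(* On [[-M, M]] such an [h] is a uniform limit of polynomials, and [u] vanishes elsewhere. *)
have tent (h : R -> R) : (forall x y, `|h x - h y| <= 1 * `|x - y|) -> \int[mu]_x (h x * u x) = 0.
  move=> lip; have ch : continuous h.
    move=> x; apply/cvgrPdist_lt => e e0; near=> y; apply: le_lt_trans (lip x y) _.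
    by rewrite mul1r; near: y; exact: cvgr_dist_lt.
  have iu1 : mu.-integrable setT (EFin \o u).
    by apply: eq_integrable (iu (cst 1) _) => //; [move=> x _; rewrite /= mul1r|move=> x; exact: cvg_cst].
  have ia := integrable_norm iu1.
  pose I := \int[mu]_x `|u x|; have I0 : 0 <= I by apply: Rintegral_ge0.
  apply/eqP; rewrite -normr_le0; apply/ler_addgt0Pl => /= e e0; rewrite addr0.
  have e1 : 0 < e / (I + 1) by rewrite divr_gt0// ltr_wpDl.
  have [p hp] := weierstrass_lipschitz M0 ler01 e1 (fun x y _ _ => lip x y).
  have cp : continuous (horner p) by exact: continuous_horner.
  have chp : continuous (fun x => h x - p.[x]) by move=> x; apply: cvgB; [exact: ch|exact: cp].
  have -> : \int[mu]_x (h x * u x) = \int[mu]_x ((h x - p.[x]) * u x).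
    rewrite -[LHS]subr0 -(mom p) -RintegralB//; [|exact: iu|exact: iu].
    by apply: eq_Rintegral => x _; rewrite mulrBl.
  apply: le_trans (le_normr_Rintegral measurableT (iu _ chp)) _.
  apply: (@le_trans _ _ (\int[mu]_x (e / (I + 1) * `|u x|))).
    apply: le_Rintegral => //.
    - exact: integrable_norm (iu _ chp).
    - exact: rintegrableZ.
    - move=> x _; rewrite normrM; have [xM|xM] := ltP M `|x|.
        by rewrite uM ?(ltW xM)// normr0 !mulr0.
      by rewrite ler_wpM2r// hp.
  rewrite RintegralZl// -/I mulrAC ler_pdivrMr ?ltr_wpDl//.
  by rewrite ler_wpM2l ?(ltW e0)// lerDl.
(* The sign [s] treats positive and negative values together. The tent has radius [d], within which
   [s * u] exceeds half of its value at [y]. *)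
have main (s : R) : s = 1 \/ s = -1 -> forall y, ~ 0 < s * u y.
  move=> s1 y uy; pose c := s * u y / 2.
  have c0 : 0 < c by rewrite divr_gt0.
  have csu : continuous (fun x => s * u x) by move=> x; apply: cvgM; [exact: cvg_cst|exact: cu].
  have cu' : \forall x \near y, c < s * u x.
    by apply: (cvgr_gt _ (csu y)); rewrite /c; lra.
  have [d /= d0 hd] := cu'.
  pose h x := Num.max 0 (d - `|y - x|).
  have lip x z : `|h x - h z| <= 1 * `|x - z|.
    rewrite mul1r; have h1 : `| `|y - x| - `|y - z| | <= `|x - z|.
      rewrite (_ : x - z = (y - z) - (y - x)); last by ring.
      rewrite [leRHS]distrC; exact: ler_dist_dist.
    move: h1; rewrite /h; move: `|y - x| `|y - z| `|x - z| => a b r; rewrite ler_norml => /andP[h1 h2].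
    have [q1|q1] := leP 0 (d - a); have [q2|q2] := leP 0 (d - b); rewrite ler_norml; apply/andP; split; lra.
  have h0 := tent _ lip.
  have ch : continuous h.
    move=> x; apply/cvgrPdist_lt => e e0; near=> z; apply: le_lt_trans (lip x z) _.
    by rewrite mul1r; near: z; exact: cvgr_dist_lt.
  pose D : set R := `]y - d / 2, y + d / 2[%classic.
  have : \int[mu]_x (d / 2 * c * \1_D x) <= \int[mu]_x (s * (h x * u x)).
    apply: le_Rintegral => //.
    - exact: integrable_indic_oo.
    - exact: rintegrableZ (iu _ ch).
    - move=> x _; have [Dx|nDx] := pselect (D x).
        rewrite indic_in// mulr1 [leRHS]mulrCA.
        move: Dx; rewrite /D /= in_itv/= => /andP[x1 x2].
        have xd : `|y - x| < d / 2 by rewrite ltr_norml; apply/andP; split; lra.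
        have hx : d / 2 <= h x by rewrite /h le_max; apply/orP; right; lra.
        have ux : c <= s * u x.
          by apply/ltW/hd; rewrite /ball_ /=; lra.
        by apply: ler_pM => //; [lra|exact: (ltW c0)].
      rewrite indic_out// mulr0 [leRHS]mulrCA.
      have [xd|xd] := ltP `|y - x| d.
        by rewrite mulr_ge0 ?le_max ?lexx// ltW// (lt_trans c0)//; exact: hd.
      by rewrite /h max_l ?mul0r// subr_le0.
  rewrite [leRHS](RintegralZl _ measurableT (iu _ ch)) h0 mulr0 leNgt => /negP; apply.
  rewrite (RintegralZl _ measurableT (integrable_indic_itv _ _ false true)) /Rintegral.
  rewrite integral_indic //.
  have hm : mu (`]y - d / 2, y + d / 2[%classic : set R) = d%:E.
    rewrite lebesgue_measure_itv /= lte_fin ifT; last by lra.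
    by rewrite -EFinB; congr EFin; lra.
  have -> : fine (mu (`]y - d / 2, y + d / 2[%classic `&` [set: Rm R])) = d.
    transitivity (fine (mu (`]y - d / 2, y + d / 2[%classic : set R))); last by rewrite hm.
    by congr (fine (mu _)); exact: setIT.
  have d2 : 0 < d / 2 by exact: divr_gt0.
  exact: (mulr_gt0 (mulr_gt0 d2 c0) d0).
move=> x; apply/eqP; case: (ltgtP (u x) 0) => // ux; exfalso.
  by apply: (main (-1) (or_intror erefl) x); rewrite mulN1r oppr_gt0.
by apply: (main 1 (or_introl erefl) x); rewrite mul1r.
Unshelve. all: by end_near.
Qed.
End compact_support.

(** * The transposed kernel *)

Section dual_kernel_operator.
Context {R : realType} (k1 k2 : R[i]) (k1_gt0 : 0 < Re k1) (k2_gt0 : 0 < Re k2).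
Implicit Types (x y z t s e : R) (f g : R -> R[i]).

Let p := Re k1 + Re k2.
Let p_gt0 : 0 < p. Proof. exact: addr_gt0. Qed.

Let sgM e y t : `|e| = 1 -> 0 < t -> `|e * (`|y| + t)| = `|y| + t /\ Num.sg (e * (`|y| + t)) = e.
Proof.
move=> e1 t0; have yt : 0 < `|y| + t by rewrite ltr_wpDl.
split; first by rewrite normrM e1 mul1r gtr0_norm.
by rewrite sgrM (gtr0_sg yt) mulr1 [RHS]numEsg e1 mulr1.
Qed.

(** For fixed [t], the point [x = e (|y| + t)] moves along with [y]; on this curve the mass is an
    integral over a fixed interval with a dominating function free of [y]. *)
Lemma ccont_kernel_mass e t (a : R) : `|e| = 1 -> 0 < t ->
  ccont (fun y => kernel_mass k1 k2 (e * (`|y| + t)) y) a.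
Proof.
move=> e1 t0; pose ki y s := kernel_integrand k1 k2 (e * (`|y| + t)) y (t * s + `|y|).
have -> : (fun y => kernel_mass k1 k2 (e * (`|y| + t)) y) = (fun y => t%:C * cint `]0, 1[ (ki y)).
  by apply/funext => y; apply: (kernel_mass_affine k1_gt0 k2_gt0 t0); exact: (sgM y e1 t0).1.
apply: ccontM; first exact: ccontC.
pose L : R := `|a| + 1 + t; have L0 : 0 < L by rewrite ltr_wpDl// ltr_wpDl.
have [K K0 hK] := kernel_integrand_scaled_bound k1_gt0 k2_gt0 L0.
pose w (s : R) := (s - 0) `^ (Re k1 - 1) * (1 - s) `^ (Re k2 - 1).
have iw : mu.-integrable `]0, 1[ (EFin \o w) := integrable_powR_product ltr01 k1_gt0 k2_gt0.
have iw' := rintegrableZ (K * t `^ (p - 2)) (msble_itv `]0, 1[) iw.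
have aI : a - 1 < a < a + 1 by apply/andP; split; lra.
apply: (@ccont_cint R ki _ _ (a - 1) (a + 1) a (msble_itv _) _ _ _ iw' aI).
- move=> y _; have [yt _] := sgM y e1 t0.
  have yx : `|y| < `|e * (`|y| + t)| by rewrite yt ltrDl.
  have h := kernel_integrable k1_gt0 k2_gt0 yx.
  have h' : cintegrable `]`|y|, `|y| + t * 1[ (kernel_integrand k1 k2 (e * (`|y| + t)) y).
    by rewrite mulr1 -[X in `]_, X[]yt.
  have [Is _] := cint_affine_itv t0 h'.
  exact: cintegrable_cmeas Is.
- move=> y s _; rewrite /= in_itv/= => /andP[s0 s1].
  have cn_ : continuous (fun y : R => `|y|) by move=> u; exact: norm_continuous.
  have cx : continuous (fun y : R => e * (`|y| + t)).
    by move=> u; apply: cvgM; [exact: cvg_cst|apply: cvgD; [exact: cn_|exact: cvg_cst]].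
  have cz : continuous (fun y : R => t * s + `|y|).
    by move=> u; apply: cvgD; [exact: cvg_cst|exact: cn_].
  have ch (h : R -> R) : continuous h -> continuous (fun y : R => h y / 2).
    by move=> hh u; apply: cvgM; [exact: hh|exact: cvg_cst].
  have cc (F h : R -> R) : continuous F -> continuous h -> continuous (fun y : R => F (h y)).
    by move=> cF hh u; apply: continuous_comp; [exact: hh|exact: cF].
  have cN (h : R -> R) : continuous h -> continuous (fun y : R => - h y).
    by move=> hh u; apply: cvgN; exact: hh.
  have cM (h h' : R -> R) : continuous h -> continuous h' -> continuous (fun y : R => h y * h' y).
    by move=> hh hh' u; apply: cvgM; [exact: hh|exact: hh'].
  have cB (h h' : R -> R) : continuous h -> continuous h' -> continuous (fun y : R => h y - h' y).
    by move=> hh hh' u; apply: cvgB; [exact: hh|exact: hh'].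
  have cC (c : R) : continuous (fun _ : R => c) by move=> u; exact: cvg_cst.
  have cid : continuous (fun y : R => y) by move=> u; exact: cvg_id.
  have cch := @continuous_cosh R; have csh := @continuous_sinh R; have cex := @continuous_expR R.
  (* The sign in [ksigma] is the constant [e] along the curve; without it every factor is visibly
     continuous in [y]. *)
  have -> : ki ^~ s = (fun y => (e * (expR (e * (`|y| + t) / 2) * (2 * cosh (e * (`|y| + t) / 2))
      - expR (- (y / 2)) * (2 * cosh ((t * s + `|y|) / 2))))%:C *
      cpow (cosh ((t * s + `|y|) / 2) - cosh (y / 2)) (k1 - 1) *
      cpow (cosh (e * (`|y| + t)) - cosh (t * s + `|y|)) (k2 - 1) *
      (sinh ((t * s + `|y|) / 2))%:C).
    by apply/funext => u; rewrite /ki /kernel_integrand /ksigma (sgM u e1 t0).2.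
  have zy : `|y| < t * s + `|y| by rewrite ltrDr mulr_gt0.
  have zx : t * s + `|y| < `|y| + t by rewrite addrC ltrD2l -[ltRHS]mulr1 ltr_pM2l.
  apply: ccontM; last by apply: ccontR; exact: (cc _ _ csh (ch _ cz)).
  apply: ccontM.
    apply: ccontM.
      apply: ccontR; apply: (cM _ _ (cC e)); apply: cB.
        exact: (cM _ _ (cc _ _ cex (ch _ cx)) (cM _ _ (cC 2) (cc _ _ cch (ch _ cx)))).
      exact: (cM _ _ (cc _ _ cex (cN _ (ch _ cid))) (cM _ _ (cC 2) (cc _ _ cch (ch _ cz)))).
    apply: ccont_cpow; first exact: (cB _ _ (cc _ _ cch (ch _ cz)) (cc _ _ cch (ch _ cid))).
    have -> : cosh (y / 2) = cosh (`|y| / 2).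
      by rewrite -[in LHS]cosh_abs normrM (ger0_norm (_ : 0 <= 2^-1))// invr_ge0.
    exact: (abel_weight_lt (@abel_weight_cosh_half R) (normr_ge0 y) zy).
  apply: ccont_cpow; first exact: (cB _ _ (cc _ _ cch cx) (cc _ _ cch cz)).
  rewrite -[cosh (e * _)]cosh_abs (sgM y e1 t0).1.
  by apply: (abel_weight_lt (@abel_weight_cosh R) _ zx); exact: le_trans (normr_ge0 y) (ltW zy).
- move=> y s /andP[ya1 ya2]; rewrite /= in_itv/= => s01.
  apply: hK => //; rewrite (sgM y e1 t0).1// lerD2r.
  have : `|y - a| <= 1 by rewrite ler_norml; apply/andP; split; lra.
  have := ler_normD (y - a) a; rewrite subrK; lra.
Qed.

Local Opaque kernel_mass.

Let msble_abs (A B : R) : msble [set x : R | A < `|x| < B].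
Proof.
have mn : measurable_fun setT (fun x : Rm R => `|x|) by exact: (@normr_measurable R setT).
have := mn measurableT `]A, B[%classic (measurable_itv _); rewrite setTI.
by congr (measurable _); apply/seteqP; split => x; rewrite /= in_itv.
Qed.

Let msble_absr (A : R) : msble [set x : R | A < `|x|].
Proof.
have mn : measurable_fun setT (fun x : Rm R => `|x|) by exact: (@normr_measurable R setT).
have := mn measurableT `]A, +oo[%classic (measurable_itv _); rewrite setTI.
by congr (measurable _); apply/seteqP; split => x; rewrite /= in_itv/= andbT.
Qed.

Definition dual_mass g y : R[i] := cint [set x | `|y| < `|x|] (fun x => kernel_mass k1 k2 x y * g x).

Section test_function.
Context (g : R -> R[i]) (M : R) (M_gt0 : 0 < M).
Hypotheses (cg : forall x, ccont g x) (gM : forall x, M <= `|x| -> g x = 0).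

(** The substitution [|x| = |y| + t] frees the domain of [y]; since [g] vanishes for [|x| >= M], it
    is enough to let [t] run through []0, M[]. *)
Lemma dual_mass_formula y :
  cintegrable [set x | `|y| < `|x|] (fun x => kernel_mass k1 k2 x y * g x) /\
  dual_mass g y = cint `]0, M[ (fun t =>
    kernel_mass k1 k2 (1 * (`|y| + t)) y * g (1 * (`|y| + t)) +
    kernel_mass k1 k2 (-1 * (`|y| + t)) y * g (-1 * (`|y| + t))).
Proof.
pose a : R := `|y|; have a0 : 0 <= a by rewrite /a.
pose D : set R := `]a, a + M[%classic; pose F x := kernel_mass k1 k2 x y * g x.
have mD : msble D by exact: msble_itv.
have aM : 0 < a + M by exact: ltr_wpDl.
have [G G0 hG] := bounded_support cg gM.
have [K K0 hK] := kernel_mass_bound k1_gt0 k2_gt0 aM.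
have [iw _] := @integral_powR_left R a (a + M) p (ltr_pwDr M_gt0 (lexx a)) p_gt0.
have half e : `|e| = 1 -> cintegrable D (fun x => F (e * x)).
  move=> e1; apply: cintegrable_dom (rintegrableZ (K * G) mD iw) => //.
    apply: (@cmeasS _ _ _ D setT) => //; apply: cmeasM.
      have me : measurable_fun setT (fun x : Rm R => ((e * x : R), y) : Rm R * Rm R).
        by apply: measurable_fun_pair => //; exact: measurable_funM.
      exact: (cmeas_comp me (cmeas_kernel_mass k1 k2)).
    apply: ccont_cmeas; first exact: openT.
    move=> x _; apply: ccont_comp; last exact: cg.
    by apply: cvgM; [exact: cvg_cst|exact: cvg_id].
  move=> x; rewrite /D /= in_itv/= => /andP[ax xM].
  have ex : `|e * x| = x by rewrite normrM e1 mul1r gtr0_norm// (le_lt_trans a0).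
  rewrite /F cnM mulrAC; apply: ler_pM; rewrite ?cn_ge0 ?hG//.
  by have := hK (e * x) y; rewrite ex; apply => //; exact: ltW.
have i1 : cintegrable D F.
  have <- : (fun x => F (1 * x)) = F by apply/funext => x; rewrite mul1r.
  exact: half (normr1 _).
have i2 : cintegrable D (fun x => F (- x)).
  have <- : (fun x => F (-1 * x)) = (fun x => F (- x)) by apply/funext => x; rewrite mulN1r.
  exact: half (normrN1 _).
pose S := [set x : R | a < `|x| < a + M].
have D0 x : D x -> 0 < x by rewrite /D /= in_itv/= => /andP[ax _]; exact: le_lt_trans ax.
have DS x : S x <-> D x \/ D (- x).
  rewrite /S /D /= !in_itv/=; split.
    by have [x0|x0] := leP 0 x; [rewrite ger0_norm//; left|rewrite ltr0_norm//; right].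
  move=> [h|h]; first by rewrite gtr0_norm//; case/andP: h => ax _; exact: le_lt_trans ax.
  by rewrite -normrN gtr0_norm//; case/andP: h => ax _; exact: le_lt_trans ax.
have mS := msble_abs a (a + M).
have [iS eS] := cint_reflect mD mS D0 DS i1 i2.
(* Cutting [|x| > |y|] down to [|y| < |x| < |y| + M] loses nothing, as [g] vanishes beyond [M]. *)
have eF : (fun x => (\1_[set x | a < `|x|] x)%:C * F x) = (fun x => (\1_S x)%:C * F x).
  apply/funext => x; have [Sx|nSx] := pselect (S x).
    by rewrite (indic_in Sx) indic_in//; case/andP: Sx.
  rewrite (indic_out nSx) mul0r; have [ax|ax] := ltP a `|x|; last first.
    by rewrite indic_out ?mul0r//= => h; move: ax; rewrite leNgt h.
  rewrite /F gM ?mulr0//; rewrite leNgt; apply/negP => xM; apply: nSx.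
  by rewrite /S /= ax ltr_wpDl.
split.
  apply/(cintegrable_mkcond _ (msble_absr a)); rewrite eF.
  exact/(cintegrable_mkcond _ mS).
rewrite /dual_mass -/a [LHS]cint_mkcond eF -[LHS]cint_mkcond eS.
have iD := cintegrableD mD i1 i2.
have eaM : a + 1 * M = a + M by rewrite mul1r.
have iD' : cintegrable `]a, a + 1 * M[ (fun x => F x + F (- x)) by rewrite eaM.
have [_] := cint_affine_itv ltr01 iD'; rewrite eaM -/D rmorph1 mul1r => ->.
by apply: eq_cint => t _; rewrite /F -/a !mul1r mulN1r [a + t]addrC.
Qed.

(** Continuity is what lets the vanishing of all moments be read pointwise in [moment_zero]. *)
Lemma ccont_dual_mass (b : R) : ccont (dual_mass g) b.
Proof.
pose F y t := kernel_mass k1 k2 (1 * (`|y| + t)) y * g (1 * (`|y| + t)) +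
  kernel_mass k1 k2 (-1 * (`|y| + t)) y * g (-1 * (`|y| + t)).
have -> : dual_mass g = (fun y => cint `]0, M[ (F y)).
  by apply/funext => y; exact: (dual_mass_formula y).2.
have [G G0 hG] := bounded_support cg gM.
pose L : R := `|b| + 1 + M; have L0 : 0 < L by rewrite ltr_wpDl// ltr_wpDl.
have [K K0 hK] := kernel_mass_bound k1_gt0 k2_gt0 L0.
have [iw _] := integral_powR_left M_gt0 p_gt0.
have bI : b - 1 < b < b + 1 by apply/andP; split; lra.
apply: (@ccont_cint R F _ _ (b - 1) (b + 1) b (msble_itv _) _ _ _
  (rintegrableZ (2 * (K * G)) (msble_itv _) iw) bI).
- move=> y _; apply: (@cmeasS _ _ _ _ setT) => //.
  have half e : cmeas setT (fun t : Rm R => kernel_mass k1 k2 (e * (`|y| + t)) y * g (e * (`|y| + t))).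
    have mt : measurable_fun setT (fun t : Rm R => (e * (`|y| + t) : R)).
      by apply: measurable_funM => //; exact: measurable_funD.
    apply: cmeasM.
      have me : measurable_fun setT (fun t : Rm R => ((e * (`|y| + t) : R), y) : Rm R * Rm R).
        exact: measurable_fun_pair.
      exact: (cmeas_comp me (cmeas_kernel_mass k1 k2)).
    apply: ccont_cmeas; first exact: openT.
    move=> x _; apply: ccont_comp; last exact: cg.
    by apply: cvgM; [exact: cvg_cst|apply: cvgD; [exact: cvg_cst|exact: cvg_id]].
  exact: cmeasD (half 1) (half (-1)).
- move=> y t _; rewrite /= in_itv/= => /andP[t0 _].
  have half e : `|e| = 1 -> ccont (fun y => kernel_mass k1 k2 (e * (`|y| + t)) y * g (e * (`|y| + t))) y.
    move=> e1; apply: ccontM; first exact: ccont_kernel_mass.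
    apply: ccont_comp; last exact: cg.
    by apply: cvgM; [exact: cvg_cst|apply: cvgD; [exact: norm_continuous|exact: cvg_cst]].
  exact: ccontD (half 1 (normr1 _)) (half (-1) (normrN1 _)).
- move=> y t /andP[yb1 yb2]; rewrite /= in_itv/= => /andP[t0 tM].
  have yb : `|y| <= `|b| + 1.
    have : `|y - b| <= 1 by rewrite ler_norml; apply/andP; split; lra.
    by have := ler_normD (y - b) b; rewrite subrK; lra.
  have half e : `|e| = 1 -> cn (kernel_mass k1 k2 (e * (`|y| + t)) y * g (e * (`|y| + t))) <=
      K * G * (t - 0) `^ (p - 1).
    move=> e1; have [h1 _] := sgM y e1 t0.
    rewrite cnM mulrAC subr0; apply: ler_pM; rewrite ?cn_ge0 ?hG//.
    have := hK (e * (`|y| + t)) y; rewrite h1 [`|y| + t - `|y|]addrAC subrr add0r; apply.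
      by rewrite ltrDl.
    by rewrite /L; lra.
  have calc (u v c r : R) : u <= c * r -> v <= c * r -> u + v <= 2 * c * r by lra.
  exact: le_trans (cnD _ _) (calc _ _ _ _ (half 1 (normr1 _)) (half (-1) (normrN1 _))).
Qed.

Lemma dual_mass_out y : M <= `|y| -> dual_mass g y = 0.
Proof.
move=> yM; apply: cint_eq0 => x /= yx; rewrite gM ?mulr0//.
exact: le_trans yM (ltW yx).
Qed.

Lemma kernel_mass_fubini f : (forall y, ccont f y) ->
  cintegrable setT (fun x => cint [set y | `|y| < `|x|] (fun y => kernel_mass k1 k2 x y * f y) * g x) /\
  cint setT (fun x => cint [set y | `|y| < `|x|] (fun y => kernel_mass k1 k2 x y * f y) * g x) =
  cint setT (fun y => f y * dual_mass g y).
Proof.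
move=> cf; have [Gf Gf0 hf] := ccont_bounded M cf; have [G G0 hG] := bounded_support cg gM.
have [K K0 hK] := kernel_mass_bound k1_gt0 k2_gt0 M_gt0.
pose F x y := kernel_mass k1 k2 x y * f y * g x.
have mF : cmeas setT (fun q : Rm R * Rm R => F q.1 q.2).
  apply: cmeasM; first apply: cmeasM; first exact: cmeas_kernel_mass.
    apply: (cmeas_comp measurable_snd); apply: ccont_cmeas => //; exact: openT.
  apply: (cmeas_comp measurable_fst); apply: ccont_cmeas => //; exact: openT.
pose B := K * (Gf * G); have B0 : 0 < B by rewrite !mulr_gt0.
(* The integral of [(X + y)^(p-1) + (X - y)^(p-1)] over []-X, X[] is [2 (2X)^p / p], and
   [X = |x| < M]. One of the two summands is [(X - |y|)^(p-1)], the bound on the kernel. *)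
pose C := B * (2 * ((2 * M) `^ p / p)).
have C0 : 0 <= C by exact: mulr_ge0 (ltW B0) (mulr_ge0 (ler0n _ _) (divr_ge0 (powR_ge0 _ _) (ltW p_gt0))).
have F0 x y : `|x| <= `|y| -> F x y = 0 by move=> xy; rewrite /F (kernel_mass_out k1 k2 xy) !mul0r.
have bF x : (\int[mu]_y (cn (F x y))%:E <= (C * \1_(`]- M, M[%classic) x)%:E)%E.
  have [xM|xM] := ltP `|x| M; last first.
    rewrite integral0_eq; first by rewrite lee_fin mulr_ge0// indicE.
    by move=> y _; rewrite /F gM// mulr0 cn0.
  rewrite indic_oo -?ltr_norml// mulr1; have [->|x0] := eqVneq x 0.
    rewrite integral0_eq; first by rewrite lee_fin.
    by move=> y _; rewrite F0 ?cn0// normr0.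
  pose X : R := `|x|; have X0 : 0 < X by rewrite normr_gt0.
  have NX : - X < X by rewrite gtrN.
  have [i1 v1] := integral_powR_left NX p_gt0; have [i2 v2] := integral_powR_right NX p_gt0.
  have m := msble_itv `]- X, X[.
  pose h1 y := (y - - X) `^ (p - 1); pose h2 y := (X - y) `^ (p - 1).
  have i12 : mu.-integrable `]- X, X[ (EFin \o (fun y => h1 y + h2 y)).
    by have := integrableD m i1 i2; apply: eq_integrable.
  apply: (@le_trans _ _ (\int[mu]_(y in `]- X, X[) (B * (h1 y + h2 y)))%:E).
    apply: le_integral_support (rintegrableZ B m i12) _ _ _ => //.
    - exact: (measurableT_comp (cmeas_cn mF) (pair1_measurable x)).
    - by move=> y; exact: cn_ge0.
    - move=> y; rewrite /= in_itv/= => /andP[y1 y2].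
      have yX : `|y| < X by rewrite ltr_norml y1.
      have le_h : (X - `|y|) `^ (p - 1) <= h1 y + h2 y.
        rewrite /h1 /h2; have [y0|y0] := leP 0 y.
          by rewrite ger0_norm// lerDr powR_ge0.
        by rewrite ltr0_norm// !opprK addrC lerDl powR_ge0.
      rewrite /F !cnM /B.
      have fy : cn (f y) <= Gf by apply: hf; exact: ltW (lt_trans yX xM).
      have kxy := hK _ _ yX (ltW xM).
      apply: (@le_trans _ _ (K * (X - `|y|) `^ (p - 1) * Gf * G)).
        apply: ler_pM; rewrite ?hG ?mulr_ge0 ?cn_ge0//.
        by apply: ler_pM => //; exact: cn_ge0.
      rewrite -!mulrA ler_wpM2l ?(ltW K0)// mulrC -!mulrA.
      by rewrite ler_wpM2l ?(ltW Gf0)// ler_wpM2l// ltW.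
    - move=> y; rewrite /= in_itv/= => /negP; rewrite -ltr_norml -leNgt => yX.
      by rewrite F0 ?cn0.
  rewrite lee_fin (RintegralZl _ m i12) (RintegralD _ i1 i2)//.
  rewrite v1 v2 opprK /C ler_wpM2l ?(ltW B0)// -mulr2n.
  rewrite [leRHS]mulr_natl; apply: ler_wMn2r; apply: ler_wpM2r.
    by rewrite invr_ge0 (ltW p_gt0).
  rewrite ge0_ler_powR ?nnegrE ?(ltW p_gt0)//; rewrite /X.
  - by rewrite addr_ge0.
  - by rewrite mulr_ge0// ltW.
  - by rewrite mulr_natl mulr2n; exact: lerD (ltW xM) (ltW xM).
have [j1 _ E] := cint_fubini mF bF (integrable_indic_oo (- M) M C).
have e1 : (fun x => cint setT (F x)) =
    (fun x => cint [set y | `|y| < `|x|] (fun y => kernel_mass k1 k2 x y * f y) * g x).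
  apply/funext => x; have eF : (fun y => (\1_[set y | `|y| < `|x|] y)%:C * (kernel_mass k1 k2 x y * f y)) =
      (fun y => kernel_mass k1 k2 x y * f y).
    apply/funext => y; have [xy|xy] := ltP `|y| `|x|.
      by rewrite (indic_in (xy : [set y : R | `|y| < `|x|] y)) mul1r.
    by rewrite (kernel_mass_out k1 k2 xy) mul0r mulr0.
  rewrite [in RHS]cint_mkcond eF mulrC.
  have ix : cintegrable setT (fun y => kernel_mass k1 k2 x y * f y).
    have [x0|x0] := eqVneq x 0.
      have x0y (y : R) : `|x| <= `|y| by rewrite x0 normr0.
      have -> : (fun y => kernel_mass k1 k2 x y * f y) = (fun=> 0).
        by apply/funext => t; rewrite (kernel_mass_out k1 k2 (x0y t)) mul0r.
      apply: (@cintegrable_support R (fun=> 0) 0) => [y|y _]; first exact: ccontC.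
      by [].
    have [I _] := kernel_mass_integral k1_gt0 k2_gt0 x0 cf.
    have mS : msble [set y : R | `|y| < `|x|].
      have -> : [set y : R | `|y| < `|x|] = `]- `|x|, `|x|[%classic.
        by apply/seteqP; split => y; rewrite /= in_itv/= ltr_norml.
      exact: msble_itv.
    have := proj1 (cintegrable_mkcond _ mS) I; by rewrite eF.
  apply: etrans (cintZ (g x) measurableT ix).
  by congr (cint setT _); apply/funext => y; rewrite /F mulrC.
have e2 : (fun y => cint setT (F ^~ y)) = (fun y => f y * dual_mass g y).
  apply/funext => y; have eF : (fun x => (\1_[set x | `|y| < `|x|] x)%:C * (kernel_mass k1 k2 x y * g x)) =
      (fun x => kernel_mass k1 k2 x y * g x).
    apply/funext => x; have [xy|xy] := ltP `|y| `|x|.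
      by rewrite (indic_in (xy : [set x : R | `|y| < `|x|] x)) mul1r.
    by rewrite (kernel_mass_out k1 k2 xy) mul0r mulr0.
  rewrite /dual_mass [in RHS]cint_mkcond eF.
  have iy : cintegrable setT (fun x => kernel_mass k1 k2 x y * g x).
    by have := proj1 (cintegrable_mkcond _ (msble_absr `|y|)) (dual_mass_formula y).1; rewrite eF.
  apply: etrans (cintZ (f y) measurableT iy).
  congr (cint setT _); apply/funext => x; rewrite /F.
  by rewrite -mulrA mulrCA.
rewrite e1 in j1 E; rewrite e2 in E; exact: conj j1 E.
Qed.

End test_function.
End dual_kernel_operator.

Section dual_operator.
Context {R : realType} (k1 k2 : R[i]) (k1_gt0 : 0 < Re k1) (k2_gt0 : 0 < Re k2).
Context (V : (R -> R[i]) -> (R -> R[i])) (hV : intertwining k1 k2 V).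
Implicit Types (f g : R -> R[i]) (x y : R).

Let c := kconst k1 k2 / 4.

Let vkernelE x y : vkernel k1 k2 x y = c * (weight k1 k2 x)^-1 * kernel_mass k1 k2 x y.
Proof. by []. Qed.

Local Opaque kconst vkernel weight.

Let msble_abs_lt x : msble [set y : R | `|y| < `|x|].
Proof.
have -> : [set y : R | `|y| < `|x|] = `]- `|x|, `|x|[%classic.
  by apply/seteqP; split => y; rewrite /= in_itv/= ltr_norml.
exact: msble_itv.
Qed.

Let pairing_kernel f g M : 0 < M -> csmooth f -> (forall x, ccont g x) ->
  (forall x, M <= `|x| -> g x = 0) ->
  cint setT (fun x => V f x * g x * weight k1 k2 x) =
  cint setT (fun y => f y * (c * dual_mass k1 k2 g y)).
Proof.
move=> M0 sf cg gM; have cf := csmooth_ccont sf.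
have [I E] := kernel_mass_fubini k1_gt0 k2_gt0 M0 cg gM cf.
pose Q x := cint [set y | `|y| < `|x|] (fun y => kernel_mass k1 k2 x y * f y) * g x.
have iQ : cintegrable setT (fun x => c * Q x) by exact: (cintegrableZ c measurableT I).
have eQ x : x != 0 -> V f x * g x * weight k1 k2 x = c * Q x.
  move=> x0; rewrite (intertwining_kernel k1_gt0 k2_gt0 hV sf x0) /kernel_op.
  have [J _] := kernel_mass_integral k1_gt0 k2_gt0 x0 cf.
  have -> : (fun y => vkernel k1 k2 x y * f y) =
      (fun y => c * (weight k1 k2 x)^-1 * (kernel_mass k1 k2 x y * f y)).
    by apply/funext => y; rewrite vkernelE mulrA.
  have calc (a w K u : R[i]) : w != 0 -> a * w^-1 * K * u * w = a * (K * u).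
    by move=> w0; field.
  have -> : cint [set y | `|y| < `|x|] (fun y => c * (weight k1 k2 x)^-1 * (kernel_mass k1 k2 x y * f y)) =
      c * (weight k1 k2 x)^-1 * cint [set y | `|y| < `|x|] (fun y => kernel_mass k1 k2 x y * f y).
    exact: cintZ (msble_abs_lt x) J.
  exact: calc (weight_neq0 k1 k2 x).
(* The formula for [V f] is available for [x != 0] only, so the integrals are compared off this null
   point. *)
have m0 : msble ([set: R] `\ 0) by apply: measurableD => //; exact: measurable_set1.
have iQ0 : cintegrable (setT `\ 0) (fun x => c * Q x).
  exact: cintegrableS measurableT m0 (@subsetT _ _) iQ.
have eQ0 : {in setT `\ 0, (fun x => c * Q x) =1 (fun x => V f x * g x * weight k1 k2 x)}.
  by move=> x; rewrite inE => -[_ /= /eqP x0]; rewrite (eQ x x0).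
have iV0 := eq_cintegrable m0 eQ0 iQ0.
have [_ e1] := cint_setD1 measurableT iV0; have [_ e2] := cint_setD1 measurableT iQ0.
have cD := ccont_dual_mass k1_gt0 k2_gt0 M0 cg gM.
have iD : cintegrable setT (fun y => f y * dual_mass k1 k2 g y).
  apply: (@cintegrable_support _ _ M) => [y|y yM]; first by apply: ccontM; [exact: cf|exact: cD].
  by rewrite (dual_mass_out k1 k2 gM yM) mulr0.
have e3 := cintZ c measurableT I; have e4 := cintZ c measurableT iD.
apply: (etrans e1); apply: (etrans (esym (eq_cint eQ0))); apply: (etrans (esym e2)).
apply: (etrans e3); rewrite E; apply: (etrans (esym e4)).
by congr (cint setT _); apply/funext => y; rewrite mulrCA.
Qed.

Theorem dual_kernel Vt g y : dual_intertwining k1 k2 V Vt -> ctest g ->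
  cintegrable [set x | `|y| < `|x|] (fun x => vkernel k1 k2 x y * g x * weight k1 k2 x) /\
  Vt g y = cint [set x | `|y| < `|x|] (fun x => vkernel k1 k2 x y * g x * weight k1 k2 x).
Proof.
move=> hVt tg; have [sg [M1 gM1]] := tg; have [sh [M2 hM2]] := dual_test hVt tg.
(* A common bound for the supports of [g] and [Vt g]; the added 1 makes it positive and allows the
   weak inequality [M <= |x|]. *)
pose M : R := Num.max 0 (Num.max M1 M2) + 1.
have M0 : 0 < M by rewrite ltr_wpDl// le_max lexx.
have M1M : M1 < M by rewrite /M ltr_pwDr// !le_max lexx orbT.
have M2M : M2 < M by rewrite /M ltr_pwDr// !le_max lexx !orbT.
have gM x : M <= `|x| -> g x = 0 by move=> xM; apply: gM1; exact: lt_le_trans xM.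
have hM x : M <= `|x| -> Vt g x = 0 by move=> xM; apply: hM2; exact: lt_le_trans xM.
have cg := csmooth_ccont sg; have ch := csmooth_ccont sh.
have cD := ccont_dual_mass k1_gt0 k2_gt0 M0 cg gM.
have [I E] := dual_mass_formula k1_gt0 k2_gt0 M0 cg gM y.
have mS : msble [set x : R | `|y| < `|x|].
  have -> : [set x : R | `|y| < `|x|] = ~` `[- `|y|, `|y|]%classic.
    apply/seteqP; split => x; rewrite /= in_itv/= -ler_norml; first by rewrite ltNge => /negP.
    by move/negP; rewrite -ltNge.
  by apply: measurableC; exact: msble_itv.
have eS : (fun x => c * (kernel_mass k1 k2 x y * g x)) =
    (fun x => vkernel k1 k2 x y * g x * weight k1 k2 x).
  apply/funext => x; rewrite vkernelE.
  have calc (a w K u : R[i]) : w != 0 -> a * (K * u) = a * w^-1 * K * u * w.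
    by move=> w0; field.
  exact: calc (weight_neq0 k1 k2 x).
rewrite -eS; split; first exact: (cintegrableZ c mS I).
apply: etrans (esym (cintZ c mS I)); rewrite -/(dual_mass k1 k2 g y).
pose D x := Vt g x + -1 * (c * dual_mass k1 k2 g x).
have cDD x : ccont D x.
  apply: ccontD; first exact: ch.
  by apply: ccontM; [exact: ccontC|apply: ccontM; [exact: ccontC|exact: cD]].
have DM x : M <= `|x| -> D x = 0.
  by move=> xM; rewrite /D (hM _ xM) (dual_mass_out k1 k2 gM xM) !mulr0 addr0.
(* The test polynomials are real-valued, so that the moments of the real and of the imaginary part
   of [D] vanish separately. *)
have mom (p : {poly R}) : cint setT (fun x => cpoly p 0 x * D x) = 0.
  have sp := csmooth_cpoly p 0; have cp := csmooth_ccont sp.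
  have i1 : cintegrable setT (fun x => cpoly p 0 x * Vt g x).
    apply: (@cintegrable_support _ _ M) => [x|x xM]; first by apply: ccontM; [exact: cp|exact: ch].
    by rewrite (hM _ xM) mulr0.
  have i2 : cintegrable setT (fun x => cpoly p 0 x * (c * dual_mass k1 k2 g x)).
    apply: (@cintegrable_support _ _ M) => [x|x xM].
      by apply: ccontM; [exact: cp|apply: ccontM; [exact: ccontC|exact: cD]].
    by rewrite (dual_mass_out k1 k2 gM xM) !mulr0.
  have -> : (fun x => cpoly p 0 x * D x) = (fun x => cpoly p 0 x * Vt g x +
      -1 * (cpoly p 0 x * (c * dual_mass k1 k2 g x))).
    by apply/funext => x; rewrite /D mulrDr; congr (_ + _); rewrite mulrCA.
  have e1 := cintD measurableT i1 (cintegrableZ (-1) measurableT i2).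
  have e2 := cintZ (-1) measurableT i2.
  have e3 := etrans (esym (dual_pairing hVt sp tg)) (pairing_kernel M0 sp cg gM).
  by apply: (etrans e1); rewrite e2 e3 mulN1r subrr.
have rD x : Re (D x) = 0.
  apply: (@moment_zero R (fun x => Re (D x)) M) => [t|t tM|p].
  - exact: (cDD t).1.
  - by rewrite (DM _ tM).
  - have := congr1 (@complex.Re R) (mom p); rewrite Re_cint => /= h.
    rewrite -[RHS]h; apply: eq_Rintegral => t _.
    by rewrite ReM /= horner0 mul0r subr0.
have iD x : Im (D x) = 0.
  apply: (@moment_zero R (fun x => Im (D x)) M) => [t|t tM|p].
  - exact: (cDD t).2.
  - by rewrite (DM _ tM).
  - have := congr1 (@complex.Im R) (mom p); rewrite Im_cint => /= h.
    rewrite -[RHS]h; apply: eq_Rintegral => t _.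
    by rewrite ImM /= horner0 mul0r addr0.
have Dy : D y = 0 by apply: complexP; [exact: rD|exact: iD].
by apply/eqP; rewrite -subr_eq0 -mulN1r; apply/eqP.
Qed.
End dual_operator.

(** The integrability clauses give the integrals their meaning, as [cint] is a total function. *)
Theorem theorem2p1 (R : realType) (k1 k2 : R[i])
    (hk1 : 0 < complex.Re k1) (hk2 : 0 < complex.Re k2) :
  (forall x y : R, `|y| < `|x| ->
     cintegrable `]`|y|, `|x|[ (kernel_integrand k1 k2 x y)) /\
  forall V : (R -> R[i]) -> (R -> R[i]), intertwining k1 k2 V ->
    (forall f : R -> R[i], csmooth f -> forall x : R, x != 0 ->
       cintegrable [set y : R | `|y| < `|x|]
         (fun y : R => vkernel k1 k2 x y * f y) /\
       V f x = cint [set y : R | `|y| < `|x|]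
                 (fun y : R => vkernel k1 k2 x y * f y)) /\
    (forall Vt : (R -> R[i]) -> (R -> R[i]), dual_intertwining k1 k2 V Vt ->
       forall g : R -> R[i], ctest g -> forall y : R,
         cintegrable [set x : R | `|y| < `|x|]
           (fun x : R => vkernel k1 k2 x y * g x * weight k1 k2 x) /\
         Vt g y = cint [set x : R | `|y| < `|x|]
                    (fun x : R => vkernel k1 k2 x y * g x * weight k1 k2 x)).
Proof.
split=> [x y yx|V hV]; first exact: (kernel_integrable hk1 hk2 yx).
split=> [f sf x x0|Vt hVt g tg y]; last exact: (dual_kernel hk1 hk2 hV y hVt tg).
have [I _] := kernel_op_formula hk1 hk2 x0 (csmooth_ccont sf).
by split; [exact: I|exact: (intertwining_kernel hk1 hk2 hV sf x0)].
Qed.
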